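(* Let $\sigma_0>0$, $K>0$, and let $q\ge1$ and $D\ge1$ be integers. Let $\mathbf r_0\in C^{4+q}(\mathbb T;\mathbb R^3)$ be a closed curve in scaled arclength coordinates, with $\ell'=L/2\pi>0$ constant ($L$ the length of the curve) and curvature $\kappa>0$. Let $B_0\in H^{1+q}(\mathbb T)$, let $\phi^{(\mathrm{IC})}=\sum_{m\ge0}\rho^m(\phi_{m0}(s)e^{-\mathrm im\theta}+\phi_{mm}(s)e^{\mathrm im\theta})$ be $(\sigma_0,H^{q+2D})$-analytic, and let $$P=\left(-\frac1{K^2}\Big(\frac{L}{2\pi\ell'}\frac{\partial}{\partial s}\Big)^2\right)^D+\left(-\frac1{K^2}\frac{\partial^2}{\partial\theta^2}\right)^D.$$ Then for some $\sigma>0$ with $\sigma\le\sigma_0$ and $\sigma<\min_s\kappa^{-1}$, the near-axis solution $\phi$ with initial data $\phi^{(\mathrm{IC})}$ of the regularized Poisson equation $$\Delta\phi+\frac{\rho}{\sqrt g}\Delta_\perp P\phi=-\nabla\cdot\tilde{\mathbf B}$$ is $(\sigma,H^{q+2D})$-analytic, is continuous in $\mathbf r_0$, and satisfies $$\|\phi\|_{\sigma,H^{q+2D}}\le C\|B_0\|_{H^{1+q}}+C\|\phi^{(\mathrm{IC})}\|_{\sigma_0,H^{q+2D}},$$ with $\sigma$ and $C$ independent of $B_0$ and $\phi^{(\mathrm{IC})}$. Furthermore, the associated divergence-free field $\mathbf B_K$ is well-defined and is $(\sigma',H^q)$-analytic for all $0<\sigma'<\sigma$.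
   Context: $\mathbb T=\mathbb R/2\pi\mathbb Z$. For $\sigma>0$, $\Omega_\sigma^0=[0,\sigma)\times\mathbb T^2$ with coordinates $(\rho,\theta,s)$ is the solid torus. For a Banach space $W$ of functions on $\mathbb T^2$, $f$ on $\Omega_\sigma^0$ is $(\sigma,W)$-analytic if it has a convergent expansion $f=\sum_{m\ge0}f_m(\theta,s)\rho^m$ with $f_m=\sum_{n=0}^mf_{mn}(s)e^{(2n-m)\mathrm i\theta}$ (convergence in $W$ for each fixed $\rho<\sigma$) and $\|f\|_{\sigma,W}=\sup_m\sigma^m\|f_m\|_W<\infty$. $H^q=H^q(\mathbb T^2)$ in $(\theta,s)$ when used in such norms. Geometry: $\ell'=\|\mathbf r_0'\|$; $\kappa,\tau$ are the curvature and torsion of $\mathbf r_0$, and $(\mathbf n,\mathbf b,\mathbf t)$ its Frenet frame. Coordinates $\mathbf q=(\rho,\theta,s)$ are given by $\mathbf r=\mathbf r_0(s)+x\,\mathbf n(s)+y\,\mathbf b(s)$, $(x,y)=(\rho\cos\theta,\rho\sin\theta)$. With $h_s=\ell'(1-\kappa\rho\cos\theta)$, the Euclidean metric in $\mathbf q$ has $\sqrt g=\rho h_s$ and inverse $$g^{-1}=\begin{pmatrix}1&0&0\\0&(\ell')^2\tau^2h_s^{-2}+\rho^{-2}&-\ell'\tau h_s^{-2}\\0&-\ell'\tau h_s^{-2}&h_s^{-2}\end{pmatrix}.$$ $\Delta\phi=\frac1{\sqrt g}\partial_{q^i}(\sqrt g\,g^{ij}\partial_{q^j}\phi)$; $\tilde{\mathbf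 B}=B_0\ell'\nabla s$, i.e. $\tilde B^i=B_0\ell'g^{is}$, and $\nabla\cdot\tilde{\mathbf B}=\frac1{\sqrt g}\partial_{q^i}(\sqrt g\tilde B^i)$. $\Delta_\perp\phi=\frac1\rho\partial_\rho(\rho\,\partial_\rho\phi)+\frac1{\rho^2}\partial_\theta^2\phi$. Near-axis solution with initial data $\phi^{(\mathrm{IC})}$: the series $\phi=\sum_m\rho^m\phi_m$, $\phi_m=\sum_{n=0}^m\phi_{mn}(s)e^{(2n-m)\mathrm i\theta}$, whose $e^{\pm\mathrm im\theta}$ coefficients in $\phi_m$ are those of $\phi^{(\mathrm{IC})}$ and which satisfies the equation, multiplied by $h_s$ and expanded in powers of $\rho$, at every order in $\rho$. The associated field $\mathbf B_K$ has contravariant components $B_K^i=g^{ij}\partial_{q^j}\phi+\tilde B^i+\frac{\rho}{\sqrt g}G^{ij}\partial_{q^j}(P\phi)$ with $G=\mathrm{Diag}(1,\rho^{-2},0)$ in the $(\rho,\theta,s)$ coordinates; the regularized equation says $\nabla\cdot\mathbf B_K=0$. Analyticity of $\mathbf B_K$ refers to its components in the nonsingular coordinates $(x,y,s)$. Continuity in $\mathbf r_0$ is with respect to the $C^{4+q}(\mathbb T)$ norm on (admissible) $\mathbf r_0$ and the $(\sigma,H^{q+2D})$-analytic norm on $\phi$, locally near a given $\mathbf r_0$ with a common $\sigma$. *)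

(* Defs.v *)
From HB Require Import structures.
From mathcomp Require Import all_boot all_order all_algebra.
From mathcomp Require Import complex.
From mathcomp Require Import all_classical all_reals all_analysis.
Import Order.TTheory GRing.Theory Num.Theory.
Import numFieldNormedType.Exports.

Set Implicit Arguments.
Unset Strict Implicit.
Unset Printing Implicit Defensive.

Local Open Scope classical_set_scope.
Local Open Scope ring_scope.
Local Open Scope complex_scope.

(* Functions on the circle T = R / 2 pi Z are 2 pi-periodic functions on R.
   Derivatives of complex-valued functions of a real variable, and their
   integrals, are taken separately on real and imaginary parts. *)

Section Complex_valued.
Variable R : realType.
Local Notation C := R[i].

Definition reC : C -> R := @complex.Re R.
Definition imC : C -> R := @complex.Im R.

Definition period : R := 2 * pi.

Definition expi (x : R) : C := cos x +i* sin x.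

Definition sqmod (z : C) : R := reC z ^+ 2 + imC z ^+ 2.

Definition cderive (f : R -> C) (x : R) : C :=
  derive1 (reC \o f) x +i* derive1 (imC \o f) x.

Definition cderivable (f : R -> C) (x : R) : Prop :=
  derivable (reC \o f) x 1 /\ derivable (imC \o f) x 1.

Definition cintegral d (T : measurableType d) (mu : {measure set T -> \bar R})
    (D : set T) (f : T -> C) : C :=
  Rintegral mu D (reC \o f) +i* Rintegral mu D (imC \o f).

Definition square_integrable d (T : measurableType d)
    (mu : {measure set T -> \bar R}) (D : set T) (f : T -> C) : Prop :=
  [/\ measurable_fun D (reC \o f), measurable_fun D (imC \o f) &
      mu.-integrable D (EFin \o (sqmod \o f))].

Definition Ck (V : normedModType R) (k : nat) (f : R -> V) : Prop :=
  (forall j x, (j < k)%N -> derivable (derive1n j f) x 1) /\ continuous (derive1n k f).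

Definition cCk (k : nat) (f : R -> C) : Prop :=
  Ck k (reC \o f : R -> R^o) /\ Ck k (imC \o f : R -> R^o).

End Complex_valued.

(* Sobolev spaces of integer order on T and T^2, defined by Fourier
   coefficients: ||f||^2 = sum (1 + |k|^2)^q |f^(k)|^2. *)

Section Sobolev.
Variable R : realType.
Local Notation C := R[i].
Local Notation mu := (@lebesgue_measure R).
Local Notation mu2 := (mu \x mu)%E.

Definition cell : set R := `[0, period R].
Definition cell2 : set (R * R) := cell `*` cell.

Definition fourier1 (f : R -> C) (k : int) : C :=
  ((period R)^-1)%:C * cintegral mu cell (fun s => f s * expi (- (k%:~R * s))).

Definition sobT_energy (q : nat) (f : R -> C) : \bar R :=
  (\esum_(k in [set: int])
     ((1 + k%:~R ^+ 2) ^+ q * sqmod (fourier1 f k))%:E)%E.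

(* H^q(T) for q >= 1, whose elements are identified with their continuous
   representatives. *)
Definition sobT (q : nat) (f : R -> C) : Prop :=
  [/\ forall s, f (s + period R) = f s, cCk 0 f & (sobT_energy q f < +oo)%E].

Definition sobT_norm (q : nat) (f : R -> C) : R :=
  Num.sqrt (fine (sobT_energy q f)).

Definition fourier2 (f : R -> R -> C) (k : int * int) : C :=
  ((period R) ^- 2)%:C *
  cintegral mu2 cell2
    (fun p => f p.1 p.2 * expi (- (k.1%:~R * p.1 + k.2%:~R * p.2))).

Definition sobT2_energy (q : nat) (f : R -> R -> C) : \bar R :=
  (\esum_(k in [set: int * int])
     ((1 + k.1%:~R ^+ 2 + k.2%:~R ^+ 2) ^+ q * sqmod (fourier2 f k))%:E)%E.

Definition sobT2 (q : nat) (f : R -> R -> C) : Prop :=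
  [/\ forall t s, f (t + period R) s = f t s,
      forall t s, f t (s + period R) = f t s,
      square_integrable mu2 cell2 (fun p => f p.1 p.2) &
      (sobT2_energy q f < +oo)%E].

Definition sobT2_norm (q : nat) (f : R -> R -> C) : R :=
  Num.sqrt (fine (sobT2_energy q f)).

(* A normed space W of functions of (theta, s). *)
Record fspace := FSpace {
  fs_mem : (R -> R -> C) -> Prop;
  fs_norm : (R -> R -> C) -> R }.

Definition Hq (q : nat) : fspace := FSpace (sobT2 q) (sobT2_norm q).

End Sobolev.

(* Near-axis expansions.  A family a : nat -> nat -> R -> C stands for the
   coefficients a m n s, 0 <= n <= m, of rho^m e^{(2n-m) i theta}; the values
   for n > m are irrelevant. *)

Section Analytic.
Variable R : realType.
Local Notation C := R[i].
Implicit Types (a : nat -> nat -> R -> C) (W : fspace R) (sigma : R).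

Definition mode a (m : nat) (t s : R) : C :=
  \sum_(n < m.+1) a m n s * expi ((2 * n%:R - m%:R) * t).

Definition partial_sum a (M : nat) (rho t s : R) : C :=
  \sum_(m < M) (rho ^+ m)%:C * mode a m t s.

Definition series_fun a (rho t s : R) : C :=
  lim ((fun M => reC (partial_sum a M rho t s)) @ \oo) +i*
  lim ((fun M => imC (partial_sum a M rho t s)) @ \oo).

Definition analytic_norm sigma W a : \bar R :=
  ereal_sup (range (fun m => (sigma ^+ m * fs_norm W (mode a m))%:E)).

(* The function f(rho, theta, s) on [0, sigma) x T^2 is (sigma, W)-analytic,
   with coefficients a. *)
Definition expands sigma W (f : R -> R -> R -> C) a : Prop :=
  [/\ forall m, fs_mem W (mode a m),
      forall rho, 0 <= rho < sigma ->
        fs_mem W (f rho) /\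
        ((fun M => fs_norm W (fun t s => f rho t s - partial_sum a M rho t s))
           @ \oo --> (0 : R)) &
      (analytic_norm sigma W a < +oo)%E].

Definition analytic sigma W (f : R -> R -> R -> C) : Prop :=
  exists a, expands sigma W f a.

Definition analytic_series sigma W a : Prop :=
  expands sigma W (series_fun a) a.

End Analytic.

Section Curve.
Variable R : realType.
Implicit Types (r : R -> 'rV[R]_3) (u v : 'rV[R]_3).

Definition dotv u v : R := \sum_(i < 3) u 0 i * v 0 i.

Definition enorm u : R := Num.sqrt (dotv u u).

Definition crossv u v : 'rV[R]_3 :=
  \row_(i < 3) (u 0 (i + 1) * v 0 (i + 2) - u 0 (i + 2) * v 0 (i + 1)).

Definition curve_length r : R :=
  Rintegral (@lebesgue_measure R) (@cell R) (fun s => enorm (derive1 r s)).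

Definition ell r : R := curve_length r / (2 * pi).

(* Frenet apparatus of a curve whose speed is the constant ell r. *)
Definition tangent r (s : R) : 'rV[R]_3 := (ell r)^-1 *: derive1 r s.
Definition curvature r (s : R) : R := (ell r)^-1 * enorm (derive1 (tangent r) s).
Definition normal r (s : R) : 'rV[R]_3 :=
  (ell r * curvature r s)^-1 *: derive1 (tangent r) s.
Definition binormal r (s : R) : 'rV[R]_3 := crossv (tangent r s) (normal r s).
Definition torsion r (s : R) : R :=
  (ell r)^-1 * dotv (derive1 (normal r) s) (binormal r s).

(* Closed C^k curves in scaled arclength coordinates with positive curvature. *)
Definition admissible (k : nat) r : Prop :=
  [/\ forall s, r (s + period R) = r s, Ck k r,
      0 < ell r, forall s, enorm (derive1 r s) = ell r &
      forall s, 0 < curvature r s].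

Definition Ck_norm (k : nat) r : \bar R :=
  ereal_sup [set x | exists j s, (j <= k)%N /\ x = (enorm (derive1n j r s))%:E].

End Curve.

(* The differential operators are written once, over a "calculus" that is
   either the functions of (rho, theta, s), or the formal Laurent series in rho
   whose coefficients are functions of (theta, s). *)

Section Calculus.
Variable R : realType.
Local Notation C := R[i].

Record calculus := Calculus {
  carrier :> zmodType;
  mul : carrier -> carrier -> carrier;
  coef : (R -> R -> C) -> carrier; (* functions of (theta, s) only *)
  rhoX : int -> carrier;           (* rho ^ k *)
  geom : (R -> R -> C) -> carrier; (* 1 / (1 - c(theta, s) rho) *)
  pd : 'I_3 -> carrier -> carrier  (* partial derivatives in (rho, theta, s) *)
}.

Definition coord3 (A : Type) (x0 x1 x2 : A) (i : 'I_3) : A :=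
  match val i with 0%N => x0 | 1%N => x1 | _ => x2 end.

Definition slice (i : 'I_3) (f : R -> R -> R -> C) (rho t s : R) : R -> C :=
  coord3 (fun x => f x t s) (fun x => f rho x s) (fun x => f rho t x) i.

Definition pd_fun (i : 'I_3) (f : R -> R -> R -> C) (rho t s : R) : C :=
  cderive (slice i f rho t s) (coord3 rho t s i).

Definition pderivable (i : 'I_3) (f : R -> R -> R -> C) (rho t s : R) : Prop :=
  cderivable (slice i f rho t s) (coord3 rho t s i).

Definition functions : calculus := @Calculus (R -> R -> R -> C)
  (fun f g rho t s => f rho t s * g rho t s)
  (fun c _ t s => c t s)
  (fun k rho _ _ => (rho ^ k)%:C)
  (fun c rho t s => (1 - c t s * rho%:C)^-1)
  pd_fun.

(* In the Cauchy product, the sum over all of int is finite because only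
   finitely many negative powers of rho ever occur. *)
Definition laurent : calculus := @Calculus (int -> R -> R -> C)
  (fun f g k t s => \sum_(i \in [set: int]) f i t s * g (k - i) t s)
  (fun c k t s => if k == 0 then c t s else 0)
  (fun j k _ _ => (k == j)%:R)
  (fun c k t s => if k is Posz n then c t s ^+ n else 0)
  (fun i f => coord3
     (fun k t s => (k + 1)%:~R * f (k + 1) t s)
     (fun k t s => cderive (fun x => f k x s) t)
     (fun k t s => cderive (f k t) s) i).

Definition formal (a : nat -> nat -> R -> C) : laurent :=
  fun k t s => if k is Posz m then mode a m t s else 0.

Variables (A : calculus) (r : R -> 'rV[R]_3).
Local Notation "x *! y" := (mul x y) (at level 40, left associativity).

Definition i_rho : 'I_3 := inord 0.
Definition i_theta : 'I_3 := inord 1.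
Definition i_s : 'I_3 := inord 2.

Definition rcst (x : R) : A := coef A (fun _ _ => x%:C).
Definition rcoef (f : R -> R) : A := coef A (fun _ s => (f s)%:C).
Definition kcos (t s : R) : C := (curvature r s * cos t)%:C.

Definition hs : A :=
  rcst (ell r) - rcst (ell r) *! coef A kcos *! rhoX A 1.
Definition hsV : A := rcst (ell r)^-1 *! geom A kcos.

Definition sqrtg : A := rhoX A 1 *! hs.
Definition sqrtgV : A := rhoX A (-1) *! hsV.

Definition entry (M : seq (seq A)) (i j : 'I_3) : A := nth 0 (nth [::] M i) j.

(* The inverse of the Euclidean metric in the coordinates (rho, theta, s) given
   by r + rho cos theta n + rho sin theta b. *)
Definition ginv : 'I_3 -> 'I_3 -> A :=
  let tau := rcoef (torsion r) in
  let l := rcst (ell r) in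
  let hs2V := hsV *! hsV in
  let gts := - (l *! tau *! hs2V) in
  entry [:: [:: rcst 1; 0; 0];
            [:: 0; l *! l *! tau *! tau *! hs2V + rhoX A (-2); gts];
            [:: 0; gts; hs2V]].

Definition Gperp : 'I_3 -> 'I_3 -> A :=
  entry [:: [:: rcst 1; 0; 0]; [:: 0; rhoX A (-2); 0]; [:: 0; 0; 0]].

Definition grad (f : A) (i : 'I_3) : A := \sum_(j < 3) ginv i j *! pd j f.

Definition divergence (V : 'I_3 -> A) : A :=
  sqrtgV *! \sum_(i < 3) pd i (sqrtg *! V i).

Definition laplacian (f : A) : A := divergence (grad f).

Definition lap_perp (f : A) : A :=
  rhoX A (-1) *! pd i_rho (rhoX A 1 *! pd i_rho f) +
  rhoX A (-2) *! pd i_theta (pd i_theta f).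

Definition Btilde (B0 : R -> C) (i : 'I_3) : A :=
  coef A (fun _ s => B0 s) *! rcst (ell r) *! ginv i i_s.

Definition Pop (K : R) (D : nat) (f : A) : A :=
  let Ds g := rcst (curve_length r / (2 * pi * ell r)) *! pd i_s g in
  iter D (fun g => rcst (- K ^- 2) *! Ds (Ds g)) f +
  iter D (fun g => rcst (- K ^- 2) *! pd i_theta (pd i_theta g)) f.

Definition BK (K : R) (D : nat) (B0 : R -> C) (phi : A) (i : 'I_3) : A :=
  grad phi i + Btilde B0 i +
  rhoX A 1 *! sqrtgV *! \sum_(j < 3) Gperp i j *! pd j (Pop K D phi).

(* The regularized Poisson equation, multiplied by h_s. *)
Definition regularized_poisson (K : R) (D : nat) (B0 : R -> C) (phi : A) :
    Prop :=
  hs *! (laplacian phi + rhoX A 1 *! sqrtgV *! lap_perp (Pop K D phi)) =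
  - (hs *! divergence (Btilde B0)).

End Calculus.

Section NearAxis.
Variable R : realType.
Local Notation C := R[i].
Implicit Types (r : R -> 'rV[R]_3) (a ic : nat -> nat -> R -> C).

(* a is the near-axis solution with initial data ic: its coefficients are
   smooth enough for the equation to be meant classically. *)
Definition near_axis_solution r (K : R) (D : nat) (B0 : R -> C) ic a : Prop :=
  [/\ forall m n, (n <= m)%N ->
        cCk (2 * D) (a m n) /\ forall s, a m n (s + period R) = a m n s,
      forall m s, a m 0%N s = ic m 0%N s /\ a m m s = ic m m s &
      regularized_poisson r K D B0 (formal a)].

(* B_K^x, B_K^y, B_K^s, with x = rho cos theta and y = rho sin theta. *)
Definition cartesian (B : 'I_3 -> functions R) (i : 'I_3) :
    R -> R -> R -> C := fun rho t s =>
  let Brho := B i_rho rho t s in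
  let Btheta := B i_theta rho t s in
  coord3 ((cos t)%:C * Brho - (rho * sin t)%:C * Btheta)
         ((sin t)%:C * Brho + (rho * cos t)%:C * Btheta)
         (B i_s rho t s) i.

(* Every derivative entering P phi, B_K and div B_K exists classically. *)
Definition BK_well_defined r (K : R) (D : nat) (B0 : R -> C) (phi : functions R)
    (rho t s : R) : Prop :=
  [/\ forall i, pderivable i phi rho t s,
      forall i j, i \in [:: i_theta; i_s] -> (j < 2 * D)%N ->
        pderivable i (iter j (pd_fun i) phi) rho t s,
      forall i, i \in [:: i_rho; i_theta] ->
        pderivable i (Pop r K D phi) rho t s &
      forall i, pderivable i
        (mul (sqrtg (functions R) r) (BK r K D B0 phi i)) rho t s].

End NearAxis.

(* Main.v *)
(* With U = (phi_s - l tau phi_theta + l B_0) / h_s, the equation at order rho^m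
   reads (l + (j / K)^(2D) + (-K^-2 d_s^2)^D) phi_mn = r_mn for 0 < n < m, j = 2n - m,
   where r_mn is linear in phi_{m-1} and in one derivative of U_{m-2}; dividing by
   m^2 - j^2 = 4 n (m - n) makes its coefficients bounded uniformly in m.  Thanks to
   the regularization the operator gains 2D >= 2 derivatives in (theta, s), again
   uniformly in m, which pays for the derivatives in the definition of U and in
   r_mn, so the recursion closes with phi_m in H^{q+2D} and U_m in H^{q+1}.  A
   supremum over m of the energies weighted by sigma^(2m) is then bounded for small
   sigma, with constants depending only on C^{q+1} bounds of curvature and torsion.
   The difference of the solutions for two curves solves the same recursion with a
   small source, whence the continuity in the curve.  B_K and its divergence are
   obtained by evaluating the formal identities at rho < sigma. *)
Require Import Defs.
From HB Require Import structures.
From mathcomp Require Import all_boot all_order all_algebra.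
From mathcomp Require Import complex.
From mathcomp Require Import all_classical all_reals all_analysis.
From mathcomp Require Import ring lra zify.
Import Order.TTheory GRing.Theory Num.Theory.
Import numFieldNormedType.Exports.

Set Implicit Arguments.
Unset Strict Implicit.
Unset Printing Implicit Defensive.

Local Open Scope classical_set_scope.
Local Open Scope ring_scope.
Local Open Scope complex_scope.

(** * Calculus of complex-valued functions *)

(** The coefficients with n = 0 and n = m are free because the order-m equation holds there
    identically; the initial data enter nowhere else. U is a second unknown and not an abbreviation:
    it absorbs B_0 before any derivative in s falls on it, so B_0 in H^(1+q) suffices, and its
    recursion, the definition multiplied by h_s, reaches back one order only, whereas expanding
    1/h_s would reach back to order 0. Estimates are made one theta-mode at a time: frequency j
    contributes an energy with weights (1 + j^2 + k^2)^p, and the squared norm of phi_m on the torus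
    is the sum of these. The obstacle is uniformity in j and m; every factor lost in a product or a
    shift depends on p and the curve alone. Functions in H^1 have absolutely summable Fourier
    coefficients, so derivatives, inverses of the mode operators and uniqueness are read off
    coefficients. Polynomial factors in m, from d/drho and d/dtheta, are paid for by a slightly
    smaller radius, hence sigma' < sigma for B_K. From the recursion on, the variable [q] denotes
    the exponent of the theorem minus one. *)

Section ComplexNumbers.
Variable R : realType.
Local Notation C := R[i].
Implicit Types (x y : R) (z w : C).

Lemma ceqP z w : reC z = reC w -> imC z = imC w -> z = w.
Proof. by case: z => a b; case: w => c d /= -> ->. Qed.

Lemma reCD z w : reC (z + w) = reC z + reC w.
Proof. by case: z => a b; case: w. Qed.
Lemma imCD z w : imC (z + w) = imC z + imC w.
Proof. by case: z => a b; case: w. Qed.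
Lemma reCN z : reC (- z) = - reC z. Proof. by case: z. Qed.
Lemma imCN z : imC (- z) = - imC z. Proof. by case: z. Qed.
Lemma reCB z w : reC (z - w) = reC z - reC w. Proof. by rewrite reCD reCN. Qed.
Lemma imCB z w : imC (z - w) = imC z - imC w. Proof. by rewrite imCD imCN. Qed.
Lemma reCM z w : reC (z * w) = reC z * reC w - imC z * imC w.
Proof. by case: z => a b; case: w. Qed.
Lemma imCM z w : imC (z * w) = reC z * imC w + imC z * reC w.
Proof. by case: z => a b; case: w. Qed.
Lemma reC_real x : reC x%:C = x. Proof. by []. Qed.
Lemma imC_real x : imC x%:C = 0. Proof. by []. Qed.
Lemma reC0 : reC (0 : C) = 0. Proof. by []. Qed.
Lemma imC0 : imC (0 : C) = 0. Proof. by []. Qed.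
Lemma reC1 : reC (1 : C) = 1. Proof. by []. Qed.
Lemma imC1 : imC (1 : C) = 0. Proof. by []. Qed.
Lemma reCi : reC ('i : C) = 0. Proof. by []. Qed.
Lemma imCi : imC ('i : C) = 1. Proof. by []. Qed.

Definition reimE := (reCD, imCD, reCN, imCN, reCM, imCM, reC_real, imC_real,
  reC0, imC0, reC1, imC1, reCi, imCi).

Lemma reC_sum (I : Type) (r : seq I) (P : pred I) (F : I -> C) :
  reC (\sum_(i <- r | P i) F i) = \sum_(i <- r | P i) reC (F i).
Proof. exact: (big_morph _ reCD reC0). Qed.

Lemma natrCE n : (n%:R : C) = (n%:R : R)%:C. Proof. by rewrite rmorph_nat. Qed.
Lemma intrCE (k : int) : (k%:~R : C) = (k%:~R : R)%:C.
Proof. by rewrite rmorph_int. Qed.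
Lemma realCD x y : (x + y)%:C = x%:C + y%:C :> C. Proof. exact: rmorphD. Qed.
Lemma realCB x y : (x - y)%:C = x%:C - y%:C :> C. Proof. exact: rmorphB. Qed.
Lemma realCN x : (- x)%:C = - x%:C :> C. Proof. exact: rmorphN. Qed.
Lemma realCM x y : (x * y)%:C = x%:C * y%:C :> C. Proof. exact: rmorphM. Qed.
Lemma realCV x : (x^-1)%:C = x%:C^-1 :> C. Proof. exact: fmorphV. Qed.
Lemma realCX x n : (x ^+ n)%:C = x%:C ^+ n :> C. Proof. exact: rmorphXn. Qed.
Lemma realC_eq0 x : (x%:C == 0 :> C) = (x == 0).
Proof. by rewrite -(rmorph0 (real_complex R)) (inj_eq (@complexI R)). Qed.

Lemma sqmodE z : sqmod z = reC z ^+ 2 + imC z ^+ 2. Proof. by []. Qed.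
Lemma sqmod_ge0 z : 0 <= sqmod z.
Proof. by rewrite addr_ge0// sqr_ge0. Qed.
Lemma sqmod0 : sqmod (0 : C) = 0. Proof. by rewrite sqmodE /= expr0n addr0. Qed.
Lemma sqmod_eq0 z : (sqmod z == 0) = (z == 0).
Proof.
apply/idP/eqP => [|->]; last by rewrite sqmod0.
by rewrite paddr_eq0 ?sqr_ge0// !sqrf_eq0 => /andP[/eqP a /eqP b]; exact: ceqP.
Qed.
Lemma sqmodM z w : sqmod (z * w) = sqmod z * sqmod w.
Proof. by rewrite !sqmodE !reimE; ring. Qed.
Lemma sqmodN z : sqmod (- z) = sqmod z.
Proof. by rewrite !sqmodE !reimE; ring. Qed.
Lemma sqmod_real x : sqmod x%:C = x ^+ 2.
Proof. by rewrite sqmodE !reimE expr0n addr0. Qed.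
Lemma sqmodD z w : sqmod (z + w) <= 2 * sqmod z + 2 * sqmod w.
Proof.
rewrite !sqmodE !reimE.
have := sqr_ge0 (reC z - reC w); have := sqr_ge0 (imC z - imC w); nra.
Qed.
Lemma sqmod_i : sqmod ('i : C) = 1. Proof. by rewrite sqmodE /= expr0n expr1n add0r. Qed.
Lemma reC_sqmod z : reC z ^+ 2 <= sqmod z. Proof. by rewrite lerDl sqr_ge0. Qed.
Lemma imC_sqmod z : imC z ^+ 2 <= sqmod z. Proof. by rewrite lerDr sqr_ge0. Qed.

Definition cabs z : R := Num.sqrt (sqmod z).
Lemma cabs_ge0 z : 0 <= cabs z. Proof. exact: sqrtr_ge0. Qed.
Lemma sqr_cabs z : cabs z ^+ 2 = sqmod z.
Proof. by rewrite sqr_sqrtr// sqmod_ge0. Qed.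
Lemma cabsM z w : cabs (z * w) = cabs z * cabs w.
Proof. by rewrite /cabs sqmodM sqrtrM// sqmod_ge0. Qed.
Lemma cabs0 : cabs 0 = 0. Proof. by rewrite /cabs sqmod0 sqrtr0. Qed.
Lemma cabsN z : cabs (- z) = cabs z. Proof. by rewrite /cabs sqmodN. Qed.
Lemma cabs_real x : cabs x%:C = `|x|.
Proof. by rewrite /cabs sqmod_real sqrtr_sqr. Qed.
Lemma cabsD z w : cabs (z + w) <= cabs z + cabs w.
Proof.
rewrite -(ler_pXn2r (n:=2))// ?nnegrE ?addr_ge0 ?cabs_ge0// sqrrD !sqr_cabs.
have h : 0 <= cabs z * cabs w by rewrite mulr_ge0 ?cabs_ge0.
suff : reC z * reC w + imC z * imC w <= cabs z * cabs w.
  by rewrite !sqmodE !reimE mulr2n; lra.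
apply: (le_trans (ler_norm _)).
rewrite -(ler_pXn2r (n:=2))// ?nnegrE// real_normK ?num_real// exprMn !sqr_cabs.
by rewrite !sqmodE; have := sqr_ge0 (reC z * imC w - imC z * reC w); nra.
Qed.
Lemma cabs_sum (I : Type) (r : seq I) (P : pred I) (F : I -> C) :
  cabs (\sum_(i <- r | P i) F i) <= \sum_(i <- r | P i) cabs (F i).
Proof.
elim/big_ind2: _ => //; first by rewrite cabs0.
by move=> a b c d ac bd; apply: le_trans (cabsD _ _) _; exact: lerD.
Qed.
Lemma reC_cabs z : `|reC z| <= cabs z.
Proof. by rewrite -sqrtr_sqr ler_wsqrtr// reC_sqmod. Qed.
Lemma imC_cabs z : `|imC z| <= cabs z.
Proof. by rewrite -sqrtr_sqr ler_wsqrtr// imC_sqmod. Qed.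
Lemma cabs_reim z : cabs z <= `|reC z| + `|imC z|.
Proof.
rewrite -(ler_pXn2r (n:=2))// ?nnegrE ?cabs_ge0 ?addr_ge0// sqr_cabs sqmodE.
rewrite sqrrD !real_normK ?num_real//.
rewrite -addrA [X in _ <= _ + X]addrC lerD2l lerDl.
by rewrite mulrn_wge0// mulr_ge0.
Qed.
Lemma cabs_le z x : 0 <= x -> (cabs z <= x) = (sqmod z <= x ^+ 2).
Proof.
by move=> x0; rewrite -sqr_cabs ler_pXn2r// nnegrE cabs_ge0.
Qed.

Lemma expiE x : expi x = cos x +i* sin x. Proof. by []. Qed.
Lemma expiD x y : expi (x + y) = expi x * expi y.
Proof.
apply: ceqP; rewrite !reimE /= ?cosD ?sinD //.
by rewrite addrC.
Qed.
Lemma expi0 : expi (0 : R) = 1.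
Proof. by apply: ceqP; rewrite /= ?cos0 ?sin0. Qed.
Lemma sqmod_expi x : sqmod (expi x) = 1.
Proof. by rewrite sqmodE /= cos2Dsin2. Qed.
Lemma cabs_expi x : cabs (expi x) = 1.
Proof. by rewrite /cabs sqmod_expi sqrtr1. Qed.
Lemma expiN x : expi x * expi (- x) = 1.
Proof. by rewrite -expiD subrr expi0. Qed.
Lemma expi_conj x : expi (- x) = cos x -i* sin x.
Proof. by rewrite expiE cosN sinN. Qed.
Lemma cosCE x : (cos x)%:C = 2^-1 * (expi x + expi (- x)).
Proof.
rewrite expi_conj expiE.
apply: (@mulfI _ (2 : C)); first by rewrite pnatr_eq0.
rewrite mulrA mulfV ?pnatr_eq0// mul1r.
by apply: ceqP; rewrite mulr_natl mulr2n !reimE /=; ring.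
Qed.
Lemma sinCE x : 'i * (sin x)%:C = 2^-1 * (expi x - expi (- x)).
Proof.
rewrite expi_conj expiE.
apply: (@mulfI _ (2 : C)); first by rewrite pnatr_eq0.
rewrite [RHS]mulrA mulfV ?pnatr_eq0// mul1r.
by apply: ceqP; rewrite mulr_natl mulr2n !reimE /=; ring.
Qed.

Lemma period_gt0 : 0 < period R.
Proof. by rewrite mulr_gt0// pi_gt0. Qed.
Lemma expi_period x : expi (x + period R) = expi x.
Proof.
by rewrite /expi /period mulr_natl [x + _]addrC addrC cosD2pi sinD2pi.
Qed.
Lemma expi_int_period (k : int) : expi (k%:~R * period R) = 1.
Proof.
have pn (n : nat) : expi (n%:R * period R) = 1.
  elim: n => [|n IH]; first by rewrite mul0r expi0.
  by rewrite -natr1 mulrDl mul1r expi_period.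
case: k => n; first exact: pn.
rewrite NegzE mulrNz mulNr; have := expiN (n.+1%:R * period R).
by rewrite pn mul1r => ->.
Qed.
Lemma expi_intD (k : int) x : expi (k%:~R * (x + period R)) = expi (k%:~R * x).
Proof. by rewrite mulrDr expiD expi_int_period mulr1. Qed.

End ComplexNumbers.

(** * Integration of bounded measurable complex functions *)

Section BoundedMeasurable.
Variable R : realType.
Local Notation C := R[i].
Context d (T : measurableType d) (mu : {measure set T -> \bar R}) (D : set T).
Hypothesis mD : measurable D.
Hypothesis finD : (mu D < +oo)%E.
Local Notation "\intr f" := (Rintegral mu D f) (at level 10).
Local Notation intc := (cintegral mu D).

(** Boundedness replaces integrability because it is stable under products; on a set of finite
    measure it implies integrability, so the integral is linear on this class without further side
    conditions. *)
Definition bmr (g : T -> R) : Prop :=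
  measurable_fun D g /\ exists M, forall x, D x -> `|g x| <= M.

Lemma bmr_integrable g : bmr g -> mu.-integrable D (EFin \o g).
Proof.
move=> [mg [M gM]]; apply: measurable_bounded_integrable => //.
exists M; split; first exact: num_real.
by move=> N MN x /= /gM /le_trans; apply; exact: ltW.
Qed.

Lemma bmr_cst c : bmr (fun=> c).
Proof. by split=> //; exists `|c|. Qed.

Lemma bmrD f g : bmr f -> bmr g -> bmr (fun x => f x + g x).
Proof.
move=> [mf [M fM]] [mg [N gN]]; split.
  exact: measurable_realfun.measurable_funD.
exists (M + N) => x Dx; apply: le_trans (ler_normD _ _) _.
by rewrite lerD ?fM ?gN.
Qed.

Lemma bmrM f g : bmr f -> bmr g -> bmr (fun x => f x * g x).
Proof.
move=> [mf [M fM]] [mg [N gN]]; split.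
  exact: measurable_realfun.measurable_funM.
by exists (M * N) => x Dx; rewrite normrM ler_pM ?fM ?gN.
Qed.

Lemma bmrN f : bmr f -> bmr (fun x => - f x).
Proof.
move=> bf; have := bmrM (bmr_cst (-1)) bf.
by under [X in bmr X]eq_fun do rewrite mulN1r.
Qed.

Definition bmf (f : T -> C) : Prop := bmr (@reC R \o f) /\ bmr (@imC R \o f).

Lemma bmf_cst c : bmf (fun=> c). Proof. by split; exact: bmr_cst. Qed.

Lemma eq_bmr f g : f =1 g -> bmr f -> bmr g.
Proof. by move=> /funext ->. Qed.
Lemma eq_bmf f g : f =1 g -> bmf f -> bmf g.
Proof. by move=> /funext ->. Qed.

Lemma bmfD f g : bmf f -> bmf g -> bmf (fun x => f x + g x).
Proof.
move=> [rf jf] [rg jg]; split.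
- by apply: eq_bmr (bmrD rf rg) => x /=; rewrite reCD.
- by apply: eq_bmr (bmrD jf jg) => x /=; rewrite imCD.
Qed.

Lemma bmfM f g : bmf f -> bmf g -> bmf (fun x => f x * g x).
Proof.
move=> [rf jf] [rg jg]; split.
- by apply: eq_bmr (bmrD (bmrM rf rg) (bmrN (bmrM jf jg))) => x /=; rewrite reCM.
- by apply: eq_bmr (bmrD (bmrM rf jg) (bmrM jf rg)) => x /=; rewrite imCM.
Qed.

Lemma bmfZ c f : bmf f -> bmf (fun x => c * f x).
Proof. exact/bmfM/bmf_cst. Qed.

Lemma bmfN f : bmf f -> bmf (fun x => - f x).
Proof.
by move=> /(bmfZ (-1)); apply: eq_bmf => x; rewrite mulN1r.
Qed.

Lemma bmfB f g : bmf f -> bmf g -> bmf (fun x => f x - g x).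
Proof. by move=> bf /bmfN; exact: bmfD. Qed.

Lemma bmf_sum (I : Type) (r : seq I) (F : I -> T -> C) :
  (forall i, bmf (F i)) -> bmf (fun x => \sum_(i <- r) F i x).
Proof.
move=> bF; elim: r => [|i r IH].
  by apply: eq_bmf (bmf_cst 0) => x; rewrite big_nil.
by apply: eq_bmf (bmfD (bF i) IH) => x; rewrite big_cons.
Qed.

Lemma bmf_sqmod f : bmf f -> bmr (fun x => sqmod (f x)).
Proof.
move=> [rf jf]; apply: eq_bmr (bmrD (bmrM rf rf) (bmrM jf jf)) => x /=.
by rewrite sqmodE !expr2.
Qed.

Lemma reC_int f : reC (intc f) = \intr (@reC R \o f). Proof. by []. Qed.
Lemma imC_int f : imC (intc f) = \intr (@imC R \o f). Proof. by []. Qed.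

Lemma eq_intc f g : (forall x, D x -> f x = g x) -> intc f = intc g.
Proof.
move=> fg; apply: ceqP; rewrite ?reC_int ?imC_int; apply: eq_Rintegral => x;
  by rewrite inE /= => /fg ->.
Qed.

Lemma intcD f g : bmf f -> bmf g ->
  intc (fun x => f x + g x) = intc f + intc g.
Proof.
move=> [rf jf] [rg jg]; apply: ceqP; rewrite ?reCD ?imCD ?reC_int ?imC_int.
- rewrite -RintegralD//; last 2 first. exact: bmr_integrable. exact: bmr_integrable.
  by apply: eq_Rintegral => x _ /=; rewrite reCD.
- rewrite -RintegralD//; last 2 first. exact: bmr_integrable. exact: bmr_integrable.
  by apply: eq_Rintegral => x _ /=; rewrite imCD.
Qed.

Lemma intr_lin a b f g : bmr f -> bmr g ->
  \intr (fun x => a * f x + b * g x) = a * \intr f + b * \intr g.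
Proof.
move=> bf bg; rewrite RintegralD//.
- by rewrite !RintegralZl//; exact: bmr_integrable.
- by apply: bmr_integrable; apply: bmrM => //; exact: bmr_cst.
- by apply: bmr_integrable; apply: bmrM => //; exact: bmr_cst.
Qed.

Lemma intcZ c f : bmf f -> intc (fun x => c * f x) = c * intc f.
Proof.
move=> [rf jf]; apply: ceqP; rewrite ?reCM ?imCM ?reC_int ?imC_int.
- rewrite -mulNr -intr_lin//; apply: eq_Rintegral => x _ /=.
  by rewrite reCM mulNr.
- rewrite -intr_lin//; apply: eq_Rintegral => x _ /=.
  by rewrite imCM.
Qed.



Lemma intc_cst c : intc (fun=> c) = c * (fine (mu D))%:C.
Proof.
apply: ceqP; rewrite ?reC_int ?imC_int /= /comp Rintegral_cst// !reimE;
 by rewrite mulr0 ?subr0 ?add0r.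
Qed.

Lemma intc_sum (I : Type) (r : seq I) (F : I -> T -> C) :
  (forall i, bmf (F i)) ->
  intc (fun x => \sum_(i <- r) F i x) = \sum_(i <- r) intc (F i).
Proof.
move=> bF; elim: r => [|i r IH].
  rewrite big_nil -[RHS](mul0r ((fine (mu D))%:C)) -intc_cst.
  by apply: eq_intc => x _; rewrite big_nil.
rewrite big_cons -IH -intcD//; last exact: bmf_sum.
by apply: eq_intc => x _; rewrite big_cons.
Qed.


Lemma intr_le f g : bmr f -> bmr g -> (forall x, D x -> f x <= g x) ->
  \intr f <= \intr g.
Proof.
by move=> bf bg; apply: le_Rintegral => //; exact: bmr_integrable.
Qed.

Lemma intr_bound g M : bmr g -> (forall x, D x -> `|g x| <= M) ->
  `|\intr g| <= M * fine (mu D).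
Proof.
move=> bg gM; apply: le_trans (le_normr_Rintegral mD (bmr_integrable bg)) _.
rewrite -Rintegral_cst//; apply: intr_le => //; last exact: bmr_cst.
split; first by apply: measurableT_comp => //; case: bg.
by exists M => x Dx; rewrite normr_id gM.
Qed.

(** The factor 2 comes from estimating real and imaginary parts separately. It is harmless: the
    bound only serves to carry limits through Fourier coefficients. *)
Lemma intc_bound f M : bmf f -> (forall x, D x -> cabs (f x) <= M) ->
  cabs (intc f) <= 2 * M * fine (mu D).
Proof.
move=> [rf jf] fM; apply: le_trans (cabs_reim _) _.
rewrite reC_int imC_int -mulrA mulr_natl mulr2n; apply: lerD; apply: intr_bound => //.
- by move=> x Dx; apply: le_trans (reC_cabs _) (fM _ Dx).
- by move=> x Dx; apply: le_trans (imC_cabs _) (fM _ Dx).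
Qed.

Lemma bmf_bounded f : bmf f -> exists M, forall x, D x -> cabs (f x) <= M.
Proof.
move=> [[_ [M fM]] [_ [N fN]]]; exists (M + N) => x Dx.
by apply: le_trans (cabs_reim _) _; apply: lerD; [exact: fM|exact: fN].
Qed.

(* Measurability of a limit of bounded measurable functions is pointwise,
   boundedness is required separately. *)
Lemma bmf_cvg (F : nat -> T -> C) f M : (forall n, bmf (F n)) ->
  (forall x, D x -> (cabs (F n x - f x) @[n --> \oo] --> (0 : R))) ->
  (forall x, D x -> cabs (f x) <= M) -> bmf f.
Proof.
move=> bF cF fM; split; split.
- apply: (@measurable_realfun.measurable_fun_cvg _ _ _ D (fun n => @reC R \o F n)) => [n|x Dx].
    by case: (bF n) => -[].
  apply/cvgrPdist_le => e e0; move/cvgrPdist_le: (cF x Dx) => /(_ e e0).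
  apply: filterS => n; rewrite sub0r normrN ger0_norm ?cabs_ge0// => h.
  by rewrite distrC -reCB; apply: le_trans (reC_cabs _) h.
- by exists M => x Dx; apply: le_trans (reC_cabs _) (fM x Dx).
- apply: (@measurable_realfun.measurable_fun_cvg _ _ _ D (fun n => @imC R \o F n)) => [n|x Dx].
    by case: (bF n) => _ [].
  apply/cvgrPdist_le => e e0; move/cvgrPdist_le: (cF x Dx) => /(_ e e0).
  apply: filterS => n; rewrite sub0r normrN ger0_norm ?cabs_ge0// => h.
  by rewrite distrC -imCB; apply: le_trans (imC_cabs _) h.
- by exists M => x Dx; apply: le_trans (imC_cabs _) (fM x Dx).
Qed.

End BoundedMeasurable.

(** * Differentiation and term-by-term limits *)

Section RealDerivatives.
Variable R : realType.
Implicit Types (f g : R -> R) (x y : R).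

(* An elementary form of differentiability: the derivatives of the library are
   taken in several convertible but distinct normed-module structures on R. *)
Definition rd f x (l : R) : Prop := forall e, 0 < e ->
  exists2 d, 0 < d & forall h, h != 0 ->
    `|h| < d -> `|h^-1 * (f (x + h) - f x) - l| <= e.

Lemma rdP f x l : rd f x l <-> is_derive x 1 f l.
Proof.
split => [H|[cv E]].
  have cv : (h^-1 *: ((f \o shift x) (h *: 1) - f x)) @[h --> 0^'] --> l.
    apply/cvgrPdist_le => e e0; have [d d0 dH] := H e e0.
    near=> h; rewrite distrC /= /GRing.scale /= mulr1 [h + x]addrC; apply: dH.
    - by near: h; exact: nbhs_dnbhs_neq.
    - by near: h; exact: dnbhs0_lt.
  by apply: DeriveDef; [exact: cvgP cv|exact: cvg_lim cv].
move=> e e0.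
have /cvgrPdist_le/(_ e e0) : (h^-1 *: ((f \o shift x) (h *: 1) - f x)) @[h --> 0^'] --> l.
  by rewrite -E; exact: cv.
move=> /nbhs_ballP[d /= d0 dH]; exists d => // h h0 hd.
have := dH h; rewrite /ball /= sub0r normrN => /(_ hd h0).
by rewrite distrC /GRing.scale /= mulr1 [h + x]addrC.
Unshelve. all: by end_near. Qed.

Lemma rd_derivable f x l : rd f x l -> derivable f x 1.
Proof. by move=> /rdP h; exact: (@ex_derive _ _ _ _ _ _ _ h). Qed.
Lemma rd_derive1 f x l : rd f x l -> derive1 f x = l.
Proof. by move=> /rdP h; rewrite derive1E; exact: (@derive_val _ _ _ _ _ _ _ h). Qed.
Lemma derivable_rd f x : derivable f x 1 -> rd f x (derive1 f x).
Proof. by move=> h; apply/rdP; rewrite derive1E; exact: DeriveDef. Qed.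

Lemma rdD f g x a b : rd f x a -> rd g x b -> rd (fun y => f y + g y) x (a + b).
Proof. by move=> /rdP fa /rdP gb; apply/rdP; exact: (is_deriveD fa gb). Qed.
Lemma rdN f x a : rd f x a -> rd (fun y => - f y) x (- a).
Proof. by move=> /rdP fa; apply/rdP; exact: (is_deriveN fa). Qed.
Lemma rdB f g x a b : rd f x a -> rd g x b -> rd (fun y => f y - g y) x (a - b).
Proof. by move=> fa gb; exact: rdD fa (rdN gb). Qed.
Lemma rdM f g x a b : rd f x a -> rd g x b ->
  rd (fun y => f y * g y) x (a * g x + f x * b).
Proof.
move=> /rdP fa /rdP gb; apply/rdP; apply: (is_derive_eq (is_deriveM fa gb)).
by rewrite /GRing.scale /= addrC mulrC.
Qed.
Lemma rd_cst c x : rd (fun=> c) x 0. Proof. by apply/rdP; exact: is_derive_cst. Qed.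
Lemma rd_id x : rd id x 1. Proof. by apply/rdP; exact: is_derive_id. Qed.
Lemma rd_comp f g x a b : rd f (g x) a -> rd g x b -> rd (fun y => f (g y)) x (a * b).
Proof. by move=> /rdP fa /rdP gb; apply/rdP; exact: is_derive1_comp. Qed.
Lemma rd_cos x : rd cos x (- sin x). Proof. by apply/rdP; exact: is_derive_cos. Qed.
Lemma rd_sin x : rd sin x (cos x). Proof. by apply/rdP; exact: is_derive_sin. Qed.
Lemma rdV f x a : f x != 0 -> rd f x a -> rd (fun y => (f y)^-1) x (- (f x ^- 2) * a).
Proof. by move=> f0 /rdP fa; apply/rdP; exact: is_deriveV. Qed.
Lemma rd_sqrt f x a : 0 < f x -> rd f x a ->
  rd (fun y => Num.sqrt (f y)) x ((2 * Num.sqrt (f x))^-1 * a).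
Proof. by move=> f0 fa; apply: rd_comp => //; apply/rdP; exact: is_derive1_sqrt. Qed.
Lemma rdX n x : rd (fun y => y ^+ n) x (n%:R * x ^+ n.-1).
Proof.
elim: n => [|n IH]; first by rewrite mul0r; exact: rd_cst.
have := rdM (rd_id x) IH.
rewrite [X in rd X](_ : _ = (fun y => y ^+ n.+1)); last by apply/funext => y; rewrite exprS.
rewrite (_ : _ + _ = n.+1%:R * x ^+ n.+1.-1)//= mul1r -natr1 mulrDl mul1r addrC.
by case: n {IH} => [|n]; rewrite ?mul0r ?mulr0 //= mulrCA -exprS.
Qed.

Lemma rd_near f g x a (d : R) : 0 < d -> (forall y, `|y - x| < d -> f y = g y) ->
  rd f x a -> rd g x a.
Proof.
move=> d0 fg /rdP fa; apply/rdP; apply: near_eq_is_derive fa.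
near=> y; apply: fg; near: y; apply/nbhs_ballP; exists d => //= y.
by rewrite /ball /= distrC.
Unshelve. all: by end_near. Qed.

Lemma rd_continuous f x a : rd f x a -> {for x, continuous f}.
Proof.
by move=> /rd_derivable /derivable1_diffP /differentiable_continuous.
Qed.

Lemma rd_unique f x a b : rd f x a -> rd f x b -> a = b.
Proof. by move=> /rd_derive1 <- /rd_derive1 <-. Qed.

Lemma rd_lip f df M x y :
  (forall z, Num.min x y <= z <= Num.max x y -> rd f z (df z)) ->
  (forall z, Num.min x y <= z <= Num.max x y -> `|df z| <= M) ->
  `|f y - f x| <= M * `|y - x|.
Proof.
wlog xy : x y / x <= y.
  move=> W; have /orP[xy|yx] := le_total x y; first by move=> ? ?; exact: W.
  by rewrite minC maxC distrC (distrC y) => ? ?; exact: W.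
move=> fd dM; rewrite (min_idPl xy) (max_idPr xy) in fd dM.
have [//||c] := @MVT_segment R f df x y xy.
- move=> z; rewrite in_itv /= => /andP[a b]; apply/rdP; apply: fd.
  by rewrite !ltW.
- apply: derivable_within_continuous => z; rewrite in_itv /= => zi.
  exact: rd_derivable (fd z zi).
by rewrite in_itv /= => ci ->; rewrite normrM ler_wpM2r// dM.
Qed.

(** The mean value inequality applied to [F m - F n] turns the uniform Cauchy bound on derivatives
    into one on difference quotients; an eps / 3 argument then exchanges limit and derivative. *)
Lemma rd_limit (F dF : nat -> R -> R) (f : R -> R) x l d (e : nat -> R) :
  0 < d ->
  (forall n y, `|y - x| < d -> rd (F n) y (dF n y)) ->
  (forall n m y, (n <= m)%N -> `|y - x| < d -> `|dF m y - dF n y| <= e n) ->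
  e n @[n --> \oo] --> (0 : R) ->
  (forall y, `|y - x| < d -> F n y @[n --> \oo] --> f y) ->
  dF n x @[n --> \oo] --> l ->
  rd f x l.
Proof.
move=> d0 Fd Fe e0 Ff dFl eps eps0.
have e3 : 0 < eps / 3 by lra.
have [n en] : exists n, e n <= eps / 3.
  move/cvgrPdist_le : e0 => /(_ _ e3)[n _ /(_ n (leqnn n))] /=.
  by rewrite sub0r normrN => h; exists n; apply: le_trans h; exact: ler_norm.
have xx : `|x - x| < d by rewrite subrr normr0.
have ln : `|l - dF n x| <= eps / 3.
  apply: le_trans en.
  have cv : `|dF m x - dF n x| @[m --> \oo] --> `|l - dF n x|.
    by apply: cvg_norm; apply: cvgB => //; exact: cvg_cst.
  rewrite -(cvg_lim _ cv)//; apply: limr_le; first exact: cvgP cv.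
  by exists n => // m /= nm; exact: Fe.
have [r r0 rH] := Fd n x xx _ e3.
exists (Num.min r d) => [|h h0]; first by rewrite lt_min r0.
rewrite lt_min => /andP[hr hd].
have xh : `|x + h - x| < d by rewrite addrC addKr.
have tail : `|(f (x + h) - f x) - (F n (x + h) - F n x)| <= eps / 3 * `|h|.
  have cv : `|(F m (x + h) - F m x) - (F n (x + h) - F n x)| @[m --> \oo] -->
      `|(f (x + h) - f x) - (F n (x + h) - F n x)|.
    apply: cvg_norm; apply: cvgB; last exact: cvg_cst.
    by apply: cvgB; exact: Ff.
  rewrite -(cvg_lim _ cv)//; apply: limr_le; first exact: cvgP cv.
  exists n => // m /= nm.
  have -> : (F m (x + h) - F m x) - (F n (x + h) - F n x) =
            (F m (x + h) - F n (x + h)) - (F m x - F n x) by ring.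
  rewrite -[X in _ <= _ * `|X|](addKr x h) [- x + _]addrC.
  have near_ z : Num.min x (x + h) <= z <= Num.max x (x + h) -> `|z - x| < d.
    move=> zi; apply: le_lt_trans hd; move: zi.
    have /orP[h0'|h0'] := le_total 0 h.
      rewrite min_l ?max_r ?lerDl// => /andP[a b].
      by rewrite (ger0_norm h0') ger0_norm; lra.
    rewrite min_r ?max_l ?gerDl// => /andP[a b].
    by rewrite (ler0_norm h0') ler0_norm; lra.
  apply: (@rd_lip (fun z => F m z - F n z) (fun z => dF m z - dF n z)) => z /near_ zd.
    by apply: rdB; exact: Fd.
  by apply: le_trans (Fe _ _ _ nm zd) en.
have -> : h^-1 * (f (x + h) - f x) - l =
   h^-1 * ((f (x + h) - f x) - (F n (x + h) - F n x)) +
   (h^-1 * (F n (x + h) - F n x) - dF n x) - (l - dF n x) by ring.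
apply: le_trans (ler_normB _ _) _; apply: le_trans (lerD (ler_normD _ _) (lexx _)) _.
have -> : eps = eps / 3 + eps / 3 + eps / 3 by field.
apply: lerD => //; apply: lerD; last exact: rH.
by rewrite normrM normfV mulrC ler_pdivrMr// normr_gt0.
Qed.

End RealDerivatives.

Section CkClass.
Variables (R : realType) (V : normedModType R).
Implicit Types f : R -> V.

(** [Ck] counts derivatives from the outside; removing the innermost one instead is the form in
    which sums and products are treated by induction on k. *)
Lemma CkS k f : Ck k.+1 f <-> (forall x, derivable f x 1) /\ Ck k (derive1 f).
Proof.
split=> [[dk ck]|[d0 [dk ck]]].
  split=> [x|]; first exact: (dk 0%N).
  split=> [j x jk|]; last by rewrite -derive1Sn.
  by rewrite -derive1Sn; exact: (dk j.+1).
split=> [[|j] x jk|]; [exact: d0| |by rewrite derive1Sn].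
by rewrite derive1Sn; exact: dk.
Qed.

Lemma Ck0 f : Ck 0 f <-> continuous f.
Proof. by split=> [[_]|cf]//; split. Qed.

Lemma Ck_pred k f : Ck k.+1 f -> Ck k f.
Proof.
elim: k f => [|k IH] f /CkS[df /[dup] cf].
  move=> _; apply/Ck0 => x.
  by move/derivable1_diffP/differentiable_continuous: (df x).
by move=> /IH cdf; apply/CkS.
Qed.

Lemma Ck_le k l f : (k <= l)%N -> Ck l f -> Ck k f.
Proof.
move=> /subnKC <-; elim: (l - k)%N => [|n IH]; first by rewrite addn0.
by rewrite addnS => /Ck_pred.
Qed.

End CkClass.

Section RealCk.
Variable R : realType.
Implicit Types f : R -> R.

Lemma CkR0 f : Ck 0 (f : R -> R^o) <-> continuous f.
Proof. exact: Ck0. Qed.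

Lemma CkRS k f : Ck k.+1 (f : R -> R^o) <->
  (forall x, derivable f x 1) /\ Ck k (derive1 f : R -> R^o).
Proof. exact: CkS. Qed.

Lemma CkRI k f df : (forall x, rd f x (df x)) -> Ck k (df : R -> R^o) ->
  Ck k.+1 (f : R -> R^o).
Proof.
move=> fd dk; apply/CkRS; split=> [x|]; first exact: rd_derivable (fd x).
by rewrite (_ : derive1 f = df)//; apply/funext => x; exact: rd_derive1.
Qed.

Lemma CkRE k f : Ck k.+1 (f : R -> R^o) ->
  (forall x, rd f x (derive1 f x)) /\ Ck k (derive1 f : R -> R^o).
Proof. by move=> /CkRS[a b]; split => // x; exact: derivable_rd. Qed.


End RealCk.

Section ComplexDerivatives.
Variable R : realType.
Local Notation C := R[i].
Implicit Types (f g : R -> C) (x y : R).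

Definition cd f x (l : C) : Prop :=
  rd (@reC R \o f) x (reC l) /\ rd (@imC R \o f) x (imC l).

Lemma cd_cderivable f x l : cd f x l -> cderivable f x.
Proof. by move=> [a b]; split; [exact: rd_derivable a|exact: rd_derivable b]. Qed.
Lemma cd_cderive f x l : cd f x l -> cderive f x = l.
Proof.
by move=> [a b]; apply: ceqP; [exact: rd_derive1 a|exact: rd_derive1 b].
Qed.
Lemma cderivable_cd f x : cderivable f x -> cd f x (cderive f x).
Proof. by move=> [a b]; split; exact: derivable_rd. Qed.
Lemma cd_unique f x a b : cd f x a -> cd f x b -> a = b.
Proof. by move=> /cd_cderive <- /cd_cderive <-. Qed.
Lemma eq_cd f g x a : f =1 g -> cd f x a -> cd g x a.
Proof. by move=> /funext ->. Qed.

Lemma cdD f g x a b : cd f x a -> cd g x b -> cd (fun y => f y + g y) x (a + b).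
Proof.
move=> [rf jf] [rg jg]; split; rewrite ?reCD ?imCD.
- rewrite [X in rd X](_ : _ = (fun y => reC (f y) + reC (g y))); first exact: rdD.
  by apply/funext => y; rewrite /= reCD.
- rewrite [X in rd X](_ : _ = (fun y => imC (f y) + imC (g y))); first exact: rdD.
  by apply/funext => y; rewrite /= imCD.
Qed.
Lemma cdM f g x a b : cd f x a -> cd g x b ->
  cd (fun y => f y * g y) x (a * g x + f x * b).
Proof.
move=> [rf jf] [rg jg]; split; rewrite ?reCD ?imCD ?reCM ?imCM.
- rewrite [X in rd X](_ : _ =
    (fun y => reC (f y) * reC (g y) - imC (f y) * imC (g y))); last first.
    by apply/funext => y; rewrite /= reCM.
  have := rdB (rdM rf rg) (rdM jf jg); rewrite /comp /=.
  by congr (rd _ _ _); ring.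
- rewrite [X in rd X](_ : _ =
    (fun y => reC (f y) * imC (g y) + imC (f y) * reC (g y))); last first.
    by apply/funext => y; rewrite /= imCM.
  have := rdD (rdM rf jg) (rdM jf rg); rewrite /comp /=.
  by congr (rd _ _ _); ring.
Qed.
Lemma cd_cst (c : C) x : cd (fun=> c) x 0.
Proof. by split; exact: rd_cst. Qed.
Lemma cdZ (c : C) f x a : cd f x a -> cd (fun y => c * f y) x (c * a).
Proof. by move=> fa; have := cdM (cd_cst c x) fa; rewrite mul0r add0r. Qed.
Lemma cdN f x a : cd f x a -> cd (fun y => - f y) x (- a).
Proof.
move=> /(cdZ (-1)); rewrite mulN1r; apply: eq_cd => y; by rewrite mulN1r.
Qed.
Lemma cdB f g x a b : cd f x a -> cd g x b -> cd (fun y => f y - g y) x (a - b).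
Proof. by move=> fa /cdN; exact: cdD. Qed.
Lemma cd_sum (I : Type) (r : seq I) (F : I -> R -> C) (dF : I -> C) x :
  (forall i, cd (F i) x (dF i)) ->
  cd (fun y => \sum_(i <- r) F i y) x (\sum_(i <- r) dF i).
Proof.
move=> Fd; elim: r => [|i r IH].
  by rewrite big_nil; apply: eq_cd (cd_cst 0 x) => y; rewrite big_nil.
rewrite big_cons; apply: eq_cd (cdD (Fd i) IH) => y; by rewrite big_cons.
Qed.
Lemma cd_real (h : R -> R) x a : rd h x a -> cd (fun y => (h y)%:C) x a%:C.
Proof. by move=> ha; split => //; exact: rd_cst. Qed.
Lemma cd_expi (c x : R) :
  cd (fun y => expi (c * y)) x ('i * c%:C * expi (c * x)).
Proof.
have hc : rd (fun y => c * y) x c.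
  have := rdM (rd_cst c x) (rd_id x); by rewrite mul0r add0r mulr1.
split; rewrite !reimE /comp /=.
- have := rd_comp (rd_cos (c * x)) hc; congr (rd _ _ _); ring.
- have := rd_comp (rd_sin (c * x)) hc; congr (rd _ _ _); ring.
Qed.
Lemma cd_near f g x a (d : R) : 0 < d -> (forall y, `|y - x| < d -> f y = g y) ->
  cd f x a -> cd g x a.
Proof.
move=> d0 fg [ra ja]; split.
- by apply: (rd_near d0 _ ra) => y yd; rewrite /= fg.
- by apply: (rd_near d0 _ ja) => y yd; rewrite /= fg.
Qed.

Definition ccont f := continuous (@reC R \o f) /\ continuous (@imC R \o f).

Lemma cCk0P f : cCk 0 f <-> ccont f.
Proof.
by split=> [[/CkR0 a /CkR0 b]|[a b]]; split => //; exact/CkR0.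
Qed.
Lemma eq_ccont f g : f =1 g -> ccont f -> ccont g.
Proof. by move=> /funext ->. Qed.
Lemma ccontD f g : ccont f -> ccont g -> ccont (fun x => f x + g x).
Proof.
move=> [a b] [c d]; split => x.
- rewrite [X in continuous_at _ X](_ : _ = (fun x => reC (f x) + reC (g x))).
    by apply: cvgD; [exact: a|exact: c].
  by apply/funext => y; rewrite /= reCD.
- rewrite [X in continuous_at _ X](_ : _ = (fun x => imC (f x) + imC (g x))).
    by apply: cvgD; [exact: b|exact: d].
  by apply/funext => y; rewrite /= imCD.
Qed.
Lemma ccontM f g : ccont f -> ccont g -> ccont (fun x => f x * g x).
Proof.
move=> [a b] [c d]; split => x.
- rewrite [X in continuous_at _ X](_ : _ =
    (fun x => reC (f x) * reC (g x) - imC (f x) * imC (g x))).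
    by apply: cvgB; apply: cvgM; [exact: a|exact: c|exact: b|exact: d].
  by apply/funext => y; rewrite /= reCM.
- rewrite [X in continuous_at _ X](_ : _ =
    (fun x => reC (f x) * imC (g x) + imC (f x) * reC (g x))).
    by apply: cvgD; apply: cvgM; [exact: a|exact: d|exact: b|exact: c].
  by apply/funext => y; rewrite /= imCM.
Qed.
Lemma ccont_cst c : ccont (fun=> c).
Proof. by split=> x; exact: cvg_cst. Qed.
Lemma ccontZ c f : ccont f -> ccont (fun x => c * f x).
Proof. exact/ccontM/ccont_cst. Qed.
Lemma ccontN f : ccont f -> ccont (fun x => - f x).
Proof. by move=> /(ccontZ (-1)); apply: eq_ccont => x; rewrite mulN1r. Qed.
Lemma ccontB f g : ccont f -> ccont g -> ccont (fun x => f x - g x).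
Proof. by move=> cf /ccontN; exact: ccontD. Qed.
Lemma ccont_sum (I : Type) (r : seq I) (F : I -> R -> C) :
  (forall i, ccont (F i)) -> ccont (fun x => \sum_(i <- r) F i x).
Proof.
move=> cF; elim: r => [|i r IH].
  by apply: eq_ccont (ccont_cst 0) => x; rewrite big_nil.
by apply: eq_ccont (ccontD (cF i) IH) => x; rewrite big_cons.
Qed.
Lemma ccont_real (h : R -> R) : continuous h -> ccont (fun x => (h x)%:C).
Proof. by move=> ch; split => // x; exact: cvg_cst. Qed.
Lemma cd_ccont f : (forall x, exists l, cd f x l) -> ccont f.
Proof.
by move=> fd; split => x; have [l [a b]] := fd x;
  [exact: rd_continuous a|exact: rd_continuous b].
Qed.
Lemma ccont_expi (c : R) : ccont (fun x => expi (c * x)).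
Proof. by apply: cd_ccont => x; eexists; exact: cd_expi. Qed.

Lemma cCkS k f : cCk k.+1 f <-> (forall x, cderivable f x) /\ cCk k (cderive f).
Proof.
split=> [[/CkRS[a b] /CkRS[c d]]|[a [b c]]]; first by split=> // x; split.
by split; apply/CkRS; split => // x; case: (a x).
Qed.
Lemma cCk_le k l f : (k <= l)%N -> cCk l f -> cCk k f.
Proof. by move=> kl [a b]; split; exact: Ck_le kl _. Qed.
Lemma cCk_ccont k f : cCk k f -> ccont f.
Proof. by move=> fk; apply/cCk0P; exact: cCk_le fk. Qed.
Lemma eq_cCk k f g : f =1 g -> cCk k f -> cCk k g.
Proof. by move=> /funext ->. Qed.
Lemma cCk_cd k f x : cCk k.+1 f -> cd f x (cderive f x).
Proof. by move=> /cCkS[+ _] => /(_ x)/cderivable_cd. Qed.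
Lemma cCkI k f df : (forall x, cd f x (df x)) -> cCk k df -> cCk k.+1 f.
Proof.
move=> fd dk; apply/cCkS; split=> [x|]; first exact: cd_cderivable (fd x).
by apply: eq_cCk dk => x; rewrite (cd_cderive (fd x)).
Qed.

Lemma cCkD k f g : cCk k f -> cCk k g -> cCk k (fun x => f x + g x).
Proof.
elim: k f g => [|k IH] f g.
  by move=> /cCk0P cf /cCk0P cg; apply/cCk0P; exact: ccontD.
move=> fk gk; apply: (@cCkI k _ (fun x => cderive f x + cderive g x)).
  by move=> x; exact: cdD (cCk_cd x fk) (cCk_cd x gk).
have [_ dfk] := (cCkS _ _).1 fk; have [_ dgk] := (cCkS _ _).1 gk.
exact: IH.
Qed.
Lemma cCkM k f g : cCk k f -> cCk k g -> cCk k (fun x => f x * g x).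
Proof.
elim: k f g => [|k IH] f g.
  by move=> /cCk0P cf /cCk0P cg; apply/cCk0P; exact: ccontM.
move=> fk gk; apply: (@cCkI k _ (fun x => cderive f x * g x + f x * cderive g x)).
  by move=> x; exact: cdM (cCk_cd x fk) (cCk_cd x gk).
have [_ dfk] := (cCkS _ _).1 fk; have [_ dgk] := (cCkS _ _).1 gk.
have fk' := cCk_le (leqnSn k) fk; have gk' := cCk_le (leqnSn k) gk.
exact: cCkD (IH _ _ dfk gk') (IH _ _ fk' dgk).
Qed.
Lemma cCk_cst k (c : C) : cCk k (fun _ : R => c).
Proof.
elim: k c => [|k IH] c; first by apply/cCk0P; exact: ccont_cst.
by apply: (@cCkI k _ (fun=> 0)) => // x; exact: cd_cst.
Qed.
Lemma cCkZ k c f : cCk k f -> cCk k (fun x => c * f x).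
Proof. exact/cCkM/cCk_cst. Qed.
Lemma cCkB k f g : cCk k f -> cCk k g -> cCk k (fun x => f x - g x).
Proof.
move=> fk /(cCkZ (-1)) gk; apply: eq_cCk (cCkD fk gk) => x.
by rewrite mulN1r.
Qed.

Definition ccvg (F : nat -> C) (l : C) := cabs (F n - l) @[n --> \oo] --> (0 : R).

Lemma eq_ccvg F G l : F =1 G -> ccvg F l -> ccvg G l.
Proof. by move=> /funext ->. Qed.

Lemma ccvgP F l : ccvg F l <->
  (reC (F n) @[n --> \oo] --> reC l) /\ (imC (F n) @[n --> \oo] --> imC l).
Proof.
split=> [Fl|[a b]].
  split; apply/cvgrPdist_le => e e0; move/cvgrPdist_le: Fl => /(_ e e0);
    apply: filterS => n; rewrite sub0r normrN ger0_norm ?cabs_ge0// => h;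
    rewrite distrC.
  - by rewrite -reCB; apply: le_trans (reC_cabs _) h.
  - by rewrite -imCB; apply: le_trans (imC_cabs _) h.
have : `|reC (F n) - reC l| + `|imC (F n) - imC l| @[n --> \oo] --> (0 : R).
  rewrite -[X in _ --> X](addr0 0); apply: cvgD.
  - by rewrite -(@normr0 _ R) -(subrr (reC l)); apply: cvg_norm; apply: cvgB => //; exact: cvg_cst.
  - by rewrite -(@normr0 _ R) -(subrr (imC l)); apply: cvg_norm; apply: cvgB => //; exact: cvg_cst.
move=> h; apply: (squeeze_cvgr _ (cvg_cst 0) h); near=> n.
by rewrite cabs_ge0 /=; apply: le_trans (cabs_reim _) _; rewrite reCB imCB.
Unshelve. all: by end_near. Qed.

Lemma ccvg_unique F a b : ccvg F a -> ccvg F b -> a = b.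
Proof.
move=> /ccvgP[ra ja] /ccvgP[rb jb].
by apply: ceqP; [apply: (cvg_unique _ ra rb)|apply: (cvg_unique _ ja jb)].
Qed.
Lemma ccvg_cst c : ccvg (fun=> c) c.
Proof. by rewrite /ccvg subrr cabs0; exact: cvg_cst. Qed.
Lemma ccvgD F G a b : ccvg F a -> ccvg G b -> ccvg (fun n => F n + G n) (a + b).
Proof.
move=> /ccvgP[ra ja] /ccvgP[rb jb]; apply/ccvgP; split; rewrite ?reCD ?imCD.
- by under eq_cvg do rewrite reCD; exact: cvgD.
- by under eq_cvg do rewrite imCD; exact: cvgD.
Qed.
Lemma ccvgM F G a b : ccvg F a -> ccvg G b -> ccvg (fun n => F n * G n) (a * b).
Proof.
move=> /ccvgP[ra ja] /ccvgP[rb jb]; apply/ccvgP; split; rewrite ?reCM ?imCM.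
- by under eq_cvg do rewrite reCM; apply: cvgB; exact: cvgM.
- by under eq_cvg do rewrite imCM; apply: cvgD; exact: cvgM.
Qed.
Lemma ccvgB F G a b : ccvg F a -> ccvg G b -> ccvg (fun n => F n - G n) (a - b).
Proof.
move=> Fa Gb; have := ccvgD Fa (ccvgM (ccvg_cst (-1)) Gb); rewrite mulN1r.
by apply: eq_ccvg => n; rewrite mulN1r.
Qed.
Lemma ccvg_sqmod F a : ccvg F a -> sqmod (F n) @[n --> \oo] --> sqmod a.
Proof.
move=> /ccvgP[ra ja]; rewrite /sqmod; under eq_cvg do rewrite !expr2.
by rewrite !expr2; apply: cvgD; exact: cvgM.
Qed.
Lemma ccvg_cabs_le F a M : ccvg F a -> (\forall n \near \oo, cabs (F n) <= M) ->
  cabs a <= M.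
Proof.
move=> Fa FM.
have M0 : 0 <= M by near \oo => n; apply: le_trans (cabs_ge0 (F n)) _; near: n.
rewrite cabs_le//; have cv := ccvg_sqmod Fa.
rewrite -(cvg_lim _ cv)//; apply: limr_le; first exact: cvgP cv.
by move: FM; apply: filterS => n; rewrite cabs_le.
Unshelve. all: by end_near. Qed.

Lemma ccvg_cauchy (F : nat -> C) (e : nat -> R) :
  (forall n m, (n <= m)%N -> cabs (F m - F n) <= e n) ->
  e n @[n --> \oo] --> (0 : R) -> exists l, ccvg F l.
Proof.
move=> Fe e0.
suff cau (h : C -> R) : (forall z w, `|h z - h w| <= cabs (z - w)) ->
    cvgn (h \o F).
  exists (lim (reC (F n) @[n --> \oo]) +i* lim (imC (F n) @[n --> \oo])).
  apply/ccvgP; split => /=.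
  - by apply: (cau (@reC R)) => z w; rewrite -reCB reC_cabs.
  - by apply: (cau (@imC R)) => z w; rewrite -imCB imC_cabs.
move=> hl; apply/cauchy_cvgP/cauchy_exP => eps eps0.
have [n en] : exists n, e n < eps.
  move/cvgrPdist_lt : e0 => /(_ _ eps0)[n _ /(_ n (leqnn n))] /=.
  by rewrite sub0r normrN => en; exists n; apply: le_lt_trans en; exact: ler_norm.
exists (h (F n)), n => // m /= nm; rewrite /ball /= distrC.
by apply: le_lt_trans (hl _ _) _; apply: le_lt_trans en; exact: Fe.
Qed.

End ComplexDerivatives.

(** * Fourier series on the circle *)

Section CircleIntegral.
Variable R : realType.
Local Notation C := R[i].
Local Notation mu := (@lebesgue_measure R).
Local Notation cellR := (@cell R).
Local Notation intp := (cintegral mu cellR).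
Local Notation per := (period R).
Implicit Types (f g : R -> C).

Definition periodic (T : Type) (f : R -> T) : Prop := forall s, f (s + per) = f s.

Lemma measurable_cell : measurable (cellR : set (measurableTypeR R)).
Proof. exact: measurable_itv. Qed.

Lemma mu_cell : mu cellR = per%:E.
Proof.
rewrite /cell lebesgue_measure_itv /= lte_fin period_gt0 sube0.
by [].
Qed.

Lemma mu_cell_fin : (mu cellR < +oo)%E.
Proof. by rewrite mu_cell ltry. Qed.

Lemma fine_mu_cell : fine (mu cellR) = per. Proof. by rewrite mu_cell. Qed.

Hint Resolve measurable_cell mu_cell_fin : core.

Local Notation bmc := (@bmf R _ (measurableTypeR R) cellR).

Lemma continuous_bounded_cell (h : R -> R) : continuous h ->
  exists M, forall x, cellR x -> `|h x| <= M.
Proof.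
move=> ch.
have [|c _ cM] := @EVT_max R (fun x => `|h x|) 0 per (ltW (period_gt0 R)).
  by apply: continuous_subspaceT => x; apply: cvg_norm; exact: ch.
by exists `|h c| => x /= xi; apply: cM.
Qed.

Lemma ccont_bmf f : ccont f -> bmc f.
Proof.
move=> [rf jf]; split; split; try exact: continuous_bounded_cell.
- by apply: measurable_funTS; exact: measurable_realfun.continuous_measurable_fun.
- by apply: measurable_funTS; exact: measurable_realfun.continuous_measurable_fun.
Qed.

Lemma intpD f g : bmc f -> bmc g -> intp (fun x => f x + g x) = intp f + intp g.
Proof. exact: intcD. Qed.
Lemma intpZ c f : bmc f -> intp (fun x => c * f x) = c * intp f.
Proof. exact: intcZ. Qed.
Lemma intp_sum (I : Type) (r : seq I) (F : I -> R -> C) : (forall i, bmc (F i)) ->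
  intp (fun x => \sum_(i <- r) F i x) = \sum_(i <- r) intp (F i).
Proof. exact: intc_sum. Qed.
Lemma eq_intp f g : (forall x, cellR x -> f x = g x) -> intp f = intp g.
Proof. exact: (@eq_intc R _ (measurableTypeR R) mu). Qed.
Lemma intpr_lin a b (f g : R -> R) : bmr cellR (f : measurableTypeR R -> R) ->
  bmr cellR (g : measurableTypeR R -> R) ->
  Rintegral mu cellR (fun x => a * f x + b * g x) =
  a * Rintegral mu cellR f + b * Rintegral mu cellR g.
Proof. exact: (@intr_lin R _ (measurableTypeR R) mu). Qed.
Lemma intpr_le (f g : R -> R) : bmr cellR (f : measurableTypeR R -> R) ->
  bmr cellR (g : measurableTypeR R -> R) -> (forall x, cellR x -> f x <= g x) ->
  Rintegral mu cellR f <= Rintegral mu cellR g.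
Proof. exact: (@intr_le R _ (measurableTypeR R) mu). Qed.

Lemma reduce_cell (s : R) : exists (k : int) (x : R), cellR x /\ s = x + k%:~R * per.
Proof.
pose k := Num.floor (s / per).
have p0 := period_gt0 R.
have h1 : k%:~R <= s / per by exact: floor_le.
have h2 : s / per < k%:~R + 1.
  by have := floorD1_gt (s / per); rewrite intrD.
exists k, (s - k%:~R * per); split; last by ring.
rewrite /cell /= in_itv /=; move: h1 h2.
rewrite ler_pdivlMr// ltr_pdivrMr// mulrDl mul1r => h1 h2.
by apply/andP; split; lra.
Qed.

Lemma periodic_int (T : Type) (f : R -> T) (k : int) s : periodic f ->
  f (s + k%:~R * per) = f s.
Proof.
move=> pf.
have pn (n : nat) x : f (x + n%:R * per) = f x.
  elim: n x => [|n IH] x; first by rewrite mul0r addr0.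
  by rewrite -natr1 mulrDl mul1r addrA pf.
case: k => n; first exact: pn.
rewrite NegzE mulrNz mulNr -[in RHS](subrK (n.+1%:R * per) s).
by rewrite pn.
Qed.

Lemma periodic_bounded f : ccont f -> periodic f ->
  exists2 M, 0 <= M & forall x, cabs (f x) <= M.
Proof.
move=> cf pf; have [M fM] := bmf_bounded (ccont_bmf cf).
have h x : cabs (f x) <= M.
  by have [k [y [yc ->]]] := reduce_cell x; rewrite periodic_int//; exact: fM.
by exists M => //; apply: le_trans (cabs_ge0 (f 0)) _.
Qed.

Lemma Rint_derivative (F f : R -> R) : (forall x, rd F x (f x)) -> continuous f ->
  Rintegral mu cellR f = F per - F 0.
Proof.
move=> Ff cf; rewrite /Rintegral (@continuous_FTC2 R f F)//.
- exact: period_gt0.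
- exact: continuous_subspaceT.
- split.
  + by move=> x _; exact: rd_derivable (Ff x).
  + by apply: cvg_at_right_filter; exact: rd_continuous (Ff 0).
  + by apply: cvg_at_left_filter; exact: rd_continuous (Ff per).
- by move=> x _; exact: rd_derive1 (Ff x).
Qed.

Lemma intp_derivative (F f : R -> C) : (forall x, cd F x (f x)) -> ccont f ->
  intp f = F per - F 0.
Proof.
move=> Ff [rf jf]; apply: ceqP; rewrite ?reCB ?imCB.
- by rewrite reC_int (@Rint_derivative (@reC R \o F))// => x; case: (Ff x).
- by rewrite imC_int (@Rint_derivative (@imC R \o F))// => x; case: (Ff x).
Qed.

Lemma intp_periodic_derivative (F f : R -> C) : (forall x, cd F x (f x)) ->
  ccont f -> periodic F -> intp f = 0.
Proof.
by move=> Ff cf pF; rewrite (intp_derivative Ff cf) -[per]add0r pF subrr.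
Qed.

Definition eik (k : int) (s : R) : C := expi (k%:~R * s).

Lemma eikD k l s : eik (k + l) s = eik k s * eik l s.
Proof. by rewrite /eik intrD mulrDl expiD. Qed.
Lemma eik0 s : eik 0 s = 1. Proof. by rewrite /eik mul0r expi0. Qed.
Lemma eikN k s : eik (- k) s = expi (- (k%:~R * s)).
Proof. by rewrite /eik mulrNz mulNr. Qed.
Lemma eik_period k : periodic (eik k).
Proof. by move=> s; exact: expi_intD. Qed.
Lemma eik_cont k : ccont (eik k). Proof. exact: ccont_expi. Qed.
Lemma eik_cd k x : cd (eik k) x ('i * k%:~R * eik k x).
Proof. by rewrite intrCE; exact: cd_expi. Qed.
Lemma cabs_eik k s : cabs (eik k s) = 1. Proof. exact: cabs_expi. Qed.
Lemma eik_conj k s : conjc (eik k s) = eik (- k) s.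
Proof. by rewrite eikN expi_conj. Qed.

Lemma i_neq0 : ('i : C) != 0.
Proof. by rewrite -sqmod_eq0 sqmod_i oner_eq0. Qed.

Lemma intp_eik k : intp (eik k) = if k == 0 then per%:C else 0.
Proof.
case: eqP => [->|/eqP k0].
  rewrite (@eq_intp _ (fun=> 1)) => [|x _].
    by rewrite (@intc_cst R _ (measurableTypeR R) mu)// fine_mu_cell mul1r.
  exact: eik0.
have ik : 'i * k%:~R != 0 :> C by rewrite mulf_neq0 ?i_neq0 ?intr_eq0.
rewrite (@intp_periodic_derivative (fun s => ('i * k%:~R)^-1 * eik k s))//.
- move=> x; have := cdZ ('i * k%:~R)^-1 (eik_cd k x).
  by rewrite mulrA mulVf// mul1r.
- exact: eik_cont.
- by move=> s; rewrite eik_period.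
Qed.

Lemma fourier1E f k : fourier1 f k = per^-1%:C * intp (fun s => f s * eik (- k) s).
Proof.
rewrite /fourier1; congr (_ * _).
by apply: eq_intp => s _; rewrite eikN.
Qed.

Lemma eq_fourier1 f g k : f =1 g -> fourier1 f k = fourier1 g k.
Proof. by move=> /funext ->. Qed.

Lemma bmc_eik f k : bmc f -> bmc (fun s => f s * eik k s).
Proof. by move=> bf; apply: bmfM => //; exact/ccont_bmf/eik_cont. Qed.

Lemma fourier1D f g k : bmc f -> bmc g ->
  fourier1 (fun s => f s + g s) k = fourier1 f k + fourier1 g k.
Proof.
move=> bf bg; rewrite !fourier1E -mulrDr; congr (_ * _).
rewrite -(@intpD) //; last 2 first.
- exact: bmc_eik.
- exact: bmc_eik.
by apply: eq_intp => s _; rewrite mulrDl.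
Qed.

Lemma fourier1Z c f k : bmc f -> fourier1 (fun s => c * f s) k = c * fourier1 f k.
Proof.
move=> bf; rewrite !fourier1E mulrCA; congr (_ * _).
rewrite -(@intpZ) //; last exact: bmc_eik.
by apply: eq_intp => s _; rewrite mulrA.
Qed.

Lemma fourier1N f k : bmc f -> fourier1 (fun s => - f s) k = - fourier1 f k.
Proof.
move=> bf; rewrite -mulN1r -fourier1Z//; apply: eq_fourier1 => s.
by rewrite mulN1r.
Qed.

Lemma fourier1B f g k : bmc f -> bmc g ->
  fourier1 (fun s => f s - g s) k = fourier1 f k - fourier1 g k.
Proof. by move=> bf bg; rewrite fourier1D ?fourier1N//; exact: bmfN. Qed.

Lemma fourier1_0 k : fourier1 (fun _ : R => 0) k = 0 :> C.
Proof.
rewrite -[RHS](mul0r (fourier1 (fun _ : R => (0 : C)) k)).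
rewrite -(@fourier1Z 0 (fun=> 0) k (bmf_cst _ 0)).
by apply: eq_fourier1 => s; rewrite mul0r.
Qed.

Lemma fourier1_sum (I : Type) (r : seq I) (F : I -> R -> C) k :
  (forall i, bmc (F i)) ->
  fourier1 (fun s => \sum_(i <- r) F i s) k = \sum_(i <- r) fourier1 (F i) k.
Proof.
move=> bF; elim: r => [|i r IH].
  by rewrite big_nil -[RHS](fourier1_0 k); apply: eq_fourier1 => s; rewrite big_nil.
rewrite big_cons -IH -fourier1D//; last exact: bmf_sum.
by apply: eq_fourier1 => s; rewrite big_cons.
Qed.

Lemma fourier1_bound f M k : bmc f -> (forall s, cellR s -> cabs (f s) <= M) ->
  cabs (fourier1 f k) <= 2 * M.
Proof.
move=> bf fM; rewrite fourier1E cabsM cabs_real ger0_norm; last first.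
  by rewrite invr_ge0 ltW// period_gt0.
rewrite mulrC ler_pdivrMr ?period_gt0//.
have := @intc_bound R _ (measurableTypeR R) mu cellR measurable_cell mu_cell_fin
  (fun s => f s * eik (- k) s) M (bmc_eik _ bf).
rewrite fine_mu_cell; apply => s cs.
by rewrite cabsM cabs_eik mulr1 fM.
Qed.

Lemma fourier1_eik k l : fourier1 (eik k) l = (k == l)%:R.
Proof.
rewrite fourier1E (@eq_intp _ (eik (k - l))).
  rewrite intp_eik subr_eq0; case: eqP => _; last by rewrite mulr0.
  by rewrite -realCM mulVf// gt_eqF// period_gt0.
by move=> s _; rewrite eikD.
Qed.

(** Integration by parts over one period: the derivative [G] of [f * eik (- k)] has zero integral,
    since the boundary terms cancel by periodicity. *)
Lemma fourier1_derivative f df k : (forall x, cd f x (df x)) -> ccont df ->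
  periodic f -> fourier1 df k = 'i * k%:~R * fourier1 f k.
Proof.
move=> fd cdf pf.
have cf : ccont f by apply: cd_ccont => x; exists (df x).
pose G s := df s * eik (- k) s + f s * ('i * (- k)%:~R * eik (- k) s).
have : intp G = 0.
  apply: (@intp_periodic_derivative (fun s => f s * eik (- k) s)).
  - by move=> x; apply: cdM => //; exact: eik_cd.
  - apply: ccontD; apply: ccontM => //; first exact: eik_cont.
    by apply: ccontZ; exact: eik_cont.
  - by move=> s; rewrite pf eik_period.
rewrite /G (@intpD) //; last 2 first.
- by apply: bmc_eik; exact: ccont_bmf.
- apply: ccont_bmf; apply: ccontM => //; apply: ccontZ; exact: eik_cont.
rewrite (@eq_intp
  (fun s => f s * ('i * (- k)%:~R * eik (- k) s))
  (fun s => ('i * (- k)%:~R) * (f s * eik (- k) s))); last first.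
  by move=> s _; ring.
rewrite (@intpZ) //; last first.
  by apply: bmc_eik; exact: ccont_bmf.
move/eqP; rewrite addr_eq0 => /eqP E.
by rewrite !fourier1E E rmorphN /=; ring.
Qed.

End CircleIntegral.

(** * Trigonometric polynomials and Bessel's inequality *)

Section TrigPolynomials.
Variable R : realType.
Local Notation C := R[i].
Local Notation mu := (@lebesgue_measure R).
Local Notation cellR := (@cell R).
Local Notation intp := (cintegral mu cellR).
Local Notation per := (period R).
Local Notation bmc := (@bmf R _ (measurableTypeR R) cellR).
Implicit Types (f g : R -> C) (c : int -> C).

Definition box (N : nat) : seq int :=
  [seq (i%:Z - N%:Z) | i <- iota 0 N.*2.+1].

Lemma box_uniq N : uniq (box N).
Proof. by rewrite map_inj_uniq ?iota_uniq// => i j; lia. Qed.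

Lemma mem_box N k : (k \in box N) = (`|k| <= N)%N.
Proof.
apply/mapP/idP => [[j]|kN].
  by rewrite mem_iota add0n => /andP[_ h] ->; lia.
exists `|(k + N%:Z)%R|%N; last by lia.
by rewrite mem_iota; lia.
Qed.

Definition psum (V : nmodType) (c : int -> V) N : V := \sum_(k <- box N) c k.

Lemma psum_pick (V : nmodType) (x : V) N k :
  \sum_(l <- box N) (if l == k then x else 0) = if (`|k| <= N)%N then x else 0.
Proof.
rewrite -mem_box -big_mkcond /=; case: ifPn => kN.
  rewrite (big_rem k)// eqxx big1_seq ?Monoid.mulm1// => i /andP[/eqP ->].
  by rewrite mem_rem_uniqF// box_uniq.
by rewrite big1_seq// => i /andP[/eqP ->]; rewrite (negPf kN).
Qed.

Definition tp N c (s : R) : C := \sum_(k <- box N) c k * eik k s.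

Lemma tp_cont N c : ccont (tp N c).
Proof. by apply: ccont_sum => k; apply: ccontZ; exact: eik_cont. Qed.
Lemma tp_periodic N c : periodic (tp N c).
Proof. by move=> s; apply: eq_bigr => k _; rewrite eik_period. Qed.
Lemma tp_bmc N c : bmc (tp N c). Proof. exact/ccont_bmf/tp_cont. Qed.
Lemma tp_cd N c x : cd (tp N c) x (tp N (fun k => 'i * k%:~R * c k) x).
Proof.
rewrite /tp; apply: cd_sum => k; rewrite mulrAC [X in cd _ _ X]mulrC mulrCA.
rewrite [X in _ * X]mulrC -mulrA.
have := cdZ (c k) (eik_cd k x); congr (cd _ _ _); ring.
Qed.
Lemma fourier1_tp N c k : fourier1 (tp N c) k = if (`|k| <= N)%N then c k else 0.
Proof.
rewrite fourier1_sum => [|l]; last by apply: bmfZ; exact/ccont_bmf/eik_cont.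
rewrite -psum_pick; apply: eq_bigr => l _.
rewrite fourier1Z ?fourier1_eik; last exact/ccont_bmf/eik_cont.
by case: eqP => [->|]; rewrite ?mulr1 ?mulr0.
Qed.

Lemma conjc_sum (I : Type) (r : seq I) (F : I -> C) :
  conjc (\sum_(i <- r) F i) = \sum_(i <- r) conjc (F i).
Proof. exact: (rmorph_sum (@conjc R)). Qed.
Lemma conjcM (z w : C) : conjc (z * w) = conjc z * conjc w.
Proof. exact: (rmorphM (@conjc R)). Qed.
Lemma reC_conj (z : C) : reC (conjc z) = reC z. Proof. by case: z. Qed.
Lemma imC_conj (z : C) : imC (conjc z) = - imC z. Proof. by case: z. Qed.
Lemma mul_conj (z : C) : z * conjc z = (sqmod z)%:C.
Proof.
by apply: ceqP; rewrite !reimE reC_conj imC_conj ?sqmodE; ring.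
Qed.
Lemma sqmodB_conj (z w : C) :
  sqmod (z - w) = sqmod z + sqmod w - 2 * reC (z * conjc w).
Proof. by rewrite !sqmodE !reimE reC_conj imC_conj; ring. Qed.

Lemma intp_mul_conj_tp f N c : bmc f ->
  intp (fun s => f s * conjc (tp N c s)) =
  per%:C * psum (fun k => fourier1 f k * conjc (c k)) N.
Proof.
move=> bf.
rewrite (@eq_intp R _
  (fun s => \sum_(k <- box N) conjc (c k) * (f s * eik (- k) s))); last first.
  move=> s _; rewrite conjc_sum mulr_sumr; apply: eq_bigr => k _.
  by rewrite conjcM eik_conj; ring.
rewrite (@intp_sum R)//; last first.
  by move=> k; apply: bmfZ; exact: bmc_eik.
rewrite /psum.  rewrite mulr_sumr; apply: eq_bigr => k _.
rewrite (@intpZ R)//; last exact: bmc_eik.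
rewrite fourier1E mulrA mulrA -realCM mulfV ?mul1r; last by rewrite gt_eqF// period_gt0.
by rewrite mulrC.
Qed.

Lemma intr_sqmod_tp N c :
  Rintegral mu cellR (fun s => sqmod (tp N c s)) = per * psum (fun k => sqmod (c k)) N.
Proof.
have := intp_mul_conj_tp N c (tp_bmc N c) => /(congr1 (@reC R)).
rewrite reC_int reCM reC_real imC_real mul0r subr0 => E.
rewrite (_ : (fun s => sqmod (tp N c s)) =
   @reC R \o (fun s => tp N c s * conjc (tp N c s))); last first.
  by apply/funext => s /=; rewrite mul_conj.
rewrite E; congr (_ * _); rewrite /psum reC_sum big_seq [RHS]big_seq.
by apply: eq_bigr => k; rewrite mem_box => kN; rewrite fourier1_tp kN mul_conj.
Qed.

(** Expand the nonnegative integral of |f - S|^2, where S is the truncated Fourier series: both the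
    cross term and the norm of S equal the truncated sum of squared coefficients. *)
Lemma bessel f N : bmc f ->
  per * psum (fun k => sqmod (fourier1 f k)) N <=
  Rintegral mu cellR (fun s => sqmod (f s)).
Proof.
move=> bf; set c := fourier1 f; set S := tp N c.
have bS : bmc S := tp_bmc N c.
have b1 : bmc (fun s => f s * conjc (S s)).
  apply: bmfM => //; case: bS => a b; split.
    by apply: eq_bmr a => s /=; rewrite reC_conj.
  by apply: eq_bmr (bmrN b) => s /=; rewrite imC_conj.
have h0 : 0 <= Rintegral mu cellR (fun s => sqmod (f s - S s)).
  by apply: Rintegral_ge0 => s _; exact: sqmod_ge0.
have E1 : Rintegral mu cellR (fun s => reC (f s * conjc (S s))) =
    per * psum (fun k => sqmod (c k)) N.
  have := intp_mul_conj_tp N c bf => /(congr1 (@reC R)).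
  rewrite reC_int reCM reC_real imC_real mul0r subr0 /comp => ->.
  congr (_ * _); rewrite /psum reC_sum; apply: eq_bigr => k _.
  by rewrite mul_conj.
move: h0.
rewrite (@eq_Rintegral _ _ _ mu cellR (fun s => 1 * (1 * sqmod (f s) + 1 * sqmod (S s))
   + (- 2) * reC (f s * conjc (S s)))); last first.
  by move=> s _; rewrite sqmodB_conj; ring.
have bfs := bmf_sqmod bf; have bSs := bmf_sqmod bS.
rewrite (@intpr_lin R)//; last first.
- by case: b1.
- by apply: bmrD; apply: bmrM => //; exact: bmr_cst.
rewrite (@intpr_lin R)// E1 intr_sqmod_tp.
lra.
Qed.

End TrigPolynomials.

(** * A continuous periodic function is determined by its Fourier coefficients *)

Section FourierUniqueness.
Variable R : realType.
Local Notation C := R[i].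
Local Notation mu := (@lebesgue_measure R).
Local Notation cellR := (@cell R).
Local Notation intp := (cintegral mu cellR).
Local Notation intr := (Rintegral mu cellR).
Local Notation per := (period R).
Local Notation bmc := (@bmf R _ (measurableTypeR R) cellR).

Lemma continuous_bmr (h : R -> R) : continuous h ->
  bmr cellR (h : measurableTypeR R -> R).
Proof. by move=> /ccont_real/ccont_bmf[]. Qed.

Lemma cos_lt1 (y : R) : 0 < y < per -> cos y < 1.
Proof.
move=> /andP[y0 y2].
have s0 : 0 < sin (y / 2).
  by apply: sin_gt0_pi; rewrite divr_gt0//= ltr_pdivrMr// mulrC.
have -> : cos y = 1 - 2 * sin (y / 2) ^+ 2.
  rewrite {1}(splitr y) cosD; have := cos2Dsin2 (y / 2); rewrite !expr2; lra.
by rewrite ltrBlDr ltrDl mulr_gt0// exprn_gt0.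
Qed.

(** Near s continuity gives e; away from s the factor 1 - cos (x - s) has a positive minimum, so a
    large multiple of it dominates the oscillation of h. The approximate-identity argument thus
    reduces to one moment of the kernel. *)
Lemma continuity_bump (h : R -> R) s (e : R) : continuous h -> 0 < s < per -> 0 < e ->
  exists2 M, 0 <= M & forall x, cellR x ->
    `|h x - h s| <= e + M * (1 - cos (x - s)).
Proof.
move=> ch /andP[s0 sp] e0.
have [B hB] := continuous_bounded_cell ch.
have scell : cellR s by rewrite /cell /= in_itv /= !ltW.
have B0 : 0 <= B by apply: le_trans (normr_ge0 (h s)) (hB _ scell).
have [d0 d00 hd0] : exists2 d, 0 < d & forall x, `|x - s| < d -> `|h x - h s| <= e.
  have /cvgrPdist_le/(_ e e0) := ch s.
  move=> /nbhs_ballP[d /= d0 dH]; exists d => // x xd.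
  by rewrite distrC; apply: dH; rewrite /ball /= distrC.
(* As d is at most s and per - s, a point of the cell at distance at least d from s lies at a
   distance in [d, per - d], where the cosine stays below 1. *)
pose d := Num.min d0 (Num.min s (per - s)).
have d_gt0 : 0 < d by rewrite !lt_min d00 s0 subr_gt0.
have dd0 : d <= d0 by rewrite ge_min lexx.
have ds : d <= s by rewrite !ge_min lexx /= orbT.
have dps : d <= per - s by rewrite !ge_min lexx !orbT.
have [||c ci cM] := @EVT_min R (fun y => 1 - cos y) d (per - d).
- by lra.
- apply: continuous_subspaceT => y; apply: cvgB; first exact: cvg_cst.
  exact: continuous_cos.
have c0 : 0 < 1 - cos c.
  rewrite subr_gt0; apply: cos_lt1; move: ci; rewrite in_itv /= => /andP[a b].
  by apply/andP; split; lra.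
exists (2 * B / (1 - cos c)); first by rewrite divr_ge0 ?mulr_ge0// ltW.
move=> x /[dup] xc; rewrite /cell /= in_itv /= => /andP[x0 xp].
have [xs|xs] := ltP `|x - s| d.
  apply: le_trans (hd0 x (lt_le_trans xs dd0)) _.
  rewrite lerDl; apply: mulr_ge0; last by rewrite subr_ge0 cos_le1.
  by apply: divr_ge0; [exact: mulr_ge0|exact: ltW].
have cosabs : cos (x - s) = cos `|x - s|.
  by case: (ger0P (x - s)) => // _; rewrite cosN.
have h1 : 1 - cos c <= 1 - cos (x - s).
  rewrite cosabs; apply: cM; rewrite in_itv /= xs /=.
  by case: (ger0P (x - s)) => _; lra.
have h2 : `|h x - h s| <= 2 * B.
  by apply: le_trans (ler_normB _ _) _; have := hB _ xc; have := hB _ scell; lra.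
apply: le_trans h2 _; rewrite -[leLHS]add0r; apply: lerD; first exact: ltW.
by rewrite -mulrA ler_peMr ?mulr_ge0// ler_pdivlMl ?mulr1.
Qed.

Section Kernel.
Variable s : R.

(** This is cos^(2n) ((x - s) / 2), the de la Vallee Poussin kernel centred at s, up to
    normalization. *)
Definition cosker n (x : R) : R := (2^-1 * (1 + cos (x - s))) ^+ n.

Lemma rd_shift (x : R) : rd (fun y => y - s) x 1.
Proof. by have := rdB (rd_id x) (rd_cst s x); rewrite subr0. Qed.
Lemma rd_cosshift x : rd (fun y => cos (y - s)) x (- sin (x - s)).
Proof. by have := @rd_comp R cos (fun y => y - s) x _ _ (rd_cos (x - s)) (rd_shift x); rewrite mulr1. Qed.
Lemma rd_sinshift x : rd (fun y => sin (y - s)) x (cos (x - s)).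
Proof. by have := @rd_comp R sin (fun y => y - s) x _ _ (rd_sin (x - s)) (rd_shift x); rewrite mulr1. Qed.

Lemma cos_shift_cont : continuous (fun x => cos (x - s)).
Proof. by move=> x; exact: rd_continuous (rd_cosshift x). Qed.

Lemma cosker_rd n x : rd (cosker n) x
  (n%:R * (2^-1 * (1 + cos (x - s))) ^+ n.-1 * (2^-1 * - sin (x - s))).
Proof.
apply: (@rd_comp R (fun y => y ^+ n) (fun x => 2^-1 * (1 + cos (x - s)))).
  exact: rdX.
have := rdM (rd_cst 2^-1 x) (rdD (rd_cst 1 x) (rd_cosshift x)).
by rewrite mul0r !add0r.
Qed.

Lemma cosker_cont n : continuous (cosker n).
Proof. by move=> x; exact: rd_continuous (cosker_rd n x). Qed.

Lemma cosker_ge0 n x : 0 <= cosker n x.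
Proof.
apply: exprn_ge0; apply: mulr_ge0; first by rewrite invr_ge0.
by have := cos_geN1 (x - s); lra.
Qed.

(** The derivative of sin (x - s) times the kernel is the kernel times 1 - (n + 1) (1 - cos (x -
    s)), and it integrates to zero over a period. So the normalized kernel gives 1 - cos the mean
    1/(n + 1): concentration at s without any asymptotics. *)
Lemma cosker_moment n :
  intr (cosker n) = n.+1%:R * intr (fun x => (1 - cos (x - s)) * cosker n x).
Proof.
pose w x := (1 - cos (x - s)) * cosker n x.
have cw : continuous w.
  move=> x; apply: cvgM; last exact: cosker_cont.
  by apply: cvgB; [exact: cvg_cst|exact: cos_shift_cont].
have E : intr (fun x => 1 * cosker n x + (- n.+1%:R) * w x) = 0.
  rewrite (@Rint_derivative _ (fun x => sin (x - s) * cosker n x)).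
  - rewrite /cosker -[per - s]addrC /period mulr_natl sinD2pi cosD2pi add0r.
    by rewrite subrr.
  - move=> x; have := rdM (rd_sinshift x) (cosker_rd n x).
    congr (rd _ _ _); rewrite /w /cosker; clear w cw.
    have cs := cos2Dsin2 (x - s).
    case: n => [|n]; first by rewrite !expr0; ring.
    rewrite exprS /= -(natr1 n.+1); set c := cos (x - s) in cs *; set sn := sin (x - s) in cs *.
    set T := _ ^+ n; set m := n.+1%:R.
    have -> : sn * (m * T * (2^-1 * - sn)) = - (m * T * 2^-1 * sn ^+ 2) by ring.
    have -> : sn ^+ 2 = 1 - c ^+ 2 by lra.
    by field.
  - move=> x; apply: cvgD; apply: cvgM => //; try exact: cvg_cst.
    + exact: cosker_cont.
    + exact: cw.
move: E; rewrite (@intpr_lin R).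
- by rewrite mul1r mulNr => /eqP; rewrite subr_eq0 => /eqP.
- by apply: continuous_bmr; exact: cosker_cont.
- exact: continuous_bmr.
Qed.

(** Passing from n to n + 1 subtracts half of [w], so by the moment identity it multiplies the
    integral by 1 - 1/(2(n + 1)), which is positive. *)
Lemma cosker_gt0 n : 0 < intr (cosker n).
Proof.
elim: n => [|n IH].
  rewrite (_ : cosker 0 = fun=> 1); last by apply/funext => x; rewrite /cosker expr0.
  rewrite (@Rintegral_cst _ _ _ mu)//; last exact: measurable_cell.
  by rewrite mul1r; apply: lt_le_trans (period_gt0 R) _; rewrite fine_mu_cell.
pose w x := (1 - cos (x - s)) * cosker n x.
have cw : continuous w.
  move=> x; apply: cvgM; last exact: cosker_cont.
  by apply: cvgB; [exact: cvg_cst|exact: cos_shift_cont].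
have -> : cosker n.+1 = fun x => 1 * cosker n x + (- 2^-1) * w x.
  by apply/funext => x; rewrite /w /cosker exprS; field.
rewrite intpr_lin; last 2 first.
- by apply: continuous_bmr; exact: cosker_cont.
- exact: continuous_bmr.
move: IH; rewrite cosker_moment -/w => h.
have w0 : 0 < intr w by move: h; rewrite pmulr_rgt0.
have : 1 <= n.+1%:R :> R by rewrite ler1n.
rewrite mul1r; nra.
Qed.

(** Raising n multiplies by a trigonometric polynomial of degree one, that is, shifts frequencies by
    at most one; orthogonality to all exponentials therefore passes to every kernel. *)
Lemma coskerS n x : (cosker n.+1 x)%:C =
  2^-1 * (cosker n x)%:C + 4^-1 * expi (- s) * ((cosker n x)%:C * eik 1 x) +
  4^-1 * expi s * ((cosker n x)%:C * eik (-1) x).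
Proof.
have e1 : eik 1 x = expi x :> C by rewrite /eik mul1r.
have em : eik (-1) x = expi (- x) :> C by rewrite eikN mul1r.
rewrite e1 em /cosker exprS 2!realCM realCD cosCE expiD opprB [s - x]addrC expiD.
have -> : (2^-1 : R)%:C = 2^-1 :> C by rewrite realCV rmorph_nat.
have -> : (1 : R)%:C = 1 :> C by [].
by field.
Qed.

End Kernel.

(** F is orthogonal to every kernel centred at s. Comparing F with the constant F s, the bump
    estimate and the moment identity bound |F s| times the mass of the kernel by e times that mass,
    for each e > 0. *)
Lemma fourier_unique (F : R -> C) : ccont F -> periodic F ->
  (forall k, fourier1 F k = 0) -> forall s, F s = 0.
Proof.
move=> cF pF F0.
have per0 := period_gt0 R.
have intF k : intp (fun x => F x * eik k x) = 0.
  have := F0 (- k); rewrite fourier1E opprK => /eqP; rewrite mulf_eq0 realC_eq0.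
  by rewrite invr_eq0 gt_eqF//= => /eqP.
(* The extra exponential of arbitrary frequency k is what lets the induction on n absorb the shifts
   by one. *)
have ortho s n k : intp (fun x => F x * ((cosker s n x)%:C * eik k x)) = 0.
  elim: n k => [|n IH] k.
    rewrite -[RHS](intF k); apply: eq_intp => x _.
    by rewrite /cosker expr0 mul1r.
  have b l : bmc (fun x => F x * ((cosker s n x)%:C * eik l x)).
    apply: ccont_bmf; apply: ccontM => //; apply: ccontM; last exact: eik_cont.
    by apply: ccont_real; exact: cosker_cont.
  rewrite (eq_intp (g := fun x => 2^-1 * (F x * ((cosker s n x)%:C * eik k x)) +
    4^-1 * expi (- s) * (F x * ((cosker s n x)%:C * eik (1 + k) x)) +
    4^-1 * expi s * (F x * ((cosker s n x)%:C * eik (-1 + k) x)))).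
    rewrite intpD; [|by apply: bmfD; exact: bmfZ|exact: bmfZ].
    rewrite intpD; [|exact: bmfZ|exact: bmfZ].
    by rewrite !intpZ// !IH !mulr0 !addr0.
  by move=> x _; rewrite coskerS !eikD; ring.
have part (h : C -> R) : (h = @reC R \/ h = @imC R) -> continuous (h \o F) ->
    forall s, 0 < s < per -> h (F s) = 0.
  move=> hh ch s sp; set H := h \o F.
  apply/eqP; rewrite -normr_le0; apply/ler_addgt0Pl => e e0; rewrite addr0.
  have e2 : 0 < e / 2 by rewrite divr_gt0.
  have [M M0 HM] := continuity_bump ch sp e2.
  (* Chosen so that M / (n + 1) <= e / 2: by the moment identity the term M (1 - cos) then costs at
     most half of e. *)
  pose n := Num.trunc (2 * M / e).
  have nM : M <= e / 2 * n.+1%:R.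
    have := truncnS_gt (2 * M / e); rewrite -/n ltr_pdivrMr// => /ltW.
    lra.
  pose t := intr (cosker s n); pose w x := (1 - cos (x - s)) * cosker s n x.
  have cT := @cosker_cont s n.
  have cw : continuous w.
    move=> x; apply: cvgM; last exact: cT.
    by apply: cvgB; [exact: cvg_cst|exact: cos_shift_cont].
  have cHT : continuous (fun x => H x * cosker s n x).
    by move=> x; apply: cvgM; [exact: ch|exact: cT].
  have hT : intr (fun x => H x * cosker s n x) = 0.
    have := ortho s n 0.
    rewrite (eq_intp (g := fun x => (cosker s n x)%:C * F x)); last first.
      by move=> x _; rewrite eik0 mulr1 mulrC.
    case: hh => hE; [move=> /(congr1 (@reC R))|move=> /(congr1 (@imC R))];
      rewrite ?reC_int ?imC_int => E; rewrite -[RHS]E; apply: eq_Rintegral => x _;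
      by rewrite /H hE /= !reimE; ring.
  have tE : `|H s| * t <= e * t.
    have -> : e * t = e / 2 * t + e / 2 * t by rewrite -mulrDl -splitr.
    apply: le_trans (_ : e / 2 * t + M * intr w <= _); last first.
      rewrite lerD2l /t cosker_moment -/w mulrA ler_wpM2r//.
      apply: Rintegral_ge0 => x _; apply: mulr_ge0; last exact: cosker_ge0.
      by rewrite subr_ge0 cos_le1.
    rewrite -intpr_lin; [|exact: continuous_bmr|exact: continuous_bmr].
    have -> : `|H s| * t = `|intr (fun x => H s * cosker s n x + (-1) * (H x * cosker s n x))|.
      rewrite intpr_lin ?hT ?mulr0 ?addr0 ?normrM -/t; last 2 first.
      - exact: continuous_bmr.
      - exact: continuous_bmr.
      by congr (_ * _); rewrite ger0_norm// ltW// cosker_gt0.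
    have cD : continuous (fun x => H s * cosker s n x + (-1) * (H x * cosker s n x)).
      move=> x; apply: cvgD; apply: cvgM; try exact: cvg_cst; first exact: cT.
      exact: cHT.
    have /(bmr_integrable (@measurable_cell R) (@mu_cell_fin R)) := continuous_bmr cD.
    move=> /(le_normr_Rintegral (@measurable_cell R)) /le_trans; apply.
    apply: intpr_le.
    - by apply: continuous_bmr => x; apply: cvg_norm; exact: cD.
    - by apply: continuous_bmr => x; apply: cvgD; apply: cvgM; try exact: cvg_cst;
        [exact: cT|exact: cw].
    move=> x xc; rewrite mulN1r -mulrBl normrM (ger0_norm (cosker_ge0 _ _ _)).
    rewrite /w mulrA -mulrDl ler_wpM2r ?cosker_ge0// distrC; exact: HM.
  by move: tE; rewrite ler_pM2r// cosker_gt0.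
have inner s : 0 < s < per -> F s = 0.
  move=> sp; case: (cF) => rF jF.
  by apply: ceqP; rewrite (part _ _ _ s sp)//; [left|right].
(* The bump estimate needs s in the interior of the cell; the endpoint follows by continuity from
   points y > 0. *)
have at0 : F 0 = 0.
  suff lim0 (h : C -> R) : h 0 = 0 -> continuous (h \o F) -> h (F 0) = 0.
    by case: cF => a b; apply: ceqP; rewrite lim0.
  move=> h0 ch; apply/eqP; rewrite -normr_le0; apply/ler_addgt0Pl => e e0.
  rewrite addr0; have /cvgrPdist_le/(_ e e0) := ch 0.
  move=> /nbhs_ballP[d /= d0 dH].
  pose y := Num.min (d / 2) (per / 2).
  have y0 : 0 < y by rewrite lt_min !divr_gt0.
  have yd : y < d by rewrite gt_min; apply/orP; left; lra.
  have yp : y < per by rewrite gt_min; apply/orP; right; lra.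
  have := dH y; rewrite /ball /= sub0r normrN gtr0_norm// => /(_ yd).
  by rewrite /comp (inner y) ?y0// h0 subr0.
move=> s; have [k [x [xc ->]]] := reduce_cell s; rewrite periodic_int//.
move: xc; rewrite /cell /= in_itv /= => /andP[x0 xp].
have [->//|xn0] := eqVneq x 0.
have [->|xnp] := eqVneq x per; first by rewrite -[per]add0r pF.
by apply: inner; rewrite lt_neqAle eq_sym xn0 x0 lt_neqAle xnp.
Qed.

End FourierUniqueness.

(** * Sums over the integers and absolutely convergent Fourier series *)

Section IntegerSums.
Variable R : realType.
Local Notation C := R[i].

Lemma psumB (V : zmodType) (c : int -> V) N M : (N <= M)%N ->
  psum c M - psum c N = \sum_(k <- box M | (N < `|k|)%N) c k.
Proof.
move=> NM; rewrite /psum [X in X - _](bigID (fun k : int => (N < `|k|)%N)) /=.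
rewrite (_ : \sum_(k <- box N) c k = \sum_(k <- box M | ~~ (N < `|k|)%N) c k) ?addrK//.
rewrite -[RHS]big_filter; apply: perm_big; apply: uniq_perm.
- exact: box_uniq.
- by apply: filter_uniq; exact: box_uniq.
by move=> k; rewrite mem_filter !mem_box -leqNgt; lia.
Qed.

Lemma psumS (V : zmodType) (c : int -> V) N :
  psum c N.+1 = psum c N + (c (N.+1)%:Z + c (- (N.+1)%:Z)).
Proof.
apply/eqP; rewrite addrC -subr_eq psumB//; apply/eqP.
rewrite -big_filter (perm_big [:: (N.+1)%:Z; - (N.+1)%:Z]); last first.
  apply: uniq_perm; first by apply: filter_uniq; exact: box_uniq.
    by [].
  by move=> k; rewrite mem_filter mem_box !inE; lia.
by rewrite !big_cons big_nil Monoid.mulm1.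
Qed.

Implicit Types (c e : int -> R).

Lemma psum_ge0 c N : (forall k, 0 <= c k) -> 0 <= psum c N.
Proof. by move=> c0; exact: sumr_ge0. Qed.
Lemma psum_mono c N M : (forall k, 0 <= c k) -> (N <= M)%N -> psum c N <= psum c M.
Proof. by move=> c0 NM; rewrite -subr_ge0 psumB//; exact: sumr_ge0. Qed.
Lemma ler_psum c e N : (forall k, c k <= e k) -> psum c N <= psum e N.
Proof. by move=> ce; exact: ler_sum. Qed.
Lemma psum_lin c e a b N :
  psum (fun k => a * c k + b * e k) N = a * psum c N + b * psum e N.
Proof. by rewrite /psum big_split /= -!mulr_sumr. Qed.
Lemma psumZ c a N : psum (fun k => a * c k) N = a * psum c N.
Proof. by rewrite /psum -mulr_sumr. Qed.

(** For nonnegative terms the unordered sum is a supremum over finite sets, and each finite set lies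
    in some [B N], so partial sums along [B] decide. Used for boxes in one and in two indices. *)
Lemma esum_finite_le (T : choiceType) (B : nat -> seq T) (c : T -> R) X :
  (forall N, uniq (B N)) ->
  (forall A : set T, finite_set A -> exists N, A `<=` [set` B N]) ->
  (forall k, 0 <= c k) ->
  ((\esum_(k in [set: T]) (c k)%:E <= X%:E)%E <->
   forall N, \sum_(k <- B N) c k <= X).
Proof.
move=> uB hB c0; split=> [H N|H].
  rewrite -lee_fin; apply: le_trans H; apply: esum_ge.
  exists [set` B N]; first by split => //; exact: finite_seq.
  by rewrite -fsbig_seq// sumEFin.
apply: ub_ereal_sup => _ [A [fA _] <-].
have [N AN] := hB A fA.
apply: le_trans (_ : \sum_(k \in [set` B N]) (c k)%:E <= _)%E.
  apply: lee_fsum_nneg_subset => //.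
  - by move=> x; rewrite !inE => /AN.
  - by move=> x _; rewrite lee_fin.
by rewrite -fsbig_seq// sumEFin lee_fin.
Qed.

Lemma box_exhausts (A : set int) : finite_set A -> exists N, A `<=` [set` box N].
Proof.
move=> /finite_seqP[s ->]; exists (\max_(k <- s) `|k|)%N => k /= ks.
by rewrite mem_box; exact: (@leq_bigmax_seq _ _ xpredT (fun k : int => `|k|%N)).
Qed.

Lemma esum_psum_le c X : (forall k, 0 <= c k) ->
  ((\esum_(k in [set: int]) (c k)%:E <= X%:E)%E <-> forall N, psum c N <= X).
Proof.
by move=> c0; apply: esum_finite_le => //; [exact: box_uniq|exact: box_exhausts].
Qed.

Lemma esum_fin_lub (T : choiceType) (c : T -> R) X : (forall k, 0 <= c k) ->
  (\esum_(k in [set: T]) (c k)%:E <= X%:E)%E ->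
  (fine (\esum_(k in [set: T]) (c k)%:E) <= X) /\
  (\esum_(k in [set: T]) (c k)%:E = (fine (\esum_(k in [set: T]) (c k)%:E))%:E)%E.
Proof.
move=> c0 H; have ge : (0 <= \esum_(k in [set: T]) (c k)%:E)%E.
  by apply: esum_ge0 => k _; rewrite lee_fin.
have fn : (\esum_(k in [set: T]) (c k)%:E)%E \is a fin_num.
  by rewrite ge0_fin_numE//; apply: le_lt_trans H _; exact: ltry.
split; last by rewrite fineK.
by rewrite -lee_fin fineK.
Qed.

(** The nonnegative quadratic form [P] in (t, u) is evaluated at (B, - S); if B = 0, a suitable u
    would make the form negative unless S = 0. *)
Lemma cauchy_schwarz (I : Type) (r : seq I) (a b : I -> R) :
  (\sum_(i <- r) a i * b i) ^+ 2 <=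
  (\sum_(i <- r) a i ^+ 2) * (\sum_(i <- r) b i ^+ 2).
Proof.
set A := \sum_(i <- r) a i ^+ 2; set B := \sum_(i <- r) b i ^+ 2.
set S := \sum_(i <- r) a i * b i.
have A0 : 0 <= A by apply: sumr_ge0 => i _; exact: sqr_ge0.
have B0 : 0 <= B by apply: sumr_ge0 => i _; exact: sqr_ge0.
have P t u : 0 <= t ^+ 2 * A + 2 * t * u * S + u ^+ 2 * B.
  have -> : t ^+ 2 * A + 2 * t * u * S + u ^+ 2 * B =
      \sum_(i <- r) (t * a i + u * b i) ^+ 2.
    rewrite !mulr_sumr -!big_split /=; apply: eq_bigr => i _; ring.
  by apply: sumr_ge0 => i _; exact: sqr_ge0.
have [B00|Bn0] := eqVneq B 0.
  suff -> : S = 0 by rewrite expr0n mulr_ge0.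
  apply/eqP; apply: contraT => S0.
  have := P 1 (- (A + 1) / (2 * S)).
  rewrite B00 mulr0 addr0 expr1n mul1r mulr1.
  have -> : 2 * (- (A + 1) / (2 * S)) * S = - (A + 1) by field.
  by move=> h; exfalso; lra.
have := P B (- S); have BB : 0 < B by rewrite lt_neqAle eq_sym Bn0.
have -> : B ^+ 2 * A + 2 * B * - S * S + (- S) ^+ 2 * B = B * (A * B - S ^+ 2) by ring.
by rewrite pmulr_rge0// subr_ge0.
Qed.

Lemma psum_inv_bound N : psum (fun k => (1 + (k%:~R : R) ^+ 2)^-1) N <= 5.
Proof.
(* The induction carries a telescoping correction: with x = N + 1 the new pair of terms costs 2 / (1
   + x^2), which is at most 4/x - 4/(x + 1). At N = 0 equality holds, whence 5. *)
suff : psum (fun k => (1 + (k%:~R : R) ^+ 2)^-1) N <= 5 - 4 / N.+1%:R.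
  by move=> /le_trans; apply; rewrite gerBl divr_ge0.
elim: N => [|N IH].
  rewrite /psum /box /= big_cons big_nil subrr /= expr0n !addr0 invr1; lra.
rewrite psumS; apply: le_trans (lerD IH (lexx _)) _.
have -> : ((- (N.+1)%:Z)%:~R : R) ^+ 2 = (N.+1%:R) ^+ 2 by rewrite mulrNz sqrrN.
have -> : ((N.+1)%:Z%:~R : R) = N.+1%:R by [].
have -> : (N.+2%:R : R) = N.+1%:R + 1 by rewrite natr1.
have x1 : 1 <= N.+1%:R :> R by rewrite ler1n.
move: x1; set x : R := N.+1%:R => x1.
rewrite -lerBrDl -subr_ge0.
have -> : 5 - 4 / (x + 1) - (5 - 4 / x) - ((1 + x ^+ 2)^-1 + (1 + x ^+ 2)^-1) =
  (2 * (x - 1) ^+ 2 + 2 * (x - 1) + 4) / (x * (x + 1) * (1 + x ^+ 2)).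
  field; apply/and3P; split; rewrite gt_eqF//; nra.
apply: divr_ge0; first by have := sqr_ge0 (x - 1); lra.
by rewrite mulr_ge0 ?mulr_ge0 ?addr_ge0 ?sqr_ge0//; lra.
Qed.

(** Cauchy-Schwarz against the summable weights 1 / (1 + k^2): H^1 controls the absolute sum of the
    Fourier coefficients. This is the only source of the constant 5 in the sup bounds below. *)
Lemma psum_cabs_sqr (c : int -> C) N : psum (fun k => cabs (c k)) N ^+ 2 <=
  5 * psum (fun k => (1 + k%:~R ^+ 2) * sqmod (c k)) N.
Proof.
pose w (k : int) : R := 1 + k%:~R ^+ 2.
have w0 k : 0 < w k by rewrite ltr_wpDr ?sqr_ge0.
have -> : psum (fun k => cabs (c k)) N =
   \sum_(k <- box N) (Num.sqrt (w k))^-1 * (Num.sqrt (w k) * cabs (c k)).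
  by apply: eq_bigr => k _; rewrite mulKf// gt_eqF// sqrtr_gt0.
apply: le_trans (cauchy_schwarz _ _ _) _.
apply: ler_pM.
- by apply: sumr_ge0 => k _; exact: sqr_ge0.
- by apply: sumr_ge0 => k _; exact: sqr_ge0.
- apply: le_trans (psum_inv_bound N); apply: ler_sum => k _.
  by rewrite exprVn sqr_sqrtr// ltW.
- by apply: ler_sum => k _; rewrite exprMn sqr_cabs sqr_sqrtr// ltW.
Qed.

Definition asum (c : int -> C) : Prop :=
  exists X, forall N, psum (fun k => cabs (c k)) N <= X.

Lemma asum_tail (c : int -> C) : asum c -> exists2 e : nat -> R,
  e n @[n --> \oo] --> (0 : R) &
  forall N M, (N <= M)%N -> psum (fun k => cabs (c k)) M - psum (fun k => cabs (c k)) N <= e N.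
Proof.
move=> [X HX]; set u := psum (fun k => cabs (c k)).
have nd : {homo u : n m / (n <= m)%N >-> n <= m}.
  by move=> n m; apply: psum_mono => k; exact: cabs_ge0.
have cv : cvgn u.
  by apply: nondecreasing_is_cvgn => //; exists X => _ [N _ <-]; exact: HX.
exists (fun n => limn u - u n).
  by rewrite -(subrr (limn u)); apply: cvgB => //; exact: cvg_cst.
by move=> N M _; rewrite lerD2r; exact: nondecreasing_cvgn_le.
Qed.

Definition synth (c : int -> C) (s : R) : C :=
  lim (reC (tp N c s) @[N --> \oo]) +i* lim (imC (tp N c s) @[N --> \oo]).

Lemma tp_psum N (c : int -> C) s : tp N c s = psum (fun k => c k * eik k s) N.
Proof. by []. Qed.

Lemma tp_diff (c : int -> C) N M s : (N <= M)%N ->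
  cabs (tp M c s - tp N c s) <=
  psum (fun k => cabs (c k)) M - psum (fun k => cabs (c k)) N.
Proof.
move=> NM; rewrite !tp_psum !psumB//; apply: le_trans (cabs_sum _ _ _) _.
by apply: ler_sum => k _; rewrite cabsM cabs_eik mulr1.
Qed.

(** Exponentials have modulus 1, so the tail of the absolute coefficients bounds the error at every
    point at once. Continuity, Fourier coefficients and derivatives of the limit all rest on this
    uniformity. *)
Lemma synth_unif (c : int -> C) : asum c -> exists2 e : nat -> R,
  e n @[n --> \oo] --> (0 : R) &
  (forall N M s, (N <= M)%N -> cabs (tp M c s - tp N c s) <= e N) /\
  (forall N s, cabs (synth c s - tp N c s) <= e N).
Proof.
move=> /asum_tail[e e0 he]; exists e => //.
have h1 N M s : (N <= M)%N -> cabs (tp M c s - tp N c s) <= e N.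
  by move=> NM; apply: le_trans (tp_diff _ _ NM) (he _ _ NM).
split => // N s.
have cv : ccvg (fun M => tp M c s) (synth c s).
  have [l hl] := ccvg_cauchy (fun N M NM => h1 N M s NM) e0.
  suff -> : synth c s = l by [].
  have /ccvgP[a b] := hl.
  by apply: ceqP => /=; [exact: (cvg_lim _ a)|exact: (cvg_lim _ b)].
apply: (@ccvg_cabs_le _ (fun M => tp M c s - tp N c s)).
  by apply: ccvgB => //; exact: ccvg_cst.
by exists N => // M /= NM; exact: h1.
Qed.

Lemma synth_cvg (c : int -> C) s : asum c -> ccvg (fun N => tp N c s) (synth c s).
Proof.
move=> /synth_unif[e e0 [_ h]]; apply: (squeeze_cvgr _ (cvg_cst 0) e0).
near=> n; rewrite cabs_ge0 /= -cabsN opprB; exact: h.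
Unshelve. all: by end_near. Qed.

Lemma ccont_unif (F : nat -> R -> C) (f : R -> C) (e : nat -> R) :
  e n @[n --> \oo] --> (0 : R) -> (forall n, ccont (F n)) ->
  (forall n s, cabs (f s - F n s) <= e n) -> ccont f.
Proof.
move=> e0 cF Fe.
suff part (h : C -> R) : (forall z w, `|h z - h w| <= cabs (z - w)) ->
    (forall n, continuous (h \o F n)) -> continuous (h \o f).
  split; apply: part.
  - by move=> z w; rewrite -reCB reC_cabs.
  - by move=> n; case: (cF n).
  - by move=> z w; rewrite -imCB imC_cabs.
  - by move=> n; case: (cF n).
move=> hl ch s; apply/cvgrPdist_le => eps eps0.
have e3 : 0 < eps / 3 by lra.
have [n en] : exists n, e n <= eps / 3.
  move/cvgrPdist_le : e0 => /(_ _ e3)[n _ /(_ n (leqnn n))] /=.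
  by rewrite sub0r normrN => en; exists n; apply: le_trans en; exact: ler_norm.
have /cvgrPdist_le/(_ _ e3) := ch n s.
apply: filterS => x hx /=.
have -> : h (f s) - h (f x) = (h (f s) - h (F n s)) + (h (F n s) - h (F n x))
   - (h (f x) - h (F n x)) by ring.
apply: le_trans (ler_normB _ _) _; apply: le_trans (lerD (ler_normD _ _) (lexx _)) _.
have -> : eps = eps / 3 + eps / 3 + eps / 3 by field.
apply: lerD; first apply: lerD => //.
- by apply: le_trans (hl _ _) _; apply: le_trans en; exact: Fe.
- by apply: le_trans (hl _ _) _; apply: le_trans en; exact: Fe.
Qed.

Lemma synth_ccont (c : int -> C) : asum c -> ccont (synth c).
Proof.
move=> /synth_unif[e e0 [_ h]]; apply: ccont_unif e0 _ h => n; exact: tp_cont.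
Qed.

Lemma synth_periodic (c : int -> C) : periodic (synth c).
Proof.
by move=> s; rewrite /synth; congr (lim _ +i* lim _); under eq_fun do rewrite tp_periodic.
Qed.

Lemma fourier1_synth (c : int -> C) k : asum c -> fourier1 (synth c) k = c k.
Proof.
move=> ac; have [e e0 [_ h]] := synth_unif ac.
have bs := ccont_bmf (synth_ccont ac).
apply: (@ccvg_unique _ (fun n => fourier1 (tp n c) k)).
  have e2 : 2 * e n @[n --> \oo] --> (0 : R).
    by rewrite -(mulr0 2); apply: cvgM => //; exact: cvg_cst.
  apply: (squeeze_cvgr _ (cvg_cst 0) e2); near=> n.
  rewrite cabs_ge0 /= -cabsN opprB -fourier1B//; last exact: tp_bmc.
  by apply: fourier1_bound => [|s _]; [apply: bmfB => //; exact: tp_bmc|exact: h].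
apply: (squeeze_cvgr _ (cvg_cst 0) (cvg_cst 0)); exists `|k|%N => // n /= kn.
by rewrite fourier1_tp kn subrr cabs0 lexx.
Unshelve. all: by end_near. Qed.

(** The two continuous functions have the same Fourier coefficients, so uniqueness applies to their
    difference. *)
Lemma synth_fourier (f : R -> C) : ccont f -> periodic f -> asum (fourier1 f) ->
  synth (fourier1 f) = f.
Proof.
move=> cf pf af; apply/funext => s; apply/eqP; rewrite -subr_eq0; apply/eqP.
have cs := synth_ccont af.
apply: (@fourier_unique _ (fun s => synth (fourier1 f) s - f s)).
- exact: ccontB.
- by move=> x; rewrite synth_periodic pf.
- move=> k; rewrite fourier1B; [|exact: ccont_bmf|exact: ccont_bmf].
  by rewrite fourier1_synth// subrr.
Qed.

Lemma synth_cd (c : int -> C) x : asum c -> asum (fun k => 'i * k%:~R * c k) ->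
  cd (synth c) x (synth (fun k => 'i * k%:~R * c k) x).
Proof.
move=> ac adc; set dc := fun k => _.
have [e e0 [h1 h2]] := synth_unif adc.
have tpc N y := @tp_cd _ N c y.
split.
- apply: (@rd_limit _ (fun N y => reC (tp N c y)) (fun N y => reC (tp N dc y)) _ _ _ 1 e) => //.
  + by move=> n y _; case: (tpc n y).
  + by move=> n m y nm _; rewrite -reCB; apply: le_trans (reC_cabs _) (h1 _ _ _ nm).
  + by move=> y _; case: ((ccvgP _ _).1 (synth_cvg y ac)).
  + by case: ((ccvgP _ _).1 (synth_cvg x adc)).
- apply: (@rd_limit _ (fun N y => imC (tp N c y)) (fun N y => imC (tp N dc y)) _ _ _ 1 e) => //.
  + by move=> n y _; case: (tpc n y).
  + by move=> n m y nm _; rewrite -imCB; apply: le_trans (imC_cabs _) (h1 _ _ _ nm).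
  + by move=> y _; case: ((ccvgP _ _).1 (synth_cvg y ac)).
  + by case: ((ccvgP _ _).1 (synth_cvg x adc)).
Qed.

End IntegerSums.

(** * Sobolev spaces on the circle *)

Section SobolevCircle.
Variable R : realType.
Local Notation C := R[i].
Local Notation bmc := (@bmf R _ (measurableTypeR R) (@cell R)).
Implicit Types (f g h : R -> C) (c : int -> C) (w X : R).

Definition wgt w (p : nat) (k : int) : R := (w + k%:~R ^+ 2) ^+ p.

Lemma wgt_gt0 w p k : 1 <= w -> 0 < wgt w p k.
Proof. by move=> w1; rewrite exprn_gt0// ltr_wpDr ?sqr_ge0//; lra. Qed.
Lemma wgt_ge0 w p k : 1 <= w -> 0 <= wgt w p k.
Proof. by move=> /wgt_gt0/ltW. Qed.
Lemma wgt_base w (k : int) : 1 <= w -> 1 <= w + k%:~R ^+ 2.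
Proof. by move=> w1; have := sqr_ge0 (k%:~R : R); lra. Qed.
Lemma wgt_leX w p p' k : 1 <= w -> (p <= p')%N -> wgt w p k <= wgt w p' k.
Proof. by move=> w1 pp; rewrite ler_weXn2l// wgt_base. Qed.
Lemma wgt_lew w w' a p k : 1 <= w -> 1 <= w' -> 1 <= a -> w' <= a * w ->
  wgt w' p k <= a ^+ p * wgt w p k.
Proof.
move=> w1 w'1 a1 ww; have := sqr_ge0 (k%:~R : R); rewrite -exprMn => k0.
by apply: lerXn2r; rewrite ?nnegrE; nra.
Qed.
Lemma wgtS w p k : wgt w p.+1 k = (w + k%:~R ^+ 2) * wgt w p k.
Proof. by rewrite /wgt exprS. Qed.

Definition wsum w p c N : R := psum (fun k => wgt w p k * sqmod (c k)) N.

Lemma wsum_term_ge0 w p c k : 1 <= w -> 0 <= wgt w p k * sqmod (c k).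
Proof. by move=> w1; rewrite mulr_ge0 ?sqmod_ge0 ?wgt_ge0. Qed.
Lemma wsum_ge0 w p c N : 1 <= w -> 0 <= wsum w p c N.
Proof. by move=> w1; apply: psum_ge0 => k; exact: wsum_term_ge0. Qed.

(* Square of the H^p norm in s of one Fourier mode in theta, whose frequency j
   enters through w = 1 + j^2. *)
Definition en w p f : R :=
  fine (\esum_(k in [set: int]) (wgt w p k * sqmod (fourier1 f k))%:E).

Lemma sobTP p f : sobT p f <->
  [/\ periodic f, ccont f & exists X, forall N, wsum 1 p (fourier1 f) N <= X].
Proof.
split=> [[a /cCk0P b cfin]|[a b [X HX]]].
  split => //; exists (en 1 p f); rewrite /wsum.
  apply/(esum_psum_le (c := fun k => wgt 1 p k * sqmod (fourier1 f k))).
    by move=> k; exact: wsum_term_ge0.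
  rewrite /en fineK// ge0_fin_numE//; apply: esum_ge0 => k _.
  by rewrite lee_fin; exact: wsum_term_ge0.
split => //; first exact/cCk0P.
apply: (@le_lt_trans _ _ X%:E); last exact: ltry.
by apply/esum_psum_le => // k; exact: wsum_term_ge0.
Qed.

Lemma en_ge0 w p f : 1 <= w -> 0 <= en w p f.
Proof.
by move=> w1; apply: fine_ge0; apply: esum_ge0 => k _; rewrite lee_fin wsum_term_ge0.
Qed.

Lemma en_le w p f X : 1 <= w -> (forall N, wsum w p (fourier1 f) N <= X) ->
  en w p f <= X.
Proof.
move=> w1 HX.
have [] := @esum_fin_lub R _ (fun k => wgt w p k * sqmod (fourier1 f k)) X => //.
- by move=> k; exact: wsum_term_ge0.
- by apply/esum_psum_le => // k; exact: wsum_term_ge0.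
Qed.

Lemma wsum_le_w w p c N : 1 <= w -> wsum w p c N <= w ^+ p * wsum 1 p c N.
Proof.
move=> w1; rewrite /wsum -psumZ; apply: ler_psum => k; rewrite mulrA.
by rewrite ler_wpM2r ?sqmod_ge0//; apply: wgt_lew => //; rewrite mulr1.
Qed.

Lemma en_ub w p f N : 1 <= w -> sobT p f -> wsum w p (fourier1 f) N <= en w p f.
Proof.
move=> w1 /sobTP[_ _ [X HX]].
have w0 : 0 <= w ^+ p by rewrite exprn_ge0//; lra.
have HX' M : wsum w p (fourier1 f) M <= w ^+ p * X.
  by apply: le_trans (wsum_le_w _ _ _ w1) _; rewrite ler_wpM2l.
have [] := @esum_fin_lub R _ (fun k => wgt w p k * sqmod (fourier1 f k)) (w ^+ p * X) => //.
- by move=> k; exact: wsum_term_ge0.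
- by apply/esum_psum_le => // k; exact: wsum_term_ge0.
move=> _ E; move: N; apply/esum_psum_le; first by move=> k; exact: wsum_term_ge0.
by rewrite {1}E.
Qed.

Lemma sobT_periodic p f : sobT p f -> periodic f. Proof. by case/sobTP. Qed.
Lemma sobT_ccont p f : sobT p f -> ccont f. Proof. by case/sobTP. Qed.
Lemma sobT_bmc p f : sobT p f -> bmc f.
Proof. by move=> /sobT_ccont/ccont_bmf. Qed.

(** Reduces energy estimates to an inequality between single Fourier coefficients. The first
    conclusion yields membership in the Sobolev space (with w = 1), the second the bound on the
    energy. *)
Lemma en_term2 w p f w1 p1 g1 w2 p2 g2 a b :
  1 <= w -> 1 <= w1 -> 1 <= w2 -> sobT p1 g1 -> sobT p2 g2 -> 0 <= a -> 0 <= b ->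
  (forall k, wgt w p k * sqmod (fourier1 f k) <=
     a * (wgt w1 p1 k * sqmod (fourier1 g1 k)) +
     b * (wgt w2 p2 k * sqmod (fourier1 g2 k))) ->
  (forall N, wsum w p (fourier1 f) N <= a * en w1 p1 g1 + b * en w2 p2 g2) /\
  en w p f <= a * en w1 p1 g1 + b * en w2 p2 g2.
Proof.
move=> w0 w10 w20 s1 s2 a0 b0 H.
have HN N : wsum w p (fourier1 f) N <= a * en w1 p1 g1 + b * en w2 p2 g2.
  apply: le_trans (ler_psum _ H) _; rewrite psum_lin.
  by apply: lerD; rewrite ler_wpM2l//; exact: en_ub.
by split => //; apply: en_le.
Qed.

Lemma en_term w p f w1 p1 g1 a :
  1 <= w -> 1 <= w1 -> sobT p1 g1 -> 0 <= a ->
  (forall k, wgt w p k * sqmod (fourier1 f k) <=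
     a * (wgt w1 p1 k * sqmod (fourier1 g1 k))) ->
  (forall N, wsum w p (fourier1 f) N <= a * en w1 p1 g1) /\
  en w p f <= a * en w1 p1 g1.
Proof.
move=> w0 w10 s1 a0 H.
have HN N : wsum w p (fourier1 f) N <= a * en w1 p1 g1.
  by apply: le_trans (ler_psum _ H) _; rewrite psumZ ler_wpM2l//; exact: en_ub.
by split => //; apply: en_le.
Qed.

Lemma mul_le2 (W s a b : R) : 0 <= W -> s <= 2 * a + 2 * b ->
  W * s <= 2 * (W * a) + 2 * (W * b).
Proof. by move=> W0 /(ler_wpM2l W0); lra. Qed.

Lemma sobTD p f g : sobT p f -> sobT p g -> sobT p (fun s => f s + g s).
Proof.
move=> sf sg; apply/sobTP; split.
- by move=> s; rewrite (sobT_periodic sf) (sobT_periodic sg).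
- exact: ccontD (sobT_ccont sf) (sobT_ccont sg).
- exists (2 * en 1 p f + 2 * en 1 p g).
  apply: (en_term2 (lexx 1) (lexx 1) (lexx 1) sf sg _ _ _).1 => // k.
  rewrite fourier1D; [|exact: sobT_bmc sf|exact: sobT_bmc sg].
  by apply: mul_le2; [exact: wgt_ge0|exact: sqmodD].
Qed.

Lemma enD w p f g : 1 <= w -> sobT p f -> sobT p g ->
  en w p (fun s => f s + g s) <= 2 * en w p f + 2 * en w p g.
Proof.
move=> w1 sf sg; apply: (en_term2 w1 w1 w1 sf sg _ _ _).2 => // k.
rewrite fourier1D; [|exact: sobT_bmc sf|exact: sobT_bmc sg].
by apply: mul_le2; [exact: wgt_ge0|exact: sqmodD].
Qed.

Lemma eq_sobT p f g : f =1 g -> sobT p f -> sobT p g.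
Proof. by move=> /funext ->. Qed.
Lemma eq_en w p f g : f =1 g -> en w p f = en w p g.
Proof. by move=> /funext ->. Qed.

Lemma sobTZ p (z : C) f : sobT p f -> sobT p (fun s => z * f s).
Proof.
move=> sf; apply/sobTP; split.
- by move=> s; rewrite (sobT_periodic sf).
- exact: ccontZ (sobT_ccont sf).
- exists (sqmod z * en 1 p f).
  apply: (en_term (lexx 1) (lexx 1) sf (sqmod_ge0 z) _).1 => // k.
  by rewrite fourier1Z ?sqmodM 1?mulrCA//; exact: sobT_bmc sf.
Qed.

Lemma enZ w p (z : C) f : 1 <= w -> sobT p f ->
  en w p (fun s => z * f s) <= sqmod z * en w p f.
Proof.
move=> w1 sf; apply: (en_term w1 w1 sf (sqmod_ge0 z) _).2 => // k.
by rewrite fourier1Z ?sqmodM 1?mulrCA//; exact: sobT_bmc sf.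
Qed.

Lemma sobTN p f : sobT p f -> sobT p (fun s => - f s).
Proof. by move=> /(sobTZ (-1)); apply: eq_sobT => s; rewrite mulN1r. Qed.
Lemma enN w p f : 1 <= w -> sobT p f -> en w p (fun s => - f s) <= en w p f.
Proof.
move=> w1 /(enZ (-1) w1); rewrite sqmodN (sqmod_real 1 : sqmod 1 = _) expr1n mul1r.
by rewrite (eq_en _ _ (g := fun s => - f s))// => s; rewrite mulN1r.
Qed.
Lemma sobTB p f g : sobT p f -> sobT p g -> sobT p (fun s => f s - g s).
Proof. by move=> sf /sobTN; exact: sobTD. Qed.
Lemma enB w p f g : 1 <= w -> sobT p f -> sobT p g ->
  en w p (fun s => f s - g s) <= 2 * en w p f + 2 * en w p g.
Proof.
move=> w1 sf sg; apply: le_trans (enD w1 sf (sobTN sg)) _.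
by rewrite lerD2l ler_wpM2l// enN.
Qed.
Lemma sobT0 p : sobT p (fun _ : R => 0 : C).
Proof.
apply/sobTP; split => //; first exact: ccont_cst.
exists 0 => N; rewrite /wsum /psum big1// => k _.
by rewrite fourier1_0 sqmod0 mulr0.
Qed.
Lemma en0 w p : 1 <= w -> en w p (fun _ : R => 0 : C) = 0.
Proof.
move=> w1; apply/eqP; rewrite eq_le en_ge0// andbT; apply: en_le => // N.
by rewrite /wsum /psum big1// => k _; rewrite fourier1_0 sqmod0 mulr0.
Qed.

Lemma sobT_le p p' f : (p <= p')%N -> sobT p' f -> sobT p f.
Proof.
move=> pp sf; apply/sobTP; split; [exact: sobT_periodic sf|exact: sobT_ccont sf|].
exists (1 * en 1 p' f); apply: (en_term (lexx 1) (lexx 1) sf ler01 _).1 => k.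
by rewrite mul1r ler_wpM2r ?sqmod_ge0// wgt_leX.
Qed.

Lemma en_mono w w' a p p' f : 1 <= w -> 1 <= w' -> 1 <= a -> w' <= a * w ->
  (p <= p')%N -> sobT p' f -> en w' p f <= a ^+ p * en w p' f.
Proof.
move=> w1 w'1 a1 ww pp sf.
have a0 : 0 <= a ^+ p by rewrite exprn_ge0//; lra.
apply: (en_term w'1 w1 sf a0 _).2 => k; rewrite mulrA ler_wpM2r ?sqmod_ge0//.
apply: le_trans (wgt_lew _ _ w1 w'1 a1 ww) _.
by rewrite ler_wpM2l// wgt_leX.
Qed.

Lemma en_lep w p p' f : 1 <= w -> (p <= p')%N -> sobT p' f -> en w p f <= en w p' f.
Proof.
move=> w1 pp sf; have := @en_mono w w 1 p p' f w1 w1 (lexx 1).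
by rewrite !mul1r expr1n mul1r; apply.
Qed.

Lemma coef_asum (p : nat) (c : int -> C) X :
  (forall N, wsum 1 p.+1 c N <= X) -> asum c.
Proof.
move=> HX; exists (1 + 5 * X) => N.
have h := psum_cabs_sqr c N.
have h1 : psum (fun k => (1 + k%:~R ^+ 2) * sqmod (c k)) N <= X.
  apply: le_trans (HX N); apply: ler_psum => k.
  rewrite ler_wpM2r ?sqmod_ge0//.
  by have := @wgt_leX 1 1 p.+1 k (lexx 1) isT; rewrite {1}/wgt expr1.
have : psum (fun k => cabs (c k)) N ^+ 2 <= 5 * X by apply: le_trans h _; rewrite ler_wpM2l.
set t := psum _ N => ht; have := sqr_ge0 (t - 1); nra.
Qed.

Lemma sobT_asum p f : sobT p.+1 f -> asum (fourier1 f).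
Proof. by move=> /sobTP[_ _ [X HX]]; exact: coef_asum HX. Qed.

Lemma sobT_synthK p f : sobT p.+1 f -> synth (fourier1 f) = f.
Proof.
move=> sf; apply: synth_fourier; [exact: sobT_ccont sf|exact: sobT_periodic sf|].
exact: sobT_asum sf.
Qed.

Lemma sobT_synth p c X : (forall N, wsum 1 p.+1 c N <= X) ->
  sobT p.+1 (synth c) /\ forall k, fourier1 (synth c) k = c k.
Proof.
move=> HX; have ac := coef_asum HX.
have E k : fourier1 (synth c) k = c k by exact: fourier1_synth.
split => //; apply/sobTP; split; [exact: synth_periodic|exact: synth_ccont|].
by exists X => N; rewrite (_ : fourier1 (synth c) = c)//; apply/funext.
Qed.


(** Sobolev embedding on the circle; since w >= 1 only enlarges the weights, the constant does not
    depend on the theta-frequency behind w. *)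
Lemma sobT_sup p f s w : 1 <= w -> sobT p.+1 f -> sqmod (f s) <= 5 * en w p.+1 f.
Proof.
move=> w1 sf; have af := sobT_asum sf.
have cv := synth_cvg s af; rewrite (sobT_synthK sf) in cv.
have cv2 := ccvg_sqmod cv.
rewrite -(cvg_lim _ cv2)//; apply: limr_le; first exact: cvgP cv2.
exists 0%N => // N _ /=.
apply: le_trans (_ : psum (fun k => cabs (fourier1 f k)) N ^+ 2 <= _).
  rewrite -sqr_cabs lerXn2r ?nnegrE ?cabs_ge0//.
    by apply: psum_ge0 => k; exact: cabs_ge0.
  apply: le_trans (cabs_sum _ _ _) _; apply: ler_sum => k _.
  by rewrite cabsM cabs_eik mulr1.
apply: le_trans (psum_cabs_sqr _ _) _; rewrite ler_wpM2l//.
apply: le_trans (en_ub N w1 sf); apply: ler_psum => k.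
rewrite ler_wpM2r ?sqmod_ge0//; apply: le_trans (_ : wgt w 1 k <= _).
  by rewrite /wgt expr1 lerD2r.
exact: wgt_leX.
Qed.

Lemma sqmod_ik (k : int) (z : C) : sqmod ('i * k%:~R * z) = k%:~R ^+ 2 * sqmod z.
Proof. by rewrite !sqmodM sqmod_i mul1r intrCE sqmod_real. Qed.

Lemma wgt_ik w p k z : 1 <= w ->
  wgt w p k * sqmod ('i * k%:~R * z) <= wgt w p.+1 k * sqmod z.
Proof.
move=> w1; rewrite sqmod_ik mulrA ler_wpM2r ?sqmod_ge0// wgtS mulrC.
by rewrite ler_wpM2r ?wgt_ge0// lerDr; lra.
Qed.

Lemma sobT_derive p f : sobT p.+2 f ->
  [/\ forall x, cd f x (cderive f x), sobT p.+1 (cderive f) &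
      forall k, fourier1 (cderive f) k = 'i * k%:~R * fourier1 f k].
Proof.
move=> sf; have af := sobT_asum sf.
have HX N : wsum 1 p.+1 (fun k => 'i * k%:~R * fourier1 f k) N <= en 1 p.+2 f.
  apply: le_trans (en_ub N (lexx 1) sf); apply: ler_psum => k; exact: wgt_ik.
have [sd fd] := sobT_synth HX.
have cdf x : cd f x (synth (fun k => 'i * k%:~R * fourier1 f k) x).
  by rewrite -{1}(sobT_synthK sf); apply: synth_cd => //; exact: coef_asum HX.
have E : cderive f = synth (fun k => 'i * k%:~R * fourier1 f k).
  by apply/funext => x; rewrite (cd_cderive (cdf x)).
by rewrite E.
Qed.

Lemma en_derive w p f : 1 <= w -> sobT p.+2 f ->
  en w p.+1 (cderive f) <= en w p.+2 f.
Proof.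
move=> w1 sf; have [_ _ E] := sobT_derive sf.
have := (@en_term w p.+1 (cderive f) w p.+2 f 1 w1 w1 sf ler01 _).2.
rewrite mul1r; apply => k; rewrite E mul1r; exact: wgt_ik.
Qed.

Lemma sobT_cCk p f : sobT p.+1 f -> cCk p f.
Proof.
elim: p f => [|p IH] f sf; first by apply/cCk0P; exact: sobT_ccont sf.
have [a b _] := sobT_derive sf.
by apply: cCkI a _; exact: IH.
Qed.

End SobolevCircle.

(** * Multiplication of Sobolev functions by C^p functions *)

Section Multiplication.
Variable R : realType.
Local Notation C := R[i].
Local Notation mu := (@lebesgue_measure R).
Local Notation cellR := (@cell R).
Local Notation bmc := (@bmf R _ (measurableTypeR R) (@cell R)).
Implicit Types (f g : R -> C) (h : R -> R) (c : int -> C) (w X G : R).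

(** A periodic C^p function with h and its first p derivatives all bounded by G. The derivative is
    an existential witness, so sum, product and quotient rules can supply it directly. *)
Fixpoint Rb (p : nat) G h : Prop :=
  [/\ periodic h, continuous h, forall s, `|h s| <= G &
      if p is p'.+1 then exists dh, (forall x, rd h x (dh x)) /\ Rb p' G dh else True].

Lemma Rb_pred p G h : Rb p.+1 G h -> Rb p G h.
Proof.
elim: p h => [|p IH] h [a b c [dh [hd bd]]]; first by [].
by split => //; exists dh; split => //; exact: IH.
Qed.

Lemma Rb_le p p' G h : (p <= p')%N -> Rb p' G h -> Rb p G h.
Proof.
move=> /subnKC <-; elim: (p' - p)%N => [|n IH]; first by rewrite addn0.
by rewrite addnS => /Rb_pred.
Qed.

Lemma Rb_periodic p G h : Rb p G h -> periodic h. Proof. by case: p => [|p] []. Qed.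
Lemma Rb_cont p G h : Rb p G h -> continuous h. Proof. by case: p => [|p] []. Qed.
Lemma Rb_bound p G h s : Rb p G h -> `|h s| <= G. Proof. by case: p => [|p] []. Qed.

Lemma Rb_bmc p G h : Rb p G h -> bmc (fun s => (h s)%:C).
Proof. by move=> /Rb_cont/ccont_real/ccont_bmf. Qed.

Lemma wsum0 w c N : wsum w 0 c N = psum (fun k => sqmod (c k)) N.
Proof. by apply: eq_bigr => k _; rewrite /wgt expr0 mul1r. Qed.

(** The weight w + k^2 splits into w and the square of the multiplier of d/ds; this makes induction
    on p possible with w kept as a parameter. *)
Lemma wsumS w p c N : wsum w p.+1 c N =
  w * wsum w p c N + wsum w p (fun k => 'i * k%:~R * c k) N.
Proof.
rewrite /wsum -psumZ /psum -big_split /=; apply: eq_bigr => k _.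
by rewrite sqmod_ik wgtS; ring.
Qed.

Lemma mul_tp_arith w (Q A B X Y Z T : R) : 1 <= w -> 0 <= Q -> 0 <= A -> 0 <= B ->
  X <= Q * A -> Z <= Q * A -> T <= Q * B -> Y <= 2 * Z + 2 * T ->
  w * X + Y <= 3 * (Q * (w * A + B)).
Proof.
move=> w1 Q0 A0 B0 XQ ZQ TQ YZ.
have w0 : 0 <= w by lra.
have QA : 0 <= Q * A by rewrite mulr_ge0.
have QB : 0 <= Q * B by rewrite mulr_ge0.
have J1 := ler_wpM2l w0 XQ.
have J2 : Q * A <= w * (Q * A) by rewrite ler_peMl.
have -> : 3 * (Q * (w * A + B)) = 3 * (w * (Q * A)) + 3 * (Q * B) by ring.
lra.
Qed.

(** At p = 0 Bessel bounds the left side by an L^2 norm, and the norm of the trigonometric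
    polynomial on the right is computed exactly. For the step, Leibniz and (x + y)^2 <= 2 x^2 + 2
    y^2 give the factor 3, where w >= 1 absorbs the term with h'. The constant is free of w, hence
    of the theta-frequency. *)
Lemma mul_tp_bound p h G w N c M : 1 <= w -> Rb p G h ->
  wsum w p (fourier1 (fun s => (h s)%:C * tp N c s)) M <=
  3 ^+ p * G ^+ 2 * wsum w p c N.
Proof.
move=> w1; elim: p h c => [|p IH] h c hb.
  rewrite expr0 mul1r !wsum0; have per0 := period_gt0 R.
  have bt := tp_bmc N c.
  have bht : bmc (fun s => (h s)%:C * tp N c s).
    by apply: bmfM => //; exact: Rb_bmc hb.
  rewrite -(ler_pM2l per0); apply: le_trans (bessel M bht) _.
  rewrite mulrCA -intr_sqmod_tp -[leRHS]addr0 -[X in _ + X](mul0r (Rintegral mu cellR (fun=> 0))).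
  rewrite -intpr_lin; last 2 first.
  - exact: bmf_sqmod.
  - exact: bmr_cst.
  apply: intpr_le.
  - exact: bmf_sqmod.
  - apply: bmrD; last by apply: bmrM; exact: bmr_cst.
    by apply: bmrM; [exact: bmr_cst|exact: bmf_sqmod].
  move=> s _; rewrite mul0r addr0 sqmodM sqmod_real ler_wpM2r ?sqmod_ge0//.
  rewrite -[h s ^+ 2]real_normK ?num_real//.
  have := Rb_bound s hb; have := normr_ge0 (h s).
  by move=> a b; apply: lerXn2r; rewrite ?nnegrE//; apply: le_trans a b.
have [ph ch hG [dh [hd dhb]]] := hb.
have hb' := Rb_pred hb.
pose dc k := 'i * k%:~R * c k.
set F := fun s => (h s)%:C * tp N c s.
have dF x : cd F x ((dh x)%:C * tp N c x + (h x)%:C * tp N dc x).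
  by apply: cdM; [exact: cd_real|exact: tp_cd].
have bmul h' c' : Rb p G h' -> bmc (fun s => (h' s)%:C * tp N c' s).
  by move=> rb; apply: bmfM; [exact: Rb_bmc rb|exact: tp_bmc].
have EF k : 'i * k%:~R * fourier1 F k = fourier1 (fun s => (dh s)%:C * tp N c s) k
    + fourier1 (fun s => (h s)%:C * tp N dc s) k.
  rewrite -fourier1D; [|exact: bmul|exact: bmul].
  symmetry; apply: fourier1_derivative dF _ _.
    apply: ccontD; apply: ccontM; try exact: tp_cont; apply: ccont_real => //.
    exact: Rb_cont dhb.
  by move=> s; rewrite /F ph tp_periodic.
rewrite wsumS; under [X in _ + wsum _ _ X _]eq_fun do rewrite EF.
have S1 : wsum w p (fun k => fourier1 (fun s => (dh s)%:C * tp N c s) k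
    + fourier1 (fun s => (h s)%:C * tp N dc s) k) M <=
    2 * wsum w p (fourier1 (fun s => (dh s)%:C * tp N c s)) M +
    2 * wsum w p (fourier1 (fun s => (h s)%:C * tp N dc s)) M.
  rewrite -psum_lin; apply: ler_psum => k.
  by apply: mul_le2; [exact: wgt_ge0|exact: sqmodD].
have I1 := IH h c hb'; have I2 := IH dh c dhb; have I3 := IH h dc hb'.
rewrite [wsum w p.+1 c N]wsumS -/dc exprS -(mulrA 3 (3 ^+ p)) -(mulrA 3).
apply: (mul_tp_arith w1 _ _ _ I1 I2 I3 S1); try exact: wsum_ge0.
by rewrite mulr_ge0 ?sqr_ge0 ?exprn_ge0.
Qed.

Lemma wsum_limit w p (F : nat -> int -> C) c M X :
  (forall k, ccvg (fun n => F n k) (c k)) ->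
  (forall n, wsum w p (F n) M <= X) -> wsum w p c M <= X.
Proof.
move=> Fc HX.
have cv : wsum w p (F n) M @[n --> \oo] --> wsum w p c M.
  rewrite /wsum /psum; elim: (box M) => [|k r IH].
    by rewrite big_nil; under eq_cvg do rewrite big_nil; exact: cvg_cst.
  rewrite big_cons; under eq_cvg do rewrite big_cons; apply: cvgD => //.
  by apply: cvgM; [exact: cvg_cst|exact: ccvg_sqmod].
rewrite -(cvg_lim _ cv)//; apply: limr_le; first exact: cvgP cv.
by exists 0%N => // n _; exact: HX.
Qed.

(** The truncations of f converge uniformly, so each Fourier coefficient of the product converges
    and the bound for trigonometric polynomials survives the limit. *)
Lemma sobTM p h G f : sobT p.+1 f -> Rb p.+1 G h ->
  sobT p.+1 (fun s => (h s)%:C * f s) /\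
  forall w, 1 <= w ->
    en w p.+1 (fun s => (h s)%:C * f s) <= 3 ^+ p.+1 * G ^+ 2 * en w p.+1 f.
Proof.
move=> sf hb; set g := fun s => _.
have af := sobT_asum sf; have [e e0 [_ eN]] := synth_unif af.
rewrite (sobT_synthK sf) in eN.
have bg : bmc g by apply: bmfM; [exact: Rb_bmc hb|exact: sobT_bmc sf].
have bt N : bmc (fun s => (h s)%:C * tp N (fourier1 f) s).
  by apply: bmfM; [exact: Rb_bmc hb|exact: tp_bmc].
have cv k : ccvg (fun N => fourier1 (fun s => (h s)%:C * tp N (fourier1 f) s) k) (fourier1 g k).
  have e2 : 2 * (G * e n) @[n --> \oo] --> (0 : R).
    rewrite -(mulr0 2); apply: cvgM; first exact: cvg_cst.
    by rewrite -(mulr0 G); apply: cvgM => //; exact: cvg_cst.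
  apply: (squeeze_cvgr _ (cvg_cst 0) e2); near=> n.
  rewrite cabs_ge0 /= -cabsN opprB -fourier1B//.
  apply: fourier1_bound => [|s _]; first exact: bmfB.
  rewrite /g -mulrBr cabsM cabs_real; apply: ler_pM => //; first exact: cabs_ge0.
  exact: Rb_bound hb.
have bound w M : 1 <= w -> wsum w p.+1 (fourier1 g) M <= 3 ^+ p.+1 * G ^+ 2 * en w p.+1 f.
  move=> w1; apply: wsum_limit cv _ => N.
  apply: le_trans (mul_tp_bound N _ M w1 hb) _.
  by rewrite ler_wpM2l ?en_ub// mulr_ge0 ?sqr_ge0 ?exprn_ge0.
split=> [|w w1]; last by apply: en_le => // M; exact: bound.
apply/sobTP; split.
- by move=> s; rewrite /g (Rb_periodic hb) (sobT_periodic sf).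
- by apply: ccontM; [apply: ccont_real; exact: Rb_cont hb|exact: sobT_ccont sf].
- by eexists => N; exact: bound.
Unshelve. all: by end_near. Qed.

End Multiplication.

(** * The elliptic operator of one Fourier mode *)

Section EllipticSolve.
Variable R : realType.
Local Notation C := R[i].
Variables (K : R) (D : nat).
Hypothesis K0 : 0 < K.
Implicit Types (f u : R -> C) (lam w : R).

(** The Fourier multiplier of (-K^-2 d^2)^D. It serves for both summands of P: at k for the
    s-operator [Kop], at the fixed theta-frequency j as an additive constant of the mode
    operator. *)
Definition symb (k : int) : R := (K ^- 2 * k%:~R ^+ 2) ^+ D.
Definition Kop u : R -> C :=
  iter D (fun g s => (- K ^- 2)%:C * cderive (cderive g) s) u.

Lemma symb_ge0 k : 0 <= symb k.
Proof. by rewrite exprn_ge0// mulr_ge0 ?sqr_ge0// invr_ge0 sqr_ge0. Qed.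

Definition solve lam f : R -> C :=
  synth (fun k => (lam + symb k)^-1%:C * fourier1 f k).

Lemma cderive_periodic f : (forall x, cderivable f x) -> periodic f ->
  periodic (cderive f).
Proof.
move=> fd pf s; apply: cd_unique (cderivable_cd (fd s)).
apply: (@eq_cd _ (fun x => f (x + period R))); first by move=> x; rewrite pf.
have [a b] := cderivable_cd (fd (s + period R)).
have sh : rd (fun x => x + period R) s 1.
  by have := rdD (rd_id s) (rd_cst (period R) s); rewrite addr0.
split.
- have := @rd_comp R (@reC R \o f) (fun x => x + period R) s _ _ a sh.
  by rewrite mulr1.
- have := @rd_comp R (@imC R \o f) (fun x => x + period R) s _ _ b sh.
  by rewrite mulr1.
Qed.

Lemma fourier1_Kop u k : cCk (2 * D) u -> periodic u ->
  [/\ ccont (Kop u), periodic (Kop u) &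
      fourier1 (Kop u) k = (symb k)%:C * fourier1 u k].
Proof.
rewrite /Kop /symb; elim: D u => [|D' IH] u ck pu.
  split; [exact: cCk_ccont ck|exact: pu|].
  by rewrite expr0 rmorph1 mul1r.
rewrite iterSr; set v : R -> C := (X in iter _ _ X).
have ck2 : cCk (2 * D').+2 u by rewrite (_ : (2 * D').+2 = (2 * D'.+1)%N)//; lia.
have [d1 c1] := (cCkS _ _).1 ck2; have [d2 c2] := (cCkS _ _).1 c1.
have pu' := cderive_periodic d1 pu.
have pu'' := cderive_periodic d2 pu'.
have [] := IH v; [exact: cCkZ|by move=> s; rewrite /v pu''|].
move=> a b ->; split => //.
set A := K ^- 2 * k%:~R ^+ 2; rewrite (exprSr A) realCM -mulrA; congr (_ * _).
have cc2 := cCk_ccont c2; have cc1 := cCk_ccont c1.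
rewrite /v fourier1Z; last exact: ccont_bmf.
rewrite (fourier1_derivative k (fun x => cderivable_cd (d2 x)) cc2 pu').
rewrite (fourier1_derivative k (fun x => cderivable_cd (d1 x)) cc1 pu).
rewrite /A realCN realCM (realCX _ 2) -intrCE.
have -> : 'i * k%:~R * ('i * k%:~R * fourier1 u k) =
  ('i ^+ 2 * k%:~R ^+ 2) * fourier1 u k :> C by ring.
by rewrite sqr_i; ring.
Qed.

(** Regularity matters: [cderive] is total, and it is additive only because all derivatives involved
    exist. *)
Lemma KopB u v x : cCk (2 * D) u -> cCk (2 * D) v ->
  Kop (fun s => u s - v s) x = Kop u x - Kop v x.
Proof.
rewrite /Kop; elim: D u v => [|D' IH] u v cu cv //.
have cu2 : cCk (2 * D').+2 u by rewrite (_ : (2 * D').+2 = (2 * D'.+1)%N)//; lia.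
have cv2 : cCk (2 * D').+2 v by rewrite (_ : (2 * D').+2 = (2 * D'.+1)%N)//; lia.
have [du1 cu1] := (cCkS _ _).1 cu2; have [du2 cu3] := (cCkS _ _).1 cu1.
have [dv1 cv1] := (cCkS _ _).1 cv2; have [dv2 cv3] := (cCkS _ _).1 cv1.
rewrite !iterSr -IH; [|exact: cCkZ|exact: cCkZ].
congr (iter _ _ _ x); apply/funext => s; rewrite -mulrBr; congr (_ * _).
have -> : cderive (fun s => u s - v s) = (fun s => cderive u s - cderive v s).
  by apply/funext => y; apply: cd_cderive; apply: cdB; exact: cderivable_cd.
by apply: cd_cderive; apply: cdB; exact: cderivable_cd.
Qed.

Lemma elliptic_unique lam u : 0 < lam -> cCk (2 * D) u -> periodic u ->
  (forall s, lam%:C * u s + Kop u s = 0) -> forall s, u s = 0.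
Proof.
move=> l0 ck pu H; have cu := cCk_ccont ck.
apply: fourier_unique => // k.
have [a b E] := fourier1_Kop k ck pu.
have : fourier1 (fun s => lam%:C * u s + Kop u s) k = 0.
  by rewrite -[RHS](fourier1_0 R k); apply: eq_fourier1 => s; rewrite H.
rewrite fourier1D ?fourier1Z ?E -?mulrDl -?realCD; last 3 first.
- exact: ccont_bmf.
- by apply: bmfZ; exact: ccont_bmf.
- exact: ccont_bmf.
move/eqP; rewrite mulf_eq0 realC_eq0 gt_eqF/=; first by move/eqP.
by rewrite ltr_wpDr// symb_ge0.
Qed.

(** With m the maximum of 1, j^2, k^2 the left side is at most (3 m)^D, and m^D is at most 1 +
    j^(2D) + k^(2D). The symbol controls these three terms through l / l0 >= 1 and K^(2D) [symb];
    only the lower bound l0 of l enters, so the constant is common to nearby curves. *)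
Lemma elliptic_weight l0 l (j k : int) : 0 < l0 -> l0 <= l ->
  (1 + j%:~R ^+ 2 + k%:~R ^+ 2) ^+ D <=
  3 ^+ D * (l0^-1 + K ^+ 2 ^+ D) * (l + symb j + symb k).
Proof.
move=> l00 ll; set x : R := j%:~R ^+ 2; set y : R := k%:~R ^+ 2.
have x0 : 0 <= x by exact: sqr_ge0. have y0 : 0 <= y by exact: sqr_ge0.
have KD : K ^+ 2 ^+ D * symb j = x ^+ D.
  by rewrite /symb -exprMn -/x mulrA mulfV ?mul1r// expf_neq0// gt_eqF.
have KE : K ^+ 2 ^+ D * symb k = y ^+ D.
  by rewrite /symb -exprMn -/y mulrA mulfV ?mul1r// expf_neq0// gt_eqF.
have K2 : 0 <= K ^+ 2 ^+ D by rewrite !exprn_ge0// ltW.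
have xD : 0 <= x ^+ D by rewrite exprn_ge0.
have yD : 0 <= y ^+ D by rewrite exprn_ge0.
apply: le_trans (_ : 3 ^+ D * (1 + x ^+ D + y ^+ D) <= _).
  pose m := Num.max 1 (Num.max x y).
  have m1 : 1 <= m by rewrite le_max lexx.
  have mx : x <= m by rewrite !le_max lexx orbT.
  have my : y <= m by rewrite !le_max lexx !orbT.
  apply: le_trans (_ : (3 * m) ^+ D <= _).
    by apply: lerXn2r; rewrite ?nnegrE; lra.
  rewrite exprMn ler_wpM2l ?exprn_ge0//.
  rewrite /m; case: (leP x y) => _; case: (leP 1 _) => _; rewrite ?expr1n; lra.
rewrite -mulrA ler_wpM2l ?exprn_ge0//.
have a1 : 1 <= l0^-1 * l by rewrite ler_pdivlMl// mulr1.
have li : 0 <= l0^-1 by rewrite invr_ge0 ltW.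
have sj := symb_ge0 j; have sk := symb_ge0 k.
have -> : (l0^-1 + K ^+ 2 ^+ D) * (l + symb j + symb k) =
  l0^-1 * l + l0^-1 * symb j + l0^-1 * symb k + K ^+ 2 ^+ D * l
  + K ^+ 2 ^+ D * symb j + K ^+ 2 ^+ D * symb k by ring.
rewrite KD KE.
have b1 : 0 <= l0^-1 * symb j by rewrite mulr_ge0.
have b2 : 0 <= l0^-1 * symb k by rewrite mulr_ge0.
have b3 : 0 <= K ^+ 2 ^+ D * l by rewrite mulr_ge0//; lra.
lra.
Qed.

(** Squared because energies are quadratic in the coefficients. *)
Definition ellC l0 : R := (3 ^+ D * (l0^-1 + K ^+ 2 ^+ D)) ^+ 2.

Lemma ellC_ge0 l0 : 0 <= ellC l0. Proof. exact: sqr_ge0. Qed.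

Lemma w_ge1 (j : int) : 1 <= 1 + (j%:~R : R) ^+ 2.
Proof. by rewrite lerDl sqr_ge0. Qed.

(** Division by the symbol gains 2D orders in the full weight 1 + j^2 + k^2, that is, in theta as
    well as in s, with a constant free of j. The equation is then checked coefficient by coefficient
    and follows pointwise by Fourier uniqueness. *)
Lemma solveP q l0 l (j : int) f : 0 < l0 -> l0 <= l -> sobT q.+1 f ->
  let u := solve (l + symb j) f in
  [/\ sobT (q.+1 + 2 * D) u,
      en (1 + j%:~R ^+ 2) (q.+1 + 2 * D) u <= ellC l0 * en (1 + j%:~R ^+ 2) q.+1 f &
      forall s, (l + symb j)%:C * u s + Kop u s = f s].
Proof.
move=> l00 ll sf u; set w := 1 + _.
have w1 : 1 <= w := w_ge1 j.
pose c k := (l + symb j + symb k)^-1%:C * fourier1 f k.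
have S0 k : 0 < l + symb j + symb k.
  by have := symb_ge0 j; have := symb_ge0 k; lra.
(* Used twice: with jj = 0, so w' = 1, to place the solution in its Sobolev space, and with jj = j
   for the energy estimate. *)
have term (w' : R) (jj : int) k : w' = 1 + jj%:~R ^+ 2 -> (jj == 0) || (jj == j) ->
    wgt w' (q.+1 + 2 * D) k * sqmod (c k) <= ellC l0 * (wgt w' q.+1 k * sqmod (fourier1 f k)).
  move=> -> hjj; rewrite /c sqmodM sqmod_real.
  have W : (1 + jj%:~R ^+ 2 + k%:~R ^+ 2) ^+ D <=
      3 ^+ D * (l0^-1 + K ^+ 2 ^+ D) * (l + symb j + symb k).
    case/orP: hjj => /eqP ->; last exact: elliptic_weight.
    apply: le_trans (elliptic_weight j k l00 ll); apply: lerXn2r; rewrite ?nnegrE.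
    - by have := sqr_ge0 (k%:~R : R); lra.
    - by have := sqr_ge0 (k%:~R : R); have := sqr_ge0 (j%:~R : R); lra.
    - by have := sqr_ge0 (j%:~R : R); lra.
  rewrite /wgt exprD; set B := 1 + _ + _; set S := l + _ + _ in W *.
  have B0 : 0 <= B by rewrite /B !addr_ge0 ?sqr_ge0.
  have Z : B ^+ (2 * D) * S^-1 ^+ 2 <= ellC l0.
    rewrite mulnC exprM exprVn ler_pdivrMr ?exprn_gt0// ?S0// /ellC -exprMn.
    apply: lerXn2r => //; rewrite nnegrE ?exprn_ge0//.
    by apply: le_trans W; exact: exprn_ge0.
  have -> : B ^+ q.+1 * B ^+ (2 * D) * (S^-1 ^+ 2 * sqmod (fourier1 f k)) =
    (B ^+ (2 * D) * S^-1 ^+ 2) * (B ^+ q.+1 * sqmod (fourier1 f k)) by ring.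
  by apply: ler_wpM2r => //; rewrite mulr_ge0 ?sqmod_ge0 ?exprn_ge0.
have HX N : wsum 1 (q.+1 + 2 * D) c N <= ellC l0 * en 1 q.+1 f.
  apply: le_trans (_ : ellC l0 * wsum 1 q.+1 (fourier1 f) N <= _); last first.
    by rewrite ler_wpM2l ?ellC_ge0//; exact: en_ub.
  rewrite /wsum -psumZ; apply: ler_psum => k.
  by apply: (term 1 0); rewrite ?expr0n ?addr0.
have [su uE] := @sobT_synth R (q + 2 * D) c _ HX.
rewrite -addSn -/(solve _ _) -/u in su uE.
have ck : cCk (2 * D) u.
  by apply: cCk_le (sobT_cCk su); rewrite leq_addl.
have pu := sobT_periodic su.
split => //.
  apply: (en_term w1 w1 sf (ellC_ge0 l0) _).2 => k; rewrite uE.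
  by apply: (term w j) => //; rewrite eqxx orbT.
move=> s; apply/eqP; rewrite -subr_eq0; apply/eqP.
have [ca pa _] := fourier1_Kop 0 ck pu.
have cu := cCk_ccont ck; have cf := sobT_ccont sf.
apply: (@fourier_unique _ (fun s => (l + symb j)%:C * u s + Kop u s - f s)).
- by apply: ccontB => //; apply: ccontD => //; exact: ccontZ.
- by move=> x; rewrite pa pu (sobT_periodic sf).
- move=> k; have [_ _ E] := fourier1_Kop k ck pu.
  rewrite fourier1B ?fourier1D ?fourier1Z ?E; try exact: ccont_bmf; last first.
  - by apply: ccont_bmf; apply: ccontD => //; exact: ccontZ.
  - by apply: ccont_bmf; exact: ccontZ.
  rewrite -mulrDl -realCD uE /c mulrA -realCM mulfV ?mul1r ?subrr//.
  by rewrite gt_eqF.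
Qed.

End EllipticSolve.

(** * Fourier series on the torus *)

Section TorusFourier.
Variable R : realType.
Local Notation C := R[i].
Local Notation mu := (@lebesgue_measure R).
Local Notation mR := (measurableTypeR R).
Local Notation mu2 := (mu \x mu)%E.
Local Notation cellR := (@cell R).
Local Notation cell2R := (@cell2 R).
Local Notation intp := (cintegral mu cellR).
Local Notation int2 := (cintegral mu2 cell2R).
Local Notation per := (period R).
Local Notation bmc := (@bmf R _ mR cellR).
Local Notation bm2 := (@bmf R _ (mR * mR)%type cell2R).

Lemma measurable_cell2 : measurable (cell2R : set (mR * mR)).
Proof. by apply: measurableX; exact: measurable_cell. Qed.

Lemma mu_cell2_fin : (mu2 cell2R < +oo)%E.
Proof.
have -> : (mu2 cell2R = mu cellR * mu cellR)%E.
  by apply: product_measure1E; exact: measurable_cell.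
by rewrite !mu_cell -EFinM ltry.
Qed.

Lemma bmr_sep (f g : R -> R) : bmr cellR (f : mR -> R) -> bmr cellR (g : mR -> R) ->
  bmr cell2R (fun p : mR * mR => f p.1 * g p.2).
Proof.
move=> [mf [M fM]] [mg [N gN]]; split.
  apply: measurable_realfun.measurable_funM.
  - have sub : [set fst x | x in (cell2R : set (mR * mR))] `<=` cellR.
      by move=> _ [[x y] [/= cx cy] <-].
    exact: (measurable_comp (@measurable_cell R) sub mf (measurable_funTS measurable_fst)).
  - have sub : [set snd x | x in (cell2R : set (mR * mR))] `<=` cellR.
      by move=> _ [[x y] [/= cx cy] <-].
    exact: (measurable_comp (@measurable_cell R) sub mg (measurable_funTS measurable_snd)).
exists (M * N) => -[x y] [/= cx cy].
by rewrite normrM ler_pM ?fM ?gN.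
Qed.

(** Fubini is applied to the extension by zero from the square to the plane; its section at x is f x
    times g on the cell, or zero. *)
Lemma Rint2_sep (f g : R -> R) : bmr cellR (f : mR -> R) -> bmr cellR (g : mR -> R) ->
  Rintegral mu2 cell2R (fun p => f p.1 * g p.2) =
  Rintegral mu cellR f * Rintegral mu cellR g.
Proof.
move=> bf bg; have bfg := bmr_sep bf bg.
pose h (p : mR * mR) : R := f p.1 * g p.2.
have ih : mu2.-integrable cell2R (EFin \o h).
  exact: (@bmr_integrable R _ (mR * mR)%type mu2 cell2R measurable_cell2 mu_cell2_fin h bfg).
have ig : mu.-integrable cellR (EFin \o g).
  exact: (@bmr_integrable R _ mR mu cellR (@measurable_cell R) (@mu_cell_fin R) g bg).
have if_ : mu.-integrable cellR (EFin \o f).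
  exact: (@bmr_integrable R _ mR mu cellR (@measurable_cell R) (@mu_cell_fin R) f bf).
have fing : (\int[mu]_(y in cellR) (g y)%:E)%E \is a fin_num.
  exact: (integrable_fin_num (@measurable_cell R) ig).
have finf : (\int[mu]_(y in cellR) (f y)%:E)%E \is a fin_num.
  exact: (integrable_fin_num (@measurable_cell R) if_).
rewrite /Rintegral -fineM//; congr fine; rewrite integral_mkcond.
rewrite -(@integral12_prod_meas1 _ _ mR mR R mu mu ((EFin \o h) \_ cell2R)); last first.
  by apply/(integrable_mkcond _ measurable_cell2).
set G := (\int[mu]_(y in cellR) (g y)%:E)%E.
transitivity (\int[mu]_x (((fun x : mR => (f x)%:E * G) \_ cellR) x))%E; last first.
  rewrite -integral_mkcond /G -(fineK fing) integralZr//; exact: measurable_cell.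
apply: eq_integral => x _; rewrite /fubini_F patchE; case: ifPn => xc.
  rewrite /G -integralZl//; last exact: measurable_cell.
  rewrite [RHS]integral_mkcond; apply: eq_integral => y _.
  rewrite !patchE /cell2; have -> : ((x, y) \in cellR `*` cellR) = (y \in cellR).
    by apply/idP/idP; rewrite !inE => /=; [case|split => //; move: xc; rewrite inE].
  by case: ifP => // _; rewrite /= EFinM.
apply: integral0_eq => y _; rewrite patchE ifF//.
by apply: contraNF xc; rewrite !inE => -[].
Qed.

Lemma bm2_sep (f g : R -> C) : bmc f -> bmc g ->
  bm2 (fun p : mR * mR => f p.1 * g p.2).
Proof.
move=> [rf jf] [rg jg]; split.
- by apply: eq_bmr (bmrD (bmr_sep rf rg) (bmrN (bmr_sep jf jg))) => -[x y] /=; rewrite reCM.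
- by apply: eq_bmr (bmrD (bmr_sep rf jg) (bmr_sep jf rg)) => -[x y] /=; rewrite imCM.
Qed.

Lemma int2_sep (f g : R -> C) : bmc f -> bmc g ->
  int2 (fun p => f p.1 * g p.2) = intp f * intp g.
Proof.
move=> [rf jf] [rg jg]; apply: ceqP; rewrite ?reCM ?imCM ?reC_int ?imC_int.
- rewrite -!Rint2_sep// -[X in _ - X]mul1r -[X in X - _]mul1r -mulNr.
  rewrite -(@intr_lin R _ (mR * mR)%type mu2 cell2R measurable_cell2 mu_cell2_fin);
    [|exact: bmr_sep|exact: bmr_sep].
  by apply: eq_Rintegral => -[x y] _ /=; rewrite reCM /=; ring.
- rewrite -!Rint2_sep// -[X in _ + X]mul1r -[X in X + _]mul1r.
  rewrite -(@intr_lin R _ (mR * mR)%type mu2 cell2R measurable_cell2 mu_cell2_fin);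
    [|exact: bmr_sep|exact: bmr_sep].
  by apply: eq_Rintegral => -[x y] _ /=; rewrite imCM /=; ring.
Qed.

Implicit Types (F G : R -> R -> C) (k : int * int).

Definition bmt F : Prop := bm2 (fun p : mR * mR => F p.1 p.2).

Lemma bmtB F G : bmt F -> bmt G -> bmt (fun t s => F t s - G t s).
Proof. by move=> bF bG; exact: bmfB. Qed.
Lemma bmtZ (z : C) F : bmt F -> bmt (fun t s => z * F t s).
Proof. by move=> bF; exact: bmfZ. Qed.
Lemma bmt_sum (I : Type) (r : seq I) (F : I -> R -> R -> C) :
  (forall i, bmt (F i)) -> bmt (fun t s => \sum_(i <- r) F i t s).
Proof. by move=> bF; exact: bmf_sum. Qed.
Lemma bmt_sep (f g : R -> C) : ccont f -> ccont g -> bmt (fun t s => f s * g t).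
Proof.
move=> cf cg; apply: eq_bmf (bm2_sep (ccont_bmf cg) (ccont_bmf cf)) => p.
by rewrite mulrC.
Qed.

Definition ek2 k (p : mR * mR) : C := eik (- k.1) p.1 * eik (- k.2) p.2.

Lemma bm2_ek2 k : bm2 (ek2 k).
Proof. by apply: bm2_sep; exact/ccont_bmf/eik_cont. Qed.
Lemma bmt_ek2 F k : bmt F -> bm2 (fun p => F p.1 p.2 * ek2 k p).
Proof. by move=> bF; apply: bmfM => //; exact: bm2_ek2. Qed.

Lemma fourier2E F k :
  fourier2 F k = (per ^- 2)%:C * int2 (fun p => F p.1 p.2 * ek2 k p).
Proof.
rewrite /fourier2; congr (_ * _).
apply: (@eq_intc R _ (mR * mR)%type mu2) => -[t s] _ /=.
by rewrite /ek2 /= !eikN -expiD opprD.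
Qed.

Lemma eq_fourier2 F G k : (forall t s, F t s = G t s) -> fourier2 F k = fourier2 G k.
Proof.
by move=> FG; have -> : F = G by apply/funext => t; apply/funext => s; exact: FG.
Qed.

Lemma fourier2D F G k : bmt F -> bmt G ->
  fourier2 (fun t s => F t s + G t s) k = fourier2 F k + fourier2 G k.
Proof.
move=> bF bG; rewrite !fourier2E -mulrDr; congr (_ * _).
rewrite -(@intcD R _ (mR * mR)%type mu2 cell2R measurable_cell2 mu_cell2_fin);
  [|exact: bmt_ek2|exact: bmt_ek2].
by apply: (@eq_intc R _ (mR * mR)%type mu2) => p _; rewrite mulrDl.
Qed.

Lemma fourier2Z z F k : bmt F -> fourier2 (fun t s => z * F t s) k = z * fourier2 F k.
Proof.
move=> bF; rewrite !fourier2E mulrCA; congr (_ * _).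
rewrite -(@intcZ R _ (mR * mR)%type mu2 cell2R measurable_cell2 mu_cell2_fin);
  last exact: bmt_ek2.
by apply: (@eq_intc R _ (mR * mR)%type mu2) => p _; rewrite mulrA.
Qed.

Lemma fourier2B F G k : bmt F -> bmt G ->
  fourier2 (fun t s => F t s - G t s) k = fourier2 F k - fourier2 G k.
Proof.
move=> bF bG; rewrite -[X in _ - X]mul1r -mulNr -fourier2Z// -fourier2D//; last exact: bmtZ.
by apply: eq_fourier2 => t s; rewrite mulN1r.
Qed.

Lemma fourier2_sum (I : Type) (r : seq I) (F : I -> R -> R -> C) k :
  (forall i, bmt (F i)) ->
  fourier2 (fun t s => \sum_(i <- r) F i t s) k = \sum_(i <- r) fourier2 (F i) k.
Proof.
move=> bF; elim: r => [|i r IH].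
  have b0 : bmt (fun _ _ : R => 0 : C) by exact: bmf_cst.
  rewrite big_nil -[RHS](mul0r (fourier2 (fun _ _ : R => (0 : C)) k)).
  by rewrite -fourier2Z//; apply: eq_fourier2 => t s; rewrite big_nil mul0r.
rewrite big_cons -IH -fourier2D//; last exact: bmt_sum.
by apply: eq_fourier2 => t s; rewrite big_cons.
Qed.

Lemma fourier2_bound : exists2 A : R, 0 <= A & forall F k M, bmt F ->
  (forall t s, cabs (F t s) <= M) -> cabs (fourier2 F k) <= A * M.
Proof.
exists (per ^- 2 * (2 * fine (mu2 cell2R))).
  by rewrite mulr_ge0 ?invr_ge0 ?sqr_ge0// mulr_ge0// fine_ge0.
move=> F k M bF FM; rewrite fourier2E cabsM cabs_real ger0_norm; last first.
  by rewrite invr_ge0 sqr_ge0.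
rewrite -mulrA ler_wpM2l ?invr_ge0 ?sqr_ge0// mulrAC.
apply: (@intc_bound R _ (mR * mR)%type mu2 cell2R measurable_cell2 mu_cell2_fin).
  exact: bmt_ek2.
by move=> p _; rewrite /ek2 !cabsM !cabs_eik !mulr1.
Qed.

Lemma fourier2_sep (g : R -> C) (j : int) k : ccont g ->
  fourier2 (fun t s => g s * eik j t) k = if k.1 == j then fourier1 g k.2 else 0.
Proof.
move=> cg; rewrite fourier2E.
rewrite (@eq_intc R _ (mR * mR)%type mu2 cell2R _
   (fun p => (eik j p.1 * eik (- k.1) p.1) * (g p.2 * eik (- k.2) p.2))); last first.
  by move=> p _; rewrite /ek2; ring.
rewrite (int2_sep (f := fun t => eik j t * eik (- k.1) t)
  (g := fun s => g s * eik (- k.2) s)); last 2 first.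
- by apply: ccont_bmf; apply: ccontM; exact: eik_cont.
- by apply: ccont_bmf; apply: ccontM => //; exact: eik_cont.
have -> : (per ^- 2)%:C = per^-1%:C * per^-1%:C by rewrite -realCM -invfM -expr2.
rewrite mulrACA -!fourier1E fourier1_eik eq_sym.
by case: eqP => _; rewrite ?mul1r ?mul0r.
Qed.

Definition jf (m n : nat) : int := (n.*2)%:Z - m%:Z.
Definition wj (m n : nat) : R := 1 + (jf m n)%:~R ^+ 2.
Definition rowf (m : nat) (c : nat -> R -> C) (t s : R) : C :=
  \sum_(n < m.+1) c n s * eik (jf m n) t.

Lemma modeE (a : nat -> nat -> R -> C) m t s : mode a m t s = rowf m (a m) t s.
Proof.
apply: eq_bigr => n _; congr (_ * expi (_ * _)).
by rewrite /jf intrD mulrNz -muln2 PoszM intrM mulrC.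
Qed.

Lemma mode_rowf (a : nat -> nat -> R -> C) m : mode a m = rowf m (a m).
Proof. by apply/funext => t; apply/funext => s; exact: modeE. Qed.

Lemma jf_inj m : injective (jf m).
Proof. by rewrite /jf => n n'; lia. Qed.

Lemma wj_ge1 m n : 1 <= wj m n. Proof. exact: w_ge1. Qed.

Definition crow (m : nat) (c : nat -> R -> C) : Prop := forall n, (n <= m)%N -> ccont (c n).

Lemma bmt_rowf m c : crow m c -> bmt (rowf m c).
Proof.
by move=> cc; apply: bmt_sum => n; apply: bmt_sep; [apply: cc; rewrite -ltnS|exact: eik_cont].
Qed.

Lemma fourier2_rowf m c k : crow m c ->
  fourier2 (rowf m c) k = \sum_(n < m.+1) (if k.1 == jf m n then fourier1 (c n) k.2 else 0).
Proof.
move=> cc; have cn (n : 'I_m.+1) : ccont (c n) by apply: cc; rewrite -ltnS.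
rewrite fourier2_sum => [|n]; last by apply: bmt_sep => //; exact: eik_cont.
by apply: eq_bigr => n _; rewrite fourier2_sep.
Qed.

Lemma sum_jf_pick (V : nmodType) m (n : nat) (F : nat -> V) : (n <= m)%N ->
  \sum_(n' < m.+1) (if jf m n == jf m n' then F n' else 0) = F n.
Proof.
rewrite -ltnS => nm; rewrite (bigD1 (Ordinal nm)) //= eqxx big1 ?Monoid.mulm1// => i.
rewrite -val_eqE /= (inj_eq (@jf_inj m)) eq_sym => /negPf.
by rewrite eq_sym => ->.
Qed.

Lemma fourier2_rowf_jf m c n (l : int) : crow m c -> (n <= m)%N ->
  fourier2 (rowf m c) (jf m n, l) = fourier1 (c n) l.
Proof. by move=> cc nm; rewrite fourier2_rowf// (sum_jf_pick (fun n => fourier1 (c n) l) nm). Qed.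

Lemma rowf_coef m c n s : (n <= m)%N ->
  fourier1 (fun t => rowf m c t s) (jf m n) = c n s.
Proof.
move=> nm; rewrite fourier1_sum => [|i]; last by apply: bmfZ; exact/ccont_bmf/eik_cont.
rewrite -[RHS](sum_jf_pick (fun n => c n s) nm); apply: eq_bigr => i _.
rewrite fourier1Z ?fourier1_eik; last exact/ccont_bmf/eik_cont.
by rewrite eq_sym; case: eqP; rewrite ?mulr1 ?mulr0.
Qed.

Lemma rowf_inj m c d n s : (n <= m)%N -> (forall t, rowf m c t s = rowf m d t s) ->
  c n s = d n s.
Proof.
move=> nm E; rewrite -(rowf_coef c s nm) -(rowf_coef d s nm).
exact: eq_fourier1.
Qed.

Definition box2 N : seq (int * int) := [seq (j, l) | j <- box N, l <- box N].

Lemma box2_uniq N : uniq (box2 N).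
Proof. by apply: allpairs_uniq; [exact: box_uniq|exact: box_uniq|move=> [a b] [c d]]. Qed.

Lemma mem_box2 N k : (k \in box2 N) = (`|k.1| <= N)%N && (`|k.2| <= N)%N.
Proof.
case: k => j k; rewrite /=; apply/allpairsP/andP => [[[a b] /= []]|[aN bN]].
  by rewrite !mem_box => ? ? [-> ->].
by exists (j, k); rewrite /= !mem_box.
Qed.

Lemma box2_exhausts (A : set (int * int)) : finite_set A -> exists N, A `<=` [set` box2 N].
Proof.
move=> /finite_seqP[s ->].
exists (\max_(k <- s) (`|k.1| + `|k.2|))%N => k /= ks; rewrite mem_box2.
have := @leq_bigmax_seq _ s xpredT (fun k : int * int => `|k.1| + `|k.2|)%N k ks isT.
by move=> /= h; apply/andP; split; apply: leq_trans h; [exact: leq_addr|exact: leq_addl].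
Qed.

Definition wgt2 p k : R := (1 + k.1%:~R ^+ 2 + k.2%:~R ^+ 2) ^+ p.
Definition wsum2 p (c : int * int -> C) N : R :=
  \sum_(k <- box2 N) wgt2 p k * sqmod (c k).

Lemma wgt2_ge0 p k : 0 <= wgt2 p k.
Proof. by rewrite exprn_ge0// !addr_ge0 ?sqr_ge0. Qed.
Lemma wsum2_term_ge0 p c k : 0 <= wgt2 p k * sqmod (c k).
Proof. by rewrite mulr_ge0 ?wgt2_ge0 ?sqmod_ge0. Qed.

Lemma sobT2_energy_le p F X :
  (sobT2_energy p F <= X%:E)%E <-> forall N, wsum2 p (fourier2 F) N <= X.
Proof.
apply: (esum_finite_le (c := fun k => wgt2 p k * sqmod (fourier2 F k))).
- exact: box2_uniq.
- exact: box2_exhausts.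
- by move=> k; exact: wsum2_term_ge0.
Qed.

Lemma sobT2_energy_ge0 p F : (0 <= sobT2_energy p F)%E.
Proof. by apply: esum_ge0 => k _; rewrite lee_fin; exact: wsum2_term_ge0. Qed.

(** By orthogonality of the theta-modes this is the squared H^p norm on the torus of the row, see
    [rowf_energy]; all estimates are made on this sum. *)
Definition Em p m (c : nat -> R -> C) : R := \sum_(n < m.+1) en (wj m n) p (c n).
Definition sobrow p m (c : nat -> R -> C) : Prop := forall n, (n <= m)%N -> sobT p (c n).

Lemma sobrow_crow p m c : sobrow p m c -> crow m c.
Proof. by move=> sc n nm; exact: sobT_ccont (sc n nm). Qed.

Lemma Em_ge0 p m c : 0 <= Em p m c.
Proof. by apply: sumr_ge0 => n _; exact: en_ge0 (wj_ge1 _ _). Qed.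

Lemma en_Em p m c n : (n <= m)%N -> en (wj m n) p (c n) <= Em p m c.
Proof.
rewrite -ltnS => nm; rewrite /Em (bigD1 (Ordinal nm))//= lerDl.
by apply: sumr_ge0 => i _; exact: en_ge0 (wj_ge1 _ _).
Qed.

(** Distinct n have distinct frequencies 2n - m, so each j meets at most one coefficient of the row
    and the double sum decouples. *)
Lemma wsum2_rowf p m c N : crow m c ->
  wsum2 p (fourier2 (rowf m c)) N =
  \sum_(n < m.+1) (if (`|jf m n| <= N)%N then wsum (wj m n) p (fourier1 (c n)) N else 0).
Proof.
move=> cc; rewrite /wsum2 big_allpairs_dep /=.
have key j (l : int) : wgt2 p (j, l) * sqmod (fourier2 (rowf m c) (j, l)) =
   \sum_(n < m.+1) (if j == jf m n then wgt (wj m n) p l * sqmod (fourier1 (c n) l) else 0).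
  have [/existsP[n /eqP ->]|no] := boolP [exists n : 'I_m.+1, j == jf m n].
    have nm : (n <= m)%N by rewrite -ltnS.
    rewrite fourier2_rowf_jf//.
    by rewrite (sum_jf_pick (fun n => wgt (wj m n) p l * sqmod (fourier1 (c n) l)) nm).
  have nj (n : 'I_m.+1) : (j == jf m n) = false.
    by apply: contraNF no => h; apply/existsP; exists n.
  rewrite fourier2_rowf// !big1 ?sqmod0 ?mulr0// => n _ /=; by rewrite nj.
under eq_bigr do under eq_bigr do rewrite key.
under eq_bigr do rewrite exchange_big /=.
rewrite exchange_big /=; apply: eq_bigr => n _.
rewrite -[RHS](psum_pick _ N (jf m n)); apply: eq_bigr => j _.
by case: eqP => // _; rewrite big1.
Qed.

Lemma en_cvg w p (f : R -> C) : 1 <= w -> sobT p f ->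
  wsum w p (fourier1 f) N @[N --> \oo] --> en w p f.
Proof.
move=> w1 sf; set u := wsum w p (fourier1 f).
have nd : {homo u : n m / (n <= m)%N >-> n <= m}.
  by move=> n m; apply: psum_mono => k; exact: wsum_term_ge0.
have ub : forall N, u N <= en w p f by move=> N; exact: en_ub.
have cv : cvgn u by apply: nondecreasing_is_cvgn => //; exists (en w p f) => _ [N _ <-].
suff -> : en w p f = limn u by exact: cv.
apply/eqP; rewrite eq_le; apply/andP; split.
  by apply: en_le => // N; exact: nondecreasing_cvgn_le.
by apply: limr_le => //; exists 0%N => // N _; exact: ub.
Qed.

(** Every truncated double sum lies below [Em]; conversely the truncated energies of the single
    modes increase to theirs. *)
Lemma rowf_energy p m c : sobrow p m c -> sobT2_energy p (rowf m c) = (Em p m c)%:E.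
Proof.
move=> sc; have cc := sobrow_crow sc.
have sn (n : 'I_m.+1) : sobT p (c n) by apply: sc; rewrite -ltnS.
have le : (sobT2_energy p (rowf m c) <= (Em p m c)%:E)%E.
  apply/sobT2_energy_le => N; rewrite wsum2_rowf//; apply: ler_sum => n _.
  case: ifP => _; first exact: en_ub (wj_ge1 _ _) (sn n).
  exact: en_ge0 (wj_ge1 _ _).
apply/eqP; rewrite eq_le le /=.
have fn : sobT2_energy p (rowf m c) \is a fin_num.
  by rewrite ge0_fin_numE ?sobT2_energy_ge0//; apply: le_lt_trans le _; exact: ltry.
rewrite -(fineK fn) lee_fin.
have /sobT2_energy_le H : (sobT2_energy p (rowf m c) <= (fine (sobT2_energy p (rowf m c)))%:E)%E.
  by rewrite fineK.
have cv : \sum_(n < m.+1) wsum (wj m n) p (fourier1 (c n)) N @[N --> \oo] --> Em p m c.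
  rewrite /Em; elim: (index_enum _) => [|n r IH].
    by rewrite big_nil; under eq_cvg do rewrite big_nil; exact: cvg_cst.
  rewrite big_cons; under eq_cvg do rewrite big_cons; apply: cvgD => //.
  exact: en_cvg (wj_ge1 _ _) (sn n).
rewrite -(cvg_lim _ cv)//; apply: limr_le; first exact: cvgP cv.
(* From N >= m on the box contains all frequencies 2n - m of the row, so no mode is cut off. *)
exists m => // N /= mN; apply: le_trans (H N); rewrite wsum2_rowf//.
apply: ler_sum => n _; rewrite ifT//; rewrite /jf; have := ltn_ord n; lia.
Qed.

Lemma rowf_periodic_t m c t s : rowf m c (t + per) s = rowf m c t s.
Proof. by apply: eq_bigr => n _; rewrite eik_period. Qed.

Lemma bmt_square_integrable F : bmt F ->
  square_integrable mu2 cell2R (fun p => F p.1 p.2).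
Proof.
move=> bF; have [[mr _] [mi _]] := bF; split => //.
exact: (@bmr_integrable R _ (mR * mR)%type mu2 cell2R measurable_cell2 mu_cell2_fin _ (bmf_sqmod bF)).
Qed.

Lemma sobT2_rowf p m c : sobrow p m c -> sobT2 p (rowf m c).
Proof.
move=> sc; have cc := sobrow_crow sc; split.
- exact: rowf_periodic_t.
- move=> t s; apply: eq_bigr => n _; congr (_ * _).
  by rewrite (sobT_periodic (sc n _))// -ltnS.
- by apply: bmt_square_integrable; exact: bmt_rowf.
- by rewrite rowf_energy// ltry.
Qed.

Lemma sobT2_norm_rowf p m c : sobrow p m c -> sobT2_norm p (rowf m c) = Num.sqrt (Em p m c).
Proof. by move=> sc; rewrite /sobT2_norm rowf_energy. Qed.

(** Finite energy fixes a function only up to null sets, so continuity of the coefficients is an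
    input; periodicity in s passes to them by taking a Fourier coefficient in theta. *)
Lemma sobT2_sobrow p m c : crow m c -> sobT2 p (rowf m c) -> sobrow p m c.
Proof.
move=> cc [_ ps _ fin] n nm; apply/sobTP; split.
- by move=> s; rewrite -!(rowf_coef c _ nm); apply: eq_fourier1 => t; rewrite ps.
- exact: cc.
have fn : sobT2_energy p (rowf m c) \is a fin_num by rewrite ge0_fin_numE ?sobT2_energy_ge0.
have /sobT2_energy_le H : (sobT2_energy p (rowf m c) <= (fine (sobT2_energy p (rowf m c)))%:E)%E.
  by rewrite fineK.
exists (fine (sobT2_energy p (rowf m c))) => N.
have HN := H (maxn N m).
apply: le_trans (_ : wsum 1 p (fourier1 (c n)) (maxn N m) <= _).
  by apply: psum_mono; [move=> k; exact: wsum_term_ge0|exact: leq_maxl].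
apply: le_trans HN; rewrite wsum2_rowf//.
have nm1 : (n < m.+1)%N by [].
rewrite (bigD1 (Ordinal nm1))//= ifT; last by rewrite /jf; lia.
rewrite -[leLHS]addr0; apply: lerD.
  apply: ler_psum => k; rewrite ler_wpM2r ?sqmod_ge0//.
  rewrite -[leRHS]mul1r -[1 in leRHS](expr1n _ p); apply: wgt_lew => //; first exact: wj_ge1.
  by rewrite mul1r wj_ge1.
apply: sumr_ge0 => i _; case: ifP => // _; exact: wsum_ge0 (wj_ge1 _ _).
Qed.

End TorusFourier.

(** * Analytic series with Sobolev coefficients *)

Section PowerSeries.
Variable R : realType.
Local Notation C := R[i].
Local Notation bmt := (@bmt R).
Implicit Types (a b : nat -> nat -> R -> C) (sigma rho r q : R).

(** Write r = q * q: one geometric factor q^m absorbs a single power of m + 1, the other is left to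
    the induction on d. *)
Lemma poly_geometric d r : 0 <= r < 1 ->
  exists2 B, 0 <= B & forall m, (m.+1%:R) ^+ d * r ^+ m <= B.
Proof.
elim: d r => [|d IH] r /andP[r0 r1].
  by exists 1 => // m; rewrite expr0 mul1r exprn_ile1// ltW.
set q := Num.sqrt r.
have q0 : 0 <= q := sqrtr_ge0 r.
have qq : q * q = r by rewrite -expr2 sqr_sqrtr.
have q1 : q < 1 by rewrite -(ltr_pXn2r (n:=2))// ?nnegrE// expr1n expr2 qq.
have [B B0 hB] := IH q (introT andP (conj q0 q1)).
have q1' : 0 < 1 - q by rewrite subr_gt0.
exists (B * (1 - q)^-1) => [|m].
  by rewrite mulr_ge0// invr_ge0 ltW.
have lin : m.+1%:R * q ^+ m <= (1 - q)^-1.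
  rewrite -[(1 - q)^-1]mul1r ler_pdivlMr//.
  elim: m => [|m IHm]; first by rewrite mul1r expr0 mul1r gerBl.
  have qm : 0 <= q ^+ m by exact: exprn_ge0.
  have qm1 : q ^+ m <= 1 by rewrite exprn_ile1// ltW.
  have s1 : 1 <= m.+1%:R :> R by rewrite ler1n.
  rewrite exprS -(natr1 m.+1); move: IHm s1 qm qm1 q0 q1 q1'.
  set x : R := m.+1%:R; set y := q ^+ m => IHm s1 y0 y1 q0 q1 q1'.
  (* the sum 1 + q + ... + q^m dominates (m+1) q^m *)
  have h1 : q * y * (1 - q) <= 1 - q.
    by rewrite ler_piMl ?(ltW q1')//; apply: mulr_ile1 => //; exact: ltW.
  have h2 : q * (x * y * (1 - q)) <= q by rewrite ler_piMr.
  have -> : (x + 1) * (q * y) * (1 - q) = q * (x * y * (1 - q)) + q * y * (1 - q) by ring.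
  lra.
have rm : r ^+ m = q ^+ m * q ^+ m by rewrite -exprMn qq.
rewrite rm exprSr mulrACA; apply: ler_pM => //.
- by rewrite mulr_ge0 ?exprn_ge0.
- by rewrite mulr_ge0 ?exprn_ge0.
Qed.

Lemma geometric_tail q N M : 0 <= q < 1 ->
  \sum_(N <= m < M) q ^+ m <= q ^+ N / (1 - q).
Proof.
move=> /andP[q0 q1]; have q1' : 0 < 1 - q by rewrite subr_gt0.
rewrite ler_pdivlMr//.
have [MN|NM] := leqP M N; first by rewrite big_geq// mul0r exprn_ge0.
suff E : (\sum_(N <= m < M) q ^+ m) * (1 - q) = q ^+ N - q ^+ M.
  by rewrite E gerBl exprn_ge0.
rewrite mulr_suml; under eq_bigr do rewrite mulrBr mulr1 -exprSr.
by rewrite -[LHS]opprK -sumrN; under eq_bigr do rewrite opprB;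
  rewrite telescope_sumr ?opprB// ltnW.
Qed.

Lemma cvg_geom q (A : R) : 0 <= q < 1 -> A * q ^+ n @[n --> \oo] --> (0 : R).
Proof.
move=> /andP[q0 q1]; rewrite -(mulr0 A); apply: cvgM; first exact: cvg_cst.
by apply: cvg_expr; rewrite ger0_norm.
Qed.

Lemma partial_sum_nat a M rho t s :
  partial_sum a M rho t s = \sum_(0 <= m < M) (rho ^+ m)%:C * mode a m t s.
Proof. by rewrite big_mkord. Qed.

Lemma partial_sumB a N M rho t s : (N <= M)%N ->
  partial_sum a M rho t s - partial_sum a N rho t s =
  \sum_(N <= m < M) (rho ^+ m)%:C * mode a m t s.
Proof.
by move=> NM; rewrite !partial_sum_nat (big_cat_nat (n := N))//= addrAC subrr add0r.
Qed.

(* Coefficients of a power series in rho with radius at least sigma. *)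
Definition fbd sigma a : Prop := forall sg, 0 < sg < sigma ->
  exists2 B, 0 <= B & forall m n s, (n <= m)%N -> cabs (a m n s) * sg ^+ m <= B.

Lemma mode_bound a m t s B : (forall n, (n <= m)%N -> cabs (a m n s) <= B) ->
  cabs (mode a m t s) <= m.+1%:R * B.
Proof.
move=> aB; rewrite modeE; apply: le_trans (cabs_sum _ _ _) _.
apply: le_trans (_ : \sum_(n < m.+1) B <= _).
  by apply: ler_sum => n _; rewrite cabsM cabs_eik mulr1 aB// -ltnS.
by rewrite sumr_const card_ord mulr_natl.
Qed.

Lemma fbd_tail sigma a rho1 : fbd sigma a -> 0 <= rho1 < sigma -> exists2 e : nat -> R,
  e n @[n --> \oo] --> (0 : R) &
  forall N M rho t s, (N <= M)%N -> `|rho| <= rho1 ->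
    cabs (partial_sum a M rho t s - partial_sum a N rho t s) <= e N.
Proof.
move=> fa /andP[r0 rs].
(* Two gaps are opened: [sg] between rho1 and sigma leaves the ratio x = rho1 / sg < 1, and q
   between x and 1 leaves room to absorb the m + 1 modes of each row. *)
pose sg := (rho1 + sigma) / 2.
have sg0 : 0 < sg by rewrite /sg; lra.
have rsg : rho1 < sg by rewrite /sg; lra.
have sgs : sg < sigma by rewrite /sg; lra.
have [B B0 hB] := fa sg (introT andP (conj sg0 sgs)).
pose x := rho1 / sg.
have x0 : 0 <= x by rewrite divr_ge0// ltW.
have x1 : x < 1 by rewrite ltr_pdivrMr// mul1r.
pose q := (x + 1) / 2.
have q0 : 0 < q by rewrite /q; lra.
have q1 : q < 1 by rewrite /q; lra.
have xq : x < q by rewrite /q; lra.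
have [|A A0 hA] := @poly_geometric 1 (x / q).
  by rewrite divr_ge0 ?(ltW q0)//= ltr_pdivrMr// mul1r.
exists (fun N => A * B / (1 - q) * q ^+ N).
  by apply: cvg_geom; rewrite ltW.
move=> N M rho t s NM hr; rewrite partial_sumB//.
apply: le_trans (cabs_sum _ _ _) _.
apply: le_trans (_ : \sum_(N <= m < M) (A * B * q ^+ m) <= _).
  apply: ler_sum => m _; rewrite cabsM cabs_real.
  have h1 : cabs (mode a m t s) <= m.+1%:R * (B / sg ^+ m).
    by apply: mode_bound => n nm; rewrite ler_pdivlMr ?exprn_gt0// hB.
  apply: le_trans (_ : rho1 ^+ m * (m.+1%:R * (B / sg ^+ m)) <= _).
    apply: ler_pM => //; first exact: cabs_ge0.
    by rewrite normrX; apply: lerXn2r; rewrite ?nnegrE.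
  have := hA m; rewrite expr1 exprMn exprVn => hAm.
  have -> : rho1 ^+ m = x ^+ m * sg ^+ m by rewrite -exprMn /x divfK// gt_eqF.
  have -> : x ^+ m * sg ^+ m * (m.+1%:R * (B / sg ^+ m)) = m.+1%:R * x ^+ m * B.
    by field; rewrite expf_neq0// gt_eqF.
  rewrite [leRHS]mulrAC; apply: ler_wpM2r => //.
  by rewrite -ler_pdivrMr ?exprn_gt0// -mulrA.
rewrite -mulr_sumr -[leRHS]mulrA [X in _ <= _ * X]mulrC.
apply: ler_wpM2l; first by rewrite mulr_ge0.
by apply: geometric_tail; rewrite ltW.
Qed.

Lemma series_cvg sigma a rho t s : fbd sigma a -> `|rho| < sigma ->
  ccvg (fun N => partial_sum a N rho t s) (series_fun a rho t s).
Proof.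
move=> fa rs; have [|e e0 he] := @fbd_tail sigma a `|rho| fa.
  by rewrite normr_ge0.
have [l hl] := ccvg_cauchy (fun N M NM => he N M rho t s NM (lexx _)) e0.
suff -> : series_fun a rho t s = l by [].
have /ccvgP[x y] := hl.
by apply: ceqP => /=; [exact: (cvg_lim _ x)|exact: (cvg_lim _ y)].
Qed.

Lemma series_unif sigma a rho1 : fbd sigma a -> 0 <= rho1 < sigma ->
  exists2 e : nat -> R, e n @[n --> \oo] --> (0 : R) &
  (forall N M rho t s, (N <= M)%N -> `|rho| <= rho1 ->
    cabs (partial_sum a M rho t s - partial_sum a N rho t s) <= e N) /\
  (forall N rho t s, `|rho| <= rho1 ->
    cabs (series_fun a rho t s - partial_sum a N rho t s) <= e N).
Proof.
move=> fa /[dup] rr /andP[r0 rs]; have [e e0 he] := fbd_tail fa rr.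
exists e => //; split => // N rho t s hr.
have cv := series_cvg t s fa (le_lt_trans hr rs).
apply: (@ccvg_cabs_le _ (fun M => partial_sum a M rho t s - partial_sum a N rho t s)).
  by apply: ccvgB => //; exact: ccvg_cst.
by exists N => // M /= NM; exact: he.
Qed.

(** Weighted Cauchy-Schwarz; with geometric weights it takes the place of the triangle inequality
    for the Sobolev norm of a sum over orders, one Fourier coefficient at a time. *)
Lemma cabs_weighted (s : seq nat) (z : nat -> C) (b : nat -> R) :
  (forall m, 0 < b m) ->
  sqmod (\sum_(m <- s) z m) <=
  (\sum_(m <- s) b m) * (\sum_(m <- s) (b m)^-1 * sqmod (z m)).
Proof.
move=> b0; apply: le_trans (_ : (\sum_(m <- s) cabs (z m)) ^+ 2 <= _).
  rewrite -sqr_cabs; apply: lerXn2r; rewrite ?nnegrE ?cabs_ge0//.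
    by apply: sumr_ge0 => m _; exact: cabs_ge0.
  exact: cabs_sum.
have -> : \sum_(m <- s) cabs (z m) =
    \sum_(m <- s) Num.sqrt (b m) * ((Num.sqrt (b m))^-1 * cabs (z m)).
  by apply: eq_bigr => m _; rewrite mulVKf// gt_eqF// sqrtr_gt0.
apply: le_trans (cauchy_schwarz _ _ _) _.
rewrite le_eqVlt; apply/orP; left; apply/eqP; congr (_ * _); apply: eq_bigr => m _.
  by rewrite sqr_sqrtr// ltW.
by rewrite exprMn sqr_cabs exprVn sqr_sqrtr// ltW.
Qed.

Section SobolevSeries.
Variables (p : nat) (sigma X : R) (a : nat -> nat -> R -> C).
Hypothesis sigma0 : 0 < sigma.
Hypothesis arow : forall m, sobrow p.+1 m (a m).
Hypothesis aX : forall m, sigma ^+ (2 * m) * Em p.+1 m (a m) <= X.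

Lemma energy_fbd : fbd sigma a.
Proof.
have X0 : 0 <= X by apply: le_trans (aX 0); rewrite mulr_ge0 ?exprn_ge0 ?Em_ge0// ltW.
move=> sg /andP[s0 s1]; exists (Num.sqrt (5 * X)) => [|m n s nm]; first exact: sqrtr_ge0.
rewrite -(ler_pXn2r (n:=2)) ?nnegrE ?sqrtr_ge0//; last first.
  by rewrite mulr_ge0 ?cabs_ge0// exprn_ge0// ltW.
rewrite sqr_sqrtr ?mulr_ge0// exprMn sqr_cabs.
have h1 := sobT_sup s (wj_ge1 R m n) (arow nm).
have h2 := en_Em p.+1 (a m) nm.
apply: le_trans (_ : 5 * Em p.+1 m (a m) * sigma ^+ (2 * m) <= _); last first.
  by rewrite -mulrA ler_wpM2l// mulrC.
apply: ler_pM; rewrite ?sqmod_ge0 ?exprn_ge0 ?(ltW s0)//.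
  by apply: le_trans h1 _; rewrite ler_wpM2l.
by rewrite -exprM mulnC; apply: lerXn2r; rewrite ?nnegrE ?ltW.
Qed.

Lemma crow_arow m : crow m (a m). Proof. exact: sobrow_crow. Qed.

Lemma bmt_partial M rho : bmt (partial_sum a M rho).
Proof.
rewrite (_ : partial_sum a M rho = fun t s => \sum_(m < M) (rho ^+ m)%:C * rowf m (a m) t s).
  by apply: bmt_sum => m; apply: bmtZ; apply: bmt_rowf; exact: crow_arow.
by apply/funext => t; apply/funext => s; apply: eq_bigr => m _; rewrite modeE.
Qed.

Lemma bmt_series rho : `|rho| < sigma -> bmt (series_fun a rho).
Proof.
move=> rs; have [|e e0 [_ he]] := @series_unif sigma a `|rho| energy_fbd.
  by rewrite normr_ge0.
apply: (@bmf_cvg R _ _ _ (fun n p => partial_sum a n rho p.1 p.2)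
   (fun p => series_fun a rho p.1 p.2) (e 0%N)).
- by move=> n; exact: bmt_partial.
- move=> [t s] _ /=; apply: (squeeze_cvgr _ (cvg_cst 0) e0); near=> n.
  rewrite cabs_ge0 /= -cabsN opprB; exact: he.
- move=> [t s] _ /=; have := he 0%N rho t s (lexx _).
  by rewrite /partial_sum big_ord0 subr0.
Unshelve. all: by end_near. Qed.

Lemma fourier2_partialB N M rho k : (N <= M)%N ->
  fourier2 (fun t s => partial_sum a M rho t s - partial_sum a N rho t s) k =
  \sum_(N <= m < M) (rho ^+ m)%:C * fourier2 (rowf m (a m)) k.
Proof.
move=> NM; rewrite (eq_fourier2 _ (G := fun t s =>
    \sum_(m <- index_iota N M) (rho ^+ m)%:C * rowf m (a m) t s)); last first.
  by move=> t s; rewrite partial_sumB//; apply: eq_bigr => m _; rewrite modeE.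
rewrite fourier2_sum => [|m]; last by apply: bmtZ; apply: bmt_rowf; exact: crow_arow.
by apply: eq_bigr => m _; rewrite fourier2Z//; apply: bmt_rowf; exact: crow_arow.
Qed.

Lemma wsum2_rowf_le m N : wsum2 p.+1 (fourier2 (rowf m (a m))) N <= Em p.+1 m (a m).
Proof. by move: N; apply/sobT2_energy_le; rewrite rowf_energy. Qed.

(** With weights r^m one factor is the geometric tail; in the other r^-m rho^(2m) <= r^m sigma^(2m),
    so the energy bound X leaves a second geometric tail. *)
Lemma wsum2_partialB r N M rho L : 0 < r < 1 -> `|rho| <= r * sigma -> (N <= M)%N ->
  wsum2 p.+1 (fourier2 (fun t s => partial_sum a M rho t s - partial_sum a N rho t s)) L
  <= X * (r ^+ N / (1 - r)) ^+ 2.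
Proof.
move=> /andP[r0 r1] rr NM; set G := r ^+ N / (1 - r).
have X0 : 0 <= X by apply: le_trans (aX 0); rewrite mulr_ge0 ?exprn_ge0 ?Em_ge0// ltW.
have rm m : 0 < r ^+ m by exact: exprn_gt0.
have G0 : 0 <= G by rewrite divr_ge0 ?exprn_ge0 ?subr_ge0// ltW.
have tail : \sum_(N <= m < M) r ^+ m <= G by apply: geometric_tail; rewrite ltW.
apply: le_trans (_ : \sum_(k <- box2 L) G * (\sum_(N <= m < M)
   (r ^+ m)^-1 * rho ^+ m ^+ 2 * (wgt2 R p.+1 k * sqmod (fourier2 (rowf m (a m)) k))) <= _).
  apply: ler_sum => k _; rewrite fourier2_partialB//.
  apply: le_trans (ler_wpM2l (wgt2_ge0 _ _ _) (cabs_weighted _ _ rm)) _.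
  rewrite mulrCA; apply: ler_pM => //.
  - by apply: sumr_ge0 => m _; exact: ltW.
  - by rewrite mulr_ge0 ?wgt2_ge0//; apply: sumr_ge0 => m _; rewrite mulr_ge0 ?sqmod_ge0// invr_ge0 ltW.
  rewrite mulr_sumr; apply: ler_sum => m _.
  by rewrite sqmodM sqmod_real; rewrite le_eqVlt; apply/orP; left; apply/eqP; ring.
rewrite -mulr_sumr exchange_big /= expr2 mulrCA; apply: ler_wpM2l => //.
apply: le_trans (_ : \sum_(N <= m < M) X * r ^+ m <= _); last first.
  by rewrite -mulr_sumr ler_wpM2l.
apply: ler_sum => m _; rewrite -mulr_sumr.
have h1 : (r ^+ m)^-1 * rho ^+ m ^+ 2 <= r ^+ m * sigma ^+ (2 * m).
  rewrite mulrC ler_pdivrMr// -exprM mulnC exprM.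
  have -> : r ^+ m * sigma ^+ (2 * m) * r ^+ m = ((r * sigma) ^+ 2) ^+ m.
    have e : r ^+ (2 * m) = r ^+ m * r ^+ m by rewrite mul2n -addnn exprD.
    by rewrite -exprM exprMn e; ring.
  apply: lerXn2r; rewrite ?nnegrE ?sqr_ge0// -[rho ^+ 2]real_normK ?num_real//.
  have rs0 : 0 <= r * sigma by apply: mulr_ge0; exact: ltW.
  by apply: lerXn2r; rewrite ?nnegrE.
apply: le_trans (_ : r ^+ m * sigma ^+ (2 * m) * Em p.+1 m (a m) <= _).
  apply: ler_pM => //.
  - by rewrite mulr_ge0 ?sqr_ge0// invr_ge0 ltW.
  - by apply: sumr_ge0 => k _; exact: wsum2_term_ge0.
  - exact: wsum2_rowf_le.
by rewrite -mulrA mulrC ler_wpM2r// ltW.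
Qed.

Lemma wsum2_limit (F : nat -> R -> R -> C) G Y L :
  (forall k, ccvg (fun n => fourier2 (F n) k) (fourier2 G k)) ->
  (\forall n \near \oo, wsum2 p.+1 (fourier2 (F n)) L <= Y) ->
  wsum2 p.+1 (fourier2 G) L <= Y.
Proof.
move=> FG FY.
have cv : wsum2 p.+1 (fourier2 (F n)) L @[n --> \oo] --> wsum2 p.+1 (fourier2 G) L.
  rewrite /wsum2; elim: (box2 L) => [|k r IH].
    by rewrite big_nil; under eq_cvg do rewrite big_nil; exact: cvg_cst.
  rewrite big_cons; under eq_cvg do rewrite big_cons; apply: cvgD => //.
  by apply: cvgM; [exact: cvg_cst|exact: ccvg_sqmod].
by rewrite -(cvg_lim _ cv)//; apply: limr_le => //; exact: cvgP cv.
Qed.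

(** The partial sums converge uniformly on the torus, so Fourier coefficients pass to the limit, and
    a finite weighted sum of them keeps its bound. *)
Lemma series_energy r N rho : 0 < r < 1 -> `|rho| <= r * sigma ->
  (sobT2_energy p.+1 (fun t s => series_fun a rho t s - partial_sum a N rho t s)%R
  <= (X * (r ^+ N / (1 - r)) ^+ 2)%:E)%E.
Proof.
move=> rr rs; have rhos : `|rho| < sigma.
  by case/andP: rr => r0 r1; apply: le_lt_trans rs _; rewrite gtr_pMl.
apply/sobT2_energy_le => L.
apply: (@wsum2_limit (fun M t s => partial_sum a M rho t s - partial_sum a N rho t s)).
  move=> k; have [A A0 hA] := fourier2_bound R.
  have [|e e0 [_ he]] := @series_unif sigma a `|rho| energy_fbd.
    by rewrite normr_ge0.
  have e2 : A * e n @[n --> \oo] --> (0 : R).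
    by rewrite -(mulr0 A); apply: cvgM => //; exact: cvg_cst.
  apply: (squeeze_cvgr _ (cvg_cst 0) e2); near=> M.
  rewrite cabs_ge0 /= -cabsN opprB.
  have bs := bmt_series rhos; have bp n := bmt_partial n rho.
  rewrite fourier2B// fourier2B// opprB addrA subrK -fourier2B//.
  by apply: hA; [exact: bmtB|move=> t s; exact: he].
by exists N => // M /= NM; exact: wsum2_partialB.
Unshelve. all: by end_near. Qed.

Lemma series_periodic_t rho t s :
  series_fun a rho (t + period R) s = series_fun a rho t s.
Proof.
have E N : partial_sum a N rho (t + period R) s = partial_sum a N rho t s.
  by apply: eq_bigr => m _; rewrite !modeE rowf_periodic_t.
by rewrite /series_fun; congr (lim _ +i* lim _); under eq_fun do rewrite E.
Qed.

Lemma series_periodic_s rho t s :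
  series_fun a rho t (s + period R) = series_fun a rho t s.
Proof.
have E N : partial_sum a N rho t (s + period R) = partial_sum a N rho t s.
  apply: eq_bigr => m _; rewrite !modeE; congr (_ * _); apply: eq_bigr => n _.
  by rewrite (sobT_periodic (arow (n:=n) _))// -ltnS.
by rewrite /series_fun; congr (lim _ +i* lim _); under eq_fun do rewrite E.
Qed.

Lemma analytic_norm_le Y : 0 <= Y -> X <= Y ^+ 2 ->
  (analytic_norm sigma (Hq R p.+1) a <= Y%:E)%E.
Proof.
move=> Y0 XY; apply: ub_ereal_sup => _ [m _ <-]; rewrite lee_fin /=.
rewrite mode_rowf sobT2_norm_rowf//.
rewrite -(ler_pXn2r (n:=2)) ?nnegrE//; last first.
  by rewrite mulr_ge0 ?sqrtr_ge0 ?exprn_ge0// ltW.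
by rewrite exprMn sqr_sqrtr ?Em_ge0// -exprM mulnC; apply: le_trans XY.
Qed.

Lemma series_analytic : analytic_series sigma (Hq R p.+1) a.
Proof.
have X0 : 0 <= X by apply: le_trans (aX 0); rewrite mulr_ge0 ?exprn_ge0 ?Em_ge0// ltW.
split.
- by move=> m; rewrite /= mode_rowf; exact: sobT2_rowf.
- move=> rho /andP[rho0 rhos] /=.
  have rn : `|rho| < sigma by rewrite ger0_norm.
  (* The midpoint of rho / sigma and 1: still below 1, yet rho <= r sigma. *)
  pose r := (1 + rho / sigma) / 2.
  have rs1 : rho / sigma < 1 by rewrite ltr_pdivrMr// mul1r.
  have rs0 : 0 <= rho / sigma by rewrite divr_ge0// ltW.
  have r01 : 0 < r < 1 by rewrite /r; apply/andP; split; lra.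
  have rr : `|rho| <= r * sigma.
    by rewrite ger0_norm// -ler_pdivrMr// /r; lra.
  split.
    split.
    + exact: series_periodic_t.
    + exact: series_periodic_s.
    + by apply: bmt_square_integrable; exact: bmt_series.
    + have := series_energy 0 r01 rr; under [X in sobT2_energy _ X]eq_fun do
        under eq_fun do rewrite /partial_sum big_ord0 subr0.
      by move=> /le_lt_trans; apply; exact: ltry.
  case/andP: r01 => r0 r1.
  have c0 : Num.sqrt X / (1 - r) * r ^+ N @[N --> \oo] --> (0 : R).
    by apply: cvg_geom; rewrite ltW.
  apply: (squeeze_cvgr _ (cvg_cst 0) c0); near=> N.
  rewrite /sobT2_norm sqrtr_ge0 /=.
  have := series_energy N (introT andP (conj r0 r1)) rr.
  set E := sobT2_energy _ _ => hE.
  have fE : E \is a fin_num.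
    by rewrite ge0_fin_numE ?sobT2_energy_ge0//; apply: le_lt_trans hE _; exact: ltry.
  have r1' : 0 < 1 - r by rewrite subr_gt0.
  rewrite -(fineK fE) lee_fin in hE.
  rewrite -(ler_pXn2r (n:=2)) ?nnegrE ?sqrtr_ge0//; last first.
    by rewrite mulr_ge0 ?divr_ge0 ?sqrtr_ge0 ?exprn_ge0// ltW.
  rewrite sqr_sqrtr; last by apply: fine_ge0; exact: sobT2_energy_ge0.
  apply: le_trans hE _; rewrite !exprMn sqr_sqrtr//.
  by rewrite le_eqVlt; apply/orP; left; apply/eqP; ring.
- apply: le_lt_trans (_ : (Num.sqrt X)%:E < +oo)%E; last exact: ltry.
  by apply: analytic_norm_le; rewrite ?sqrtr_ge0// sqr_sqrtr.
Unshelve. all: by end_near. Qed.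

End SobolevSeries.

Lemma analytic_norm_ub sigma p a m : 0 <= sigma -> sobrow p m (a m) ->
  ((sigma ^+ m * Num.sqrt (Em p m (a m)))%:E <= analytic_norm sigma (Hq R p) a)%E.
Proof.
move=> s0 sa; apply: ereal_sup_ubound; exists m => //=.
by rewrite mode_rowf sobT2_norm_rowf.
Qed.

(** Converse direction, used on the initial data: a finite analytic norm Y is turned into bounds Y^2
    on the weighted energies of the rows, the quantity that the recursion propagates. *)
Lemma analytic_series_energy sigma p a : 0 < sigma ->
  (forall m n, (n <= m)%N -> cCk 0 (a m n)) ->
  analytic_series sigma (Hq R p) a ->
  exists2 Y, 0 <= Y & analytic_norm sigma (Hq R p) a = Y%:E /\
  forall m, sobrow p m (a m) /\ sigma ^+ (2 * m) * Em p m (a m) <= Y ^+ 2.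
Proof.
move=> s0 ac [ma _ fin].
have sr m : sobrow p m (a m).
  apply: sobT2_sobrow; first by move=> n nm; apply/cCk0P; exact: ac.
  by have := ma m; rewrite /= mode_rowf.
have ub m := analytic_norm_ub (ltW s0) (sr m).
have ge : (0 <= analytic_norm sigma (Hq R p) a)%E.
  apply: le_trans (ub 0%N); rewrite lee_fin; apply: mulr_ge0; last exact: sqrtr_ge0.
  by apply: exprn_ge0; exact: ltW.
have fn : analytic_norm sigma (Hq R p) a \is a fin_num by rewrite ge0_fin_numE.
exists (fine (analytic_norm sigma (Hq R p) a)); first exact: fine_ge0.
split=> [|m]; first by rewrite fineK.
split => //; have := ub m; rewrite -(fineK fn) lee_fin /= => h.
have e0 : 0 <= sigma ^+ m by rewrite exprn_ge0// ltW.
have -> : sigma ^+ (2 * m) * Em p m (a m) = (sigma ^+ m * Num.sqrt (Em p m (a m))) ^+ 2.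
  by rewrite exprMn sqr_sqrtr ?Em_ge0// -exprM mulnC.
apply: lerXn2r => //; rewrite nnegrE; first by rewrite mulr_ge0 ?sqrtr_ge0.
by apply: fine_ge0.
Qed.

End PowerSeries.

(** * The recursion for the coefficients and its a priori bound *)

Section RowOperators.
Variable R : realType.
Local Notation C := R[i].
Implicit Types (c d : nat -> R -> C) (h : R -> R) (z : nat -> C).

Definition prv c (n : nat) : R -> C := if n is n'.+1 then c n' else fun=> 0.
(* A row holds the coefficients 0 <= n <= m of one phi_m; it is extended by 0. *)
Definition trow m c : Prop := forall n, (m < n)%N -> c n = fun=> 0.

Lemma jfS m n : jf m.+1 n = jf m n - 1. Proof. by rewrite /jf; lia. Qed.
Lemma jfSS m n : jf m.+1 n.+1 = jf m n + 1. Proof. by rewrite /jf; lia. Qed.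
Lemma jfSSS m n : jf m.+2 n.+1 = jf m n. Proof. by rewrite /jf; lia. Qed.

(** Multiplication by cos theta or sin theta moves a frequency by one, and (x - 1)^2 + 1 <= 3 (1 +
    x^2); this is the origin of the factors 3^p in the shifts. *)
Lemma wjS m n : wj R m.+1 n <= 3 * wj R m n.
Proof.
rewrite /wj jfS intrD; set x : R := (jf m n)%:~R; rewrite [(-1)%:~R]mulrNz.
by have := sqr_ge0 (x + 2^-1); rewrite !expr2; nra.
Qed.
Lemma wjSS m n : wj R m.+1 n.+1 <= 3 * wj R m n.
Proof.
rewrite /wj jfSS intrD; set x : R := (jf m n)%:~R.
by have := sqr_ge0 (x - 2^-1); rewrite !expr2; nra.
Qed.

Lemma sobrow_trow p m c k : trow m c -> sobrow p m c -> sobrow p k c.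
Proof.
move=> tc sc n _; have [nm|mn] := leqP n m; first exact: sc.
by rewrite tc//; exact: sobT0.
Qed.

Lemma sobrow_prv p m c : sobrow p m c -> sobrow p m.+1 (prv c).
Proof. by move=> sc [|n] nm; [exact: sobT0|exact: sc]. Qed.

Lemma trow_prv m c : trow m c -> trow m.+1 (prv c).
Proof. by move=> tc [|n]//=; exact: tc. Qed.

Lemma sobrow_le p p' m c : (p <= p')%N -> sobrow p' m c -> sobrow p m c.
Proof. by move=> pp sc n nm; exact: sobT_le pp (sc n nm). Qed.

Lemma Em_le p p' m c : (p <= p')%N -> sobrow p' m c -> Em p m c <= Em p' m c.
Proof.
move=> pp sc; apply: ler_sum => n _; apply: en_lep => //; first exact: wj_ge1.
by apply: sc; rewrite -ltnS.
Qed.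

Lemma eq_Em p m c d : (forall n, (n <= m)%N -> c n = d n) -> Em p m c = Em p m d.
Proof. by move=> cd; apply: eq_bigr => n _; rewrite cd// -ltnS. Qed.

Lemma Em_shift0 p m c : trow m c -> sobrow p m c -> Em p m.+1 c <= 3 ^+ p * Em p m c.
Proof.
move=> tc sc; rewrite /Em big_ord_recr /= (tc m.+1)// en0 ?addr0; last exact: wj_ge1.
rewrite mulr_sumr; apply: ler_sum => n _.
apply: en_mono => //; try exact: wj_ge1; try exact: wjS; first by lra.
by apply: sc; rewrite -ltnS.
Qed.

Lemma Em_shift1 p m c : sobrow p m c -> Em p m.+1 (prv c) <= 3 ^+ p * Em p m c.
Proof.
move=> sc; rewrite /Em big_ord_recl /= en0 ?add0r; last exact: wj_ge1.
rewrite mulr_sumr; apply: ler_sum => n _ /=; rewrite /bump leq0n add1n /=.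
apply: en_mono => //; try exact: wj_ge1; try exact: wjSS; first by lra.
by apply: sc; rewrite -ltnS; exact: ltn_ord.
Qed.

(** Multiplication by rho^2 raises m by 2 and n by 1 and so keeps every theta-frequency: nothing is
    lost. *)
Lemma Em_shift2 p m c : trow m c -> Em p m.+2 (prv c) = Em p m c.
Proof.
move=> tc; rewrite /Em big_ord_recl /= en0 ?add0r; last exact: wj_ge1.
rewrite big_ord_recr /= (tc m.+1)// en0 ?addr0; last exact: wj_ge1.
by apply: eq_bigr => n _; rewrite /wj /= /bump leq0n add1n jfSSS.
Qed.

Definition rowD c d n (s : R) : C := c n s + d n s.
Definition rowB c d n (s : R) : C := c n s - d n s.
Definition rowZ z c n (s : R) : C := z n * c n s.
Definition rowM h c n (s : R) : C := (h s)%:C * c n s.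
Definition rowd c n : R -> C := cderive (c n).
Definition rowj m c n (s : R) : C := 'i * (jf m n)%:~R * c n s.

Lemma sobrowD p m c d : sobrow p m c -> sobrow p m d -> sobrow p m (rowD c d).
Proof. by move=> sc sd n nm; apply: sobTD; [exact: sc|exact: sd]. Qed.
Lemma sobrowB p m c d : sobrow p m c -> sobrow p m d -> sobrow p m (rowB c d).
Proof. by move=> sc sd n nm; apply: sobTB; [exact: sc|exact: sd]. Qed.
Lemma sobrowZ p m z c : sobrow p m c -> sobrow p m (rowZ z c).
Proof. by move=> sc n nm; apply: sobTZ; exact: sc. Qed.
Lemma sobrowJ p m k c : sobrow p m c -> sobrow p m (rowj k c).
Proof. by move=> sc n nm; apply: sobTZ; exact: sc. Qed.
Lemma sobrowM p G m h c : Rb p.+1 G h -> sobrow p.+1 m c -> sobrow p.+1 m (rowM h c).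
Proof. by move=> hb sc n nm; exact: (sobTM (sc n nm) hb).1. Qed.
Lemma sobrowd p m c : sobrow p.+2 m c -> sobrow p.+1 m (rowd c).
Proof. by move=> sc n nm; case: (sobT_derive (sc n nm)). Qed.

Lemma EmD p m c d : sobrow p m c -> sobrow p m d ->
  Em p m (rowD c d) <= 2 * Em p m c + 2 * Em p m d.
Proof.
move=> sc sd; rewrite /Em !mulr_sumr -big_split /=; apply: ler_sum => n _.
by apply: enD; [exact: wj_ge1|apply: sc; rewrite -ltnS|apply: sd; rewrite -ltnS].
Qed.
Lemma EmB p m c d : sobrow p m c -> sobrow p m d ->
  Em p m (rowB c d) <= 2 * Em p m c + 2 * Em p m d.
Proof.
move=> sc sd; rewrite /Em !mulr_sumr -big_split /=; apply: ler_sum => n _.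
by apply: enB; [exact: wj_ge1|apply: sc; rewrite -ltnS|apply: sd; rewrite -ltnS].
Qed.
Lemma EmZ p m z c A : sobrow p m c -> (forall n, sqmod (z n) <= A) ->
  Em p m (rowZ z c) <= A * Em p m c.
Proof.
move=> sc zA; rewrite /Em mulr_sumr; apply: ler_sum => n _.
apply: le_trans (enZ _ _ _) _; [exact: wj_ge1|by apply: sc; rewrite -ltnS|].
by rewrite ler_wpM2r// en_ge0// wj_ge1.
Qed.
Lemma EmZ1 p m z c : sobrow p m c -> (forall n, sqmod (z n) <= 1) ->
  Em p m (rowZ z c) <= Em p m c.
Proof. by move=> sc z1; rewrite -[leRHS]mul1r; exact: EmZ. Qed.
Lemma EmM p G m h c : Rb p.+1 G h -> sobrow p.+1 m c ->
  Em p.+1 m (rowM h c) <= 3 ^+ p.+1 * G ^+ 2 * Em p.+1 m c.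
Proof.
move=> hb sc; rewrite /Em mulr_sumr; apply: ler_sum => n _.
have sn : sobT p.+1 (c n) by apply: sc; rewrite -ltnS.
by have [_] := sobTM sn hb; apply; exact: wj_ge1.
Qed.
Lemma Emd p m c : sobrow p.+2 m c -> Em p.+1 m (rowd c) <= Em p.+2 m c.
Proof.
move=> sc; apply: ler_sum => n _; apply: en_derive; first exact: wj_ge1.
by apply: sc; rewrite -ltnS.
Qed.
(** The multiplier of d/dtheta satisfies j^2 <= 1 + j^2 + k^2, so a theta-derivative costs one
    Sobolev order and no factor growing with m. *)
Lemma EmJ p m c : sobrow p.+1 m c -> Em p m (rowj m c) <= Em p.+1 m c.
Proof.
move=> sc; apply: ler_sum => n _.
have sn : sobT p.+1 (c n) by apply: sc; rewrite -ltnS.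
have sn' := sobT_le (leqnSn p) sn; have w1 := wj_ge1 R m n.
rewrite -[leRHS]mul1r; apply: (en_term w1 w1 sn ler01 _).2 => k.
rewrite mul1r fourier1Z; last exact: sobT_bmc sn'.
rewrite sqmod_ik mulrA ler_wpM2r ?sqmod_ge0// wgtS mulrC.
rewrite ler_wpM2r ?wgt_ge0// /wj.
by have := sqr_ge0 (k%:~R : R); lra.
Qed.

End RowOperators.

(** * Energy estimates for one order of the recursion *)

Section NearAxisRecursion.
Variable R : realType.
Local Notation C := R[i].
Variables (K : R) (D q : nat).
Hypothesis K0 : 0 < K.
Hypothesis D0 : (0 < D)%N.
Implicit Types (c d : nat -> R -> C) (chi eta kap tau : R -> R) (li e l M : R).
Local Notation pa := (q.+1 + 2 * D)%N.
Local Notation symbR := (symb K D).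
Local Notation KopR := (Kop K D).

(** Here D >= 1 enters: the elliptic gain 2D puts phi at least one order above U, enough for the
    derivative of phi in the definition of U. *)
Lemma pa_ge : (q.+3 <= pa)%N.
Proof. by move: D0; case: (D) => // D' _; lia. Qed.

(** By uniqueness of the mode equation any regular solution is the constructed one and inherits its
    estimate. So a priori bounds hold for given families, in particular for differences of
    solutions. *)
Lemma solve_bound l0 l (j : int) (a r : R -> C) : 0 < l0 -> l0 <= l ->
  sobT pa a -> sobT q.+1 r ->
  (forall s, (l + symbR j)%:C * a s + KopR a s = r s) ->
  en (1 + j%:~R ^+ 2) pa a <= ellC K D l0 * en (1 + j%:~R ^+ 2) q.+1 r.
Proof.
move=> l00 ll sa sr H.
have [sv ev eqv] := @solveP R K D K0 q l0 l j r l00 ll sr.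
suff -> : a = solve K D (l + symbR j) r by exact: ev.
move: sv eqv; clear ev; set v := solve _ _ _ _ => sv eqv.
have cC (x : R -> C) : sobT pa x -> cCk (2 * D) x.
  by rewrite addSn => /sobT_cCk; apply: cCk_le; rewrite leq_addl.
have lam0 : 0 < l + symbR j by apply: ltr_wpDr (symb_ge0 K D j) _; exact: lt_le_trans ll.
have dab := sobTB sa sv.
apply/funext => s; apply/eqP; rewrite -subr_eq0; apply/eqP.
apply: (elliptic_unique K0 lam0 (cC _ dab) (sobT_periodic dab)) => x.
rewrite (KopB K0 x (cC _ sa) (cC _ sv)) mulrBr addrACA -opprD H eqv.
exact: subrr.
Qed.

(** [al], [be] and [ga] are the coefficients of phi_(m-1) at n, of phi_(m-1) at n - 1, and of the
    U_(m-2) term, after division by 4 n (m - n). Left uncancelled they are all 0 at n = 0 and n = m,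
    where the inverse of 0 is 0. *)
Definition al (m n : nat) : R := n%:R * (2 * (m - n)%:R - 1) / (4 * n%:R * (m - n)%:R).
Definition be (m n : nat) : R := (m - n)%:R * (2 * n%:R - 1) / (4 * n%:R * (m - n)%:R).
Definition ga (m n : nat) : R := (4 * n%:R * (m - n)%:R)^-1.

Lemma coef_bounds m n : [/\ (al m n) ^+ 2 <= 1, (be m n) ^+ 2 <= 1 & (ga m n) ^+ 2 <= 1].
Proof.
rewrite /al /be /ga.
case: n => [|n]; first by rewrite !(mulr0n, mulr0, mul0r, invr0, expr0n) /=; split; rewrite ?ler01.
case: (m - n.+1)%N => [|p].
  by rewrite !(mulr0n, mulr0, mul0r, invr0, expr0n) /=; split; rewrite ?ler01.
have x1 : 1 <= n.+1%:R :> R by rewrite ler1n.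
have y1 : 1 <= p.+1%:R :> R by rewrite ler1n.
move: x1 y1; set x : R := n.+1%:R; set y : R := p.+1%:R => x1 y1.
have sq (t : R) : 0 <= t -> t <= 1 -> t ^+ 2 <= 1.
  by move=> t0 t1; rewrite expr_le1.
have xy : 0 < 4 * x * y by rewrite !mulr_gt0//; lra.
split; apply: sq.
- by rewrite divr_ge0 ?(ltW xy)// mulr_ge0//; lra.
- by rewrite ler_pdivrMr// mul1r; nra.
- by rewrite divr_ge0 ?(ltW xy)// mulr_ge0//; lra.
- by rewrite ler_pdivrMr// mul1r; nra.
- by rewrite invr_ge0 ltW.
- by rewrite invf_le1//; nra.
Qed.

Lemma sqmod_al m n : sqmod (al m n)%:C <= 1.
Proof. by rewrite sqmod_real; case: (coef_bounds m n). Qed.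
Lemma sqmod_be m n : sqmod (be m n)%:C <= 1.
Proof. by rewrite sqmod_real; case: (coef_bounds m n). Qed.
Lemma sqmod_ga m n : sqmod (ga m n)%:C <= 1.
Proof. by rewrite sqmod_real; case: (coef_bounds m n). Qed.

(* With e = 1, chi = l kappa, eta = l tau this is the right-hand side of the
   order-m equation for phi; rrow is linear in (chi, eta, e), so differences of
   two curves are again of this form with e = 0. *)
Definition rrow chi eta e m c d : nat -> R -> C :=
  rowB (rowM chi (rowD (rowZ (fun n => (al m n)%:C) c) (rowZ (fun n => (be m n)%:C) (prv c))))
       (rowZ (fun n => (ga m n)%:C)
         (rowB (rowZ (fun=> e%:C) (rowd (prv d))) (rowM eta (rowj m (prv d))))).

Definition urow li tau m c : nat -> R -> C :=
  rowB (rowZ (fun=> li%:C) (rowd c)) (rowM tau (rowj m c)).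
(** Multiplication by kappa rho cos theta: the cosine splits a row into its two neighbours in
    frequency. Division by h_s is encoded through it, as U = (terms in phi and B_0) + kappa rho cos
    theta U. *)
Definition kmix kap d : nat -> R -> C :=
  rowM kap (rowZ (fun=> (2^-1)%:C) (rowD d (prv d))).

Lemma rrow_sobrow chi eta e m c d X Y : Rb q.+1 X chi -> Rb q.+1 Y eta ->
  trow m.+1 c -> sobrow q.+1 m.+1 c -> trow m d -> sobrow q.+2 m d ->
  sobrow q.+1 m.+2 (rrow chi eta e m.+2 c d).
Proof.
move=> bX bY tc sc td sd.
have sc2 := sobrow_trow (k := m.+2) tc sc; have scp := sobrow_prv sc.
have sd2 : sobrow q.+2 m.+2 (prv d) := sobrow_prv (sobrow_trow (k := m.+1) td sd).
have sd1 := sobrow_le (leqnSn _) sd2.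
have c1 := sobrowZ (fun n => (al m.+2 n)%:C) sc2.
have c2 := sobrowZ (fun n => (be m.+2 n)%:C) scp.
have c3 := sobrowZ (fun=> e%:C) (sobrowd sd2).
have c4 := sobrowM bY (sobrowJ m.+2 sd1).
exact: (sobrowB (sobrowM bX (sobrowD c1 c2)) (sobrowZ (fun n => (ga m.+2 n)%:C) (sobrowB c3 c4))).
Qed.

Lemma rrow_arith (T tx ty e2 E1 E2 r p z s1 a1 a1' a2 a2' z' y1 y1' y2 y2' : R) :
  0 <= tx -> 0 <= ty -> 0 <= e2 ->
  r <= 2 * p + 2 * z -> p <= tx * s1 -> s1 <= 2 * a1 + 2 * a2 ->
  a1 <= a1' -> a1' <= T * E1 -> a2 <= a2' -> a2' <= T * E1 ->
  z <= z' -> z' <= 2 * y1 + 2 * y2 -> y1 <= e2 * y1' -> y1' <= E2 ->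
  y2 <= ty * y2' -> y2' <= E2 ->
  r <= 8 * (tx * (T * E1)) + 4 * (e2 * E2) + 4 * (ty * E2).
Proof.
move=> tx0 ty0 e0 bb b1 b2 b3 b5 b4 b6 b7 b8 b9 b10 b11 b12.
have h1 : s1 <= 4 * (T * E1) by lra.
have h2 := ler_wpM2l tx0 h1; have h3 := ler_wpM2l e0 b10; have h4 := ler_wpM2l ty0 b12.
have h5 : tx * (4 * (T * E1)) = 4 * (tx * (T * E1)) by ring.
lra.
Qed.

Lemma rrow_bound chi eta e m c d X Y : Rb q.+1 X chi -> Rb q.+1 Y eta ->
  trow m.+1 c -> sobrow q.+1 m.+1 c -> trow m d -> sobrow q.+2 m d ->
  Em q.+1 m.+2 (rrow chi eta e m.+2 c d) <=
  8 * (3 ^+ q.+1 * X ^+ 2 * (3 ^+ q.+1 * Em q.+1 m.+1 c)) +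
  4 * (e ^+ 2 * Em q.+2 m d) + 4 * (3 ^+ q.+1 * Y ^+ 2 * Em q.+2 m d).
Proof.
move=> bX bY tc sc td sd.
have sc2 := sobrow_trow (k := m.+2) tc sc; have scp := sobrow_prv sc.
have sd2 : sobrow q.+2 m.+2 (prv d) := sobrow_prv (sobrow_trow (k := m.+1) td sd).
have sd1 := sobrow_le (leqnSn _) sd2; have sdd := sobrowd sd2.
have sJ := sobrowJ m.+2 sd1.
have c1 := sobrowZ (fun n => (al m.+2 n)%:C) sc2.
have c2 := sobrowZ (fun n => (be m.+2 n)%:C) scp.
have c3 := sobrowZ (fun=> e%:C) sdd.
have c4 := sobrowM bY sJ.
have c5 := sobrowM bX (sobrowD c1 c2).
have c6 := sobrowZ (fun n => (ga m.+2 n)%:C) (sobrowB c3 c4).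
have b9 := EmZ sdd (fun=> lexx (sqmod e%:C)).
have b10 := Emd sd2; have b12 := EmJ sd2.
rewrite sqmod_real in b9; rewrite Em_shift2// in b10 b12.
have X0 : 0 <= 3 ^+ q.+1 * X ^+ 2 by apply: mulr_ge0; [exact: exprn_ge0|exact: sqr_ge0].
have Y0 : 0 <= 3 ^+ q.+1 * Y ^+ 2 by apply: mulr_ge0; [exact: exprn_ge0|exact: sqr_ge0].
exact: (rrow_arith X0 Y0 (sqr_ge0 e) (EmB c5 c6) (EmM bX (sobrowD c1 c2)) (EmD c1 c2)
  (EmZ1 sc2 (sqmod_al m.+2)) (Em_shift0 tc sc) (EmZ1 scp (sqmod_be m.+2)) (Em_shift1 sc)
  (EmZ1 (sobrowB c3 c4) (sqmod_ga m.+2)) (EmB c3 c4) b9 b10 (EmM bY sJ) b12).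
Qed.

Lemma urow_sobrow li tau m c X : Rb q.+2 X tau -> sobrow q.+3 m c ->
  sobrow q.+2 m (urow li tau m c).
Proof.
move=> bX sc; have sc' := sobrow_le (leqnSn _) sc.
exact: (sobrowB (sobrowZ (fun=> li%:C) (sobrowd sc)) (sobrowM bX (sobrowJ m sc'))).
Qed.

Lemma urow_arith (li2 ty E r y1 y1' y2 y2' : R) : 0 <= li2 -> 0 <= ty ->
  r <= 2 * y1 + 2 * y2 -> y1 <= li2 * y1' -> y1' <= E -> y2 <= ty * y2' -> y2' <= E ->
  r <= 2 * (li2 * E) + 2 * (ty * E).
Proof.
move=> l0 t0 b1 b2 b3 b4 b5; have := ler_wpM2l l0 b3; have := ler_wpM2l t0 b5; lra.
Qed.

Lemma urow_bound li tau m c X : Rb q.+2 X tau -> sobrow q.+3 m c ->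
  Em q.+2 m (urow li tau m c) <=
  2 * (li ^+ 2 * Em q.+3 m c) + 2 * (3 ^+ q.+2 * X ^+ 2 * Em q.+3 m c).
Proof.
move=> bX sc; have sd := sobrowd sc.
have sJ := sobrowJ m (sobrow_le (leqnSn _) sc).
have c3 := sobrowZ (fun=> li%:C) sd; have c4 := sobrowM bX sJ.
have b9 := EmZ sd (fun=> lexx (sqmod li%:C)); rewrite sqmod_real in b9.
have Y0 : 0 <= 3 ^+ q.+2 * X ^+ 2 by apply: mulr_ge0; [exact: exprn_ge0|exact: sqr_ge0].
exact: (urow_arith (sqr_ge0 li) Y0 (EmB c3 c4) b9 (Emd sc) (EmM bX sJ) (EmJ sc)).
Qed.

Lemma kmix_sobrow p kap m d X : Rb p.+1 X kap -> trow m d -> sobrow p.+1 m d ->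
  sobrow p.+1 m.+1 (kmix kap d).
Proof.
move=> bX td sd; have sd1 := sobrow_trow (k := m.+1) td sd.
exact: (sobrowM bX (sobrowZ (fun=> (2^-1)%:C) (sobrowD sd1 (sobrow_prv sd)))).
Qed.

Lemma kmix_arith (T tx E r z s d1 d2 : R) : 0 <= tx ->
  r <= tx * z -> z <= 2^-1 ^+ 2 * s -> s <= 2 * d1 + 2 * d2 -> d1 <= T * E ->
  d2 <= T * E -> r <= tx * (T * E).
Proof.
move=> t0 b1 b2 b3 b4 b5; apply: le_trans b1 _; apply: ler_wpM2l => //.
apply: le_trans b2 _; have -> : (2^-1 : R) ^+ 2 = 4^-1 by rewrite expr2; field.
lra.
Qed.

Lemma kmix_bound p kap m d X : Rb p.+1 X kap -> trow m d -> sobrow p.+1 m d ->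
  Em p.+1 m.+1 (kmix kap d) <= 3 ^+ p.+1 * X ^+ 2 * (3 ^+ p.+1 * Em p.+1 m d).
Proof.
move=> bX td sd.
have sd1 := sobrow_trow (k := m.+1) td sd; have sdp := sobrow_prv sd.
have sD := sobrowD sd1 sdp.
have b2 := EmZ sD (fun=> lexx (sqmod (2^-1)%:C)); rewrite sqmod_real in b2.
have X0 : 0 <= 3 ^+ p.+1 * X ^+ 2 by apply: mulr_ge0; [exact: exprn_ge0|exact: sqr_ge0].
exact: (kmix_arith X0 (EmM bX (sobrowZ (fun=> (2^-1)%:C) sD)) b2 (EmD sd1 sdp)
  (Em_shift0 td sd) (Em_shift1 sd)).
Qed.

(* U = (phi_s - l tau phi_theta + l B_0) / h_s, where g plays the role of B_0. *)
Definition recU li tau kap (a u g : nat -> nat -> R -> C) : Prop :=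
  forall m n s, (n <= m)%N -> u m n s =
    urow li tau m (a m) n s + (if m is m'.+1 then kmix kap (u m') n s else 0) + g m n s.

Definition recA l chi eta e (a u f : nat -> nat -> R -> C) : Prop :=
  forall m n s, (0 < n < m)%N ->
    (l + symbR (jf m n))%:C * a m n s + KopR (a m n) s =
    rrow chi eta e m (a m.-1) (u m.-2) n s + f m n s.

Definition tfam (a : nat -> nat -> R -> C) : Prop := forall m, trow m (a m).
Definition sfam p (a : nat -> nat -> R -> C) : Prop := forall m, sobrow p m (a m).

Section Apriori.
Variable M : R.
Hypothesis M1 : 1 <= M.

(** All that the estimates know of the curve. A single M serves a whole neighbourhood of curves,
    which makes sigma and the constants common to them. *)
Definition geo l chi eta kap tau : Prop :=
  [/\ M^-1 <= l, l^-1 <= M, Rb q.+2 M chi, Rb q.+2 M eta & Rb q.+2 M kap /\ Rb q.+2 M tau].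

(** In energy, U_m is bounded by [c1] times phi_m plus [c2] times U_(m-1), the common factor 4
    coming from (x + y)^2 <= 2 x^2 + 2 y^2 applied twice. [c3] is the elliptic constant at the lower
    bound M^-1 of l times the bound of the right-hand side [rrow]. *)
Definition c1 : R := 8 * M ^+ 2 * (1 + 3 ^+ q.+2).
Definition c2 : R := 4 * (3 ^+ q.+2) ^+ 2 * M ^+ 2.
Definition c3 : R :=
  ellC K D M^-1 * (16 * (3 ^+ q.+2) ^+ 2 * M ^+ 2 + 8 + 8 * 3 ^+ q.+2 * M ^+ 2).

Lemma T_ge0 : 0 <= 3 ^+ q.+2 :> R. Proof. exact: exprn_ge0. Qed.
Lemma c1_ge0 : 0 <= c1.
Proof.
by apply: mulr_ge0; [apply: mulr_ge0 => //; exact: sqr_ge0|apply: addr_ge0 => //; exact: T_ge0].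
Qed.
Lemma c2_ge0 : 0 <= c2.
Proof. by apply: mulr_ge0; [apply: mulr_ge0 => //|]; exact: sqr_ge0. Qed.
Lemma c3_ge0 : 0 <= c3.
Proof.
have M0 : 0 <= M ^+ 2 by exact: sqr_ge0.
have T2 : 0 <= (3 ^+ q.+2) ^+ 2 :> R by exact: sqr_ge0.
apply: mulr_ge0; first exact: ellC_ge0.
apply: addr_ge0; first apply: addr_ge0 => //.
  by apply: mulr_ge0 => //; exact: mulr_ge0.
by apply: mulr_ge0 => //; apply: mulr_ge0 => //; exact: T_ge0.
Qed.

Variables (l : R) (chi eta kap tau : R -> R).
Hypothesis lgeo : geo l chi eta kap tau.

Lemma l_gt0 : 0 < l.
Proof.
by case: lgeo => h _ _ _ _; apply: lt_le_trans h; rewrite invr_gt0; exact: lt_le_trans ltr01 M1.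
Qed.

Lemma u_arith (T li2 E E' r : R) : 0 <= T -> 0 <= E -> E <= E' -> 0 <= li2 ->
  li2 <= M ^+ 2 -> r <= 2 * (li2 * E) + 2 * (T * M ^+ 2 * E) ->
  4 * r <= 8 * M ^+ 2 * (1 + T) * E'.
Proof.
move=> T0 E0 EE l0 lM b1.
have M0 : 0 <= M ^+ 2 by exact: sqr_ge0.
have h1 : li2 * E <= M ^+ 2 * E' by exact: ler_pM.
have TM : 0 <= T * M ^+ 2 by exact: mulr_ge0.
have h2 := ler_wpM2l TM EE.
have -> : 8 * M ^+ 2 * (1 + T) * E' = 8 * (M ^+ 2 * E') + 8 * (T * M ^+ 2 * E') by ring.
lra.
Qed.

Lemma u_fin0 (t g cA r : R) : 0 <= t -> 0 <= g -> 4 * t <= cA ->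
  r <= 2 * t + 2 * g -> r <= cA + 0 + 4 * g.
Proof. lra. Qed.
Lemma u_fin1 (t g cA k k' s r : R) : 0 <= g -> 4 * t <= cA -> k <= k' ->
  s <= 2 * t + 2 * k -> r <= 2 * s + 2 * g -> r <= cA + 4 * k' + 4 * g.
Proof. lra. Qed.

Lemma U_step a u g m : tfam u -> sfam pa a -> sfam q.+2 u -> sfam q.+2 g ->
  recU l^-1 tau kap a u g ->
  Em q.+2 m (u m) <= c1 * Em pa m (a m)
    + (if m is m'.+1 then c2 * Em q.+2 m' (u m') else 0) + 4 * Em q.+2 m (g m).
Proof.
case: lgeo => lM liM _ _ [bk bt] tu sa su sg H.
have sa3 := sobrow_le pa_ge (sa m).
have s1 := urow_sobrow l^-1 bt sa3.
have li0 : 0 <= l^-1 by rewrite invr_ge0 ltW// l_gt0.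
have li2 : l^-1 ^+ 2 <= M ^+ 2 by apply: lerXn2r; rewrite ?nnegrE//; apply: le_trans ler01 M1.
have T0 : 0 <= 3 ^+ q.+2 :> R by exact: exprn_ge0.
have e1 := u_arith T0 (Em_ge0 _ _ _) (Em_le pa_ge (sa m)) (sqr_ge0 l^-1) li2 (urow_bound l^-1 bt sa3).
rewrite -/c1 in e1; have G0 := Em_ge0 q.+2 m (g m).
have U0 := Em_ge0 q.+2 m (urow l^-1 tau m (a m)).
have Hm n s := H m n s.
have sgm := sg m; clear H sg; move: Hm; clear sa3; case: m => [|m] in s1 e1 G0 U0 sgm *.
  move=> Hm.
  have -> : Em q.+2 0 (u 0%N) = Em q.+2 0 (rowD (urow l^-1 tau 0 (a 0%N)) (g 0%N)).
    by apply: eq_Em => n n0; apply/funext => s; rewrite Hm// addr0.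
  exact: u_fin0 U0 G0 e1 (EmD s1 sgm).
move=> Hm.
have -> : Em q.+2 m.+1 (u m.+1) =
    Em q.+2 m.+1 (rowD (rowD (urow l^-1 tau m.+1 (a m.+1)) (kmix kap (u m))) (g m.+1)).
  by apply: eq_Em => n n0; apply/funext => s; rewrite Hm.
have s2 := kmix_sobrow bk (tu m) (su m).
have -> : c2 * Em q.+2 m (u m) = 4 * (3 ^+ q.+2 * M ^+ 2 * (3 ^+ q.+2 * Em q.+2 m (u m))).
  by rewrite /c2; ring.
exact: u_fin1 G0 e1 (kmix_bound bk (tu m) (su m)) (EmD s1 s2) (EmD (sobrowD s1 s2) sgm).
Qed.

Lemma a_arith (S T E1 EA EU EF r : R) : 0 <= S -> S <= T -> 0 <= E1 -> 0 <= EA ->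
  0 <= EU -> 0 <= EF -> E1 <= EA ->
  r <= 8 * (S * M ^+ 2 * (S * E1)) + 4 * (1 ^+ 2 * EU) + 4 * (S * M ^+ 2 * EU) ->
  2 * r + 2 * EF <= (16 * T ^+ 2 * M ^+ 2 + 8 + 8 * T * M ^+ 2) * (EA + EU + EF).
Proof.
move=> S0 ST E0 A0 U0 F0 EE br.
have M0 : 0 <= M ^+ 2 by exact: sqr_ge0.
have T0 : 0 <= T by exact: le_trans ST.
have SM : S * M ^+ 2 <= T * M ^+ 2 by exact: ler_wpM2r.
have SM0 : 0 <= S * M ^+ 2 by exact: mulr_ge0.
have k1 : S * M ^+ 2 * (S * E1) <= T * M ^+ 2 * (T * EA).
  by apply: ler_pM => //; [exact: mulr_ge0|exact: ler_pM].
have k2 : S * M ^+ 2 * EU <= T * M ^+ 2 * EU by exact: ler_wpM2r.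
have TM : 0 <= T * M ^+ 2 by exact: mulr_ge0.
have z1 : 0 <= T * M ^+ 2 * (T * EU) by exact: mulr_ge0 TM (mulr_ge0 T0 U0).
have z2 : 0 <= T * M ^+ 2 * EA by exact: mulr_ge0.
have z3 : 0 <= T * M ^+ 2 * (T * EF) by exact: mulr_ge0 TM (mulr_ge0 T0 F0).
have z4 : 0 <= T * M ^+ 2 * EF by exact: mulr_ge0.
have -> : (16 * T ^+ 2 * M ^+ 2 + 8 + 8 * T * M ^+ 2) * (EA + EU + EF) =
  16 * (T * M ^+ 2 * (T * EA)) + 16 * (T * M ^+ 2 * (T * EU)) + 16 * (T * M ^+ 2 * (T * EF))
  + 8 * EA + 8 * EU + 8 * EF
  + 8 * (T * M ^+ 2 * EA) + 8 * (T * M ^+ 2 * EU) + 8 * (T * M ^+ 2 * EF) by ring.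
rewrite expr1n mul1r in br; lra.
Qed.

(** The entries n = 0 and n = m are data and give the first term; the others obey the elliptic
    estimate. Below order 2 there are no others. *)
Lemma A_step a u b f m : tfam a -> tfam u -> sfam pa a -> sfam q.+2 u ->
  sfam pa b -> sfam q.+1 f ->
  (forall m s, a m 0%N s = b m 0%N s /\ a m m s = b m m s) ->
  recA l chi eta 1 a u f ->
  Em pa m (a m) <= Em pa m (b m) + c3 * ((if m is m'.+1 then Em pa m' (a m') else 0)
    + (if m is m'.+2 then Em q.+2 m' (u m') else 0) + Em q.+1 m (f m)).
Proof.
case: lgeo => lM liM bx be_ _ ta tu sa su sb sf H0 H.
have Mi : 0 < M^-1 by rewrite invr_gt0; exact: lt_le_trans ltr01 M1.
have bdr n : (n == 0%N) || (n == m) -> a m n = b m n.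
  by move=> /orP[]/eqP ->; apply/funext => s; case: (H0 m s).
have pos : 0 <= c3 * ((if m is m'.+1 then Em pa m' (a m') else 0)
    + (if m is m'.+2 then Em q.+2 m' (u m') else 0) + Em q.+1 m (f m)).
  rewrite mulr_ge0 ?c3_ge0// !addr_ge0 ?Em_ge0//; first by case: (m) => // m'; exact: Em_ge0.
  by case: (m) => [|[|m']] //; exact: Em_ge0.
have [m2|m2] := ltnP m 2.
  rewrite -[leLHS]addr0; apply: lerD => //.
  rewrite (eq_Em _ (d := b m))// => n nm; apply: bdr; lia.
case: m m2 bdr pos => [|[|m]]// _ bdr pos.
have T0 : 0 <= 3 ^+ q.+2 :> R by exact: exprn_ge0.
have bx' := Rb_le (leqnSn _) bx; have be' := Rb_le (leqnSn _) be_.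
have q1 : (q.+1 <= pa)%N by rewrite leq_addr.
have sa1 := sobrow_le q1 (sa m.+1).
pose r := rrow chi eta 1 m.+2 (a m.+1) (u m).
have sr : sobrow q.+1 m.+2 r := rrow_sobrow 1 bx' be' (ta m.+1) sa1 (tu m) (su m).
have br := rrow_bound 1 bx' be' (ta m.+1) sa1 (tu m) (su m).
pose rf := rowD r (f m.+2).
have srf : sobrow q.+1 m.+2 rf := sobrowD sr (sf m.+2).
have brf := EmD sr (sf m.+2).
have inner (n : nat) : (0 < n < m.+2)%N ->
    en (wj R m.+2 n) pa (a m.+2 n) <= ellC K D M^-1 * en (wj R m.+2 n) q.+1 (rf n).
  move=> nm; have nm2 : (n <= m.+2)%N by move: nm => /andP[_ /ltnW].
  have sn : sobT q.+1 (rf n) := srf n nm2.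
  apply: (solve_bound Mi lM (sa m.+2 n nm2) sn) => x.
  exact: H m.+2 n x nm.
have step : Em pa m.+2 (a m.+2) <= Em pa m.+2 (b m.+2) + ellC K D M^-1 * Em q.+1 m.+2 rf.
  rewrite /Em mulr_sumr -big_split /=; apply: ler_sum => n _.
  have e0 : 0 <= en (wj R m.+2 n) pa (b m.+2 n) by exact: en_ge0 (wj_ge1 _ _ _).
  have e1 : 0 <= ellC K D M^-1 * en (wj R m.+2 n) q.+1 (rf n).
    by apply: mulr_ge0; [exact: ellC_ge0|exact: en_ge0 (wj_ge1 _ _ _)].
  have [nb|] := boolP ((n == 0%N :> nat) || (n == m.+2 :> nat)).
    by rewrite (bdr n nb) lerDl.
  rewrite negb_or => /andP[n0 nm]; apply: le_trans (inner n _) _; last by rewrite lerDr.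
  by rewrite lt0n n0 /= ltn_neqAle nm /= -ltnS.
apply: le_trans step _; rewrite lerD2l /c3 -mulrA; apply: ler_wpM2l; first exact: ellC_ge0.
have ba := Em_le q1 (sa m.+1).
apply: le_trans brf _.
have := a_arith (exprn_ge0 q.+1 (ler0n R 3)) (_ : 3 ^+ q.+1 <= 3 ^+ q.+2) (Em_ge0 _ _ _)
  (Em_ge0 _ _ _) (Em_ge0 _ _ _) (Em_ge0 _ _ _) ba br.
by apply; rewrite ler_weXn2l//; lra.
Qed.

End Apriori.
End NearAxisRecursion.

(** * A majorant for the coupled recursion *)

Section SourceBounds.
Variable R : realType.
Implicit Types (A U B F G : nat -> R).

(** AA is a fixed point of the weighted bounds: the sources beta, k3 phi and gam make up one half,
    A_(m-1) costs at most a quarter by k3 x <= 1/4, and U_(m-2) at most another quarter plus the gam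
    already counted. Likewise UU = k1 AA + UU/2 + 4 gam, by k2 x <= 1/2. *)
Lemma weighted_recursion_bound A U B F G (x k1 k2 k3 beta phi gam : R) :
  0 <= x -> 0 <= k1 -> 0 <= k2 -> 0 <= k3 ->
  k3 * x <= 4^-1 -> k2 * x <= 2^-1 -> k3 * x ^+ 2 * (2 * k1) <= 4^-1 ->
  8 * (k3 * x ^+ 2) <= 1 ->
  (forall m, 0 <= A m) -> (forall m, 0 <= U m) ->
  0 <= beta -> 0 <= phi -> 0 <= gam ->
  (forall m, x ^+ m * B m <= beta) -> (forall m, x ^+ m * F m <= phi) ->
  (forall m, x ^+ m * G m <= gam) ->
  (forall m, A m <= B m + k3 * ((if m is m'.+1 then A m' else 0) +
     (if m is m'.+2 then U m' else 0) + F m)) ->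
  (forall m, U m <= k1 * A m + (if m is m'.+1 then k2 * U m' else 0) + 4 * G m) ->
  let AA := 2 * (beta + k3 * phi + gam) in
  forall m, x ^+ m * A m <= AA /\ x ^+ m * U m <= 2 * k1 * AA + 8 * gam.
Proof.
move=> x0 k10 k20 k30 h1 h2 h3 h4 A0 U0 b0 p0 g0 HB HF HG HA HU AA.
set UU := 2 * k1 * AA + 8 * gam.
have k3p : 0 <= k3 * phi by exact: mulr_ge0.
have AA0 : 0 <= AA by rewrite /AA; lra.
have kA : 0 <= k1 * AA by exact: mulr_ge0.
have UU0 : 0 <= UU by rewrite /UU -mulrA; lra.
have xm m : 0 <= x ^+ m by exact: exprn_ge0.
have stepU m X Y : 0 <= Y -> x ^+ m * A m <= X ->
    (if m is m'.+1 then x ^+ m' * U m' <= Y else True) ->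
    x ^+ m * U m <= k1 * X + 2^-1 * Y + 4 * gam.
  move=> Y0 hA hU; apply: le_trans (ler_wpM2l (xm m) (HU m)) _.
  have h5 := ler_wpM2l k10 hA; have h6 := HG m.
  case: m hA hU h5 h6 => [|m] hA hU h5 h6.
    have -> : x ^+ 0 * (k1 * A 0%N + 0 + 4 * G 0%N) =
      k1 * (x ^+ 0 * A 0%N) + 4 * (x ^+ 0 * G 0%N) by ring.
    lra.
  have -> : x ^+ m.+1 * (k1 * A m.+1 + k2 * U m + 4 * G m.+1) =
    k1 * (x ^+ m.+1 * A m.+1) + (k2 * x) * (x ^+ m * U m) + 4 * (x ^+ m.+1 * G m.+1).
    by rewrite exprS; ring.
  have h7 : (k2 * x) * (x ^+ m * U m) <= 2^-1 * Y.
    by apply: ler_pM => //; rewrite mulr_ge0.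
  lra.
have stepA m : (if m is m'.+1 then x ^+ m' * A m' <= AA else True) ->
    (if m is m'.+2 then x ^+ m' * U m' <= UU else True) -> x ^+ m * A m <= AA.
  move=> hA hU; apply: le_trans (ler_wpM2l (xm m) (HA m)) _.
  have h5 := HB m; have h6 := ler_wpM2l k30 (HF m).
  have e2 : k3 * x ^+ 2 * UU <= 4^-1 * AA + gam.
    have -> : k3 * x ^+ 2 * UU = (k3 * x ^+ 2 * (2 * k1)) * AA + 8 * (k3 * x ^+ 2) * gam.
      by rewrite /UU; ring.
    apply: lerD; first exact: ler_wpM2r.
    by rewrite -[leRHS]mul1r; exact: ler_wpM2r.
  have z0 : 0 <= k3 * x ^+ 2 by apply: mulr_ge0 => //; exact: exprn_ge0.
  have e3 : beta + k3 * phi + gam = 2^-1 * AA by rewrite /AA; field.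
  case: m hA hU h5 h6 => [|[|m]] hA hU h5 h6.
  - have -> : x ^+ 0 * (B 0%N + k3 * (0 + 0 + F 0%N)) =
      x ^+ 0 * B 0%N + k3 * (x ^+ 0 * F 0%N) by ring.
    lra.
  - have -> : x ^+ 1 * (B 1%N + k3 * (A 0%N + 0 + F 1%N)) =
      x ^+ 1 * B 1%N + (k3 * x) * (x ^+ 0 * A 0%N) + k3 * (x ^+ 1 * F 1%N) by ring.
    have h7 : (k3 * x) * (x ^+ 0 * A 0%N) <= 4^-1 * AA.
      by apply: ler_pM => //; rewrite mulr_ge0.
    lra.
  - have -> : x ^+ m.+2 * (B m.+2 + k3 * (A m.+1 + U m + F m.+2)) =
      x ^+ m.+2 * B m.+2 + (k3 * x) * (x ^+ m.+1 * A m.+1)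
      + (k3 * x ^+ 2) * (x ^+ m * U m) + k3 * (x ^+ m.+2 * F m.+2).
      by rewrite !exprS; ring.
    have h7 : (k3 * x) * (x ^+ m.+1 * A m.+1) <= 4^-1 * AA.
      by apply: ler_pM => //; rewrite mulr_ge0.
    have h8 := ler_wpM2l z0 hU.
    lra.
have fin m : x ^+ m * A m <= AA ->
    (if m is m'.+1 then x ^+ m' * U m' <= UU else True) -> x ^+ m * U m <= UU.
  move=> hA hU; apply: le_trans (stepU m AA UU UU0 hA hU) _.
  by rewrite /UU -!mulrA; lra.
(* Two consecutive orders are carried, since A_m depends on U_(m-2). *)
suff H m : (x ^+ m * A m <= AA /\ x ^+ m * U m <= UU) /\
    (x ^+ m.+1 * A m.+1 <= AA /\ x ^+ m.+1 * U m.+1 <= UU).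
  by move=> m; case: (H m).
elim: m => [|m [[a0 u0] [a1 u1]]].
  have a0 : x ^+ 0 * A 0%N <= AA by exact: (stepA 0%N).
  have u0 : x ^+ 0 * U 0%N <= UU by exact: (fin 0%N).
  have a1 : x ^+ 1 * A 1%N <= AA by exact: (stepA 1%N).
  by split; split => //; exact: (fin 1%N).
split => //; have a2 : x ^+ m.+2 * A m.+2 <= AA by exact: (stepA m.+2).
by split => //; exact: (fin m.+2).
Qed.

End SourceBounds.

(** * Existence, uniqueness and dependence on the coefficients *)

Section NearAxisSolution.
Variable R : realType.
Local Notation C := R[i].
Variables (K : R) (D q : nat).
Hypothesis K0 : 0 < K.
Hypothesis D0 : (0 < D)%N.
Implicit Types (c d : nat -> R -> C) (chi eta kap tau : R -> R) (l e M : R).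
Implicit Types (a u b f g : nat -> nat -> R -> C).
Local Notation pa := (q.+1 + 2 * D)%N.
Local Notation symbR := (symb K D).
Local Notation KopR := (Kop K D).
Local Notation k1 := (c1 q).
Local Notation k2 := (c2 q).
Local Notation k3 := (c3 K D q).

(* Smallness of the radius sigma = sqrt x needed to close the recursion. *)
Definition small M x : Prop :=
  [/\ k3 M * x <= 4^-1, k2 M * x <= 2^-1, k3 M * x ^+ 2 * (2 * k1 M) <= 4^-1 &
      8 * (k3 M * x ^+ 2) <= 1].

Lemma apriori M x l chi eta kap tau a u b f g beta phi gam :
  1 <= M -> 0 <= x -> small M x -> geo q M l chi eta kap tau ->
  tfam a -> tfam u -> sfam pa a -> sfam q.+2 u -> sfam pa b -> sfam q.+1 f -> sfam q.+2 g ->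
  (forall m s, a m 0%N s = b m 0%N s /\ a m m s = b m m s) ->
  recA K D l chi eta 1 a u f -> recU l^-1 tau kap a u g ->
  0 <= beta -> 0 <= phi -> 0 <= gam ->
  (forall m, x ^+ m * Em pa m (b m) <= beta) ->
  (forall m, x ^+ m * Em q.+1 m (f m) <= phi) ->
  (forall m, x ^+ m * Em q.+2 m (g m) <= gam) ->
  let AA := 2 * (beta + k3 M * phi + gam) in
  forall m, x ^+ m * Em pa m (a m) <= AA /\
    x ^+ m * Em q.+2 m (u m) <= 2 * k1 M * AA + 8 * gam.
Proof.
move=> M1 x0 [s1 s2 s3 s4] lg ta tu sa su sb sf sg H0 HA HU b0 p0 g0 hb hf hg AA.
apply: (weighted_recursion_bound x0 (c1_ge0 q M) (c2_ge0 q M) (c3_ge0 K D q M)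
  s1 s2 s3 s4 _ _ b0 p0 g0 hb hf hg).
- by move=> m; exact: Em_ge0.
- by move=> m; exact: Em_ge0.
- by move=> m; exact: (A_step K0 D0 M1 lg m ta tu sa su sb sf H0 HA).
- by move=> m; exact: (U_step K0 D0 M1 lg m tu sa su sg HU).
Qed.

Definition z0 : nat -> R -> C := fun _ _ => 0.

Lemma sobrow0 p m : sobrow p m z0. Proof. by move=> n _; exact: sobT0. Qed.
Lemma Em0 p m : Em p m z0 = 0.
Proof. by rewrite /Em big1// => n _; rewrite en0// wj_ge1. Qed.

Section Existence.
Variables (M l : R) (chi eta kap tau : R -> R) (b g : nat -> nat -> R -> C).
Hypothesis M1 : 1 <= M.
Hypothesis lgeo : geo q M l chi eta kap tau.
Hypothesis sb : sfam pa b.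
Hypothesis sg : sfam q.+2 g.

Definition newa m c d n : R -> C :=
  if n == 0%N then b m 0%N else if n == m then b m m else
  if (n < m)%N then solve K D (l + symbR (jf m n)) (rrow chi eta 1 m c d n) else fun=> 0.
Definition newu m c d n : R -> C :=
  if (n <= m)%N then (fun s => urow l^-1 tau m c n s + d n s + g m n s) else fun=> 0.

(** The state is (phi_m, U_m, U_(m-1)); the third component is remembered because order m + 1 needs
    U_(m-1). *)
Fixpoint rec_state m : (nat -> R -> C) * (nat -> R -> C) * (nat -> R -> C) :=
  if m is m'.+1 then
    let c' := newa m (rec_state m').1.1 (rec_state m').2 in
    (c', newu m c' (kmix kap (rec_state m').1.2), (rec_state m').1.2)
  else (newa 0 z0 z0, newu 0 (newa 0 z0 z0) z0, z0).

Definition sola m := (rec_state m).1.1.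
Definition solu m := (rec_state m).1.2.

Lemma sola2 m : sola m.+2 = newa m.+2 (sola m.+1) (solu m). Proof. by []. Qed.
Lemma soluS m : solu m.+1 = newu m.+1 (sola m.+1) (kmix kap (solu m)). Proof. by []. Qed.

Lemma trow_newa m c d : trow m (newa m c d).
Proof.
move=> n mn; rewrite /newa; case: eqP => [n0|_]; first by rewrite n0 in mn.
case: eqP => [nm|_]; first by rewrite nm ltnn in mn.
by rewrite ltnNge (ltnW mn).
Qed.
Lemma trow_newu m c d : trow m (newu m c d).
Proof. by move=> n mn; rewrite /newu leqNgt mn. Qed.

Lemma tfam_sola : tfam sola.
Proof. by case=> [|m]; exact: trow_newa. Qed.
Lemma tfam_solu : tfam solu.
Proof. by case=> [|m]; exact: trow_newu. Qed.

Lemma sol_regular m : sobrow pa m (sola m) /\ sobrow q.+2 m (solu m).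
Proof.
case: lgeo => lM liM bx be_ [bk bt].
have Mi : 0 < M^-1 by rewrite invr_gt0; exact: lt_le_trans ltr01 M1.
have bx' := Rb_le (leqnSn _) bx; have be' := Rb_le (leqnSn _) be_.
have regu k c d : sobrow pa k c -> sobrow q.+2 k d -> sobrow q.+2 k (newu k c d).
  move=> sc sd n nk; rewrite /newu nk.
  have su := urow_sobrow l^-1 bt (sobrow_le (pa_ge q K0 D0) sc).
  exact: sobTD (sobTD (su n nk) (sd n nk)) (sg nk).
have rega k c d : (k < 2)%N \/ sobrow q.+1 k (rrow chi eta 1 k c d) -> sobrow pa k (newa k c d).
  move=> hk n nk; rewrite /newa; case: eqP => [_|n0]; first exact: sb.
  case: eqP => [_|nk']; first exact: sb.
  case: ifP => nlt; last exact: sobT0.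
  case: hk => [k2|sr]; first by lia.
  by case: (solveP D K0 (jf k n) Mi lM (sr n nk)).
suff H : forall m, (sobrow pa m (sola m) /\ sobrow q.+2 m (solu m)) /\
    (sobrow pa m.+1 (sola m.+1) /\ sobrow q.+2 m.+1 (solu m.+1)).
  by case: (H m).
elim=> [|k [[a0 u0] [a1 u1]]].
  have a0 : sobrow pa 0 (sola 0) by apply: rega; left.
  have u0 : sobrow q.+2 0 (solu 0) := regu _ _ _ a0 (@sobrow0 q.+2 0).
  have a1 : sobrow pa 1 (sola 1) by apply: rega; left.
  have k0 := kmix_sobrow bk (@tfam_solu 0%N) u0.
  exact: conj (conj a0 u0) (conj a1 (regu _ _ _ a1 k0)).
have q1 : (q.+1 <= pa)%N by rewrite leq_addr.
apply: (conj (conj a1 u1)).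
have a2 : sobrow pa k.+2 (sola k.+2).
  rewrite sola2; apply: rega; right.
  exact (rrow_sobrow 1 bx' be' (@tfam_sola k.+1) (sobrow_le q1 a1) (@tfam_solu k) u0).
have k0 := kmix_sobrow bk (@tfam_solu k.+1%N) u1.
exact: conj a2 (regu _ _ _ a2 k0).
Qed.

Lemma sfam_sola : sfam pa sola. Proof. by move=> m; case: (sol_regular m). Qed.
Lemma sfam_solu : sfam q.+2 solu. Proof. by move=> m; case: (sol_regular m). Qed.

Lemma sola_boundary m s : sola m 0%N s = b m 0%N s /\ sola m m s = b m m s.
Proof.
by case: m => [|m]; rewrite /sola /= /newa /= ?eqxx.
Qed.

Lemma sol_recU : recU l^-1 tau kap sola solu g.
Proof.
by case=> [|m] n s nm; [rewrite /solu /= /newu nm|rewrite soluS /newu nm].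
Qed.

Lemma sol_recA : recA K D l chi eta 1 sola solu (fun _ => z0).
Proof.
move=> [|[|m]] n s nm; try by lia.
case: lgeo => lM liM bx be_ [bk bt].
have Mi : 0 < M^-1 by rewrite invr_gt0; exact: lt_le_trans ltr01 M1.
have bx' := Rb_le (leqnSn _) bx; have be' := Rb_le (leqnSn _) be_.
have q1 : (q.+1 <= pa)%N by rewrite leq_addr.
have sr := rrow_sobrow 1 bx' be' (@tfam_sola m.+1%N) (sobrow_le q1 (@sfam_sola m.+1))
  (@tfam_solu m) (@sfam_solu m).
have /andP[n0 nlt] := nm.
have [_ _ E] := solveP D K0 (jf m.+2 n) Mi lM (sr n (ltnW nlt)).
rewrite addr0 -[RHS]E sola2 /newa gtn_eqF// ltn_eqF// nlt.
by [].
Qed.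

End Existence.

(** Order by order, the difference of two solutions solves the homogeneous mode equation, whose only
    periodic C^(2D) solution is zero; the rows of U then agree by their own recursion. *)
Lemma solution_unique l chi eta kap tau li a u a' u' b f g :
  0 < l -> tfam a -> tfam u -> tfam a' -> tfam u' ->
  (forall m n, (n <= m)%N -> cCk (2 * D) (a m n) /\ periodic (a m n)) ->
  (forall m n, (n <= m)%N -> cCk (2 * D) (a' m n) /\ periodic (a' m n)) ->
  (forall m s, a m 0%N s = b m 0%N s /\ a m m s = b m m s) ->
  (forall m s, a' m 0%N s = b m 0%N s /\ a' m m s = b m m s) ->
  recA K D l chi eta 1 a u f -> recA K D l chi eta 1 a' u' f ->
  recU li tau kap a u g -> recU li tau kap a' u' g ->
  forall m, a m = a' m /\ u m = u' m.
Proof.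
move=> l0 ta tu ta' tu' ra ra' ba ba' HA HA' HU HU'.
have eqa m : (forall k, (k < m)%N -> a k = a' k /\ u k = u' k) -> a m = a' m.
  move=> IH; apply/funext => n; have [mn|nm] := ltnP m n.
    by rewrite ta// ta'.
  have [->|n0] := eqVneq n 0%N.
    by apply/funext => s; rewrite (ba m s).1 (ba' m s).1.
  have [->|nm'] := eqVneq n m.
    by apply/funext => s; rewrite (ba m s).2 (ba' m s).2.
  have nn : (0 < n < m)%N by rewrite lt0n n0 ltn_neqAle nm' nm.
  apply/funext => s; apply/eqP; rewrite -subr_eq0; apply/eqP.
  have [ca pa_] := ra m n nm; have [ca' pa_'] := ra' m n nm.
  have lam0 : 0 < l + symbR (jf m n) by apply: ltr_wpDr (symb_ge0 K D (jf m n)) _.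
  have pd : periodic (fun s => a m n s - a' m n s) by move=> x; rewrite pa_ pa_'.
  apply: (elliptic_unique K0 lam0 (cCkB ca ca') pd) => x.
  have m1 : (m.-1 < m)%N by lia. have m2 : (m.-2 < m)%N by lia.
  have E := HA m n x nn; have E' := HA' m n x nn.
  rewrite (IH _ m1).1 (IH _ m2).2 -E' in E.
  rewrite (KopB K0 x ca ca') mulrBr addrACA -opprD E.
  exact: subrr.
have equ m : a m = a' m -> (forall k, (k < m)%N -> u k = u' k) -> u m = u' m.
  move=> am IH; apply/funext => n; have [mn|nm] := ltnP m n.
    by rewrite tu// tu'.
  apply/funext => s; rewrite HU// HU'// am.
  by case: m am IH nm => [|m] am IH nm //; rewrite (IH m).
elim/ltn_ind => m IH; have am := eqa m IH.
by split => //; apply: equ => // k km; case: (IH k km).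
Qed.

Section Difference.
Variables (l1 l2 : R) (chi1 chi2 eta1 eta2 kap1 kap2 tau1 tau2 : R -> R).
Variables (a1 a2 u1 u2 b g : nat -> nat -> R -> C).
Hypothesis (sa1 : sfam pa a1) (sa2 : sfam pa a2) (su1 : sfam q.+2 u1) (su2 : sfam q.+2 u2).
Hypothesis (ta1 : tfam a1) (tu1 : tfam u1) (ta2 : tfam a2) (tu2 : tfam u2).
Hypothesis (b1 : forall m s, a1 m 0%N s = b m 0%N s /\ a1 m m s = b m m s).
Hypothesis (b2 : forall m s, a2 m 0%N s = b m 0%N s /\ a2 m m s = b m m s).
Hypothesis (HA1 : recA K D l1 chi1 eta1 1 a1 u1 (fun _ => z0)).
Hypothesis (HA2 : recA K D l2 chi2 eta2 1 a2 u2 (fun _ => z0)).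
Hypothesis (HU1 : recU l1^-1 tau1 kap1 a1 u1 g) (HU2 : recU l2^-1 tau2 kap2 a2 u2 g).

Definition dfun (h1 h2 : R -> R) s := h2 s - h1 s.
Definition dfam (a1 a2 : nat -> nat -> R -> C) m := rowB (a2 m) (a1 m).
(** A difference of products is split as chi2 a2 - chi1 a1 = chi2 (a2 - a1) + (chi2 - chi1) a1. The
    first part belongs to the recursion of curve 2; the second, built on the solution of curve 1, is
    the source. Here e = 0, since d_s U carries no coefficient of the curve and leaves no source. *)
Definition diff_f m : nat -> R -> C := if m is m'.+2 then
  rowB (rrow (dfun chi1 chi2) (dfun eta1 eta2) 0 m (a1 m'.+1) (u1 m'))
       (rowZ (fun=> (l2 - l1)%:C) (a1 m)) else z0.
Definition diff_g m : nat -> R -> C :=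
  rowD (urow (l2^-1 - l1^-1) (dfun tau1 tau2) m (a1 m))
       (if m is m'.+1 then kmix (dfun kap1 kap2) (u1 m') else z0).

Lemma cd_sobT p (f : R -> C) x : sobT p.+2 f -> cd f x (cderive f x).
Proof. by case/sobT_derive. Qed.

Lemma cderiveB_sob p (f1 f2 : R -> C) x : sobT p.+2 f1 -> sobT p.+2 f2 ->
  cderive (fun s => f1 s - f2 s) x = cderive f1 x - cderive f2 x.
Proof.
by move=> s1 s2; apply: cd_cderive; exact: cdB (cd_sobT x s1) (cd_sobT x s2).
Qed.

Lemma diff_recU : recU l2^-1 tau2 kap2 (dfam a1 a2) (dfam u1 u2) diff_g.
Proof.
move=> m n s nm; rewrite /dfam /rowB HU1// HU2//.
have s1 := sobT_le (pa_ge q K0 D0) (sa1 nm); have s2 := sobT_le (pa_ge q K0 D0) (sa2 nm).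
rewrite /diff_g /urow /rowD /rowB /rowZ /rowM /rowd /rowj (cderiveB_sob s s2 s1).
have -> : (l2^-1 - l1^-1)%:C = l2^-1%:C - l1^-1%:C :> C by rewrite realCB.
have -> : (dfun tau1 tau2 s)%:C = (tau2 s)%:C - (tau1 s)%:C :> C by rewrite realCB.
case: m nm {s1 s2} => [|m] nm; first by rewrite /z0; ring.
rewrite /kmix /rowM /rowZ /rowD.
have -> : (dfun kap1 kap2 s)%:C = (kap2 s)%:C - (kap1 s)%:C :> C by rewrite realCB.
by case: n nm => [|n] nm /=; ring.
Qed.

Lemma diff_recA : recA K D l2 chi2 eta2 1 (dfam a1 a2) (dfam u1 u2) diff_f.
Proof.
move=> [|[|m]] n s nm; try by lia.
have /andP[n0 nlt] := nm; have nle := ltnW nlt.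
have cC (x : R -> C) : sobT pa x -> cCk (2 * D) x.
  by rewrite addSn => /sobT_cCk; apply: cCk_le; rewrite leq_addl.
have E1 := etrans (HA1 s nm) (addr0 _); have E2 := etrans (HA2 s nm) (addr0 _).
rewrite /= in E1 E2.
rewrite /= /dfam {1 2}/rowB (KopB K0 s (cC _ (sa2 nle)) (cC _ (sa1 nle))).
have -> : (l2 + symbR (jf m.+2 n))%:C * (a2 m.+2 n s - a1 m.+2 n s) +
    (KopR (a2 m.+2 n) s - KopR (a1 m.+2 n) s) =
    rrow chi2 eta2 1 m.+2 (a2 m.+1) (u2 m) n s - rrow chi1 eta1 1 m.+2 (a1 m.+1) (u1 m) n s
    - (l2 - l1)%:C * a1 m.+2 n s.
  by rewrite -E1 -E2 !realCD realCN; ring.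
rewrite /diff_f /rrow /rowB /rowM /rowZ /rowD /rowd /rowj.
case: n n0 nlt nle nm E1 E2 => // n n0 nlt nle nm E1 E2 /=.
have nm1 : (n <= m)%N by rewrite -ltnS -ltnS.
rewrite (cderiveB_sob s (su2 nm1) (su1 nm1)).
have -> : (dfun chi1 chi2 s)%:C = (chi2 s)%:C - (chi1 s)%:C :> C by rewrite realCB.
have -> : (dfun eta1 eta2 s)%:C = (eta2 s)%:C - (eta1 s)%:C :> C by rewrite realCB.
have -> : (0 : R)%:C = 0 :> C by [].
have -> : (1 : R)%:C = 1 :> C by [].
ring.
Qed.

Variables (M x eps : R).
Hypothesis (M1 : 1 <= M) (x0 : 0 <= x) (x1 : x <= 1) (sm : small M x).
Hypothesis lgeo2 : geo q M l2 chi2 eta2 kap2 tau2.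
Hypothesis (eps0 : 0 <= eps).
Hypothesis (dl : `|l2 - l1| <= eps) (dli : `|l2^-1 - l1^-1| <= eps).
Hypothesis (dchi : Rb q.+2 eps (dfun chi1 chi2)) (deta : Rb q.+2 eps (dfun eta1 eta2)).
Hypothesis (dkap : Rb q.+2 eps (dfun kap1 kap2)) (dtau : Rb q.+2 eps (dfun tau1 tau2)).
Variables (AA UU : R).
Hypothesis boundA : forall m, x ^+ m * Em pa m (a1 m) <= AA.
Hypothesis boundU : forall m, x ^+ m * Em q.+2 m (u1 m) <= UU.
Local Notation T := (3 ^+ q.+2 : R).
Local Notation S := (3 ^+ q.+1 : R).

Lemma sqr_abs_le (y : R) : `|y| <= eps -> y ^+ 2 <= eps ^+ 2.
Proof.
by move=> h; rewrite -real_normK ?num_real//; apply: lerXn2r; rewrite ?nnegrE.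
Qed.

Lemma AA_ge0 : 0 <= AA.
Proof. by apply: le_trans (boundA 0); rewrite mulr_ge0 ?exprn_ge0 ?Em_ge0. Qed.
Lemma UU_ge0 : 0 <= UU.
Proof. by apply: le_trans (boundU 0); rewrite mulr_ge0 ?exprn_ge0 ?Em_ge0. Qed.

Lemma shift_bound m k (E X : R) : 0 <= E -> x ^+ m * E <= X -> x ^+ (m + k) * E <= X.
Proof.
move=> E0 h; apply: le_trans h; rewrite exprD mulrAC.
apply: ler_piMr; [by apply: mulr_ge0 => //; exact: exprn_ge0|exact: exprn_ile1].
Qed.

Lemma diff_g_arith (e2 t y Ea Eu r p p1 s : R) : 0 <= e2 -> 0 <= t -> 0 <= y ->
  r <= 2 * p + 2 * s -> p <= 2 * (p1 * Ea) + 2 * (t * e2 * Ea) -> p1 <= e2 -> 0 <= Ea ->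
  s <= t * e2 * (t * Eu) -> y * Ea <= AA -> y * Eu <= UU ->
  y * r <= e2 * ((4 + 4 * t) * AA + 2 * t ^+ 2 * UU).
Proof.
move=> e0 t0 y0 h1 h2 h3 Ea0 h4 h5 h6.
have h7 := ler_wpM2r Ea0 h3.
have h8 : r <= 4 * (e2 * Ea) + 4 * (t * e2 * Ea) + 2 * (t * e2 * (t * Eu)) by lra.
apply: le_trans (ler_wpM2l y0 h8) _.
have te : 0 <= t * e2 by exact: mulr_ge0.
have tte : 0 <= t * e2 * t by exact: mulr_ge0.
have g1 := ler_wpM2l e0 h5; have g2 := ler_wpM2l te h5; have g3 := ler_wpM2l tte h6.
have -> : y * (4 * (e2 * Ea) + 4 * (t * e2 * Ea) + 2 * (t * e2 * (t * Eu))) =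
  4 * (e2 * (y * Ea)) + 4 * (t * e2 * (y * Ea)) + 2 * (t * e2 * t * (y * Eu)) by ring.
have -> : e2 * ((4 + 4 * t) * AA + 2 * t ^+ 2 * UU) =
  4 * (e2 * AA) + 4 * (t * e2 * AA) + 2 * (t * e2 * t * UU) by ring.
lra.
Qed.

Lemma diff_g_bound : sfam q.+2 diff_g /\ forall m,
  x ^+ m * Em q.+2 m (diff_g m) <= eps ^+ 2 * ((4 + 4 * T) * AA + 2 * T ^+ 2 * UU).
Proof.
have su m := urow_sobrow (l2^-1 - l1^-1) dtau (sobrow_le (pa_ge q K0 D0) (@sa1 m)).
have sk m : sobrow q.+2 m (if m is m'.+1 then kmix (dfun kap1 kap2) (u1 m') else z0).
  case: m => [|m]; first exact: sobrow0.
  exact: kmix_sobrow dkap (@tu1 m) (@su1 m).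
split=> m; first exact: sobrowD (su m) (sk m).
have bu := urow_bound (l2^-1 - l1^-1) dtau (sobrow_le (pa_ge q K0 D0) (@sa1 m)).
have ba := Em_le (pa_ge q K0 D0) (@sa1 m).
have xm : 0 <= x ^+ m by exact: exprn_ge0.
have T0 : 0 <= T by exact: exprn_ge0.
have hA : x ^+ m * Em q.+3 m (a1 m) <= AA := le_trans (ler_wpM2l xm ba) (boundA m).
have fin Eu h := diff_g_arith (Eu := Eu) (sqr_ge0 eps) T0 xm (EmD (su m) (sk m)) bu (sqr_abs_le dli)
  (Em_ge0 _ _ _) h hA.
move: fin; case: m {su bu ba} sk xm hA => [|m] sk xm hA fin.
  by apply: (fin (0 : R)); rewrite ?Em0 !mulr0 //; exact: UU_ge0.
apply: (fin (Em q.+2 m (u1 m))).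
  exact: kmix_bound dkap (@tu1 m) (@su1 m).
by rewrite -(addn1 m); apply: shift_bound; [exact: Em_ge0|exact: boundU].
Qed.

Lemma diff_f_arith (e2 t y Ea1 Eu Ea r p s d : R) : 0 <= e2 -> 0 <= t -> 0 <= y ->
  r <= 2 * p + 2 * s ->
  p <= 8 * (t * e2 * (t * Ea1)) + 4 * (0 ^+ 2 * Eu) + 4 * (t * e2 * Eu) ->
  s <= d * Ea -> d <= e2 -> 0 <= Ea -> y * Ea1 <= AA -> y * Eu <= UU -> y * Ea <= AA ->
  y * r <= e2 * ((16 * t ^+ 2 + 2) * AA + 8 * t * UU).
Proof.
move=> e0 t0 y0 h1 h2 h3 h4 Ea0 h5 h6 h7.
have h8 := ler_wpM2r Ea0 h4.
have h9 : r <= 16 * (t * e2 * (t * Ea1)) + 8 * (t * e2 * Eu) + 2 * (e2 * Ea).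
  by rewrite expr0n mul0r in h2; lra.
apply: le_trans (ler_wpM2l y0 h9) _.
have te : 0 <= t * e2 by exact: mulr_ge0.
have tte : 0 <= t * e2 * t by exact: mulr_ge0.
have g1 := ler_wpM2l tte h5; have g2 := ler_wpM2l te h6; have g3 := ler_wpM2l e0 h7.
have -> : y * (16 * (t * e2 * (t * Ea1)) + 8 * (t * e2 * Eu) + 2 * (e2 * Ea)) =
  16 * (t * e2 * t * (y * Ea1)) + 8 * (t * e2 * (y * Eu)) + 2 * (e2 * (y * Ea)) by ring.
have -> : e2 * ((16 * t ^+ 2 + 2) * AA + 8 * t * UU) =
  16 * (t * e2 * t * AA) + 8 * (t * e2 * UU) + 2 * (e2 * AA) by ring.
lra.
Qed.

Lemma diff_f_bound : sfam q.+1 diff_f /\ forall m,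
  x ^+ m * Em q.+1 m (diff_f m) <= eps ^+ 2 * ((16 * S ^+ 2 + 2) * AA + 8 * S * UU).
Proof.
have q1 : (q.+1 <= pa)%N by rewrite leq_addr.
have dc := Rb_le (leqnSn _) dchi; have de := Rb_le (leqnSn _) deta.
have S0 : 0 <= S by exact: exprn_ge0.
have rhs0 : 0 <= eps ^+ 2 * ((16 * S ^+ 2 + 2) * AA + 8 * S * UU).
  apply: mulr_ge0; first exact: sqr_ge0.
  apply: addr_ge0; apply: mulr_ge0; try exact: AA_ge0; try exact: UU_ge0; last exact: mulr_ge0.
  by apply: addr_ge0 => //; apply: mulr_ge0 => //; exact: sqr_ge0.
have sa m := sobrow_le q1 (@sa1 m).
have sr m := rrow_sobrow 0 dc de (@ta1 m.+1) (sa m.+1) (@tu1 m) (@su1 m).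
have sz m := sobrowZ (fun=> (l2 - l1)%:C) (sa m).
split=> [[|[|m]]|[|[|m]]]; try exact: sobrow0; try by rewrite Em0 mulr0.
  exact: sobrowB (sr m) (sz m.+2).
have br := rrow_bound 0 dc de (@ta1 m.+1) (sa m.+1) (@tu1 m) (@su1 m).
have bz := EmZ (sa m.+2) (fun=> lexx (sqmod (l2 - l1)%:C)); rewrite sqmod_real in bz.
have xm k : 0 <= x ^+ k by exact: exprn_ge0.
have hA k : x ^+ k * Em q.+1 k (a1 k) <= AA.
  exact: le_trans (ler_wpM2l (xm k) (Em_le q1 (sa1 (m:=k)))) (boundA k).
apply: (diff_f_arith (sqr_ge0 eps) S0 (xm m.+2) (EmB (sr m) (sz m.+2)) br bz (sqr_abs_le dl)
  (Em_ge0 _ _ _) _ _ (hA m.+2)).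
- by rewrite -(addn1 m.+1); apply: shift_bound (hA m.+1); exact: Em_ge0.
- by rewrite -(addn2 m); apply: shift_bound (boundU m); exact: Em_ge0.
Qed.

(** Both solutions share their initial data, so the difference has zero data and only the sources
    [diff_f] and [diff_g], whose energies are of size eps^2; the a priori estimate applies with the
    geometry of curve 2. *)
Lemma difference_bound m :
  x ^+ m * Em pa m (dfam a1 a2 m) <=
  eps ^+ 2 * (2 * (k3 M * ((16 * S ^+ 2 + 2) * AA + 8 * S * UU) +
                   ((4 + 4 * T) * AA + 2 * T ^+ 2 * UU))).
Proof.
have [sf bf] := diff_f_bound; have [sg bg] := diff_g_bound.
have td (c d : nat -> nat -> R -> C) : tfam c -> tfam d -> tfam (dfam c d).
  by move=> tc td k n kn; apply/funext => s; rewrite /dfam /rowB tc// td// subrr.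
have sd p (c d : nat -> nat -> R -> C) : sfam p c -> sfam p d -> sfam p (dfam c d).
  by move=> sc sd k; exact: sobrowB (sd k) (sc k).
have f0 := le_trans (mulr_ge0 (exprn_ge0 0 x0) (Em_ge0 q.+1 0 (diff_f 0))) (bf 0%N).
have g0 := le_trans (mulr_ge0 (exprn_ge0 0 x0) (Em_ge0 q.+2 0 (diff_g 0))) (bg 0%N).
have bd k s : dfam a1 a2 k 0%N s = (fun _ => z0) k 0%N s /\ dfam a1 a2 k k s = (fun _ => z0) k k s.
  by rewrite /dfam /rowB (b1 k s).1 (b1 k s).2 (b2 k s).1 (b2 k s).2 !subrr.
have H := apriori M1 x0 sm lgeo2 (td _ _ ta1 ta2) (td _ _ tu1 tu2) (sd _ _ _ sa1 sa2)
  (sd _ _ _ su1 su2) (fun m => @sobrow0 pa m) sf sg bd diff_recA diff_recU (lexx 0) f0 g0 _ bf bg.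
have [|h _] := H _ m; first by move=> k; rewrite Em0 mulr0.
apply: le_trans h _; rewrite add0r le_eqVlt; apply/orP; left; apply/eqP; ring.
Qed.

End Difference.

End NearAxisSolution.

(** * The Poisson equation as a recursion *)

Section Families.
Variable R : realType.
Local Notation C := R[i].
Variables (K : R) (D : nat).
Implicit Types (a b : nat -> nat -> R -> C) (c d : nat -> R -> C) (h : R -> R).


Lemma rowf_z m c t s : eik 1 t * rowf m c t s = rowf m.+1 (prv c) t s.
Proof.
rewrite [RHS]/rowf big_ord_recl /= mul0r add0r mulr_sumr; apply: eq_bigr => n _ /=.
by rewrite /bump leq0n add1n jfSS eikD; ring.
Qed.

Lemma rowf_zbar m c t s : trow m c -> eik (-1) t * rowf m c t s = rowf m.+1 c t s.
Proof.
move=> tc; rewrite [RHS]/rowf big_ord_recr /= tc// mul0r addr0 mulr_sumr.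
by apply: eq_bigr => n _ /=; rewrite jfS eikD; ring.
Qed.

Lemma rowf_lin m (x y : C) c d t s :
  rowf m (fun n s => x * c n s + y * d n s) t s = x * rowf m c t s + y * rowf m d t s.
Proof. by rewrite /rowf !mulr_sumr -big_split /=; apply: eq_bigr => n _; ring. Qed.

Lemma eq_rowf m c d t s : (forall n, (n <= m)%N -> c n s = d n s) -> rowf m c t s = rowf m d t s.
Proof. by move=> cd; apply: eq_bigr => n _; rewrite cd// -ltnS. Qed.

Lemma cosE t : (cos t)%:C = 2^-1 * (eik 1 t + eik (-1) t) :> C.
Proof. by rewrite cosCE eikN /eik !mul1r. Qed.
Lemma sinE t : (sin t)%:C = - 'i * 2^-1 * (eik 1 t - eik (-1) t) :> C.
Proof.
rewrite eikN /eik !mul1r -mulrA -sinCE mulrA mulNr.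
have -> : 'i * 'i = -1 :> C by rewrite -expr2 sqr_i.
by rewrite opprK mul1r.
Qed.

Lemma rowf_cd_t m c t s :
  cd (fun x => rowf m c x s) t (rowf m (rowj m c) t s).
Proof.
have := cd_sum (index_enum 'I_m.+1) (fun n => cdZ (c n s) (eik_cd (R := R) (jf m n) t)).
congr cd; apply: eq_bigr => n _; rewrite /rowj; ring.
Qed.

Lemma rowf_cd_s m c t s : (forall n, cderivable (c n) s) ->
  cd (fun x => rowf m c t x) s (rowf m (rowd c) t s).
Proof.
move=> cc.
have := cd_sum (index_enum 'I_m.+1) (fun n : 'I_m.+1 => cdZ (eik (jf m n) t) (cderivable_cd (cc n))).
move=> H; have -> : rowf m (rowd c) t s =
    \sum_(i <- index_enum 'I_m.+1) eik (jf m i) t * cderive (c i) s.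
  by apply: eq_bigr => n _; rewrite mulrC.
by apply: eq_cd H => x; apply: eq_bigr => n _; rewrite mulrC.
Qed.

(* The operators [rho d/drho], [d/dtheta], [d/ds] and multiplication by
   [rho cos theta], [rho sin theta], [rho^2] on near-axis families. *)
Definition fe a m n s : C := m%:R * a m n s.
Definition fj a m := rowj m (a m).
Definition fd a m := rowd (a m).
Definition fcos a m : nat -> R -> C :=
  if m is m'.+1 then rowZ (fun=> (2^-1)%:C) (rowD (a m') (prv (a m'))) else @z0 R.
Definition fsin a m : nat -> R -> C :=
  if m is m'.+1 then rowZ (fun=> - 'i * 2^-1) (rowB (prv (a m')) (a m')) else @z0 R.
Definition fsq a m : nat -> R -> C := if m is m'.+2 then prv (a m') else @z0 R.
Definition fP a m n s : C := Kop K D (a m n) s + (symb K D (jf m n))%:C * a m n s.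

Definition formalf a (k : int) (t s : R) : C := if k is Posz m then rowf m (a m) t s else 0.

Lemma formalE a : formal a = formalf a.
Proof.
apply/funext => -[m|m] //; apply/funext => t; apply/funext => s.
by rewrite /formal /formalf modeE.
Qed.

Lemma rowf0 m t s : rowf m (@z0 R) t s = 0.
Proof. by rewrite /rowf big1// => n _; rewrite mul0r. Qed.

Lemma formalf_e a k t s : k%:~R * formalf a k t s = formalf (fe a) k t s.
Proof.
case: k => [m|m] /=; last by rewrite mulr0.
by rewrite /rowf mulr_sumr; apply: eq_bigr => n _; rewrite /fe mulrA.
Qed.

Lemma rowf_cos m c t s : trow m c ->
  (cos t)%:C * rowf m c t s = rowf m.+1 (rowZ (fun=> (2^-1)%:C) (rowD c (prv c))) t s.
Proof.
move=> tc; rewrite cosE -mulrA mulrDl rowf_z rowf_zbar// addrC mulrDr -rowf_lin.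
by apply: eq_rowf => n _; rewrite /rowZ /rowD realCV natrCE; ring.
Qed.

Lemma rowf_sin m c t s : trow m c ->
  (sin t)%:C * rowf m c t s = rowf m.+1 (rowZ (fun=> - 'i * 2^-1) (rowB (prv c) c)) t s.
Proof.
move=> tc; rewrite sinE.
have -> : - 'i * 2^-1 * (eik 1 t - eik (-1) t) * rowf m c t s =
    (- 'i * 2^-1) * (eik 1 t * rowf m c t s) + 'i * 2^-1 * (eik (-1) t * rowf m c t s) :> C by ring.
rewrite rowf_z rowf_zbar// -rowf_lin.
by apply: eq_rowf => n _; rewrite /rowZ /rowB; ring.
Qed.

Lemma formalf_cos a k t s : tfam a -> (cos t)%:C * formalf a (k - 1) t s = formalf (fcos a) k t s.
Proof.
move=> ta; case: k => [[|m]|m]; [by rewrite /= mulr0 rowf0| |by rewrite /= mulr0].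
have -> : Posz m.+1 - 1 = Posz m by lia.
exact: rowf_cos (@ta m).
Qed.

Lemma rowf_sq m c t s : trow m c -> rowf m c t s = rowf m.+2 (prv c) t s.
Proof.
move=> tc; have tp : trow m.+1 (prv c) := trow_prv tc.
by rewrite -(rowf_zbar _ _ tp) -rowf_z mulrA -eikD addNr eik0 mul1r.
Qed.

Lemma formalf_sq a k t s : tfam a -> formalf a (k - 2) t s = formalf (fsq a) k t s.
Proof.
move=> ta; case: k => [[|[|m]]|m] //; try by rewrite /= rowf0.
have -> : Posz m.+2 - 2 = Posz m by lia.
exact: rowf_sq (@ta m).
Qed.

Lemma formalf_lin (x y : C) a b k t s :
  formalf (fun m n s => x * a m n s + y * b m n s) k t s = x * formalf a k t s + y * formalf b k t s.
Proof. by case: k => [m|m] /=; [exact: rowf_lin|rewrite !mulr0 addr0]. Qed.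

Lemma formalf_coef (h : R -> C) a k t s :
  formalf (fun m n s => h s * a m n s) k t s = h s * formalf a k t s.
Proof.
case: k => [m|m] /=; last by rewrite mulr0.
by rewrite /rowf mulr_sumr; apply: eq_bigr => n _; rewrite mulrA.
Qed.

Lemma eq_formalf a b k t s : (forall m n, (n <= m)%N -> a m n s = b m n s) ->
  formalf a k t s = formalf b k t s.
Proof. by move=> ab; case: k => [m|m] //=; apply: eq_rowf => n; exact: ab. Qed.

Lemma formalf_cd_t a k t s : cd (fun x => formalf a k x s) t (formalf (fj a) k t s).
Proof. by case: k => [m|m] /=; [exact: rowf_cd_t|exact: cd_cst]. Qed.

Lemma formalf_cd_s a k t s : (forall m n, cderivable (a m n) s) ->
  cd (fun x => formalf a k t x) s (formalf (fd a) k t s).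
Proof. by move=> ac; case: k => [m|m] /=; [exact: rowf_cd_s|exact: cd_cst]. Qed.

Lemma formalf0 a : (forall k t s, formalf a k t s = 0) <->
  (forall m n s, (n <= m)%N -> a m n s = 0).
Proof.
split=> [H m n s nm|H [m|m] t s //=].
  rewrite (rowf_inj (c := a m) (d := @z0 R) (s := s) nm)// => t.
  by rewrite rowf0; exact: (H (Posz m)).
by rewrite -(rowf0 m t s); apply: eq_rowf => n; exact: H.
Qed.

(* rho^2 times the equation, for phi = sum a_m rho^m and u = sum U_m rho^m. *)
Definition eqfam (l : R) chi eta a U m n s : C :=
  let L b := fun m n s => l%:C * b m n s - (chi s)%:C * fcos b m n s in
  (fe (fun m n s => L (fe a) m n s + fe (fP a) m n s) m n s +
   fj (fun m n s => L (fj a) m n s + fj (fP a) m n s) m n s) +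
  fsq (fun m n s => fd U m n s - (eta s)%:C * fj U m n s) m n s.

Lemma tfam_fe a : tfam a -> tfam (fe a).
Proof. by move=> ta m n mn; apply/funext => s; rewrite /fe ta// mulr0. Qed.
Lemma tfam_fj a : tfam a -> tfam (fj a).
Proof. by move=> ta m n mn; apply/funext => s; rewrite /fj /rowj ta// mulr0. Qed.

Lemma cderive0 (x : R) : cderive (fun=> 0 : C) x = 0.
Proof. exact: cd_cderive (cd_cst 0 x). Qed.

Lemma jfE m n : ((jf m n)%:~R : C) = 2 * n%:R - m%:R.
Proof. by rewrite /jf intrB -muln2 PoszM intrM mulrC. Qed.

Lemma realC1 : (1 : R)%:C = 1 :> C. Proof. by []. Qed.

Lemma alC m n : (al R m n)%:C = n%:R * (2 * (m - n)%:R - 1) / (4 * n%:R * (m - n)%:R) :> C.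
Proof. by rewrite /al !(realCM, realCV, realCB, realC1, =^~ natrCE). Qed.
Lemma beC m n : (be R m n)%:C = (m - n)%:R * (2 * n%:R - 1) / (4 * n%:R * (m - n)%:R) :> C.
Proof. by rewrite /be !(realCM, realCV, realCB, realC1, =^~ natrCE). Qed.
Lemma gaC m n : (ga R m n)%:C = (4 * n%:R * (m - n)%:R)^-1 :> C.
Proof. by rewrite /ga !(realCM, realCV, =^~ natrCE). Qed.

(** J, x, y and j stand for i, n, m - n and 2n - m, so x + y = m. The factor 4 x y is m^2 - j^2, the
    symbol of the perpendicular Laplacian on rho^m e^(i j theta). *)
Lemma eqfam_arith (J x y l h e p a a1 a0 u' u j : C) :
  J * J = -1 -> y != 0 -> x != 0 -> j = x - y ->
  (x + y) * (l * ((x + y) * a) - h * (2^-1 * ((x + y - 1) * a1 + (x + y - 1) * a0)) + (x + y) * p) +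
  J * j * (l * (J * j * a) - h * (2^-1 * (J * (j + 1) * a1 + J * (j - 1) * a0)) + J * j * p) +
  (u' - e * (J * j * u)) =
  4 * x * y * (l * a + p - (h * (x * (2 * y - 1) / (4 * x * y) * a1 +
     y * (2 * x - 1) / (4 * x * y) * a0) - (4 * x * y)^-1 * (1 * u' - e * (J * j * u)))).
Proof.
move=> JJ y0 x0 ->.
have -> : J * (x - y) * (l * (J * (x - y) * a) - h * (2^-1 * (J * (x - y + 1) * a1 + J * (x - y - 1) * a0)) + J * (x - y) * p) = (J * J) * ((x - y) * (l * ((x - y) * a) - h * (2^-1 * ((x - y + 1) * a1 + (x - y - 1) * a0)) + (x - y) * p)) by ring.
by rewrite JJ; field; rewrite x0 y0.
Qed.

Lemma jfE2 m n : (n <= m)%N -> ((jf m n)%:~R : C) = n%:R - (m - n)%:R.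
Proof. by move=> nm; rewrite jfE natrB//; ring. Qed.

Lemma eqfam_interior (l : R) chi eta a U m n s : (0 < n < m)%N ->
  eqfam l chi eta a U m n s = 4 * n%:R * (m - n)%:R *
   (l%:C * a m n s + (Kop K D (a m n) s + (symb K D (jf m n))%:C * a m n s)
    - rrow chi eta 1 m (a m.-1) (U m.-2) n s).
Proof.
move=> /andP[n0 nm].
case: m nm => [|[|m]] nm; try by lia.
case: n n0 nm => // n _ nm.
have nm2 : (n <= m)%N by rewrite -ltnS -ltnS.
have x0 : n.+1%:R != 0 :> C by rewrite pnatr_eq0.
have y0 : (m.+2 - n.+1)%:R != 0 :> C by rewrite pnatr_eq0 subn_eq0 -ltnNge.
have mE : m.+2%:R = n.+1%:R + (m.+2 - n.+1)%:R :> C by rewrite -natrD subnKC// ltnW.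
have m1E : m.+1%:R = n.+1%:R + (m.+2 - n.+1)%:R - 1 :> C by rewrite -mE -[m.+2%:R]natr1 addrK.
have j1 : (jf m.+1 n.+1)%:~R = (jf m.+2 n.+1)%:~R + 1 :> C.
  by rewrite [jf m.+2 _]jfS -[X in _ = _ + X]/(1%:~R) -intrD subrK.
have j0 : (jf m.+1 n)%:~R = (jf m.+2 n.+1)%:~R - 1 :> C.
  by rewrite [jf m.+2 _]jfSS -[X in _ = _ - X]/(1%:~R) -intrB addrK.
have ju : (jf m n)%:~R = (jf m.+2 n.+1)%:~R :> C by rewrite jfSSS.
have JJ : 'i * 'i = -1 :> C by rewrite -expr2 sqr_i.
have := eqfam_arith l%:C (chi s)%:C (eta s)%:C (fP a m.+2 n.+1 s) (a m.+2 n.+1 s) (a m.+1 n.+1 s)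
  (a m.+1 n s) (cderive (U m n) s) (U m n s) JJ y0 x0 (jfE2 (ltnW nm)).
rewrite -m1E -mE /eqfam /fe /fj /fcos /fsq /fd /rrow /rowB /rowM /rowD /rowZ /rowd /rowj.
rewrite alC beC gaC realC1 realCV -natrCE /= j1 j0 ju => ->.
by [].
Qed.

(** At n = 0 and n = m one has j^2 = m^2, so the terms in phi_m and P phi_m cancel. The only
    neighbour in phi_(m-1) is extreme too, which cancels the cosine terms, and a row multiplied by
    rho^2 has no extreme entries. Hence the initial data are unconstrained. *)
Lemma eqfam_boundary (l : R) chi eta a U m n s : tfam a -> tfam U ->
  (n == 0%N) || (n == m) -> eqfam l chi eta a U m n s = 0.
Proof.
move=> ta tU nm.
have JJ : 'i * 'i = -1 :> C by rewrite -expr2 sqr_i.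
rewrite /eqfam /fe /fj /fcos /fsq /fd /rowB /rowM /rowD /rowZ /rowd /rowj.
set P := fP a m n s; set A := a m n s.
have key (h j k x y : C) : j * j = k * k -> k * (l%:C * (k * A) - h * x + k * P) +
  'i * j * (l%:C * ('i * j * A) - h * ('i * y) + 'i * j * P) = - h * (k * x - j * y).
  move=> jk; have -> : 'i * j * (l%:C * ('i * j * A) - h * ('i * y) + 'i * j * P) =
    ('i * 'i) * (l%:C * (j * j) * A - j * h * y + j * j * P) by ring.
  by rewrite JJ jk; ring.
have uz : (if m is m'.+2 then prv (fun n s => cderive (U m' n) s - (eta s)%:C * ('i * (jf m' n)%:~R * U m' n s)) else @z0 R) n s = 0.
  case: (m) nm => [|[|m']]// ; case: n {P A key} => // n /=.
  by rewrite eqSS => /eqP ->; rewrite tU//= cderive0 !mulr0 subrr.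
rewrite uz addr0.
case/orP: nm => /eqP nm; subst n.
  have j0 : ((jf m 0)%:~R : C) = - m%:R by rewrite jfE mulr0 sub0r.
  have jj : (jf m 0)%:~R * (jf m 0)%:~R = m%:R * m%:R :> C by rewrite j0 mulrNN.
  case: m @P @A key uz j0 jj => [|m] P A key uz j0 jj.
    by rewrite j0 /z0; ring.
  rewrite /prv /= !addr0.
  have -> : ('i * (jf m 0)%:~R * a m 0%N s) = 'i * ((jf m 0)%:~R * a m 0%N s) by rewrite mulrA.
  have -> : (2^-1)%:C * ('i * ((jf m 0)%:~R * a m 0%N s)) = 'i * ((2^-1)%:C * ((jf m 0)%:~R * a m 0%N s)) by ring.
  by rewrite (key _ _ _ _ _ jj) j0 !jfE mulr0 -natr1; ring.
have j0 : ((jf m m)%:~R : C) = m%:R by rewrite jfE; ring.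
have jj : (jf m m)%:~R * (jf m m)%:~R = m%:R * m%:R :> C by rewrite j0.
case: m @P @A key uz j0 jj => [|m] P A key uz j0 jj.
  by rewrite j0 /z0; ring.
rewrite /prv /= (ta m m.+1)//= !mulr0 !add0r.
have -> : (2^-1)%:C * ('i * (jf m m)%:~R * a m m s) = 'i * ((2^-1)%:C * ((jf m m)%:~R * a m m s)) by ring.
by rewrite (key _ _ _ _ _ jj) j0 !jfE -natr1; ring.
Qed.

Lemma eqfam_recA (l : R) chi eta a U : tfam a -> tfam U ->
  (forall m n s, (n <= m)%N -> eqfam l chi eta a U m n s = 0) <->
  recA K D l chi eta 1 a U (fun _ => @z0 R).
Proof.
move=> ta tU.
have E m n s : (l + symb K D (jf m n))%:C * a m n s + Kop K D (a m n) s =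
  l%:C * a m n s + (Kop K D (a m n) s + (symb K D (jf m n))%:C * a m n s).
  by rewrite realCD; ring.
have pos m n : (0 < n < m)%N -> 4 * n%:R * (m - n)%:R != 0 :> C.
  move=> /andP[n0 nm]; rewrite !mulf_neq0// pnatr_eq0 -?lt0n//.
  by rewrite subn_gt0.
split=> H m n s nm.
  rewrite addr0 E; have := H m n s _; rewrite eqfam_interior// => /(_ _)/eqP.
  rewrite mulf_eq0 (negPf (pos _ _ nm)) subr_eq0 => h; apply/eqP/h.
  by case/andP: nm => _ /ltnW.
have [b|] := boolP ((n == 0%N) || (n == m)); first exact: eqfam_boundary.
rewrite negb_or => /andP[n0 nm']; have nn : (0 < n < m)%N by rewrite lt0n n0 ltn_neqAle nm' nm.
have := H m n s nn; rewrite addr0 E => h.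
by rewrite eqfam_interior// h subrr mulr0.
Qed.

End Families.

(** * Formal Laurent series in rho *)

Section LaurentAlgebra.
Variable R : realType.
Local Notation C := R[i].
Local Notation fam := (int -> R -> R -> C).
Local Notation L := (laurent R).
Implicit Types (f g h X Y F : fam) (k : int) (N n : nat) (t s : R) (c d : R -> R -> C).

Definition lmul f g : fam := @Defs.mul R L f g.
(** A lower bound on the order makes each coefficient of the Cauchy product a finite sum, which its
    algebraic rules presuppose. *)
Definition lbd N f : Prop := forall k t s, (k < - N%:Z)%R -> f k t s = 0.

Lemma lbd_le N M f : (N <= M)%N -> lbd N f -> lbd M f.
Proof. by move=> NM lf k t s kM; apply: lf; lia. Qed.

Lemma lmul_seq (r : seq int) f g k t s : uniq r ->
  (forall i, i \notin r -> f i t s * g (k - i) t s = 0) ->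
  lmul f g k t s = \sum_(i <- r) f i t s * g (k - i) t s.
Proof.
move=> ur H; rewrite /lmul /= (fsbigE r)//; last by move=> i _; exact: H.
by apply: eq_bigl => i; rewrite in_setT.
Qed.

Definition win N n : seq int := [seq Posz i - N%:Z | i <- iota 0 n].

Lemma win_uniq N n : uniq (win N n).
Proof. by rewrite map_inj_uniq ?iota_uniq// => i j; lia. Qed.

Lemma mem_win N n k : (k \in win N n) = (- N%:Z <= k < n%:Z - N%:Z).
Proof.
apply/mapP/idP => [[m]|kN]; first by rewrite mem_iota => ? ->; lia.
by exists (absz (k + N%:Z)); rewrite ?mem_iota; lia.
Qed.

Lemma lmulE N n f g k t s : lbd N f -> lbd N g -> (k + N%:Z + N%:Z < n%:Z) ->
  lmul f g k t s = \sum_(i <- win N n) f i t s * g (k - i) t s.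
Proof.
move=> lf lg kn; apply: lmul_seq => [|i]; first exact: win_uniq.
rewrite mem_win => ni; have [iN|Ni] := ltP i (- N%:Z); first by rewrite lf// mul0r.
by rewrite lg ?mulr0//; lia.
Qed.

Lemma lbd_mul N f g : lbd N f -> lbd N g -> lbd (N + N) (lmul f g).
Proof.
move=> lf lg k t s kN; rewrite (@lmul_seq [::]) ?big_nil// => i _.
have [iN|Ni] := ltP i (- N%:Z); first by rewrite lf// mul0r.
by rewrite lg ?mulr0//; lia.
Qed.


Definition big_n (k : int) N : nat := ((absz k).+1 + N + N)%N.
Lemma big_nP k N : (k + N%:Z + N%:Z < (big_n k N)%:Z)%R.
Proof. by rewrite /big_n; lia. Qed.

Lemma lmulDr N f g1 g2 k t s : lbd N f -> lbd N g1 -> lbd N g2 ->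
  lmul f (fun k t s => g1 k t s + g2 k t s) k t s = lmul f g1 k t s + lmul f g2 k t s.
Proof.
move=> lf l1 l2; have H := big_nP k N; rewrite !(lmulE (N := N) _ _ _ _ H)//; last first.
  by move=> i x y iN; rewrite l1// l2// addr0.
by rewrite -big_split; apply: eq_bigr => i _; rewrite mulrDr.
Qed.

Lemma lmulDl N f1 f2 g k t s : lbd N f1 -> lbd N f2 -> lbd N g ->
  lmul (fun k t s => f1 k t s + f2 k t s) g k t s = lmul f1 g k t s + lmul f2 g k t s.
Proof.
move=> l1 l2 lg; have H := big_nP k N; rewrite !(lmulE (N := N) _ _ _ _ H)//; last first.
  by move=> i x y iN; rewrite l1// l2// addr0.
by rewrite -big_split; apply: eq_bigr => i _; rewrite mulrDl.
Qed.

Lemma lmulZl N c f g k t s : lbd N f -> lbd N g ->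
  lmul (fun k t s => c t s * f k t s) g k t s = c t s * lmul f g k t s.
Proof.
move=> lf lg; have H := big_nP k N; rewrite !(lmulE (N := N) _ _ _ _ H)//; last first.
  by move=> i x y iN; rewrite lf// mulr0.
by rewrite mulr_sumr; apply: eq_bigr => i _; rewrite mulrA.
Qed.

Lemma lmulZr N c f g k t s : lbd N f -> lbd N g ->
  lmul f (fun k t s => c t s * g k t s) k t s = c t s * lmul f g k t s.
Proof.
move=> lf lg; have H := big_nP k N; rewrite !(lmulE (N := N) _ _ _ _ H)//; last first.
  by move=> i x y iN; rewrite lg// mulr0.
by rewrite mulr_sumr; apply: eq_bigr => i _; rewrite mulrCA.
Qed.

Lemma lmul_coef c f k t s : lmul (coef L c) f k t s = c t s * f k t s.
Proof.
rewrite (@lmul_seq [:: 0])//= ?big_seq1 ?subr0// => i; rewrite inE => /negPf.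
by move=> -> ; rewrite mul0r.
Qed.

Lemma lmul_coefr c f k t s : lmul f (coef L c) k t s = f k t s * c t s.
Proof.
rewrite (@lmul_seq [:: k])//= ?big_seq1 ?subrr// => i; rewrite inE => ik.
by rewrite subr_eq0 eq_sym (negPf ik) mulr0.
Qed.

Lemma lmul_rho j f k t s : lmul (rhoX L j) f k t s = f (k - j) t s.
Proof.
rewrite (@lmul_seq [:: j])//= ?big_seq1 ?eqxx ?mul1r// => i; rewrite inE => /negPf ->.
by rewrite mul0r.
Qed.

Lemma lmul0 f k t s : lmul (0 : L) f k t s = 0.
Proof. by rewrite (@lmul_seq [::]) ?big_nil// => i _; rewrite mul0r. Qed.

Lemma lmul_shift N M (j : int) f g k t s : lbd N f -> lbd N g -> j <= M%:Z -> - M%:Z <= j ->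
  lmul (fun k => f (k - j)) g k t s = lmul f g (k - j) t s.
Proof.
move=> lf lg jM Mj.
rewrite (lmulE (N := (N + M)%N) (n := big_n k (N + M + M))); first last.
- by rewrite /big_n; lia.
- by apply: lbd_le lg; rewrite leq_addr.
- by move=> i x y iN; apply: lf; lia.
rewrite (@lmul_seq [seq i - j | i <- win (N + M) (big_n k (N + M + M))]).
- rewrite [RHS]big_map; apply: eq_bigr => i _; congr (_ * g _ t s); lia.
- by rewrite map_inj_uniq ?win_uniq// => a b /addIr.
move=> i ni; have [iN|Ni] := ltP i (- N%:Z); first by rewrite lf// mul0r.
have [iN|Ni'] := ltP (k - j - i) (- N%:Z); first by rewrite lg// mulr0.
exfalso; move/negP: ni; apply; apply/mapP; exists (i + j); last by lia.
by rewrite mem_win /big_n; lia.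
Qed.

End LaurentAlgebra.

(** * Division by h_s and the metric in Laurent series *)

Section LaurentGeometry.
Variable R : realType.
Local Notation C := R[i].
Local Notation fam := (int -> R -> R -> C).
Local Notation L := (laurent R).
Variable r : R -> 'rV[R]_3.
Local Notation l := (ell r).
Hypothesis l0 : l != 0.
Implicit Types (f g X Y F : fam) (k : int) (N n : nat) (t s : R).
Local Notation kc := (kcos r).
Local Notation hsL := (hs L r : fam).
Local Notation hsVL := (hsV L r : fam).

Lemma hsLE k t s : hsL k t s =
  if k == 0 then l%:C else if k == 1 then - (l%:C * kc t s) else 0.
Proof.
rewrite [LHS](_ : _ = rcst L l k t s -
   lmul (lmul (rcst L l) (coef L kc)) (rhoX L 1) k t s)//.
have E : lmul (rcst L l) (coef L kc) = coef L (fun t s => l%:C * kc t s).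
  apply/funext => i; apply/funext => x; apply/funext => y; rewrite lmul_coef /=.
  by case: ifP; rewrite ?mulr0.
rewrite E lmul_coef /=; case: eqP => [->|_]; first by rewrite /= mulr0 subr0.
by rewrite sub0r; case: eqP => _ /=; rewrite ?mulr1 ?mulr0 ?oppr0.
Qed.

Lemma lmul_hs F k t s : lmul hsL F k t s = l%:C * F k t s - l%:C * kc t s * F (k - 1) t s.
Proof.
rewrite (@lmul_seq R [:: 0; 1])// => [|i].
  by rewrite !big_cons big_nil !hsLE /= subr0 addr0 mulNr.
by rewrite !inE negb_or hsLE => /andP[/negPf -> /negPf ->]; rewrite mul0r.
Qed.

Lemma lmul_sqrtg F k t s : lmul (sqrtg L r) F k t s = lmul hsL F (k - 1) t s.
Proof.
have E i x y : (sqrtg L r : fam) i x y = hsL (i - 1) x y.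
  by rewrite [LHS](_ : _ = lmul (rhoX L 1) hsL i x y)// lmul_rho.
rewrite (@lmul_seq R [:: 1; 2])// => [|i].
  by rewrite !big_cons big_nil !E !hsLE /= lmul_hs addr0 mulNr; congr (_ - _ * F _ t s); lia.
rewrite !inE negb_or E hsLE => /andP[i1 i2].
by rewrite subr_eq0 (negPf i1) subr_eq (_ : 1 + 1 = 2 :> int)// (negPf i2) mul0r.
Qed.

Lemma hsVLE k t s : hsVL k t s = (l^-1)%:C * (if k is Posz n then kc t s ^+ n else 0).
Proof. by rewrite [LHS](_ : _ = lmul (rcst L l^-1) (geom L kc) k t s)// lmul_coef. Qed.

Lemma lbd_hsV N : lbd N hsVL.
Proof. by move=> k t s kN; rewrite hsVLE; case: k kN => [k|k] kN; [lia|rewrite mulr0]. Qed.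

(** h_s has just two terms, so it acts as a combination of the identity and one shift; associativity
    with such a factor follows from the shift rule, without triple sums. *)
Lemma lmul_hsA N X F k t s : lbd N X -> lbd N F ->
  lmul (lmul hsL X) F k t s = lmul hsL (lmul X F) k t s.
Proof.
move=> lX lF; rewrite lmul_hs.
have -> : lmul hsL X = (fun k t s => l%:C * X k t s + (- (l%:C * kc t s)) * X (k - 1) t s).
  by apply/funext => i; apply/funext => x; apply/funext => y; rewrite lmul_hs mulNr.
have lX1 : lbd N.+1 (fun k => X (k - 1)) by move=> i x y iN; apply: lX; lia.
have lX' : lbd N.+1 X by apply: lbd_le lX.
have lF' : lbd N.+1 F by apply: lbd_le lF.
rewrite (lmulDl (N := N.+1)) //; first last.
- by move=> i x y iN; rewrite lX1// mulr0.
- by move=> i x y iN; rewrite lX'// mulr0.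
rewrite (lmulZl (fun _ _ => l%:C) _ _ _ lX' lF').
rewrite (lmulZl (fun t s => - (l%:C * kc t s)) _ _ _ lX1 lF').
by rewrite (lmul_shift (M := 1) _ _ _ lX lF) ?mulNr.
Qed.

Lemma lmul_hs_hsV k t s : lmul hsL hsVL k t s = if k == 0 then 1 else 0.
Proof.
have lC : l%:C != 0 :> C by rewrite realC_eq0.
rewrite lmul_hs !hsVLE realCV; case: k => [[|n]|n].
- by rewrite /= expr0; field.
- have -> : Posz n.+1 - 1 = Posz n by lia.
  by rewrite /= exprS; field.
- by rewrite /= !mulr0 subr0.
Qed.

Lemma lmul_hsK N F k t s : lbd N F -> lmul hsL (lmul hsVL F) k t s = F k t s.
Proof.
move=> lF; rewrite -(lmul_hsA _ _ _ (@lbd_hsV N) lF).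
have -> : lmul hsL hsVL = coef L (fun _ _ => 1).
  by apply/funext => i; apply/funext => x; apply/funext => y; rewrite lmul_hs_hsV.
by rewrite lmul_coef mul1r.
Qed.

Lemma lmul_hsV_rec N F k t s : lbd N F ->
  lmul hsVL F k t s = (l^-1)%:C * F k t s + kc t s * lmul hsVL F (k - 1) t s.
Proof.
move=> lF; have lC : l%:C != 0 :> C by rewrite realC_eq0.
have := lmul_hsK k t s lF; rewrite lmul_hs => <-; rewrite realCV; field.
exact: lC.
Qed.

(** Multiplication by h_s is a one-step recurrence in the order. Two solutions agree below all
    orders that occur, where both vanish, and then upwards by induction. *)
Lemma lmul_hsV_unique N F X : lbd N F -> lbd N X ->
  (forall k t s, l%:C * X k t s - l%:C * kc t s * X (k - 1) t s = F k t s) ->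
  forall k t s, lmul hsVL F k t s = X k t s.
Proof.
move=> lF lX H k t s; have lC : l%:C != 0 :> C by rewrite realC_eq0.
have lV : lbd (N + N) (lmul hsVL F) by apply: lbd_mul lF; exact: lbd_hsV.
have lX' : lbd (N + N) X by apply: lbd_le lX; rewrite leq_addr.
suff E n : lmul hsVL F (n%:Z - (N + N).+1%:Z) t s = X (n%:Z - (N + N).+1%:Z) t s.
  have [kN|Nk] := ltP k (- (N + N)%:Z); first by rewrite lV// lX'.
  have -> : k = Posz (absz (k + (N + N).+1%:Z)) - (N + N).+1%:Z by lia.
  exact: E.
elim: n => [|n IH]; first by rewrite lV ?lX'//; lia.
rewrite (lmul_hsV_rec _ _ _ lF) -H realCV.
have -> : n.+1%:Z - (N + N).+1%:Z - 1 = n%:Z - (N + N).+1%:Z by lia.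
by rewrite IH; field.
Qed.

Definition hs2V : fam := lmul hsVL hsVL.

Lemma lbd_hs2V N : lbd N hs2V.
Proof. by apply: lbd_le (lbd_mul (@lbd_hsV 0) (@lbd_hsV 0)); lia. Qed.

Lemma lmul_hs2 N F k t s : lbd N F -> lmul hsL (lmul hs2V F) k t s = lmul hsVL F k t s.
Proof.
move=> lF; rewrite -(lmul_hsA _ _ _ (@lbd_hs2V N) lF); congr (lmul _ F k t s).
by apply/funext => i; apply/funext => x; apply/funext => y; exact: lmul_hsK (@lbd_hsV 0).
Qed.

Lemma lmul_sqrtgV N F k t s : lbd N F -> lmul (sqrtgV L r) F k t s = lmul hsVL F (k + 1) t s.
Proof.
move=> lF; have -> : (sqrtgV L r : fam) = fun k => hsVL (k - (-1)).
  apply/funext => i; apply/funext => x; apply/funext => y.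
  by rewrite [LHS](_ : _ = lmul (rhoX L (-1)) hsVL i x y)// lmul_rho.
by rewrite (lmul_shift (M := 1) _ _ _ (@lbd_hsV N) lF)// opprK.
Qed.

Lemma rho_sqrtgV : lmul (rhoX L 1) (sqrtgV L r) = hsVL.
Proof.
apply/funext => i; apply/funext => x; apply/funext => y; rewrite lmul_rho.
by rewrite [LHS](_ : _ = lmul (rhoX L (-1)) hsVL (i - 1) x y)// lmul_rho; congr (hsVL _ x y); lia.
Qed.

Local Notation eta s := ((l * torsion r s)%:C : C).

Lemma ginv_tt (F : fam) N k t s : lbd N F ->
  lmul (ginv L r i_theta i_theta) F k t s = eta s ^+ 2 * lmul hs2V F k t s + F (k + 2) t s.
Proof.
move=> lF.
have -> : (ginv L r i_theta i_theta : fam) =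
    fun k t s => eta s ^+ 2 * hs2V k t s + rhoX L (-2) k t s.
  rewrite /ginv /entry /i_theta !inordK//=.
  apply/funext => i; apply/funext => x; apply/funext => y.
  rewrite [LHS](_ : _ = lmul (lmul (lmul (lmul (rcst L l) (rcst L l)) (rcoef L (torsion r)))
    (rcoef L (torsion r))) hs2V i x y + rhoX L (-2) i x y)//; congr (_ + _).
  have -> : lmul (lmul (lmul (rcst L l) (rcst L l)) (rcoef L (torsion r))) (rcoef L (torsion r)) =
     coef L (fun _ s => eta s ^+ 2).
    apply/funext => i'; apply/funext => x'; apply/funext => y'.
    rewrite !lmul_coefr /= (realCM l (torsion r y')); case: ifP => _; last by rewrite !(mulr0, mul0r).
    ring.
  by rewrite lmul_coef.
have lr : lbd N.+2 (rhoX L (-2) : fam) by move=> i x y iN /=; case: eqP => // i2; lia.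
have lF' : lbd N.+2 F by apply: lbd_le lF; lia.
rewrite (lmulDl (N := N.+2)) //; last first.
  by move=> i x y iN; rewrite (lbd_hs2V _ _ iN) mulr0.
rewrite (lmulZl (fun _ s => eta s ^+ 2) _ _ _ (@lbd_hs2V N.+2) lF') lmul_rho.
by rewrite opprK.
Qed.

Lemma ginv_ts (F : fam) N k t s (i j : 'I_3) : lbd N F ->
  (i == i_theta) && (j == i_s) || (i == i_s) && (j == i_theta) ->
  lmul (ginv L r i j) F k t s = - eta s * lmul hs2V F k t s.
Proof.
move=> lF ij.
have -> : (ginv L r i j : fam) = fun k t s => - eta s * hs2V k t s.
  have E : (- (Defs.mul (Defs.mul (rcst L l) (rcoef L (torsion r))) (Defs.mul (hsV L r) (hsV L r))) : L) =
      (fun k t s => - eta s * hs2V k t s).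
    apply/funext => i'; apply/funext => x; apply/funext => y.
    rewrite [LHS](_ : _ = - lmul (lmul (rcst L l) (rcoef L (torsion r))) hs2V i' x y)//.
    have -> : lmul (rcst L l) (rcoef L (torsion r)) = coef L (fun _ s => eta s).
      apply/funext => i2; apply/funext => x'; apply/funext => y'.
      rewrite lmul_coef /= (realCM l (torsion r y')); case: ifP => _ //.
      exact: mulr0.
    by rewrite lmul_coef mulNr.
  apply: etrans E; case/orP: ij => /andP[/eqP -> /eqP ->];
    by rewrite /ginv /entry /i_theta /i_s !inordK.
by rewrite (lmulZl (fun _ s => - eta s) _ _ _ (@lbd_hs2V N) lF).
Qed.

Lemma ginv_ss : (ginv L r i_s i_s : fam) = hs2V.
Proof. by rewrite /ginv /entry /i_s !inordK. Qed.

Lemma ginv_rho0 (j : 'I_3) : j != i_rho -> (ginv L r i_rho j = 0) * (ginv L r j i_rho = 0).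
Proof.
by rewrite /ginv /entry /i_rho inordK//; case: j => -[|[|[|]]]//= ? H; exfalso; move: H;
  rewrite -val_eqE /= inordK.
Qed.

Lemma ginv_rr : ginv L r i_rho i_rho = rcst L 1.
Proof. by rewrite /ginv /entry /i_rho !inordK. Qed.

Lemma sum_coord3 (V : zmodType) (F : 'I_3 -> V) :
  \sum_(i < 3) F i = F i_rho + F i_theta + F i_s.
Proof.
rewrite !big_ord_recl big_ord0 addr0 addrA; congr (F _ + F _ + F _); apply: val_inj;
  by rewrite /= /i_rho /i_theta /i_s inordK.
Qed.

Lemma i_neq : [/\ i_theta != i_rho, i_s != i_rho & i_s != i_theta].
Proof. by rewrite -!val_eqE /= /i_rho /i_theta /i_s !inordK. Qed.

Lemma gradE (f : L) i k t s : (grad r f i : fam) k t s =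
  lmul (ginv L r i i_rho) (pd i_rho f) k t s + lmul (ginv L r i i_theta) (pd i_theta f) k t s
  + lmul (ginv L r i i_s) (pd i_s f) k t s.
Proof. by rewrite /grad sum_coord3. Qed.

Lemma sqrtg_grad_rho (f : L) k t s :
  lmul (sqrtg L r) (grad r f i_rho) k t s =
  l%:C * (pd i_rho f : fam) (k - 1) t s - l%:C * kc t s * (pd i_rho f : fam) (k - 2) t s.
Proof.
rewrite lmul_sqrtg lmul_hs; have [n1 n2 _] := i_neq.
have E i x y : (grad r f i_rho : fam) i x y = (pd i_rho f : fam) i x y.
  rewrite gradE ginv_rr lmul_coef mul1r (ginv_rho0 n1).1 (ginv_rho0 n2).1 !lmul0.
  by rewrite !addr0.
by rewrite !E; congr (_ - _ * (pd i_rho f : fam) _ t s); lia.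
Qed.

Lemma sqrtg_grad_s (f : L) N k t s : lbd N (pd i_theta f : fam) -> lbd N (pd i_s f : fam) ->
  lmul (sqrtg L r) (grad r f i_s) k t s =
  lmul hsVL (pd i_s f) (k - 1) t s - eta s * lmul hsVL (pd i_theta f) (k - 1) t s.
Proof.
move=> lt ls; have [n1 n2 n3] := i_neq.
rewrite lmul_sqrtg -(lmul_hs2 _ _ _ lt) -(lmul_hs2 _ _ _ ls) !lmul_hs.
have E i x y : (grad r f i_s : fam) i x y =
    lmul hs2V (pd i_s f) i x y - eta y * lmul hs2V (pd i_theta f) i x y.
  rewrite gradE (ginv_rho0 n2).2 lmul0 add0r (ginv_ts _ _ _ lt) ?eqxx ?orbT//.
  by rewrite ginv_ss mulNr addrC.
by rewrite !E; ring.
Qed.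

Lemma sqrtg_grad_theta (f : L) N k t s : lbd N (pd i_theta f : fam) -> lbd N (pd i_s f : fam) ->
  lmul (sqrtg L r) (grad r f i_theta) k t s =
  l%:C * (pd i_theta f : fam) (k + 1) t s - l%:C * kc t s * (pd i_theta f : fam) k t s
  - eta s * (lmul hsVL (pd i_s f) (k - 1) t s - eta s * lmul hsVL (pd i_theta f) (k - 1) t s).
Proof.
move=> lt ls; have [n1 n2 n3] := i_neq.
rewrite lmul_sqrtg -(lmul_hs2 _ _ _ lt) -(lmul_hs2 _ _ _ ls) !lmul_hs.
have E i x y : (grad r f i_theta : fam) i x y = (eta y ^+ 2 * lmul hs2V (pd i_theta f) i x y +
    (pd i_theta f : fam) (i + 2) x y) - eta y * lmul hs2V (pd i_s f) i x y.
  rewrite gradE (ginv_rho0 n1).2 lmul0 add0r (ginv_tt _ _ _ lt) (ginv_ts _ _ _ ls) ?eqxx//.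
  by rewrite mulNr.
rewrite !E; have -> : k - 1 + 2 = k + 1 by lia. have -> : k - 1 - 1 + 2 = k by lia.
ring.
Qed.

Variable B0 : R -> C.
Definition lB : fam := fun k t s => l%:C * B0 s * hsVL k t s.

Lemma btildeE i k t s : (Btilde L r B0 i : fam) k t s = B0 s * l%:C * (ginv L r i i_s : fam) k t s.
Proof.
rewrite [LHS](_ : _ = lmul (lmul (coef L (fun _ s => B0 s)) (rcst L l)) (ginv L r i i_s) k t s)//.
have -> : lmul (coef L (fun _ s => B0 s)) (rcst L l) = coef L (fun _ s => B0 s * l%:C).
  apply/funext => i2; apply/funext => x'; apply/funext => y'; rewrite lmul_coef /=.
  by case: ifP; rewrite ?mulr0.
by rewrite lmul_coef.
Qed.

Lemma sqrtg_B_rho k t s : lmul (sqrtg L r) (Btilde L r B0 i_rho) k t s = 0.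
Proof.
by have [n1 n2 n3] := i_neq; rewrite lmul_sqrtg lmul_hs !btildeE (ginv_rho0 n2).1 !mulr0 subr0.
Qed.

Lemma lmul_hs_hs2V k t s : lmul hsL hs2V k t s = hsVL k t s.
Proof. exact: lmul_hsK (@lbd_hsV 0). Qed.

Lemma sqrtg_B_s k t s : lmul (sqrtg L r) (Btilde L r B0 i_s) k t s = lB (k - 1) t s.
Proof.
by rewrite lmul_sqrtg /lB -lmul_hs_hs2V !lmul_hs !btildeE ginv_ss; ring.
Qed.

Lemma sqrtg_B_theta k t s : lmul (sqrtg L r) (Btilde L r B0 i_theta) k t s =
  - eta s * lB (k - 1) t s.
Proof.
have E i x y : (ginv L r i_theta i_s : fam) i x y = - eta y * hs2V i x y.
  have := @ginv_ts (rcst L 1) 0 i x y i_theta i_s _ _; rewrite !eqxx => /(_ _ isT).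
  rewrite !lmul_coefr !mulr1; apply=> i' x' y' i0 /=.
  by case: eqP => // ?; lia.
by rewrite lmul_sqrtg /lB -lmul_hs_hs2V !lmul_hs !btildeE !E; ring.
Qed.

End LaurentGeometry.

Section Coordinates.
Variables (A : Type) (x0 x1 x2 : A).

Lemma coord3_rho : coord3 x0 x1 x2 i_rho = x0.
Proof. by rewrite /coord3 /i_rho /= inordK. Qed.
Lemma coord3_theta : coord3 x0 x1 x2 i_theta = x1.
Proof. by rewrite /coord3 /i_theta /= inordK. Qed.
Lemma coord3_s : coord3 x0 x1 x2 i_s = x2.
Proof. by rewrite /coord3 /i_s /= inordK. Qed.

End Coordinates.

(** * The regularized equation, order by order *)

Section LaurentEquation.
Variable R : realType.
Local Notation C := R[i].
Local Notation fam := (int -> R -> R -> C).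
Local Notation L := (laurent R).
Variables (r : R -> 'rV[R]_3) (K : R) (D : nat) (B0 : R -> C).
Local Notation l := (ell r).
Local Notation kap := (curvature r).
Local Notation tau := (torsion r).
Local Notation kc := (kcos r).
Local Notation hsVL := (hsV L r : fam).
Hypothesis l0 : l != 0.
Hypothesis D0 : (0 < D)%N.
Hypothesis kapd : forall s, exists k', rd kap s k'.
Hypothesis taud : forall s, exists t', rd tau s t'.
Hypothesis B0d : forall s, cderivable B0 s.
Variables (a U : nat -> nat -> R -> C).
Hypothesis ta : tfam a.
Hypothesis tU : tfam U.
Hypothesis ac : forall m n, cCk (2 * D) (a m n).
Hypothesis Ud : forall m n s, cderivable (U m n) s.

Definition source m n : R -> C := if (m == 0%N) && (n == 0%N) then B0 else fun=> 0.

Hypothesis HU : recU l^-1 tau kap a U source.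
Implicit Types (F X f : fam) (k : int) (t s : R).

Lemma pd_rhoE (f : L) : pd i_rho f = (fun k t s => (k + 1)%:~R * (f : fam) (k + 1) t s) :> fam.
Proof. by rewrite /=; rewrite coord3_rho. Qed.
Lemma pd_thetaE (f : L) : pd i_theta f = (fun k t s => cderive (fun x => (f : fam) k x s) t) :> fam.
Proof. by rewrite /=; rewrite coord3_theta. Qed.
Lemma pd_sE (f : L) : pd i_s f = (fun k t s => cderive ((f : fam) k t) s) :> fam.
Proof. by rewrite /=; rewrite coord3_s. Qed.

Lemma famP (f g : fam) : (forall k t s, f k t s = g k t s) -> f = g.
Proof. by move=> H; apply/funext => k; apply/funext => t; apply/funext => s. Qed.

Lemma pd_theta_formalf (b : nat -> nat -> R -> C) : pd i_theta (formalf b : L) = formalf (fj b) :> fam.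
Proof. by rewrite pd_thetaE; apply: famP => k t s; apply: cd_cderive; exact: formalf_cd_t. Qed.
Lemma pd_s_formalf (b : nat -> nat -> R -> C) : (forall m n s, cderivable (b m n) s) ->
  pd i_s (formalf b : L) = formalf (fd b) :> fam.
Proof. by move=> bd; rewrite pd_sE; apply: famP => k t s; apply: cd_cderive; exact: formalf_cd_s. Qed.

Lemma lbd_formalf N (b : nat -> nat -> R -> C) : lbd N (formalf b).
Proof. by move=> [m|m] t s kN //=; lia. Qed.

(** The predicate [P n] records the regularity still needed for n further applications, as each use
    of a differential operator consumes some. *)
Lemma iter_formalf (G : fam -> fam) (h : (nat -> nat -> R -> C) -> nat -> nat -> R -> C)
    (P : nat -> (nat -> nat -> R -> C) -> Prop) n b :
  (forall n b, P n.+1 b -> G (formalf b) = formalf (h b) /\ P n (h b)) ->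
  P n b -> iter n G (formalf b) = formalf (iter n h b).
Proof.
move=> H; elim: n b => [|n IH] b Pb //; have [E Pb'] := H _ _ Pb.
by rewrite !iterSr E IH.
Qed.

(** By the definition of [ell]; hence the s-operator in P is a plain power of d/ds. *)
Lemma speed_ratio : curve_length r / (2 * pi * l) = 1.
Proof.
have p0 : 2 * pi != 0 :> R by rewrite mulf_neq0// gt_eqF// pi_gt0.
have E : curve_length r = l * (2 * pi) by rewrite /ell divfK.
by rewrite E (mulrC (2 * pi)) divff// mulf_neq0.
Qed.

Local Opaque torsion curvature ell cderive.

Lemma rcst_formalf (x : R) (b : nat -> nat -> R -> C) :
  lmul (rcst L x) (formalf b) = formalf (fun m n s => x%:C * b m n s).
Proof. by apply: famP => k t s; rewrite lmul_coef -(formalf_coef (fun=> x%:C)). Qed.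

Lemma Ds_formalf (b : nat -> nat -> R -> C) : (forall m n s, cderivable (b m n) s) ->
  lmul (rcst L (curve_length r / (2 * pi * l))) (pd i_s (formalf b : L)) = formalf (fd b).
Proof.
move=> bd; rewrite speed_ratio pd_s_formalf// rcst_formalf.
by apply: famP => k t s; apply: eq_formalf => m n _; rewrite mul1r.
Qed.

Lemma Pop_s_formalf (b : nat -> nat -> R -> C) : (forall m n, cCk (2 * D) (b m n)) ->
  iter D (fun g : fam => lmul (rcst L (- K ^- 2)) (lmul (rcst L (curve_length r / (2 * pi * l)))
     (pd i_s (lmul (rcst L (curve_length r / (2 * pi * l))) (pd i_s (g : L)) : L)))) (formalf b)
  = formalf (fun m n => Kop K D (b m n)).
Proof.
move=> bc.
rewrite (@iter_formalf _ (fun b m n s => (- K ^- 2)%:C * cderive (cderive (b m n)) s)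
  (fun n b => forall m n', cCk (2 * n) (b m n')))//.
  congr formalf; move: (D) => n; elim: n => [|n IH]; first by [].
  by rewrite iterS IH.
move=> n {}b {}bc.
have bc' m n' : cCk (2 * n).+2 (b m n').
  by have -> : ((2 * n).+2 = 2 * n.+1)%N; [rewrite mulnS|exact: bc].
have c1 m n' s : cderivable (b m n') s by have /cCkS[h _] := bc' m n'.
have bd' m n' : cCk (2 * n).+1 (cderive (b m n')) by have /cCkS[_ h] := bc' m n'.
have c2 m n' s : cderivable (fd b m n') s by have /cCkS[h _] := bd' m n'.
split; first by rewrite (Ds_formalf c1) (Ds_formalf c2) rcst_formalf.
by move=> m n'; apply: cCkZ; have /cCkS[_ h] := bd' m n'.
Qed.

Lemma Pop_t_formalf (b : nat -> nat -> R -> C) :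
  iter D (fun g : fam => lmul (rcst L (- K ^- 2)) (pd i_theta (pd i_theta (g : L) : L))) (formalf b)
  = formalf (fun m n' s => (symb K D (jf m n'))%:C * b m n' s).
Proof.
rewrite (@iter_formalf _ (fun b m n s => (K ^- 2 * (jf m n)%:~R ^+ 2)%:C * b m n s) (fun _ _ => True))//.
  congr formalf; move: (D) => n; elim: n => [|n IH].
    by apply/funext => m; apply/funext => n; apply/funext => s; rewrite /symb expr0 mul1r.
  rewrite iterS IH; apply/funext => m; apply/funext => n'; apply/funext => s.
  by rewrite mulrA -realCM /symb -exprS.
move=> n {}b _; split=> //; rewrite !pd_theta_formalf rcst_formalf.
congr formalf; apply/funext => m; apply/funext => n'; apply/funext => s.
rewrite /fj /rowj (realCM (K ^- 2)) intrCE realCX.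
have JJ : 'i * 'i = -1 :> C by rewrite -expr2 sqr_i.
set J := ((jf m n')%:~R : R)%:C.
have -> : 'i * J * ('i * J * b m n' s) = ('i * 'i) * J ^+ 2 * b m n' s by ring.
by rewrite JJ realCN; ring.
Qed.

Lemma Pop_formalf : Pop r K D (formalf a : L) = formalf (fP K D a) :> fam.
Proof.
apply: famP => k t s; rewrite [LHS](_ : _ =
  iter D (fun g : fam => lmul (rcst L (- K ^- 2)) (lmul (rcst L (curve_length r / (2 * pi * l)))
     (pd i_s (lmul (rcst L (curve_length r / (2 * pi * l))) (pd i_s (g : L)) : L)))) (formalf a) k t s +
  iter D (fun g : fam => lmul (rcst L (- K ^- 2)) (pd i_theta (pd i_theta (g : L) : L))) (formalf a) k t s)//.
rewrite (Pop_s_formalf ac) Pop_t_formalf -[X in X + _]mul1r -[X in _ + X]mul1r -formalf_lin.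
by apply: eq_formalf => m n _; rewrite /fP !mul1r.
Qed.

Lemma kc_cd_t t s : exists z, cd (fun x => kc x s) t z.
Proof.
exists ((kap s * - sin t)%:C); apply: cd_real.
by have := rdM (rd_cst (kap s) t) (rd_cos t); rewrite mul0r add0r.
Qed.
Lemma kc_cd_s t s : exists z, cd (fun x => kc t x) s z.
Proof.
have [k' h] := kapd s; exists ((k' * cos t + kap s * 0)%:C); apply: cd_real.
exact: rdM h (rd_cst (cos t) s).
Qed.

Definition smooth F := forall k t s,
  (exists z, cd (fun x => F k x s) t z) /\ (exists z, cd (fun x => F k t x) s z).

(** The recurrence for division by h_s expresses each coefficient through the preceding one, so
    differentiability climbs from the vanishing low orders. *)
Lemma smooth_hsV N F : lbd N F -> smooth F -> smooth (lmul hsVL F).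
Proof.
move=> lF sF k t s.
have lV : lbd (N + N) (lmul hsVL F) by apply: lbd_mul lF; exact: lbd_hsV.
suff H n : (forall t s, (exists z, cd (fun x => lmul hsVL F (n%:Z - (N + N).+1%:Z) x s) t z) /\
   (exists z, cd (fun x => lmul hsVL F (n%:Z - (N + N).+1%:Z) t x) s z)).
  have [kN|Nk] := ltP k (- (N + N)%:Z).
    by split; exists 0; [apply: eq_cd (cd_cst 0 t)|apply: eq_cd (cd_cst 0 s)] => x; rewrite lV.
  have -> : k = Posz (absz (k + (N + N).+1%:Z)) - (N + N).+1%:Z by lia.
  exact: H.
elim: n => [|n IH] {}t {}s.
  by split; exists 0; [apply: eq_cd (cd_cst 0 t)|apply: eq_cd (cd_cst 0 s)] => x; rewrite lV//; lia.
have E x y : lmul hsVL F (n.+1%:Z - (N + N).+1%:Z) x y =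
   (l^-1)%:C * F (n.+1%:Z - (N + N).+1%:Z) x y + kc x y * lmul hsVL F (n%:Z - (N + N).+1%:Z) x y.
  have e : n.+1%:Z - (N + N).+1%:Z - 1 = n%:Z - (N + N).+1%:Z by lia.
  by rewrite -e; exact: (lmul_hsV_rec l0 _ _ _ lF).
have [[z1 h1] [z2 h2]] := sF (n.+1%:Z - (N + N).+1%:Z) t s.
have [[y1 g1] [y2 g2]] := IH t s.
have [x1 f1] := kc_cd_t t s; have [x2 f2] := kc_cd_s t s.
split.
  by eexists; apply: eq_cd (cdD (cdZ _ h1) (cdM f1 g1)) => x; rewrite E.
by eexists; apply: eq_cd (cdD (cdZ _ h2) (cdM f2 g2)) => x; rewrite E.
Qed.

Lemma smooth_formalf (b : nat -> nat -> R -> C) : (forall m n s, cderivable (b m n) s) -> smooth (formalf b).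
Proof.
by move=> bd k t s; split; eexists; [exact: formalf_cd_t|exact: formalf_cd_s].
Qed.

Lemma smoothB F X : smooth F -> smooth X -> smooth (fun k t s => F k t s - X k t s).
Proof.
move=> sF sX k t s; have [[? a1] [? a2]] := sF k t s; have [[? b1] [? b2]] := sX k t s.
by split; eexists; [exact: cdB a1 b1|exact: cdB a2 b2].
Qed.

Lemma smoothM (h : R -> C) F : (forall s, exists z, cd h s z) -> smooth F ->
  smooth (fun k t s => h s * F k t s).
Proof.
move=> hd sF k t s; have [[? a1] [? a2]] := sF k t s; have [z hz] := hd s.
by split; eexists; [exact: cdZ a1|exact: cdM hz a2].
Qed.

Lemma cdt_smooth F k t s : smooth F -> cd (fun x => F k x s) t (cderive (fun x => F k x s) t).
Proof. by move=> sF; have [[z h] _] := sF k t s; apply: cderivable_cd; exact: cd_cderivable h. Qed.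
Lemma cds_smooth F k t s : smooth F -> cd (F k t) s (cderive (F k t) s).
Proof. by move=> sF; have [_ [z h]] := sF k t s; apply: cderivable_cd; exact: cd_cderivable h. Qed.

Local Notation eta s := ((l * tau s)%:C : C).
Local Notation chi s := ((l * kap s)%:C : C).

Lemma a_cd m n s : cderivable (a m n) s.
Proof.
have /(cCk_le (k := 1)) : cCk (2 * D) (a m n) := ac m n.
by case: (D) D0 => // D' _ /(_ isT)/cCkS[].
Qed.

Lemma fj_cd m n s : cderivable (fj a m n) s.
Proof. by apply: cd_cderivable; apply: cdZ; apply: cderivable_cd; exact: a_cd. Qed.
Lemma fd_cd m n s : cderivable (fd a m n) s.
Proof.
have /(cCk_le (k := 2)) : cCk (2 * D) (a m n) := ac m n.
case: (D) D0 => // D' _ /(_ _)/cCkS[]; first by rewrite mulnS.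
by move=> _ /cCkS[].
Qed.

(** The share of phi in U. The flux of phi and that of B_0 sit on opposite sides of the equation,
    each with its own 1/h_s; only their sum [w1 + w2] is U. *)
Definition w1 : fam := fun k t s =>
  lmul hsVL (formalf (fd a)) k t s - eta s * lmul hsVL (formalf (fj a)) k t s.
Local Notation w2 := (lB r B0).

Lemma eta_cd s : exists z, cd (fun s => eta s) s z.
Proof.
have [t' h] := taud s; exists ((0 * tau s + l * t')%:C); apply: cd_real.
exact: rdM (rd_cst l s) h.
Qed.

Lemma smooth_w1 : smooth w1.
Proof.
apply: smoothB; last apply: smoothM; try exact: eta_cd.
  by apply: (smooth_hsV (@lbd_formalf 0 _)); apply: smooth_formalf; exact: fd_cd.
by apply: (smooth_hsV (@lbd_formalf 0 _)); apply: smooth_formalf; exact: fj_cd.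
Qed.

Lemma w2E k t s : w2 k t s = lmul hsVL (coef L (fun _ s => l%:C * B0 s)) k t s.
Proof. by rewrite lmul_coefr mulrC. Qed.

Lemma smooth_w2 : smooth w2.
Proof.
have E : w2 = lmul hsVL (coef L (fun _ s => l%:C * B0 s)) by apply: famP; exact: w2E.
rewrite E; apply: (@smooth_hsV 0) => [k t s k0 /=|k t s]; first by case: eqP => // ?; lia.
rewrite /=; case: eqP => _; last by split; exists 0; exact: cd_cst.
split; first by exists 0; exact: cd_cst.
by eexists; exact: cdZ (cderivable_cd (B0d s)).
Qed.

Lemma recU_mul m n s : (n <= m)%N ->
  l%:C * U m n s - chi s * fcos U m n s =
  fd a m n s - eta s * fj a m n s + l%:C * source m n s.
Proof.
move=> nm; have lC : l%:C != 0 :> C by rewrite realC_eq0.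
rewrite HU// /fd /fj /urow /rowB /rowZ /rowM /rowd (realCM l (tau s)) (realCM l (kap s)).
rewrite (realCV l); case: m nm => [|m] nm; rewrite /fcos /kmix /rowM /rowZ /rowD /z0.
  by rewrite mulr0; field.
by field.
Qed.

Lemma w_sum k t s : w1 k t s + w2 k t s = formalf U k t s.
Proof.
have lf b := @lbd_formalf 0 b.
have lc (c : R -> R -> C) : lbd 0 (coef L c : fam) by move=> i x y i0 /=; case: eqP => // ?; lia.
have ls : lbd 0 (fun k t s => formalf (fd a) k t s + - eta s * formalf (fj a) k t s).
  by move=> i x y i0; rewrite !lf// mulr0 addr0.
have -> : w1 k t s + w2 k t s = lmul hsVL (fun k t s =>
   (formalf (fd a) k t s + (- eta s) * formalf (fj a) k t s) + (coef L (fun _ s => l%:C * B0 s) : fam) k t s) k t s.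
  rewrite (lmulDr _ _ _ (@lbd_hsV _ r l0 0) ls (lc _)) -w2E; congr (_ + _).
  have lz : lbd 0 (fun k t s => - eta s * formalf (fj a) k t s).
    by move=> i x y i0; rewrite lf// mulr0.
  rewrite (lmulDr _ _ _ (@lbd_hsV _ r l0 0) (lf _) lz).
  by rewrite (lmulZr (fun _ s => - eta s) _ _ _ (@lbd_hsV _ r l0 0) (lf _)) mulNr.
refine (lmul_hsV_unique l0 (N := 0) (X := formalf U) _ _ _ k t s) => [||i x y].
- by move=> i x y i0; rewrite ls// lc// addr0.
- exact: lf.
have kE : l%:C * kc x y = chi y * (cos x)%:C by rewrite /kcos -!realCM mulrA.
rewrite kE -mulrA formalf_cos//.
rewrite -mulNr -(formalf_coef (fun y => - chi y)) -(formalf_coef (fun y => - eta y)).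
rewrite -(formalf_coef (fun _ => l%:C)).
have sE : (coef L (fun _ s => l%:C * B0 s) : fam) i x y = formalf (fun m n s => l%:C * source m n s) i x y.
  case: i => [[|m]|m] //=.
    by rewrite /rowf big_ord_recl big_ord0 addr0 /source /= eik0 mulr1.
  by rewrite /rowf big1// => n _; rewrite /source /= mulr0 mul0r.
rewrite sE -[X in X + _ = _]mul1r -[X in _ + X = _]mul1r -formalf_lin.
rewrite -[X in X + _ + _]mul1r -[X in _ + X + _]mul1r -formalf_lin -[X in X + _]mul1r -[X in _ + X]mul1r -formalf_lin.
apply: eq_formalf => m n nm; rewrite !mul1r !mulNr; exact: recU_mul.
Qed.

(** The divergence before division by sqrt g; it involves 1/h_s only through the fluxes. *)
Definition fluxdiv (V : 'I_3 -> L) : fam := fun k t s =>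
  (k + 1)%:~R * lmul (sqrtg L r) (V i_rho) (k + 1) t s +
  cderive (fun x => lmul (sqrtg L r) (V i_theta) k x s) t +
  cderive (fun x => lmul (sqrtg L r) (V i_s) k t x) s.

Lemma divergenceE (V : 'I_3 -> L) : divergence r V = lmul (sqrtgV L r) (fluxdiv V) :> fam.
Proof.
rewrite /divergence; congr (lmul _ _); rewrite sum_coord3.
apply: famP => k t s.
rewrite [LHS](_ : _ = (pd i_rho (lmul (sqrtg L r) (V i_rho) : L) : fam) k t s +
  (pd i_theta (lmul (sqrtg L r) (V i_theta) : L) : fam) k t s +
  (pd i_s (lmul (sqrtg L r) (V i_s) : L) : fam) k t s)//.
by rewrite pd_rhoE pd_thetaE pd_sE.
Qed.

(** The factor h_s undoes the 1/h_s in 1/sqrt g, and the remaining 1/rho is a shift of the order by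
    one. This is why the equation is multiplied by h_s. *)
Lemma hs_divergence N (V : 'I_3 -> L) k t s : lbd N (fluxdiv V) ->
  lmul (hs L r) (divergence r V) k t s = fluxdiv V (k + 1) t s.
Proof.
move=> lF; rewrite divergenceE -[RHS](lmul_hsK l0 _ _ _ lF) !lmul_hs.
have e : k - 1 + 1 = k + 1 - 1 by lia.
by rewrite (lmul_sqrtgV l0 k t s lF) (lmul_sqrtgV l0 (k - 1) t s lF) e.
Qed.

Local Notation phi := (formalf a : L).

Lemma pd_theta_phi : pd i_theta phi = formalf (fj a) :> fam.
Proof. exact: pd_theta_formalf. Qed.
Lemma pd_s_phi : pd i_s phi = formalf (fd a) :> fam.
Proof. by apply: pd_s_formalf; exact: a_cd. Qed.

(* [l b - chi rho cos theta b], the product of [h_s] with a series. *)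
Definition hfam (b : nat -> nat -> R -> C) m n s : C := l%:C * b m n s - chi s * fcos b m n s.

Lemma hfamE (b : nat -> nat -> R -> C) k t s : tfam b ->
  l%:C * formalf b k t s - l%:C * kc t s * formalf b (k - 1) t s = formalf (hfam b) k t s.
Proof.
move=> tb; have kE : l%:C * kc t s = chi s * (cos t)%:C by rewrite /kcos -!realCM mulrA.
rewrite kE -mulrA formalf_cos// -mulNr -(formalf_coef (fun y => - chi y)) -(formalf_coef (fun _ => l%:C)).
rewrite -[X in X + _]mul1r -[X in _ + X]mul1r -formalf_lin; apply: eq_formalf => m n _.
by rewrite !mul1r mulNr.
Qed.

Lemma flux_rho k t s : lmul (sqrtg L r) (grad r phi i_rho) k t s = formalf (hfam (fe a)) k t s.
Proof.
rewrite (sqrtg_grad_rho l0) pd_rhoE -(hfamE _ _ _ (tfam_fe ta)).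
have -> : k - 1 + 1 = k by lia. have -> : k - 2 + 1 = k - 1 by lia.
by rewrite !formalf_e.
Qed.

Lemma flux_theta k t s : lmul (sqrtg L r) (grad r phi i_theta) k t s =
  formalf (hfam (fj a)) (k + 1) t s - eta s * w1 (k - 1) t s.
Proof.
have lt : lbd 0 (pd i_theta phi : fam) by rewrite pd_theta_phi; exact: lbd_formalf.
have ls : lbd 0 (pd i_s phi : fam) by rewrite pd_s_phi; exact: lbd_formalf.
rewrite (sqrtg_grad_theta l0 _ _ _ lt ls) pd_theta_phi pd_s_phi.
rewrite -(hfamE _ _ _ (tfam_fj ta)) /w1.
by have -> : k + 1 - 1 = k by lia.
Qed.

Lemma flux_s k t s : lmul (sqrtg L r) (grad r phi i_s) k t s = w1 (k - 1) t s.
Proof.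
have lt : lbd 0 (pd i_theta phi : fam) by rewrite pd_theta_phi; exact: lbd_formalf.
have ls : lbd 0 (pd i_s phi : fam) by rewrite pd_s_phi; exact: lbd_formalf.
by rewrite (sqrtg_grad_s l0 _ _ _ lt ls) pd_theta_phi pd_s_phi.
Qed.


Lemma fluxdiv_grad k t s : fluxdiv (grad r phi) k t s =
  formalf (fe (hfam (fe a))) (k + 1) t s + (formalf (fj (hfam (fj a))) (k + 1) t s
  - eta s * cderive (fun x => w1 (k - 1) x s) t) + cderive (w1 (k - 1) t) s.
Proof.
rewrite /fluxdiv flux_rho formalf_e; congr (_ + _ + _).
  apply: cd_cderive; have := cdB (formalf_cd_t (hfam (fj a)) (k + 1) t s) (cdZ (eta s) (cdt_smooth (k - 1) t s smooth_w1)).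
  by apply: eq_cd => x; rewrite flux_theta.
by congr (cderive _ s); apply/funext => x; rewrite flux_s.
Qed.

Lemma fluxdiv_B k t s : fluxdiv (Btilde L r B0) k t s =
  - (eta s * cderive (fun x => w2 (k - 1) x s) t) + cderive (w2 (k - 1) t) s.
Proof.
rewrite /fluxdiv (sqrtg_B_rho l0) mulr0 add0r; congr (_ + _).
  apply: cd_cderive; have := cdN (cdZ (eta s) (cdt_smooth (k - 1) t s smooth_w2)).
  by apply: eq_cd => x; rewrite (sqrtg_B_theta l0) mulNr.
by congr (cderive _ s); apply/funext => x; rewrite (sqrtg_B_s l0).
Qed.

Lemma lbd_w1 : lbd 0 w1.
Proof.
move=> k t s k0; have lV b : lbd 0 (lmul hsVL (formalf b)).
  by apply: (@lbd_mul _ 0); [exact: lbd_hsV|exact: lbd_formalf].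
by rewrite /w1 !lV// mulr0 subr0.
Qed.
Lemma lbd_w2 : lbd 0 w2.
Proof. by move=> k t s k0; rewrite /lB (@lbd_hsV _ r l0 0)// mulr0. Qed.

Lemma cderive_zero (f : R -> C) x : (forall y, f y = 0) -> cderive f x = 0.
Proof. by move=> f0; apply: cd_cderive; apply: eq_cd (cd_cst 0 x) => y; rewrite f0. Qed.

Lemma lbd_fluxdiv_grad : lbd 2 (fluxdiv (grad r phi)).
Proof.
move=> k t s k2; have k1 : (k - 1 < - 0%:Z)%R by lia. have k3 : (k + 1 < - 0%:Z)%R by lia.
rewrite fluxdiv_grad !(@lbd_formalf 0 _ _ _ _ k3).
have zt : cderive (fun x => w1 (k - 1) x s) t = 0.
  by apply: cderive_zero => x; exact: lbd_w1 _ _ k1.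
have zs : cderive (w1 (k - 1) t) s = 0 by apply: cderive_zero => x; exact: lbd_w1 _ _ k1.
by have arith (A B e : C) : A = 0 -> B = 0 -> 0 + (0 - e * A) + B = 0;
  [move=> -> ->; rewrite mulr0 subr0 !addr0|exact: arith zt zs].
Qed.

Lemma lbd_fluxdiv_B : lbd 2 (fluxdiv (Btilde L r B0)).
Proof.
move=> k t s k2; have k1 : (k - 1 < - 0%:Z)%R by lia.
have zt : cderive (fun x => w2 (k - 1) x s) t = 0.
  by apply: cderive_zero => x; exact: lbd_w2 _ _ k1.
have zs : cderive (w2 (k - 1) t) s = 0 by apply: cderive_zero => x; exact: lbd_w2 _ _ k1.
rewrite fluxdiv_B.
by have arith (A B e : C) : A = 0 -> B = 0 -> - (e * A) + B = 0;
  [move=> -> ->; rewrite mulr0 oppr0 addr0|exact: arith zt zs].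
Qed.

Lemma lap_perpE k t s : (lap_perp (Pop r K D phi) : fam) k t s =
  formalf (fe (fe (fP K D a))) (k + 2) t s + formalf (fj (fj (fP K D a))) (k + 2) t s.
Proof.
rewrite [LHS](_ : _ = lmul (rhoX L (-1)) (pd i_rho (lmul (rhoX L 1) (pd i_rho (Pop r K D phi)) : L)) k t s
  + lmul (rhoX L (-2)) (pd i_theta (pd i_theta (Pop r K D phi))) k t s)//.
rewrite !lmul_rho Pop_formalf !pd_theta_formalf !opprK; congr (_ + _).
rewrite pd_rhoE lmul_rho pd_rhoE.
have -> : k + 1 + 1 = k + 2 by lia. have -> : k + 2 - 1 + 1 = k + 2 by lia.
by rewrite !formalf_e.
Qed.

Lemma fj_add (b c : nat -> nat -> R -> C) :
  fj (fun m n s => b m n s + c m n s) = fun m n s => fj b m n s + fj c m n s.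
Proof. by apply/funext => m; apply/funext => n; apply/funext => s; rewrite /fj /rowj mulrDr. Qed.
Lemma fe_add (b c : nat -> nat -> R -> C) :
  fe (fun m n s => b m n s + c m n s) = fun m n s => fe b m n s + fe c m n s.
Proof. by apply/funext => m; apply/funext => n; apply/funext => s; rewrite /fe mulrDr. Qed.
Lemma formalf_add (b c : nat -> nat -> R -> C) k t s :
  formalf (fun m n s => b m n s + c m n s) k t s = formalf b k t s + formalf c k t s.
Proof. by rewrite -[RHS]mulr1 mulrDl -[X in X + _]mulrC -[X in _ + X]mulrC -formalf_lin; apply: eq_formalf => m n _; rewrite !mul1r. Qed.

Lemma w_cderive_t k t s : cderive (fun x => w1 k x s) t + cderive (fun x => w2 k x s) t =
  formalf (fj U) k t s.
Proof.
apply: cd_unique (formalf_cd_t U k t s).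
have := cdD (cdt_smooth k t s smooth_w1) (cdt_smooth k t s smooth_w2).
by apply: eq_cd => x; rewrite w_sum.
Qed.
Lemma w_cderive_s k t s : cderive (w1 k t) s + cderive (w2 k t) s = formalf (fd U) k t s.
Proof.
apply: cd_unique (formalf_cd_s k t (fun m n => Ud m n s)).
have := cdD (cds_smooth k t s smooth_w1) (cds_smooth k t s smooth_w2).
by apply: eq_cd => x; rewrite w_sum.
Qed.

Lemma tfam_du : tfam (fun m n s => fd U m n s - eta s * fj U m n s).
Proof.
move=> m n mn; apply/funext => s; rewrite /fd /rowd /fj /rowj tU// cderive0.
by rewrite !mulr0 subrr.
Qed.

Lemma formalf_du k t s : formalf (fun m n s => fd U m n s - eta s * fj U m n s) k t s =
  formalf (fd U) k t s - eta s * formalf (fj U) k t s.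
Proof.
rewrite -mulNr -(formalf_coef (fun s => - eta s)) -formalf_add.
by apply: eq_formalf => m n _; rewrite mulNr.
Qed.

Lemma formalf_eqfam k t s :
  formalf (eqfam K D l (fun s => l * kap s) (fun s => l * tau s) a U) k t s =
  (formalf (fe (hfam (fe a))) k t s + formalf (fe (fe (fP K D a))) k t s) +
  (formalf (fj (hfam (fj a))) k t s + formalf (fj (fj (fP K D a))) k t s) +
  (formalf (fd U) (k - 2) t s - eta s * formalf (fj U) (k - 2) t s).
Proof.
rewrite -formalf_du (formalf_sq _ _ _ tfam_du).
pose X m n s := hfam (fe a) m n s + fe (fP K D a) m n s.
pose Y m n s := hfam (fj a) m n s + fj (fP K D a) m n s.
have -> : eqfam K D l (fun s => l * kap s) (fun s => l * tau s) a U = (fun m n s => (fe X m n s + fj Y m n s) +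
    fsq (fun m n s => fd U m n s - eta s * fj U m n s) m n s) by [].
rewrite (formalf_add (fun m n s => fe X m n s + fj Y m n s)) (formalf_add (fe X) (fj Y)).
by rewrite (fe_add (hfam (fe a))) (fj_add (hfam (fj a))) (formalf_add (fe _)) (formalf_add (fj _)).
Qed.

Lemma residual_arith (A B E F w1t w1s w2t w2s ut us e : C) :
  w1t + w2t = ut -> w1s + w2s = us ->
  A + (B - e * w1t) + w1s + (E + F) + (- (e * w2t) + w2s) =
  (A + E) + (B + F) + (us - e * ut).
Proof. by move=> <- <-; ring. Qed.

(** The order is shifted by 2 because [eqfam] is the equation multiplied by rho^2; adding the source
    combines [w1] and [w2] into U. *)
Lemma residualE k t s :
  fluxdiv (grad r phi) (k + 1) t s + (lap_perp (Pop r K D phi) : fam) k t s +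
  fluxdiv (Btilde L r B0) (k + 1) t s =
  formalf (eqfam K D l (fun s => l * kap s) (fun s => l * tau s) a U) (k + 2) t s.
Proof.
rewrite fluxdiv_grad fluxdiv_B lap_perpE formalf_eqfam.
have -> : k + 1 - 1 = k by lia. have -> : k + 1 + 1 = k + 2 by lia.
have -> : k + 2 - 2 = k by lia.
exact: residual_arith (w_cderive_t k t s) (w_cderive_s k t s).
Qed.

(** Coefficient k of the equation times h_s is row k + 2 of [eqfam], whose entries vanish exactly
    when the mode equations hold. Existence reads the equivalence from right to left, uniqueness
    from left to right. *)
Lemma poisson_recA : regularized_poisson r K D B0 (formal a) <->
  recA K D l (fun s => l * kap s) (fun s => l * tau s) 1 a U (fun _ => @z0 R).
Proof.
rewrite formalE -(eqfam_recA K D l _ _ ta tU) -formalf0.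
have lhs k t s : lmul (hs L r) ((laplacian r phi : fam) +
    lmul (lmul (rhoX L 1) (sqrtgV L r)) (lap_perp (Pop r K D phi))) k t s =
    fluxdiv (grad r phi) (k + 1) t s + (lap_perp (Pop r K D phi) : fam) k t s.
  have lY : lbd 2 (lap_perp (Pop r K D phi) : fam).
    move=> i x y i2; have i3 : (i + 2 < - 0%:Z)%R by lia.
    by rewrite lap_perpE !(@lbd_formalf 0 _ _ _ _ i3) addr0.
  rewrite -(hs_divergence _ _ _ lbd_fluxdiv_grad) -[X in _ = _ + X](lmul_hsK l0 _ _ _ lY).
  rewrite (rho_sqrtgV l0) !lmul_hs -/(laplacian r phi).
  set Lp := laplacian r phi; set Y := lmul hsVL _.
  have E i : ((Lp : fam) + Y) i t s = (Lp : fam) i t s + Y i t s by [].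
  by rewrite !E; ring.
have rhs k t s : - lmul (hs L r) (divergence r (Btilde L r B0)) k t s = - fluxdiv (Btilde L r B0) (k + 1) t s.
  by rewrite (hs_divergence _ _ _ lbd_fluxdiv_B).
split=> [H k t s|H].
  have E : lmul (hs L r) ((laplacian r phi : fam) +
    lmul (lmul (rhoX L 1) (sqrtgV L r)) (lap_perp (Pop r K D phi))) (k - 2) t s =
    - lmul (hs L r) (divergence r (Btilde L r B0)) (k - 2) t s.
    have := congr1 (fun F : fam => F (k - 2) t s) H; exact.
  have := residualE (k - 2) t s; have -> : k - 2 + 2 = k by lia.
  by move=> <-; rewrite -lhs E rhs addNr.
apply: famP => k t s; apply: (etrans (lhs k t s)); apply: esym; apply: (etrans (rhs k t s)).
have := residualE k t s; rewrite H => /eqP; rewrite addr_eq0 => /eqP ->.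
by [].
Qed.

End LaurentEquation.

(** * Analytic families of Sobolev coefficients *)

Section EnergyFamilies.
Variable R : realType.
Local Notation C := R[i].
Implicit Types (a b : nat -> nat -> R -> C) (sigma sg rho t s : R) (h : R -> R).

(* Energies bounded by powers of any sg < sigma: unlike the (sigma, H^p) norm,
   this is stable under multiplication by powers of m. *)
Definition erg sigma p a : Prop := (forall m, sobrow p m (a m)) /\
  forall sg, 0 < sg < sigma -> exists X, forall m, sg ^+ (2 * m) * Em p m (a m) <= X.

Lemma erg_of sigma p a X : (forall m, sobrow p m (a m)) ->
  (forall m, (sigma ^+ 2) ^+ m * Em p m (a m) <= X) -> erg sigma p a.
Proof.
move=> sa aX; split=> // sg /andP[s0 s1]; exists X => m; apply: le_trans (aX m).
rewrite exprM; apply: ler_wpM2r; first exact: Em_ge0.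
by apply: lerXn2r; rewrite ?nnegrE ?exprn_ge0//; [exact: ltW|exact: (ltW (lt_trans s0 s1))|];
  apply: lerXn2r; rewrite ?nnegrE; [exact: ltW|exact: (ltW (lt_trans s0 s1))|exact: ltW].
Qed.

Lemma erg_fbd sigma p a : erg sigma p.+1 a -> fbd sigma a.
Proof.
move=> [sa ea] sg /andP[s0 s1]; pose sg' := (sg + sigma) / 2.
have h0 : 0 < sg' by rewrite /sg'; lra.
have h1 : sg' < sigma by rewrite /sg'; lra.
have h2 : sg < sg' by rewrite /sg'; lra.
have [X hX] := ea sg' (introT andP (conj h0 h1)).
by apply: (energy_fbd h0 sa hX); rewrite s0.
Qed.

Lemma erg_le sigma p p' a : (p <= p')%N -> erg sigma p' a -> erg sigma p a.
Proof.
move=> pp [sa ea]; split=> [m|sg sgs]; first exact: sobrow_le pp (sa m).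
have [X hX] := ea sg sgs; exists X => m; apply: le_trans (hX m); apply: ler_wpM2l.
  by apply: exprn_ge0; case/andP: sgs => /ltW.
exact: Em_le pp (sa m).
Qed.

Lemma erg_mono sigma p p' a b (A : R) : 0 <= A -> erg sigma p a -> (forall m, sobrow p' m (b m)) ->
  (forall m, Em p' m (b m) <= A * Em p m (a m)) -> erg sigma p' b.
Proof.
move=> A0 [sa ea] sb ab; split; first exact: sb.
move=> sg sgs; have [X hX] := ea sg sgs; exists (A * X) => m; apply: le_trans (ler_wpM2l A0 (hX m)); rewrite mulrCA.
by apply: ler_wpM2l (ab m); apply: exprn_ge0; case/andP: sgs => /ltW.
Qed.

Lemma eq_erg sigma p a b : (forall m n, (n <= m)%N -> a m n = b m n) -> erg sigma p a -> erg sigma p b.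
Proof.
move=> ab ea; apply: (@erg_mono _ _ p a b 1 ler01 ea) => [m n nm|m].
  by rewrite -ab//; case: ea => sa _; exact: sa.
by rewrite mul1r (eq_Em _ (d := a m)) => // n nm; rewrite ab.
Qed.

Lemma sum_bound (y e u v X Y : R) : 0 <= y -> e <= 2 * u + 2 * v -> y * u <= X -> y * v <= Y ->
  y * e <= 2 * X + 2 * Y.
Proof.
move=> y0 h hX hY; apply: le_trans (ler_wpM2l y0 h) _.
have -> : y * (2 * u + 2 * v) = 2 * (y * u) + 2 * (y * v) by ring.
lra.
Qed.

Lemma ergD sigma p a b : erg sigma p a -> erg sigma p b -> erg sigma p (fun m n s => a m n s + b m n s).
Proof.
move=> [sa ea] [sb eb]; split=> [m|sg sgs]; first exact: sobrowD (sa m) (sb m).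
have [X hX] := ea sg sgs; have [Y hY] := eb sg sgs.
exists (2 * X + 2 * Y) => m; have s0 : 0 <= sg ^+ (2 * m) by apply: exprn_ge0; case/andP: sgs => /ltW.
exact: sum_bound s0 (EmD (sa m) (sb m)) (hX m) (hY m).
Qed.

Lemma ergZ sigma p (z : C) a : erg sigma p a -> erg sigma p (fun m n s => z * a m n s).
Proof.
move=> ea; have [sa _] := ea.
apply: (@erg_mono _ _ p a _ (sqmod z) (sqmod_ge0 z) ea) => m.
  exact: (sobrowZ (fun=> z) (sa m)).
exact: (EmZ (z := fun=> z) (sa m) (fun=> lexx _)).
Qed.

Lemma ergB sigma p a b : erg sigma p a -> erg sigma p b -> erg sigma p (fun m n s => a m n s - b m n s).
Proof.
move=> ea /(ergZ (-1)) eb; apply: eq_erg (ergD ea eb) => m n _.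
by apply/funext => s; rewrite mulN1r.
Qed.

Lemma ergM sigma p G h a : Rb p.+1 G h -> erg sigma p.+1 a ->
  erg sigma p.+1 (fun m n s => (h s)%:C * a m n s).
Proof.
move=> hG ea; have [sa _] := ea.
apply: (@erg_mono _ _ p.+1 a _ (3 ^+ p.+1 * G ^+ 2) _ ea) => [|m|m].
- by apply: mulr_ge0; [exact: exprn_ge0|exact: sqr_ge0].
- exact: sobrowM hG (sa m).
- exact: EmM hG (sa m).
Qed.

Lemma erg_d sigma p a : erg sigma p.+2 a -> erg sigma p.+1 (fd a).
Proof.
move=> ea; have [sa _] := ea; apply: (@erg_mono _ _ p.+1 a _ 1 ler01 ea) => m.
  exact: sobrowd (sa m).
by rewrite mul1r; exact: Emd (sa m).
Qed.

(** A factor polynomial in m is absorbed by the geometric gap between sg and the midpoint of sg and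
    sigma. *)
Lemma erg_scale sigma p d (A : R) (z : nat -> nat -> C) a : 0 <= A ->
  (forall m n, (n <= m)%N -> sqmod (z m n) <= A * m.+1%:R ^+ d) ->
  erg sigma p a -> erg sigma p (fun m n s => z m n * a m n s).
Proof.
move=> A0 zA [sa ea]; split=> [m|sg /andP[s0 s1]]; first exact: (sobrowZ (z m) (sa m)).
pose sg' := (sg + sigma) / 2.
have h0 : 0 < sg' by rewrite /sg'; lra.
have h1 : sg' < sigma by rewrite /sg'; lra.
have h2 : sg < sg' by rewrite /sg'; lra.
have [X hX] := ea sg' (introT andP (conj h0 h1)).
have [|B B0 hB] := @poly_geometric R d ((sg / sg') ^+ 2).
  have q0 : 0 <= sg / sg' by exact: divr_ge0 (ltW s0) (ltW h0).
  have q1 : sg / sg' < 1 by rewrite ltr_pdivrMr// mul1r.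
  by apply/andP; split; [exact: exprn_ge0|exact: exprn_ilt1].
have X0 : 0 <= X by apply: le_trans (hX 0%N); apply: mulr_ge0; [exact: exprn_ge0 (ltW h0)|exact: Em_ge0].
exists (A * B * X) => m.
have e1 : Em p m (fun n s => z m n * a m n s) <= A * m.+1%:R ^+ d * Em p m (a m).
  rewrite /Em mulr_sumr; apply: ler_sum => n _.
  have nm : (n <= m)%N by rewrite -ltnS.
  apply: le_trans (enZ _ _ (sa m n nm)) _; first exact: wj_ge1.
  by apply: ler_wpM2r (zA m n nm); exact: en_ge0 (wj_ge1 _ _ _).
have sm : 0 <= sg ^+ (2 * m) by exact: exprn_ge0 (ltW s0).
apply: le_trans (ler_wpM2l sm e1) _.
have -> : sg ^+ (2 * m) = ((sg / sg') ^+ 2) ^+ m * sg' ^+ (2 * m).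
  by rewrite -!exprM -exprMn divfK// gt_eqF.
have -> : ((sg / sg') ^+ 2) ^+ m * sg' ^+ (2 * m) * (A * m.+1%:R ^+ d * Em p m (a m)) =
   A * (m.+1%:R ^+ d * ((sg / sg') ^+ 2) ^+ m) * (sg' ^+ (2 * m) * Em p m (a m)) by ring.
have k1 : 0 <= m.+1%:R ^+ d * ((sg / sg') ^+ 2) ^+ m.
  by apply: mulr_ge0; apply: exprn_ge0 => //; exact: sqr_ge0.
apply: ler_pM => //; [exact: mulr_ge0| |exact: ler_wpM2l].
by apply: mulr_ge0; [exact: exprn_ge0 (ltW h0)|exact: Em_ge0].
Qed.

Lemma sqmod_nat (k m : nat) : (k <= m.+1)%N -> sqmod (k%:R : C) <= 1 * m.+1%:R ^+ 2.
Proof. by move=> km; rewrite natrCE sqmod_real mul1r; apply: lerXn2r; rewrite ?nnegrE// ler_nat. Qed.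

Lemma sqmod_jf m n : (n <= m)%N -> sqmod ('i * (jf m n)%:~R : C) <= 1 * m.+1%:R ^+ 2.
Proof.
move=> nm; rewrite sqmodM sqmod_i mul1r intrCE sqmod_real mul1r.
have -> : ((jf m n)%:~R : R) = (2 * n%:R - m%:R).
  by rewrite /jf intrB -muln2 PoszM intrM mulrC.
rewrite -real_normK ?num_real//; apply: lerXn2r; rewrite ?nnegrE// ler_norml.
have h1 : (n%:R : R) <= m%:R by rewrite ler_nat.
have h0 : 0 <= n%:R :> R by exact: ler0n.
by rewrite -natr1; lra.
Qed.

Lemma erg_e sigma p a : erg sigma p a -> erg sigma p (fe a).
Proof. by apply: erg_scale ler01 _ => m n nm; apply: sqmod_nat; exact: leqnSn. Qed.

Lemma erg_j sigma p a : erg sigma p a -> erg sigma p (fj a).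
Proof. by apply: (@erg_scale _ _ _ _ (fun m n => 'i * (jf m n)%:~R) _ ler01) => m n; exact: sqmod_jf. Qed.

Lemma erg_shift sigma p a b (A : R) : 0 <= A -> erg sigma p a -> (forall m, sobrow p m (b m)) ->
  b 0%N = @z0 R -> (forall m, Em p m.+1 (b m.+1) <= A * Em p m (a m)) -> erg sigma p b.
Proof.
move=> A0 [sa ea] sb b0 ab; split; first exact: sb.
move=> sg sgs; have [X hX] := ea sg sgs.
have s0 : 0 <= sg by case/andP: sgs => /ltW.
have X0 : 0 <= X by apply: le_trans (hX 0%N); apply: mulr_ge0; [exact: exprn_ge0|exact: Em_ge0].
have AX : 0 <= A * sg ^+ 2 * X by apply: mulr_ge0 => //; apply: mulr_ge0 => //; exact: sqr_ge0.
exists (A * sg ^+ 2 * X) => -[|m]; first by rewrite b0 Em0 mulr0.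
have sm : 0 <= sg ^+ (2 * m.+1) by exact: exprn_ge0.
apply: le_trans (ler_wpM2l sm (ab m)) _.
have -> : sg ^+ (2 * m.+1) * (A * Em p m (a m)) = A * sg ^+ 2 * (sg ^+ (2 * m) * Em p m (a m)).
  by rewrite mulnS exprD; ring.
by apply: ler_wpM2l (hX m); apply: mulr_ge0 => //; exact: sqr_ge0.
Qed.


Lemma erg_shiftZ sigma p (z w y : C) a b : tfam a -> erg sigma p a ->
  b 0%N = @z0 R -> (forall m, b m.+1 = fun n s => z * (w * prv (a m) n s + y * a m n s)) ->
  erg sigma p b.
Proof.
move=> ta ea b0 bS; have [sa _] := ea.
have sw m := sobrowZ (fun=> w) (sobrow_prv (sa m)).
have sy m := sobrowZ (fun=> y) (sobrow_trow (k := m.+1) (@ta m) (sa m)).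
pose A := sqmod z * (2 * (sqmod w * 3 ^+ p) + 2 * (sqmod y * 3 ^+ p)).
have s3 : 0 <= (3 : R) ^+ p by exact: exprn_ge0.
have A0 : 0 <= A.
  by apply: mulr_ge0; [exact: sqmod_ge0|apply: addr_ge0; apply: mulr_ge0 => //; apply: mulr_ge0 => //; exact: sqmod_ge0].
apply: (erg_shift A0 ea _ b0) => [[|m]|m].
- by rewrite b0; exact: sobrow0.
- by rewrite bS; exact: (sobrowZ (fun=> z) (sobrowD (sw m) (sy m))).
rewrite bS; apply: le_trans (EmZ (z := fun=> z) (sobrowD (sw m) (sy m)) (fun=> lexx _)) _.
rewrite /A -mulrA; apply: ler_wpM2l; first exact: sqmod_ge0.
apply: le_trans (EmD (sw m) (sy m)) _.
have k1 := EmZ (z := fun=> w) (sobrow_prv (sa m)) (fun=> lexx _).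
have k2 := EmZ (z := fun=> y) (sobrow_trow (k := m.+1) (@ta m) (sa m)) (fun=> lexx _).
have k3 := ler_wpM2l (sqmod_ge0 w) (Em_shift1 (sa m)).
have k4 := ler_wpM2l (sqmod_ge0 y) (Em_shift0 (@ta m) (sa m)).
set E := Em p m (a m); have -> : (2 * (sqmod w * 3 ^+ p) + 2 * (sqmod y * 3 ^+ p)) * E =
  2 * (sqmod w * (3 ^+ p * E)) + 2 * (sqmod y * (3 ^+ p * E)) by ring.
exact: lerD (ler_wpM2l (ler0n R 2) (le_trans k1 k3)) (ler_wpM2l (ler0n R 2) (le_trans k2 k4)).
Qed.

Lemma erg_cos sigma p a : tfam a -> erg sigma p a -> erg sigma p (fcos a).
Proof.
move=> ta ea; apply: (@erg_shiftZ _ _ (2^-1)%:C 1 1 a _ ta ea) => // m.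
by apply/funext => n; apply/funext => s; rewrite /fcos /rowZ /rowD !mul1r addrC.
Qed.

Lemma erg_sin sigma p a : tfam a -> erg sigma p a -> erg sigma p (fsin a).
Proof.
move=> ta ea; apply: (@erg_shiftZ _ _ (- 'i * 2^-1) 1 (-1) a _ ta ea) => // m.
by apply/funext => n; apply/funext => s; rewrite /fsin /rowZ /rowB !mul1r mulN1r.
Qed.


Lemma erg_Kop sigma p K D a : erg sigma (p.+1 + 2 * D) a -> erg sigma p.+1 (fun m n => Kop K D (a m n)).
Proof.
elim: D a => [|D IH] a ea; first by rewrite muln0 addn0 in ea.
have e2 : erg sigma (p.+1 + 2 * D).+2 a by apply: erg_le ea; rewrite mulnS; lia.
have := ergZ (- K ^- 2)%:C (erg_d (p := p + 2 * D) (erg_d (p := (p + 2 * D).+1) e2)).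
move=> /(IH _); apply: eq_erg => m n _.
by rewrite /Kop iterSr.
Qed.

(** The s-part uses up 2D Sobolev orders; the theta-part is a multiplier polynomial in m, of degree
    4D after squaring, and costs radius only. *)
Lemma erg_P sigma p K D a : erg sigma (p.+1 + 2 * D) a -> erg sigma p.+1 (fP K D a).
Proof.
move=> ea; apply: ergD; first exact: erg_Kop.
have A0 : 0 <= ((K ^- 2) ^+ 2) ^+ D by apply: exprn_ge0; exact: sqr_ge0.
apply: (@erg_scale _ _ (2 * 2 * D) _ (fun m n => (symb K D (jf m n))%:C) _ A0).
  move=> m n nm; have := sqmod_jf nm; rewrite sqmodM sqmod_i mul1r intrCE sqmod_real mul1r.
  rewrite sqmod_real /symb; set X : R := _%:~R ^+ 2; set Y : R := m.+1%:R ^+ 2 => XY.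
  have X0 : 0 <= X by exact: sqr_ge0.
  have -> : ((K ^- 2 * X) ^+ D) ^+ 2 = ((K ^- 2) ^+ 2) ^+ D * (X ^+ 2) ^+ D.
    by move: (K ^- 2) X {XY X0} => u v; rewrite (exprMn D u v) (exprMn 2) -!exprM mulnC.
  have -> : (m.+1%:R : R) ^+ (2 * 2 * D) = (Y ^+ 2) ^+ D by rewrite !exprM.
  have Y0 : 0 <= Y by exact: sqr_ge0.
  apply: ler_wpM2l => //; apply: lerXn2r; rewrite ?nnegrE; try exact: sqr_ge0.
  by apply: lerXn2r; rewrite ?nnegrE.
by apply: erg_le ea; exact: leq_addr.
Qed.

(* [d/dx] and [d/dy] for the coordinates x = rho cos theta, y = rho sin theta. *)
Definition fdx a m n s : C := (m.+1 - n)%:R * a m.+1 n s + n.+1%:R * a m.+1 n.+1 s.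
Definition fdy a m n s : C := 'i * (n.+1%:R * a m.+1 n.+1 s - (m.+1 - n)%:R * a m.+1 n s).

(** Lowering the order by one divides the weighted energy by sg^2, allowed because sg > 0 is fixed;
    the frequency moves by one, hence 3^p. *)
Lemma erg_pull sigma p (k : nat) a : (k < 2)%N -> erg sigma p a -> erg sigma p (fun m n => a m.+1 (n + k)%N).
Proof.
move=> k2 [sa ea]; split=> [m n nm|sg sgs]; first by apply: sa; lia.
have [X hX] := ea sg sgs; have s0 : 0 < sg by case/andP: sgs.
exists (3 ^+ p * (sg ^- 2 * X)) => m.
have e1 : Em p m (fun n => a m.+1 (n + k)%N) <= 3 ^+ p * Em p m.+1 (a m.+1).
  apply: le_trans (_ : \sum_(n < m.+1) 3 ^+ p * en (wj R m.+1 (n + k)) p (a m.+1 (n + k)%N) <= _).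
    apply: ler_sum => n _; apply: en_mono; try exact: wj_ge1; first by lra.
      have ej : jf m n = jf m.+1 (n + k) + (if k is 0%N then 1 else - 1).
        by case: (k) k2 => [|[|//]] _; rewrite /jf; lia.
      rewrite /wj ej intrD; move: ((jf m.+1 (n + k))%:~R : R) => x.
      case: (k) => [|k']; rewrite ?[(-1)%:~R]mulrNz; move: (sqr_ge0 (x + 2^-1)) (sqr_ge0 (x - 2^-1));
        by rewrite !expr2; lra.
      exact: leqnn.
    by apply: sa; have := ltn_ord n; lia.
  rewrite -mulr_sumr; apply: ler_wpM2l; first exact: exprn_ge0.
  have g0 (n : 'I_m.+2) : 0 <= en (wj R m.+1 n) p (a m.+1 n) by exact: en_ge0 (wj_ge1 _ _ _).
  case: k k2 => [|[|//]] _; rewrite /Em.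
    rewrite [leRHS]big_ord_recr /= -[leLHS]addr0; apply: lerD (g0 ord_max).
    by apply: ler_sum => n _; rewrite addn0.
  rewrite [leRHS]big_ord_recl -[leLHS]add0r; apply: lerD (g0 ord0) _.
  by apply: ler_sum => n _; rewrite addn1.
have sm : 0 <= sg ^+ (2 * m) by exact: exprn_ge0 (ltW s0).
apply: le_trans (ler_wpM2l sm e1) _; rewrite mulrCA; apply: ler_wpM2l; first exact: exprn_ge0.
rewrite ler_pdivlMl ?exprn_gt0// mulrA -exprD.
by have := hX m.+1; rewrite mulnS.
Qed.

Lemma erg_dxy sigma p a (z w : C) : erg sigma p a -> erg sigma p
  (fun m n s => z * ((m.+1 - n)%:R * a m.+1 n s) + w * (n.+1%:R * a m.+1 n.+1 s)).
Proof.
move=> ea; apply: ergD; apply: ergZ.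
  apply: (@erg_scale _ _ _ _ (fun m n => (m.+1 - n)%:R) _ ler01) => [m n nm|].
    by apply: sqmod_nat; lia.
  by apply: eq_erg (erg_pull (k := 0) isT ea) => m n _; rewrite addn0.
apply: (@erg_scale _ _ _ _ (fun m n => n.+1%:R) _ ler01) => [m n nm|].
  by apply: sqmod_nat; lia.
by apply: eq_erg (erg_pull (k := 1) isT ea) => m n _; rewrite addn1.
Qed.

Lemma erg_dx sigma p a : erg sigma p a -> erg sigma p (fdx a).
Proof.
move=> /(erg_dxy 1 1); apply: eq_erg => m n _; apply/funext => s.
by rewrite !mul1r.
Qed.
Lemma erg_dy sigma p a : erg sigma p a -> erg sigma p (fdy a).
Proof.
move=> /(erg_dxy (- 'i) 'i); apply: eq_erg => m n _; apply/funext => s.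
have arith (z x y : C) : - z * y + z * x = z * (x - y) by ring.
exact: arith.
Qed.

(* Division by [1 - rho kap cos theta], up to the factor [li]. *)
Fixpoint fdiv (li : R) (kap : R -> R) a m : nat -> R -> C :=
  if m is m'.+1 then rowD (rowZ (fun=> li%:C) (a m)) (kmix kap (fdiv li kap a m'))
  else rowZ (fun=> li%:C) (a 0%N).

Lemma trow_kmix (kap : R -> R) m (d : nat -> R -> C) : trow m d -> trow m.+1 (kmix kap d).
Proof.
move=> td n mn; apply/funext => s; rewrite /kmix /rowM /rowZ /rowD.
rewrite td; last by lia.
by case: n mn => // n mn /=; rewrite td// addr0 !mulr0.
Qed.

Lemma tfam_div li kap a : tfam a -> tfam (fdiv li kap a).
Proof.
move=> ta; elim=> [|m IH] n mn; apply/funext => s.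
  by rewrite /= /rowZ ta// mulr0.
by rewrite /= /rowD /rowZ ta// mulr0 add0r (trow_kmix kap IH).
Qed.

(** The quotient obeys a one-step recursion whose feedback, the factor 2 of the energy inequality
    included, is at most one half by the smallness of sigma. *)
Lemma erg_div sigma p li kap M a : tfam a -> Rb p.+1 M kap ->
  (3 ^+ p.+1) ^+ 2 * M ^+ 2 * sigma ^+ 2 <= 4^-1 ->
  erg sigma p.+1 a -> erg sigma p.+1 (fdiv li kap a).
Proof.
move=> ta kM small [sa ea]; set v := fdiv li kap a.
have tv : tfam v by exact: tfam_div.
have sv m : sobrow p.+1 m (v m).
  elim: m => [|m IH]; first exact: (sobrowZ (fun=> li%:C) (sa 0%N)).
  exact: (sobrowD (sobrowZ (fun=> li%:C) (sa m.+1)) (kmix_sobrow kM (@tv m) IH)).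
split; first exact: sv.
move=> sg sgs; have [X hX] := ea sg sgs; have /andP[s0 s1] := sgs.
have X0 : 0 <= X by apply: le_trans (hX 0%N); apply: mulr_ge0; [exact: exprn_ge0 (ltW s0)|exact: Em_ge0].
have s2 : sg ^+ 2 <= sigma ^+ 2.
  by apply: lerXn2r; rewrite ?nnegrE ?(ltW s0) ?(ltW s1) ?(ltW (lt_trans s0 s1)).
pose T : R := (3 ^+ p.+1) ^+ 2 * M ^+ 2.
have T0 : 0 <= T by apply: mulr_ge0; exact: sqr_ge0.
have Ts : T * sg ^+ 2 <= 4^-1 by apply: le_trans small; exact: ler_wpM2l.
have l0 : 0 <= li ^+ 2 by exact: sqr_ge0.
have lX : 0 <= li ^+ 2 * X by exact: mulr_ge0.
have e0 m : Em p.+1 m (rowZ (fun=> li%:C) (a m)) <= li ^+ 2 * Em p.+1 m (a m).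
  by have := EmZ (sa m) (fun=> lexx (sqmod li%:C)); rewrite sqmod_real.
have sm m : 0 <= sg ^+ (2 * m) by exact: exprn_ge0 (ltW s0).
have ha m : sg ^+ (2 * m) * Em p.+1 m (rowZ (fun=> li%:C) (a m)) <= li ^+ 2 * X.
  apply: le_trans (ler_wpM2l (sm m) (e0 m)) _; rewrite mulrCA; exact: ler_wpM2l.
(* The constant 4 is the fixed point of c = 2 + 2 (c / 4). *)
exists (4 * (li ^+ 2 * X)); elim=> [|m IH].
  by apply: le_trans (ha 0%N) _; lra.
have bk := kmix_bound kM (@tv m) (sv m).
have bD := EmD (sobrowZ (fun=> li%:C) (sa m.+1)) (kmix_sobrow kM (@tv m) (sv m)).
apply: le_trans (ler_wpM2l (sm m.+1) bD) _.
have -> : sg ^+ (2 * m.+1) * (2 * Em p.+1 m.+1 (rowZ (fun=> li%:C) (a m.+1)) + 2 * Em p.+1 m.+1 (kmix kap (v m))) =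
  2 * (sg ^+ (2 * m.+1) * Em p.+1 m.+1 (rowZ (fun=> li%:C) (a m.+1))) +
  2 * (sg ^+ (2 * m.+1) * Em p.+1 m.+1 (kmix kap (v m))) by ring.
have h1 := ha m.+1; have h2 := ler_wpM2l (sm m.+1) bk.
have e2 : sg ^+ (2 * m.+1) * (3 ^+ p.+1 * M ^+ 2 * (3 ^+ p.+1 * Em p.+1 m (v m))) =
  (T * sg ^+ 2) * (sg ^+ (2 * m) * Em p.+1 m (v m)) by rewrite /T mulnS exprD; ring.
rewrite e2 in h2.
have TS0 : 0 <= T * sg ^+ 2 by apply: mulr_ge0 => //; exact: sqr_ge0.
have h3 : (T * sg ^+ 2) * (sg ^+ (2 * m) * Em p.+1 m (v m)) <= 4^-1 * (4 * (li ^+ 2 * X)).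
  by apply: ler_pM => //; apply: mulr_ge0 => //; exact: Em_ge0.
move: h1 h2 h3 lX.
set x1 := _ * Em _ _ (rowZ _ _); set x2 := _ * Em _ _ (kmix _ _); set x3 := (_ * _) * _; set x4 := li ^+ 2 * X.
move=> {bk bD e2}; clearbody x1 x2 x3 x4; lra.
Qed.

Lemma erg_analytic sigma p a : 0 < sigma -> erg sigma p.+1 a -> forall sg, 0 < sg < sigma ->
  analytic_series sg (Hq R p.+1) a.
Proof.
move=> s0 [sa ea] sg sgs; have [X hX] := ea sg sgs; have /andP[s1 _] := sgs.
exact: series_analytic s1 sa hX.
Qed.

End EnergyFamilies.

(** * Term-by-term operations on convergent series *)

Section SeriesCalculus.
Variable R : realType.
Local Notation C := R[i].
Implicit Types (a b : nat -> nat -> R -> C) (sigma rho t s : R).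

Lemma cd_limit (P dP : nat -> R -> C) (f : R -> C) x z d (e : nat -> R) : 0 < d ->
  (forall n y, `|y - x| < d -> cd (P n) y (dP n y)) ->
  (forall n m y, (n <= m)%N -> `|y - x| < d -> cabs (dP m y - dP n y) <= e n) ->
  e n @[n --> \oo] --> (0 : R) ->
  (forall y, `|y - x| < d -> ccvg (fun n => P n y) (f y)) ->
  ccvg (fun n => dP n x) z -> cd f x z.
Proof.
move=> d0 Pd Pe e0 Pf /ccvgP[dr di]; split.
- apply: (@rd_limit R (fun n y => reC (P n y)) (fun n y => reC (dP n y)) _ x _ d e d0 _ _ e0 _ dr) => [n y yx|n m y nm yx|y yx].
  + by case: (Pd n y yx).
  + by rewrite -reCB; apply: le_trans (reC_cabs _) (Pe n m y nm yx).
  + by have /ccvgP[] := Pf y yx.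
- apply: (@rd_limit R (fun n y => imC (P n y)) (fun n y => imC (dP n y)) _ x _ d e d0 _ _ e0 _ di) => [n y yx|n m y nm yx|y yx].
  + by case: (Pd n y yx).
  + by rewrite -imCB; apply: le_trans (imC_cabs _) (Pe n m y nm yx).
  + by have /ccvgP[] := Pf y yx.
Qed.

Lemma series_ext a b rho t s : (forall N, partial_sum a N rho t s = partial_sum b N rho t s) ->
  series_fun a rho t s = series_fun b rho t s.
Proof.
move=> H; have E : (fun N => partial_sum a N rho t s) = (fun N => partial_sum b N rho t s) by apply/funext.
by rewrite /series_fun -[fun M => reC _]/(@reC R \o (fun N => partial_sum a N rho t s))
  -[fun M => imC _]/(@imC R \o (fun N => partial_sum a N rho t s)) E.
Qed.

Lemma eq_series a b rho t s : (forall m n, (n <= m)%N -> a m n s = b m n s) ->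
  series_fun a rho t s = series_fun b rho t s.
Proof.
move=> ab; apply: series_ext => N; apply: eq_bigr => m _; congr (_ * _).
by rewrite !modeE; apply: eq_rowf => n nm; exact: ab.
Qed.

Lemma partial_sum_lin (x y : C) a b N rho t s :
  partial_sum (fun m n s => x * a m n s + y * b m n s) N rho t s =
  x * partial_sum a N rho t s + y * partial_sum b N rho t s.
Proof.
rewrite /partial_sum !mulr_sumr -big_split; apply: eq_bigr => m _.
by rewrite !modeE rowf_lin /=; ring.
Qed.

Lemma series_lin sigma (x y : C) a b rho t s : fbd sigma a -> fbd sigma b -> `|rho| < sigma ->
  fbd sigma (fun m n s => x * a m n s + y * b m n s) ->
  series_fun (fun m n s => x * a m n s + y * b m n s) rho t s =
  x * series_fun a rho t s + y * series_fun b rho t s.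
Proof.
move=> fa fb rs fab; apply: ccvg_unique (series_cvg t s fab rs) _.
apply: eq_ccvg (ccvgD (ccvgM (ccvg_cst x) (series_cvg t s fa rs)) (ccvgM (ccvg_cst y) (series_cvg t s fb rs))).
by move=> N; rewrite partial_sum_lin.
Qed.

Lemma series_coef sigma (h : R -> C) a rho t s : fbd sigma a -> `|rho| < sigma ->
  fbd sigma (fun m n s => h s * a m n s) ->
  series_fun (fun m n s => h s * a m n s) rho t s = h s * series_fun a rho t s.
Proof.
move=> fa rs fha; apply: ccvg_unique (series_cvg t s fha rs) _.
apply: eq_ccvg (ccvgM (ccvg_cst (h s)) (series_cvg t s fa rs)) => N.
rewrite /partial_sum mulr_sumr; apply: eq_bigr => m _.
rewrite !modeE mulrCA; congr (_ * _); rewrite /rowf mulr_sumr.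
by apply: eq_bigr => n _; rewrite mulrA.
Qed.

Lemma ccvg_shift (F : nat -> C) z : ccvg F z -> ccvg (fun n => F n.+1) z.
Proof. by move=> h; rewrite /ccvg (cvg_shiftS (fun n => cabs (F n - z))). Qed.

Lemma series_shift sigma (z : C) a b rho t s : fbd sigma a -> fbd sigma b -> `|rho| < sigma ->
  (forall N, partial_sum b N.+1 rho t s = z * partial_sum a N rho t s) ->
  series_fun b rho t s = z * series_fun a rho t s.
Proof.
move=> fa fb rs H; apply: ccvg_unique (ccvg_shift (series_cvg t s fb rs)) _.
by apply: eq_ccvg (ccvgM (ccvg_cst z) (series_cvg t s fa rs)) => N; rewrite H.
Qed.

Lemma partial_sum_shift a b (z : C) N rho t s : b 0%N = @z0 R ->
  (forall m, z * rowf m (a m) t s = rowf m.+1 (b m.+1) t s) ->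
  partial_sum b N.+1 rho t s = rho%:C * z * partial_sum a N rho t s.
Proof.
move=> b0 H; rewrite /partial_sum big_ord_recl modeE b0 rowf0 mulr0 add0r mulr_sumr.
by apply: eq_bigr => m _; rewrite !modeE /= /bump add1n -H exprS realCM; ring.
Qed.

Lemma series_cos sigma a rho t s : tfam a -> fbd sigma a -> fbd sigma (fcos a) -> `|rho| < sigma ->
  series_fun (fcos a) rho t s = rho%:C * (cos t)%:C * series_fun a rho t s.
Proof.
move=> ta fa fc rs; apply: (series_shift fa fc rs) => N; apply: partial_sum_shift => // m.
exact: rowf_cos (@ta m).
Qed.

Lemma series_sin sigma a rho t s : tfam a -> fbd sigma a -> fbd sigma (fsin a) -> `|rho| < sigma ->
  series_fun (fsin a) rho t s = rho%:C * (sin t)%:C * series_fun a rho t s.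
Proof.
move=> ta fa fc rs; apply: (series_shift fa fc rs) => N; apply: partial_sum_shift => // m.
exact: rowf_sin (@ta m).
Qed.

Lemma series_sq sigma a rho t s : tfam a -> fbd sigma a -> fbd sigma (fsq a) -> `|rho| < sigma ->
  series_fun (fsq a) rho t s = (rho ^+ 2)%:C * series_fun a rho t s.
Proof.
move=> ta fa fc rs.
apply: ccvg_unique (ccvg_shift (ccvg_shift (series_cvg t s fc rs))) _.
apply: eq_ccvg (ccvgM (ccvg_cst _) (series_cvg t s fa rs)) => N.
rewrite /partial_sum !big_ord_recl !modeE /= !rowf0 !mulr0 !add0r mulr_sumr.
apply: eq_bigr => m _; rewrite !modeE /= /bump !add1n /= -(rowf_sq _ _ (@ta m)).
have -> : (rho ^+ m.+2)%:C = (rho ^+ 2)%:C * (rho ^+ m)%:C :> C by rewrite -realCM -exprD.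
ring.
Qed.

Lemma partial_sum_cd_t a N rho t s :
  cd (fun x => partial_sum a N rho x s) t (partial_sum (fj a) N rho t s).
Proof.
have := cd_sum (index_enum 'I_N) (fun m : 'I_N => cdZ (rho ^+ m)%:C (rowf_cd_t m (a m) t s)).
rewrite /partial_sum; under [X in cd _ _ X -> _]eq_bigr do rewrite -/(fj a _) -(modeE (fj a)).
by apply: eq_cd => x; apply: eq_bigr => m _; rewrite modeE.
Qed.

Lemma partial_sum_cd_s a N rho t s : (forall m n, cderivable (a m n) s) ->
  cd (fun x => partial_sum a N rho t x) s (partial_sum (fd a) N rho t s).
Proof.
move=> ad.
have := cd_sum (index_enum 'I_N) (fun m : 'I_N => cdZ (rho ^+ m)%:C (rowf_cd_s m t (ad m))).
rewrite /partial_sum; under [X in cd _ _ X -> _]eq_bigr do rewrite -/(fd a _) -(modeE (fd a)).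
by apply: eq_cd => x; apply: eq_bigr => m _; rewrite modeE.
Qed.

Lemma partial_sum_cd_rho a N rho t s : rho != 0 ->
  cd (fun x => partial_sum a N x t s) rho ((rho^-1)%:C * partial_sum (fe a) N rho t s).
Proof.
move=> r0.
have H (m : 'I_N) : cd (fun x => (x ^+ m)%:C * mode a m t s) rho ((rho^-1)%:C * ((rho ^+ m)%:C * mode (fe a) m t s)).
  have -> : (rho^-1)%:C * ((rho ^+ m)%:C * mode (fe a) m t s) = (m%:R * rho ^+ m.-1)%:C * mode a m t s + (rho ^+ m)%:C * 0.
    have -> : mode (fe a) m t s = m%:R * mode a m t s.
      by rewrite !modeE /rowf mulr_sumr; apply: eq_bigr => n _; rewrite /fe mulrA.
    rewrite mulr0 addr0 mulrA mulrA -realCM natrCE -realCM; congr (_%:C * _).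
    by case: (nat_of_ord m) => [|k]; rewrite ?mulr0 ?mul0r// exprS; field.
  by apply: cdM (cd_cst _ _); apply: cd_real; exact: rdX.
by have := cd_sum (index_enum 'I_N) H; rewrite /partial_sum mulr_sumr.
Qed.

Lemma series_cd_t sigma a rho t s : fbd sigma a -> fbd sigma (fj a) -> `|rho| < sigma ->
  cd (fun x => series_fun a rho x s) t (series_fun (fj a) rho t s).
Proof.
move=> fa fj_ rs; have [|e e0 [he _]] := @series_unif R sigma (fj a) `|rho| fj_; first by rewrite normr_ge0.
apply: (@cd_limit (fun N x => partial_sum a N rho x s) (fun N x => partial_sum (fj a) N rho x s) _ _ _ 1 e ltr01).
- by move=> n y _; exact: partial_sum_cd_t.
- by move=> n m y nm _; exact: he.
- exact: e0.
- by move=> y _; exact: series_cvg fa rs.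
- exact: series_cvg fj_ rs.
Qed.

Lemma series_cd_s sigma a rho t s : (forall m n s, cderivable (a m n) s) ->
  fbd sigma a -> fbd sigma (fd a) -> `|rho| < sigma ->
  cd (fun x => series_fun a rho t x) s (series_fun (fd a) rho t s).
Proof.
move=> ad fa fd_ rs; have [|e e0 [he _]] := @series_unif R sigma (fd a) `|rho| fd_; first by rewrite normr_ge0.
apply: (@cd_limit (fun N x => partial_sum a N rho t x) (fun N x => partial_sum (fd a) N rho t x) _ _ _ 1 e ltr01).
- by move=> n y _; apply: partial_sum_cd_s => m k; exact: ad.
- by move=> n m y nm _; exact: he.
- exact: e0.
- by move=> y _; exact: series_cvg fa rs.
- exact: series_cvg fd_ rs.
Qed.

(** The derivative is written with rho d/drho, whose coefficients again form a near-axis family; the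
    factor 1/rho is bounded on the interval used, which stays above rho / 2. *)
Lemma series_cd_rho sigma a rho t s : fbd sigma a -> fbd sigma (fe a) -> 0 < rho < sigma ->
  cd (fun x => series_fun a x t s) rho ((rho^-1)%:C * series_fun (fe a) rho t s).
Proof.
move=> fa fe_ /andP[r0 rs].
have [d d0 hd] : exists2 d, 0 < d & forall y, `|y - rho| < d -> rho / 2 < y /\ y < (rho + sigma) / 2.
  exists (Num.min (rho / 2) ((sigma - rho) / 2)); first by rewrite lt_min; apply/andP; split; lra.
  by move=> y; rewrite lt_min !ltr_norml => /andP[/andP[? ?] /andP[? ?]]; split; lra.
have rr : 0 <= (rho + sigma) / 2 < sigma by apply/andP; split; lra.
have [e e0 [he _]] := series_unif fe_ rr.
have yb y : `|y - rho| < d -> `|y| <= (rho + sigma) / 2 /\ `|y| < sigma.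
  by move=> /hd[y1 y2]; rewrite ger0_norm; [split; lra|lra].
apply: (@cd_limit (fun N x => partial_sum a N x t s)
  (fun N x => (x^-1)%:C * partial_sum (fe a) N x t s) _ _ _ d (fun N => (rho / 2)^-1 * e N) d0).
- by move=> n y /hd[y1 _]; apply: partial_sum_cd_rho; rewrite gt_eqF//; lra.
- move=> n m y nm yd; rewrite -mulrBr cabsM cabs_real.
  have [y1 _] := hd y yd; have y0 : 0 < y by lra.
  have [yn _] := yb y yd; have r2 : 0 < rho / 2 by lra.
  apply: ler_pM; [exact: normr_ge0|exact: cabs_ge0| |exact: he].
  by rewrite ger0_norm ?invr_ge0 ?(ltW y0)// lef_pV2 ?posrE// ltW.
- by rewrite -(mulr0 (rho / 2)^-1); apply: cvgM e0; exact: cvg_cst.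
- by move=> y /yb[_ ys]; exact: series_cvg fa ys.
apply: ccvgM; first exact: ccvg_cst.
by apply: series_cvg fe_ _; rewrite ger0_norm// ltW.
Qed.

End SeriesCalculus.

(** * Functions represented by series away from the axis *)

Section FunctionGeometry.
Variable R : realType.
Local Notation C := R[i].
Local Notation fn := (R -> R -> R -> C).
Local Notation Fn := (functions R).
Implicit Types (F G f : fn) (a b c : nat -> nat -> R -> C) (rho t s : R) (z : C).
Variable sigma : R.

Definition cd_dir (i : 'I_3) F rho t s z : Prop :=
  cd (slice i F rho t s) (coord3 rho t s i) z.

Lemma cd_dir_pd i F rho t s z : cd_dir i F rho t s z -> pd_fun i F rho t s = z.
Proof. exact: cd_cderive. Qed.
Lemma cd_dir_pderivable i F rho t s z : cd_dir i F rho t s z -> pderivable i F rho t s.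
Proof. exact: cd_cderivable. Qed.

Lemma cd_dir_rho F rho t s z : cd (fun x => F x t s) rho z -> cd_dir i_rho F rho t s z.
Proof. by rewrite /cd_dir /slice !coord3_rho. Qed.
Lemma cd_dir_theta F rho t s z : cd (fun x => F rho x s) t z -> cd_dir i_theta F rho t s z.
Proof. by rewrite /cd_dir /slice !coord3_theta. Qed.
Lemma cd_dir_s F rho t s z : cd (F rho t) s z -> cd_dir i_s F rho t s z.
Proof. by rewrite /cd_dir /slice !coord3_s. Qed.

Lemma ord3_case (P : 'I_3 -> Prop) : P i_rho -> P i_theta -> P i_s -> forall i, P i.
Proof.
move=> p0 p1 p2 i; have [E|[E|E]] : i = i_rho \/ i = i_theta \/ i = i_s; try by rewrite E.
case: i => -[|[|[|//]]] h; [left|right; left|right; right]; apply: val_inj;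
  by rewrite /= /i_rho /i_theta /i_s inordK.
Qed.

(** Agreement is asked off the axis only, since polar coordinates are singular at rho = 0; this
    range is open in rho, so derivatives transfer. *)
Definition sums F c : Prop := forall rho t s, 0 < rho < sigma -> F rho t s = series_fun c rho t s.

Lemma pos_norm rho : 0 < rho < sigma -> `|rho| < sigma.
Proof. by move=> /andP[r0 rs]; rewrite ger0_norm// ltW. Qed.

Lemma eq_cd_rho F G rho t s z : (forall x, 0 < x < sigma -> F x t s = G x t s) -> 0 < rho < sigma ->
  cd (fun x => G x t s) rho z -> cd (fun x => F x t s) rho z.
Proof.
move=> FG /andP[r0 rs].
apply: (@cd_near _ _ _ _ _ (Num.min rho (sigma - rho))); first by rewrite lt_min r0 subr_gt0.
move=> y; rewrite lt_min !ltr_norml => /andP[/andP[? ?] /andP[? ?]].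
by rewrite FG//; apply/andP; split; lra.
Qed.

Lemma sums_cd_rho F c rho t s : sums F c -> fbd sigma c -> fbd sigma (fe c) -> 0 < rho < sigma ->
  cd (fun x => F x t s) rho ((rho^-1)%:C * series_fun (fe c) rho t s).
Proof.
move=> Fc f1 f2 rs; apply: (eq_cd_rho (fun x => Fc x t s) rs).
exact: series_cd_rho f1 f2 rs.
Qed.
Lemma sums_cd_t F c rho t s : sums F c -> fbd sigma c -> fbd sigma (fj c) -> 0 < rho < sigma ->
  cd (fun x => F rho x s) t (series_fun (fj c) rho t s).
Proof.
move=> Fc f1 f2 rs; apply: eq_cd (series_cd_t t s f1 f2 (pos_norm rs)) => x.
by rewrite Fc.
Qed.
Lemma sums_cd_s F c rho t s : sums F c -> (forall m n s, cderivable (c m n) s) ->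
  fbd sigma c -> fbd sigma (fd c) -> 0 < rho < sigma ->
  cd (fun x => F rho t x) s (series_fun (fd c) rho t s).
Proof.
move=> Fc cc f1 f2 rs; apply: eq_cd (series_cd_s t s cc f1 f2 (pos_norm rs)) => x.
by rewrite Fc.
Qed.

Lemma sums_pd_t F c : sums F c -> fbd sigma c -> fbd sigma (fj c) -> sums (pd_fun i_theta F) (fj c).
Proof. by move=> Fc f1 f2 rho t s rs; apply: cd_dir_pd; apply: cd_dir_theta; exact: sums_cd_t. Qed.
Lemma sums_pd_s F c : sums F c -> (forall m n s, cderivable (c m n) s) ->
  fbd sigma c -> fbd sigma (fd c) -> sums (pd_fun i_s F) (fd c).
Proof. by move=> Fc cc f1 f2 rho t s rs; apply: cd_dir_pd; apply: cd_dir_s; exact: sums_cd_s. Qed.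

Lemma sums_coef (h : R -> C) F c : sums F c -> fbd sigma c -> fbd sigma (fun m n s => h s * c m n s) ->
  sums (fun rho t s => h s * F rho t s) (fun m n s => h s * c m n s).
Proof.
by move=> Fc f1 f2 rho t s rs; rewrite (series_coef t s f1 (pos_norm rs) f2) Fc.
Qed.

Lemma series_add a b rho t s : fbd sigma a -> fbd sigma b -> fbd sigma (fun m n s => a m n s + b m n s) ->
  `|rho| < sigma ->
  series_fun (fun m n s => a m n s + b m n s) rho t s = series_fun a rho t s + series_fun b rho t s.
Proof.
move=> fa fb fab rs.
have E : (fun m n s => a m n s + b m n s) = (fun m n s => 1 * a m n s + 1 * b m n s).
  by apply/funext => m; apply/funext => n; apply/funext => x; rewrite !mul1r.
rewrite E in fab *; by rewrite (series_lin t s fa fb rs fab) !mul1r.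
Qed.

Lemma tfam_cderivable p c : tfam c -> (forall m, sobrow p.+2 m (c m)) ->
  forall m n s, cderivable (c m n) s.
Proof.
move=> tc sc m n s; have [mn|nm] := ltnP m n.
  by rewrite tc//; exact: cd_cderivable (cd_cst 0 s).
by have [h _ _] := sobT_derive (sc m n nm); exact: cd_cderivable (h s).
Qed.

Lemma tfam_fd c : tfam c -> tfam (fd c).
Proof.
by move=> tc m n mn; apply/funext => s; rewrite /fd /rowd tc// cderive0.
Qed.


Lemma sums_iter (G : fn -> fn) (h : (nat -> nat -> R -> C) -> nat -> nat -> R -> C)
    (P : nat -> (nat -> nat -> R -> C) -> Prop) n F c :
  (forall n F c, P n.+1 c -> sums F c -> sums (G F) (h c) /\ P n (h c)) ->
  P n c -> sums F c -> sums (iter n G F) (iter n h c).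
Proof.
move=> H; elim: n F c => [|n IH] F c Pc Fc //; have [E Pc'] := H _ _ _ Pc Fc.
by rewrite !iterSr; exact: IH.
Qed.

End FunctionGeometry.

(** * Derivatives in the nonsingular coordinates x and y *)

Section CartesianDerivatives.
Variable R : realType.
Local Notation C := R[i].
Implicit Types (a : nat -> nat -> R -> C) (c : nat -> R -> C) (rho t s : R).

Lemma tfam_dx a : tfam a -> tfam (fdx a).
Proof.
move=> ta m n mn; apply/funext => s; rewrite /fdx (ta m.+1 n.+1); last by lia.
have -> : (m.+1 - n = 0)%N by lia.
by rewrite mul0r mulr0 addr0.
Qed.
Lemma tfam_dy a : tfam a -> tfam (fdy a).
Proof.
move=> ta m n mn; apply/funext => s; rewrite /fdy (ta m.+1 n.+1); last by lia.
have -> : (m.+1 - n = 0)%N by lia.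
by rewrite mul0r mulr0 subr0 mulr0.
Qed.

Lemma rowf_dxy_arith (x y z a1 a0 : C) : x + y = z + 1 -> (* x = n, y = m + 2 - n, z = m + 1 *)
  (2^-1 * (z * a1 + z * a0) - - 'i * 2^-1 * ('i * (2 * (x - 1) - z) * a0 - 'i * (2 * x - z) * a1) =
   y * a0 + x * a1) /\
  (- 'i * 2^-1 * (z * a0 - z * a1) + 2^-1 * ('i * (2 * x - z) * a1 + 'i * (2 * (x - 1) - z) * a0) =
   'i * (x * a1 - y * a0)).
Proof.
move=> xy; have -> : y = z + 1 - x by rewrite -xy; ring.
have JJ : 'i * 'i = -1 :> C by rewrite -expr2 sqr_i.
split; last by field.
have -> : - 'i * 2^-1 * ('i * (2 * (x - 1) - z) * a0 - 'i * (2 * x - z) * a1) =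
  - ('i * 'i) * 2^-1 * ((2 * (x - 1) - z) * a0 - (2 * x - z) * a1) :> C by ring.
by rewrite JJ; field.
Qed.

(** d/dx is cos theta d/drho - (sin theta / rho) d/dtheta. The trigonometric factors produce a row
    of order m + 2 whose extreme frequencies cancel, leaving a row of order m; this cancellation
    makes the Cartesian components analytic although the polar ones are singular. *)
Lemma rowf_dx a m t s : tfam a ->
  (cos t)%:C * rowf m.+1 (fe a m.+1) t s - (sin t)%:C * rowf m.+1 (fj a m.+1) t s = rowf m (fdx a m) t s.
Proof.
move=> ta; have tfe := @tfam_fe _ a ta; have tfj := @tfam_fj _ a ta.
rewrite rowf_cos; last exact: tfe. rewrite rowf_sin; last exact: tfj.
rewrite (rowf_sq _ _ (@tfam_dx a ta m)) -[X in X - _]mul1r -[- _]mulN1r -rowf_lin.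
apply: eq_rowf => n nm; rewrite mul1r mulN1r /rowZ /rowD /rowB realCV -natrCE /fe /fj /rowj.
case: n nm => [|n] nm.
  rewrite /= addr0 sub0r jfE mulr0 sub0r.
  have JJ : 'i * 'i = -1 :> C by rewrite -expr2 sqr_i.
  have -> : - 'i * 2^-1 * - ('i * - m.+1%:R * a m.+1 0%N s) = ('i * 'i) * 2^-1 * (- m.+1%:R * a m.+1 0%N s) :> C by ring.
  by rewrite JJ; ring.
have xy : n.+1%:R + (m.+1 - n)%:R = m.+1%:R + 1 :> C by rewrite -natrD addSn subnKC ?natr1.
have [h _] := rowf_dxy_arith (a m.+1 n.+1 s) (a m.+1 n s) xy.
rewrite /prv /fdx -h !jfE.
have -> : (n%:R : C) = n.+1%:R - 1 by rewrite -natr1 addrK.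
by [].
Qed.

Lemma rowf_dy a m t s : tfam a ->
  (sin t)%:C * rowf m.+1 (fe a m.+1) t s + (cos t)%:C * rowf m.+1 (fj a m.+1) t s = rowf m (fdy a m) t s.
Proof.
move=> ta; have tfe := @tfam_fe _ a ta; have tfj := @tfam_fj _ a ta.
rewrite rowf_cos; last exact: tfj. rewrite rowf_sin; last exact: tfe.
rewrite (rowf_sq _ _ (@tfam_dy a ta m)) -[X in X + _]mul1r -[X in _ + X]mul1r -rowf_lin.
apply: eq_rowf => n nm; rewrite !mul1r /rowZ /rowD /rowB realCV -natrCE /fe /fj /rowj.
case: n nm => [|n] nm.
  by rewrite /= addr0 sub0r jfE mulr0 sub0r; ring.
have xy : n.+1%:R + (m.+1 - n)%:R = m.+1%:R + 1 :> C by rewrite -natrD addSn subnKC ?natr1.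
have [_ h] := rowf_dxy_arith (a m.+1 n.+1 s) (a m.+1 n s) xy.
rewrite /prv /fdy -h !jfE.
have -> : (n%:R : C) = n.+1%:R - 1 by rewrite -natr1 addrK.
by [].
Qed.

Lemma partial_sum_fe0 a N rho t s : partial_sum (fe a) N.+1 rho t s =
  rho%:C * \sum_(m < N) (rho ^+ m)%:C * rowf m.+1 (fe a m.+1) t s.
Proof.
rewrite /partial_sum big_ord_recl modeE {1}/rowf big_ord_recl big_ord0 /fe mul0r mul0r addr0 mulr0 add0r mulr_sumr.
by apply: eq_bigr => m _; rewrite modeE /= /bump add1n exprS realCM mulrA.
Qed.
Lemma partial_sum_fj0 a N rho t s : partial_sum (fj a) N.+1 rho t s =
  rho%:C * \sum_(m < N) (rho ^+ m)%:C * rowf m.+1 (fj a m.+1) t s.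
Proof.
rewrite /partial_sum big_ord_recl modeE {1}/rowf big_ord_recl big_ord0 /fj {1}/rowj jfE mulr0 subrr mulr0 !mul0r addr0 mulr0 add0r mulr_sumr.
by apply: eq_bigr => m _; rewrite modeE /= /bump add1n exprS realCM mulrA.
Qed.

Lemma series_dx sigma p a rho t s : tfam a -> erg sigma p.+1 a -> 0 < rho < sigma ->
  (cos t)%:C * series_fun (fe a) rho t s - (sin t)%:C * series_fun (fj a) rho t s =
  rho%:C * series_fun (fdx a) rho t s.
Proof.
move=> ta ea rs; have rs' := pos_norm rs.
have c1 := ccvg_shift (series_cvg t s (erg_fbd (erg_e ea)) rs').
have c2 := ccvg_shift (series_cvg t s (erg_fbd (erg_j ea)) rs').
have c3 := series_cvg t s (erg_fbd (erg_dx ea)) rs'.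
apply: ccvg_unique (ccvgB (ccvgM (ccvg_cst (cos t)%:C) c1) (ccvgM (ccvg_cst (sin t)%:C) c2)) _.
apply: eq_ccvg (ccvgM (ccvg_cst rho%:C) c3) => N.
rewrite partial_sum_fe0 partial_sum_fj0 mulrCA [X in _ = _ - X]mulrCA -mulrBr; congr (_ * _).
rewrite !mulr_sumr -sumrB; apply: eq_bigr => m _; rewrite modeE -rowf_dx//; ring.
Qed.

Lemma series_dy sigma p a rho t s : tfam a -> erg sigma p.+1 a -> 0 < rho < sigma ->
  (sin t)%:C * series_fun (fe a) rho t s + (cos t)%:C * series_fun (fj a) rho t s =
  rho%:C * series_fun (fdy a) rho t s.
Proof.
move=> ta ea rs; have rs' := pos_norm rs.
have c1 := ccvg_shift (series_cvg t s (erg_fbd (erg_e ea)) rs').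
have c2 := ccvg_shift (series_cvg t s (erg_fbd (erg_j ea)) rs').
have c3 := series_cvg t s (erg_fbd (erg_dy ea)) rs'.
apply: ccvg_unique (ccvgD (ccvgM (ccvg_cst (sin t)%:C) c1) (ccvgM (ccvg_cst (cos t)%:C) c2)) _.
apply: eq_ccvg (ccvgM (ccvg_cst rho%:C) c3) => N.
rewrite partial_sum_fe0 partial_sum_fj0 mulrCA [X in _ = _ + X]mulrCA -mulrDr; congr (_ * _).
rewrite !mulr_sumr -big_split; apply: eq_bigr => m _; rewrite modeE -rowf_dy//=; ring.
Qed.

End CartesianDerivatives.

(** * The field B_K *)

Section FunctionField.
Variable R : realType.
Local Notation C := R[i].
Local Notation fn := (R -> R -> R -> C).
Local Notation Fn := (functions R).
Variables (r : R -> 'rV[R]_3) (K sigma M : R) (D q : nat) (B0 : R -> C).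
Local Notation l := (ell r).
Local Notation kap := (curvature r).
Local Notation tau := (torsion r).
Local Notation pa := (q.+1 + 2 * D)%N.
Hypothesis l0 : l != 0.
Hypothesis D0 : (0 < D)%N.
Hypothesis sigma0 : 0 < sigma.
Hypothesis kapb : Rb q.+2 M kap.
Hypothesis chib : Rb q.+2 M (fun s => l * kap s).
Hypothesis etab : Rb q.+2 M (fun s => l * tau s).
Hypothesis nz : forall rho t s, 0 < rho < sigma -> 1 - kap s * cos t * rho != 0.
Variables (a U : nat -> nat -> R -> C).
Hypothesis ta : tfam a.
Hypothesis tU : tfam U.
Hypothesis ea : erg sigma pa a.
Hypothesis eU : erg sigma q.+2 U.
Hypothesis eB : erg sigma q.+2 (source B0).
Hypothesis HU : recU l^-1 tau kap a U (source B0).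
Hypothesis HA : recA K D l (fun s => l * kap s) (fun s => l * tau s) 1 a U (fun _ => @z0 R).
Implicit Types (F f : fn) (c b : nat -> nat -> R -> C) (rho t s : R).
Local Notation sums := (sums sigma).
Local Notation eta s := ((l * tau s)%:C : C).
Local Notation chi s := ((l * kap s)%:C : C).
Local Notation P := (fP K D a).
Local Notation Phi := (series_fun a : Fn).

Definition G_s : fn -> fn := fun g rho t s => (- K ^- 2)%:C * ((curve_length r / (2 * pi * l))%:C *
   pd_fun i_s (fun rho t s => (curve_length r / (2 * pi * l))%:C * pd_fun i_s g rho t s) rho t s).
Definition G_t : fn -> fn := fun g rho t s => (- K ^- 2)%:C * pd_fun i_theta (pd_fun i_theta g) rho t s.

Lemma Pop_fnE (g : Fn) rho t s : (Pop r K D g : fn) rho t s = iter D G_s g rho t s + iter D G_t g rho t s.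
Proof. by []. Qed.

Lemma sums_Phi : sums Phi a. Proof. by []. Qed.

Lemma sums_Ds F c p : tfam c -> erg sigma p.+3 c -> sums F c -> sums (G_s F) (fun m n s => (- K ^- 2)%:C * fd (fd c) m n s).
Proof.
move=> tc ec Fc; have e1 := erg_d ec; have e2 := erg_d e1.
have c1 := tfam_cderivable tc ec.1; have c2 := tfam_cderivable (tfam_fd tc) e1.1.
have s1 := sums_pd_s Fc c1 (erg_fbd ec) (erg_fbd e1).
have s1' : sums (fun rho t s => (curve_length r / (2 * pi * l))%:C * pd_fun i_s F rho t s) (fd c).
  by move=> rho t s rs; rewrite speed_ratio// mul1r s1.
have s2 := sums_pd_s s1' c2 (erg_fbd e1) (erg_fbd e2).
move=> rho t s rs; rewrite /G_s; set Y := pd_fun i_s _ rho t s.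
rewrite (speed_ratio l0) mul1r.
exact: (sums_coef (h := fun=> (- K ^- 2)%:C) s2 (erg_fbd e2) (erg_fbd (ergZ _ e2)) t s rs).
Qed.

Lemma sums_Dt F c p : erg sigma p.+1 c -> sums F c ->
  sums (G_t F) (fun m n s => (- K ^- 2)%:C * fj (fj c) m n s).
Proof.
move=> ec Fc; have e1 := erg_j ec; have e2 := erg_j e1.
have s2 := sums_pd_t (sums_pd_t Fc (erg_fbd ec) (erg_fbd e1)) (erg_fbd e1) (erg_fbd e2).
move=> rho t s rs.
exact: (sums_coef (h := fun=> (- K ^- 2)%:C) s2 (erg_fbd e2) (erg_fbd (ergZ _ e2)) t s rs).
Qed.

Lemma symb_iter n c : iter n (fun c m n s => (- K ^- 2)%:C * fj (fj c) m n s) c =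
  fun m n' s => (symb K n (jf m n'))%:C * c m n' s.
Proof.
elim: n => [|n IH].
  by apply/funext => m; apply/funext => n; apply/funext => s; rewrite /symb expr0 mul1r.
rewrite iterS IH; apply/funext => m; apply/funext => n'; apply/funext => s.
rewrite /symb [_ ^+ n.+1]exprS /fj /rowj (realCM (K ^- 2 * _)) (realCM (K ^- 2)) intrCE (realCX _ 2).
have JJ : 'i * 'i = -1 :> C by rewrite -expr2 sqr_i.
set J := ((jf m n')%:~R : R)%:C; set S := (_ ^+ n)%:C.
have -> : 'i * J * ('i * J * (S * c m n' s)) = ('i * 'i) * J ^+ 2 * S * c m n' s by ring.
by rewrite JJ realCN; ring.
Qed.

Lemma Kop_iter n c : iter n (fun c m n s => (- K ^- 2)%:C * fd (fd c) m n s) c =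
  fun m n' => Kop K n (c m n').
Proof.
elim: n => [|n IH]; first by [].
by rewrite iterS IH.
Qed.

Lemma erg_q : erg sigma q.+1 a. Proof. by apply: erg_le ea; exact: leq_addr. Qed.
Lemma erg_q3 : erg sigma q.+3 a.
Proof. by apply: erg_le ea; case: (D) D0 => // D' _; rewrite mulnS; lia. Qed.

Lemma eP : erg sigma q.+1 P. Proof. exact: erg_P ea. Qed.

Lemma tfamP : tfam P.
Proof.
have c0 : cderive (fun=> 0 : C) = fun=> 0 by apply/funext => x; exact: cderive0.
have c1 x : cderive (cderive (fun=> 0 : C)) x = 0 := etrans (congr1 (fun g : R -> C => cderive g x) c0) (cderive0 x).
have K0 n : Kop K n (fun=> 0 : C) = fun=> 0.
  elim: n => [|n IH]; first by [].
  rewrite /Kop iterS -/(Kop K n _) IH; apply/funext => x.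
  exact: (etrans (congr1 (fun z => (- K ^- 2)%:C * z) (c1 x)) (mulr0 _)).
by move=> m n mn; apply/funext => s; rewrite /fP ta// K0 mulr0 addr0.
Qed.

(** The induction tracks regularity: each second derivative in s consumes two Sobolev orders of the
    2D available, whereas those in theta consume none. *)
Lemma sums_Pop : sums (Pop r K D Phi) P.
Proof.
have [S1 S2] : sums (iter D G_s Phi) (fun m n => Kop K D (a m n)) /\
    sums (iter D G_t Phi) (fun m n s => (symb K D (jf m n))%:C * a m n s).
  rewrite -Kop_iter -symb_iter; split.
    refine (@sums_iter R sigma G_s _ (fun n c => tfam c /\ erg sigma (q.+1 + 2 * n) c) D Phi a _ (conj ta ea) sums_Phi).
    move=> n F c [tc ec] Fc.
    have e3 : erg sigma (q + 2 * n).+3 c by apply: erg_le ec; rewrite mulnS; lia.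
    split; first exact: sums_Ds tc e3 Fc.
    split; last by rewrite addSn; apply: ergZ; exact: erg_d (erg_d e3).
    by move=> m k mk; apply/funext => s; rewrite (tfam_fd (tfam_fd tc)) ?mulr0.
  refine (@sums_iter R sigma G_t _ (fun n c => erg sigma q.+1 c) D Phi a _ erg_q sums_Phi) => n F c ec Fc.
  by split; [exact: sums_Dt ec Fc|apply: ergZ; exact: erg_j (erg_j ec)].
move=> rho t s rs; rewrite (Pop_fnE Phi) S1// S2//; symmetry; apply: series_add (pos_norm rs).
- exact: erg_fbd (erg_Kop K ea).
- by rewrite -symb_iter; apply: (@erg_fbd _ _ q); elim: (D) => [|n IH] /=; [exact: erg_q|apply: ergZ; exact: erg_j (erg_j IH)].
- exact: erg_fbd eP.
Qed.

Definition hF rho t s : C := l%:C - l%:C * kcos r t s * rho%:C.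
Definition hVF rho t s : C := (l^-1)%:C * (1 - kcos r t s * rho%:C)^-1.

Lemma lC : l%:C != 0 :> C. Proof. by rewrite realC_eq0. Qed.

Lemma hV_nz rho t s : 0 < rho < sigma -> 1 - kcos r t s * rho%:C != 0.
Proof.
move=> rs; have := nz t s rs; rewrite -realC_eq0; congr (~~ (_ == 0)).
by rewrite /kcos !realCB !realCM.
Qed.

Lemma hF_hVF rho t s : 0 < rho < sigma -> hF rho t s * hVF rho t s = 1.
Proof.
move=> rs; have n0 := hV_nz t s rs; rewrite /hF /hVF realCV.
have -> : l%:C - l%:C * kcos r t s * rho%:C = l%:C * (1 - kcos r t s * rho%:C) by ring.
by rewrite mulrACA divff ?divff ?mulr1 ?lC.
Qed.

Lemma hF_nz rho t s : 0 < rho < sigma -> hF rho t s != 0.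
Proof.
move=> rs; apply/eqP => h0; have := hF_hVF t s rs; rewrite h0 mul0r => /esym/eqP.
by rewrite oner_eq0.
Qed.

Lemma hVFE rho t s : 0 < rho < sigma -> hVF rho t s = (hF rho t s)^-1.
Proof.
by move=> rs; apply: (mulfI (hF_nz t s rs)); rewrite hF_hVF// divff// hF_nz.
Qed.

Lemma erg_hfam p c : (p <= q.+1)%N -> tfam c -> erg sigma p.+1 c -> erg sigma p.+1 (hfam r c).
Proof.
move=> pq tc ec; apply: ergB; first exact: ergZ.
by apply: ergM (erg_cos tc ec); apply: Rb_le chib.
Qed.


Lemma h_series p c rho t s : (p <= q.+1)%N -> tfam c -> erg sigma p.+1 c -> 0 < rho < sigma ->
  hF rho t s * series_fun c rho t s = series_fun (hfam r c) rho t s.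
Proof.
move=> pq tc ec rs; have rs' := pos_norm rs; have ek := erg_cos tc ec.
have eX : erg sigma p.+1 (fun m n s => - chi s * fcos c m n s).
  have := ergZ (-1) (ergM (@Rb_le R p.+1 q.+2 M _ pq chib) ek); apply: eq_erg => m n _.
  by apply/funext => x; rewrite [RHS]mulNr mulN1r.
have -> : hfam r c = fun m n s => (fun m n s => l%:C * c m n s) m n s + (fun m n s => - chi s * fcos c m n s) m n s.
  by apply/funext => m; apply/funext => n; apply/funext => x; rewrite /hfam mulNr.
have e1 := ergZ l%:C ec.
rewrite (series_add t s (erg_fbd e1) (erg_fbd eX) (erg_fbd (ergD e1 eX)) rs').
rewrite (series_coef (h := fun=> l%:C) t s (erg_fbd ec) rs' (erg_fbd e1)).
rewrite (series_coef (h := fun s => - chi s) t s (erg_fbd ek) rs' (erg_fbd eX)).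
rewrite (series_cos t s tc (erg_fbd ec) (erg_fbd ek) rs').
by rewrite /hF /kcos (realCM l) (realCM (kap s)); ring.
Qed.

Lemma series_source rho t s : 0 < rho < sigma -> series_fun (source B0) rho t s = B0 s.
Proof.
move=> rs; apply: ccvg_unique (ccvg_shift (series_cvg t s (erg_fbd eB) (pos_norm rs))) _.
apply: eq_ccvg (ccvg_cst (B0 s)) => N.
rewrite /partial_sum big_ord_recl big1 => [|m _].
  by rewrite modeE /rowf big_ord_recl big_ord0 /source /= expr0 mul1r !addr0 eik0 mulr1.
by rewrite modeE /rowf big1 ?mulr0// => n _; rewrite /source /= mul0r.
Qed.

Lemma u_series rho t s : 0 < rho < sigma -> hF rho t s * series_fun U rho t s =
  series_fun (fd a) rho t s - eta s * series_fun (fj a) rho t s + l%:C * B0 s.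
Proof.
move=> rs; have rs' := pos_norm rs; rewrite (h_series t s (leqnn _) tU eU rs).
have e1 : erg sigma q.+2 (fd a) := erg_d erg_q3.
have e2 : erg sigma q.+2 (fj a) := erg_le (leqnSn _) (erg_j erg_q3).
have e3 : erg sigma q.+2 (fun m n s => - eta s * fj a m n s).
  have := ergZ (-1) (ergM etab e2); apply: eq_erg => m n _.
  by apply/funext => x; rewrite [RHS]mulNr mulN1r.
have e4 := ergZ l%:C eB.
rewrite -(series_source t s rs) -mulNr.
rewrite -(series_coef (h := fun s => - eta s) t s (erg_fbd e2) rs' (erg_fbd e3)).
rewrite -(series_coef (h := fun _ => l%:C) t s (erg_fbd eB) rs' (erg_fbd e4)).
rewrite -(series_add t s (erg_fbd e1) (erg_fbd e3) (erg_fbd (ergD e1 e3)) rs').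
rewrite -(series_add t s (erg_fbd (ergD e1 e3)) (erg_fbd e4) (erg_fbd (ergD (ergD e1 e3) e4)) rs').
by apply: eq_series => m n nm; rewrite /hfam (recU_mul l0 HU)// mulNr.
Qed.

Lemma ginv_fn rho t s :
  let hV := hVF rho t s in let g := l%:C * (tau s)%:C * (hV * hV) in
  [/\ (ginv Fn r i_rho i_rho : fn) rho t s = 1,
      (ginv Fn r i_theta i_theta : fn) rho t s = l%:C * l%:C * (tau s)%:C * (tau s)%:C * (hV * hV) + (rho ^- 2)%:C,
      (ginv Fn r i_theta i_s : fn) rho t s = - g, (ginv Fn r i_s i_theta : fn) rho t s = - g &
      (ginv Fn r i_s i_s : fn) rho t s = hV * hV].
Proof. by rewrite /ginv /entry /i_rho /i_theta /i_s !inordK. Qed.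

Lemma ginv_fn0 : [/\ ginv Fn r i_rho i_theta = 0, ginv Fn r i_rho i_s = 0,
  ginv Fn r i_theta i_rho = 0 & ginv Fn r i_s i_rho = 0].
Proof. by rewrite /ginv /entry /i_rho /i_theta /i_s !inordK. Qed.

Lemma Gperp_fn rho t s : [/\ (Gperp Fn i_rho i_rho : fn) rho t s = 1,
  (Gperp Fn i_theta i_theta : fn) rho t s = (rho ^- 2)%:C & Gperp Fn i_s i_rho = 0 /\ Gperp Fn i_s i_theta = 0 /\ Gperp Fn i_s i_s = 0].
Proof. by rewrite /Gperp /entry /i_rho /i_theta /i_s !inordK. Qed.
Lemma Gperp_fn0 : [/\ Gperp Fn i_rho i_theta = 0, Gperp Fn i_rho i_s = 0,
  Gperp Fn i_theta i_rho = 0 & Gperp Fn i_theta i_s = 0].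
Proof. by rewrite /Gperp /entry /i_rho /i_theta /i_s !inordK. Qed.

Lemma BK_fnE (F : Fn) i rho t s : (BK r K D B0 F i : fn) rho t s =
  ((ginv Fn r i i_rho : fn) rho t s * pd_fun i_rho F rho t s +
   (ginv Fn r i i_theta : fn) rho t s * pd_fun i_theta F rho t s +
   (ginv Fn r i i_s : fn) rho t s * pd_fun i_s F rho t s) +
  B0 s * l%:C * (ginv Fn r i i_s : fn) rho t s +
  rho%:C * ((rho^-1)%:C * hVF rho t s) *
  ((Gperp Fn i i_rho : fn) rho t s * pd_fun i_rho (Pop r K D F) rho t s +
   (Gperp Fn i i_theta : fn) rho t s * pd_fun i_theta (Pop r K D F) rho t s +
   (Gperp Fn i i_s : fn) rho t s * pd_fun i_s (Pop r K D F) rho t s).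
Proof. by rewrite /BK /grad !sum_coord3. Qed.

Lemma Phi_derivatives rho t s : 0 < rho < sigma ->
  [/\ pd_fun i_rho Phi rho t s = (rho^-1)%:C * series_fun (fe a) rho t s,
      pd_fun i_theta Phi rho t s = series_fun (fj a) rho t s &
      pd_fun i_s Phi rho t s = series_fun (fd a) rho t s].
Proof.
move=> rs; have e1 := erg_e erg_q; have e2 := erg_j erg_q; have e3 := erg_d erg_q3.
split.
- by apply: cd_dir_pd; apply: cd_dir_rho; exact: sums_cd_rho sums_Phi (erg_fbd erg_q) (erg_fbd e1) rs.
- exact: sums_pd_t sums_Phi (erg_fbd erg_q) (erg_fbd e2) _ _ _ rs.
- exact: sums_pd_s sums_Phi (tfam_cderivable ta erg_q3.1) (erg_fbd erg_q) (erg_fbd e3) _ _ _ rs.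
Qed.

Lemma Pop_derivatives rho t s : 0 < rho < sigma ->
  pd_fun i_rho (Pop r K D Phi) rho t s = (rho^-1)%:C * series_fun (fe P) rho t s /\
  pd_fun i_theta (Pop r K D Phi) rho t s = series_fun (fj P) rho t s.
Proof.
move=> rs; have e1 := erg_e eP; have e2 := erg_j eP; split.
- by apply: cd_dir_pd; apply: cd_dir_rho; exact: sums_cd_rho sums_Pop (erg_fbd eP) (erg_fbd e1) rs.
- exact: sums_pd_t sums_Pop (erg_fbd eP) (erg_fbd e2) _ _ _ rs.
Qed.

Lemma rhoC_nz rho : 0 < rho < sigma -> rho%:C != 0 :> C.
Proof. by move=> /andP[r0 _]; rewrite realC_eq0 gt_eqF. Qed.

Lemma BK_rho rho t s : 0 < rho < sigma -> (BK r K D B0 Phi i_rho : fn) rho t s =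
  (rho^-1)%:C * (series_fun (fe a) rho t s + hVF rho t s * series_fun (fe P) rho t s).
Proof.
move=> rs; rewrite BK_fnE; have [-> _ _ _ _] := ginv_fn rho t s; have [-> -> _ _] := ginv_fn0.
have [-> _ _] := Gperp_fn rho t s; have [-> -> _ _] := Gperp_fn0.
have [-> _ _] := Phi_derivatives t s rs; have [-> _] := Pop_derivatives t s rs.
have z0 (F : fn) : (0 : Fn) rho t s * F rho t s = 0 by rewrite [LHS](_ : _ = 0 * F rho t s)// mul0r.
rewrite !z0 [X in _ * _ * X](_ : _ = 0)// mulr0 !addr0 !mul1r realCV.
by field; exact: rhoC_nz.
Qed.

Lemma BK_theta rho t s : 0 < rho < sigma -> (BK r K D B0 Phi i_theta : fn) rho t s =
  (rho ^- 2)%:C * (series_fun (fj a) rho t s + hVF rho t s * series_fun (fj P) rho t s)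
  - eta s * hVF rho t s * series_fun U rho t s.
Proof.
move=> rs; rewrite BK_fnE; have [_ -> -> _ _] := ginv_fn rho t s; have [_ _ -> _] := ginv_fn0.
have [_ -> _] := Gperp_fn rho t s; have [_ _ -> ->] := Gperp_fn0.
have [_ -> ->] := Phi_derivatives t s rs; have [_ ->] := Pop_derivatives t s rs.
have z0 (F : fn) : (0 : Fn) rho t s * F rho t s = 0 by rewrite [LHS](_ : _ = 0 * F rho t s)// mul0r.
rewrite !z0 !add0r !addr0.
have uE : series_fun U rho t s = hVF rho t s * (series_fun (fd a) rho t s - eta s * series_fun (fj a) rho t s + l%:C * B0 s).
  by rewrite -u_series// mulrA [_ * hF _ _ _]mulrC hF_hVF// mul1r.
rewrite uE (realCM l) realCV.
by field; exact: rhoC_nz.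
Qed.

Lemma BK_s rho t s : 0 < rho < sigma -> (BK r K D B0 Phi i_s : fn) rho t s =
  hVF rho t s * series_fun U rho t s.
Proof.
move=> rs; rewrite BK_fnE; have [_ _ _ -> ->] := ginv_fn rho t s; have [_ _ _ ->] := ginv_fn0.
have [_ _ [-> [-> ->]]] := Gperp_fn rho t s.
have [_ -> ->] := Phi_derivatives t s rs.
have z0 (F : fn) : (0 : Fn) rho t s * F rho t s = 0 by rewrite [LHS](_ : _ = 0 * F rho t s)// mul0r.
rewrite !z0 !addr0 mulr0 addr0 add0r.
have uE : series_fun U rho t s = hVF rho t s * (series_fun (fd a) rho t s - eta s * series_fun (fj a) rho t s + l%:C * B0 s).
  by rewrite -u_series// mulrA [_ * hF _ _ _]mulrC hF_hVF// mul1r.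
by rewrite uE (realCM l); ring.
Qed.

(** [crho] and [ctheta] are the coefficients of rho d/drho and d/dtheta fluxes, h_s times the
    derivative of phi plus that of P phi. Multiplied by sqrt g, the field has components crho,
    ctheta / rho - rho l tau U and rho U, free of 1/h_s. *)
Definition crho m n s : C := hfam r (fe a) m n s + fe P m n s.
Definition ctheta m n s : C := hfam r (fj a) m n s + fj P m n s.

Lemma erg_crho : erg sigma q.+1 crho.
Proof. by apply: ergD; [apply: erg_hfam (tfam_fe ta) (erg_e erg_q); exact: leqnSn|exact: erg_e eP]. Qed.
Lemma erg_ctheta : erg sigma q.+1 ctheta.
Proof. by apply: ergD; [apply: erg_hfam (tfam_fj ta) (erg_j erg_q); exact: leqnSn|exact: erg_j eP]. Qed.

Lemma sqrtg_fnE (F : Fn) rho t s : (Defs.mul (sqrtg Fn r) F : fn) rho t s = rho%:C * hF rho t s * F rho t s.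
Proof. by []. Qed.

Lemma flux_fn_rho : sums (Defs.mul (sqrtg Fn r) (BK r K D B0 Phi i_rho)) crho.
Proof.
move=> rho t s rs; rewrite sqrtg_fnE BK_rho//; have rs' := pos_norm rs.
rewrite (series_add t s _ _ (erg_fbd erg_crho) rs'); first last.
- exact: erg_fbd (erg_e eP).
- by apply: erg_fbd (erg_hfam _ (tfam_fe ta) (erg_e erg_q)); exact: leqnSn.
rewrite -(h_series t s _ (tfam_fe ta) (erg_e erg_q) rs) ?leqnSn// hVFE// realCV.
by field; rewrite rhoC_nz// hF_nz.
Qed.

Lemma flux_fn_theta rho t s : 0 < rho < sigma ->
  (Defs.mul (sqrtg Fn r) (BK r K D B0 Phi i_theta) : fn) rho t s =
  (rho^-1)%:C * series_fun ctheta rho t s - rho%:C * eta s * series_fun U rho t s.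
Proof.
move=> rs; rewrite sqrtg_fnE BK_theta//; have rs' := pos_norm rs.
rewrite (series_add t s _ _ (erg_fbd erg_ctheta) rs'); first last.
- exact: erg_fbd (erg_j eP).
- by apply: erg_fbd (erg_hfam _ (tfam_fj ta) (erg_j erg_q)); exact: leqnSn.
rewrite -(h_series t s _ (tfam_fj ta) (erg_j erg_q) rs) ?leqnSn// hVFE// !realCV realCX.
by field; rewrite rhoC_nz// hF_nz.
Qed.

Lemma flux_fn_s rho t s : 0 < rho < sigma ->
  (Defs.mul (sqrtg Fn r) (BK r K D B0 Phi i_s) : fn) rho t s = rho%:C * series_fun U rho t s.
Proof.
by move=> rs; rewrite sqrtg_fnE BK_s// -mulrA [hF _ _ _ * _]mulrA hF_hVF// mul1r.
Qed.

Lemma flux_cd_rho rho t s : 0 < rho < sigma ->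
  cd_dir i_rho (Defs.mul (sqrtg Fn r) (BK r K D B0 Phi i_rho)) rho t s ((rho^-1)%:C * series_fun (fe crho) rho t s).
Proof.
move=> rs; apply: cd_dir_rho.
exact: sums_cd_rho flux_fn_rho (erg_fbd erg_crho) (erg_fbd (erg_e erg_crho)) rs.
Qed.

Lemma flux_cd_theta rho t s : 0 < rho < sigma ->
  cd_dir i_theta (Defs.mul (sqrtg Fn r) (BK r K D B0 Phi i_theta)) rho t s
   ((rho^-1)%:C * series_fun (fj ctheta) rho t s - rho%:C * eta s * series_fun (fj U) rho t s).
Proof.
move=> rs; apply: cd_dir_theta; have rs' := pos_norm rs.
have h1 := series_cd_t t s (erg_fbd erg_ctheta) (erg_fbd (erg_j erg_ctheta)) rs'.
have h2 := series_cd_t t s (erg_fbd eU) (erg_fbd (erg_j eU)) rs'.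
by apply: eq_cd (cdB (cdZ _ h1) (cdZ _ h2)) => x; rewrite flux_fn_theta.
Qed.

Lemma flux_cd_s rho t s : 0 < rho < sigma ->
  cd_dir i_s (Defs.mul (sqrtg Fn r) (BK r K D B0 Phi i_s)) rho t s (rho%:C * series_fun (fd U) rho t s).
Proof.
move=> rs; apply: cd_dir_s; have rs' := pos_norm rs.
have h2 := series_cd_s t s (tfam_cderivable tU eU.1) (erg_fbd eU) (erg_fbd (erg_d eU)) rs'.
by apply: eq_cd (cdZ rho%:C h2) => x; rewrite flux_fn_s.
Qed.

(** The identity [eqfam] = 0 holds for each coefficient; summed as a convergent series at rho <
    sigma it is rho^2 times the cleared divergence equation. *)
Lemma balance rho t s : 0 < rho < sigma ->
  series_fun (fe crho) rho t s + series_fun (fj ctheta) rho t s +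
  (rho ^+ 2)%:C * (series_fun (fd U) rho t s - eta s * series_fun (fj U) rho t s) = 0.
Proof.
move=> rs; have rs' := pos_norm rs.
pose du m n s := fd U m n s - eta s * fj U m n s.
have eq0 := (eqfam_recA K D l (fun s => l * kap s) (fun s => l * tau s) ta tU).2 HA.
have td : tfam du.
  by move=> m n mn; apply/funext => x; rewrite /du (tfam_fd tU)// (tfam_fj tU)// mulr0 subrr.
have e1 : erg sigma q.+1 (fd U) := erg_d eU.
have e2 : erg sigma q.+1 (fj U) := erg_le (leqnSn _) (erg_j eU).
have e3 : erg sigma q.+1 (fun m n s => - eta s * fj U m n s).
  have := ergZ (-1) (ergM (Rb_le (leqnSn _) etab) e2); apply: eq_erg => m n _.
  by apply/funext => x; rewrite [RHS]mulNr mulN1r.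
have ed : erg sigma q.+1 du.
  by apply: eq_erg (ergD e1 e3) => m n _; apply/funext => x; rewrite /du mulNr.
have ec := erg_e erg_crho; have et := erg_j erg_ctheta; have es := ergD ec et.
(* The bound on the rho^2 part is read off the equation, which identifies it with minus the other
   two families. *)
have esq : erg sigma q.+1 (fsq du).
  apply: eq_erg (ergZ (-1) es) => m n nm; apply/funext => x; rewrite mulN1r.
  apply/eqP; rewrite eq_sym -addr_eq0 addrC; apply/eqP; exact: eq0 m n x nm.
have -> : series_fun (fd U) rho t s - eta s * series_fun (fj U) rho t s = series_fun du rho t s.
  rewrite -mulNr -(series_coef (h := fun s => - eta s) t s (erg_fbd e2) rs' (erg_fbd e3)).
  rewrite -(series_add t s (erg_fbd e1) (erg_fbd e3) (erg_fbd (ergD e1 e3)) rs').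
  by apply: eq_series => m n _; rewrite /du mulNr.
rewrite -(series_sq t s td (erg_fbd ed) (erg_fbd esq) rs').
rewrite -(series_add t s (erg_fbd ec) (erg_fbd et) (erg_fbd es) rs').
rewrite -(series_add t s (erg_fbd es) (erg_fbd esq) (erg_fbd (ergD es esq)) rs').
rewrite (eq_series (b := fun _ => @z0 R)) => [|m n nm]; last exact: eq0 m n s nm.
have pz N : partial_sum (fun _ => @z0 R) N rho t s = 0.
  by rewrite /partial_sum big1// => m _; rewrite modeE rowf0 mulr0.
have fz : fbd sigma (fun _ => @z0 R).
  by move=> sg _; exists 0 => // m n x _; rewrite /z0 cabs0 mul0r.
apply: ccvg_unique (series_cvg t s fz rs') _.
by apply: eq_ccvg (ccvg_cst 0) => N; rewrite pz.
Qed.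

Lemma divergence_fnE (V : 'I_3 -> Fn) rho t s : (divergence r V : fn) rho t s =
  (rho^-1)%:C * hVF rho t s * (pd_fun i_rho (Defs.mul (sqrtg Fn r) (V i_rho)) rho t s +
   pd_fun i_theta (Defs.mul (sqrtg Fn r) (V i_theta)) rho t s +
   pd_fun i_s (Defs.mul (sqrtg Fn r) (V i_s)) rho t s).
Proof. by rewrite /divergence sum_coord3. Qed.

Lemma divergence_free rho t s : 0 < rho < sigma ->
  (divergence r (BK r K D B0 Phi) : fn) rho t s = 0.
Proof.
move=> rs; rewrite divergence_fnE (cd_dir_pd (flux_cd_rho t s rs)) (cd_dir_pd (flux_cd_theta t s rs))
  (cd_dir_pd (flux_cd_s t s rs)).
have := balance t s rs; have := rhoC_nz rs; rewrite realCV realCX.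
move: (series_fun (fe crho) _ _ _) (series_fun (fj ctheta) _ _ _) (series_fun (fd U) _ _ _) (series_fun (fj U) _ _ _).
move: (eta s) (hVF rho t s) (rho%:C : C) => e h x u1 u2 u3 u4 x0 H.
have -> : x^-1 * u1 + (x^-1 * u2 - x * e * u4) + x * u3 = x^-1 * (u1 + u2 + x ^+ 2 * (u3 - e * u4)).
  by field.
by rewrite H !mulr0.
Qed.

Lemma sums_iter_theta j : sums (iter j (pd_fun i_theta) Phi) (iter j (@fj R) a) /\
  erg sigma q.+1 (iter j (@fj R) a).
Proof.
elim: j => [|j [S e]]; first by split; [exact: sums_Phi|exact: erg_q].
rewrite !iterS; have e' := erg_j e; split=> //.
exact: sums_pd_t S (erg_fbd e) (erg_fbd e').
Qed.

Lemma sums_iter_s j : (j <= 2 * D)%N -> [/\ sums (iter j (pd_fun i_s) Phi) (iter j (@fd R) a),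
  tfam (iter j (@fd R) a) & erg sigma (q.+1 + (2 * D - j)) (iter j (@fd R) a)].
Proof.
elim: j => [_|j IH jD]; first by rewrite subn0; split; [exact: sums_Phi|exact: ta|exact: ea].
have [S t e] := IH (ltnW jD); rewrite !iterS.
have e2 : erg sigma (q + (2 * D - j.+1)).+2 (iter j (@fd R) a).
  by apply: erg_le e; rewrite addSn ltnS -addnS leq_add2l; lia.
have e' := erg_d e2; split; last by rewrite addSn.
- exact: sums_pd_s S (tfam_cderivable t e2.1) (erg_fbd e2) (erg_fbd e').
- exact: tfam_fd t.
Qed.

Lemma BK_is_well_defined rho t s : 0 < rho < sigma -> BK_well_defined r K D B0 Phi rho t s.
Proof.
move=> rs; split.
- apply: ord3_case; apply: cd_dir_pderivable.
  + apply: cd_dir_rho; exact: sums_cd_rho sums_Phi (erg_fbd erg_q) (erg_fbd (erg_e erg_q)) rs.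
  + apply: cd_dir_theta; exact: sums_cd_t sums_Phi (erg_fbd erg_q) (erg_fbd (erg_j erg_q)) rs.
  + apply: cd_dir_s; exact: (sums_cd_s t s sums_Phi (tfam_cderivable ta erg_q3.1) (erg_fbd erg_q) (erg_fbd (erg_d erg_q3)) rs).
- move=> i j; rewrite !inE => /orP[]/eqP -> jD; apply: cd_dir_pderivable.
  + have [S e] := sums_iter_theta j.
    apply: cd_dir_theta; exact: sums_cd_t S (erg_fbd e) (erg_fbd (erg_j e)) rs.
  + have [S tc e] := sums_iter_s (ltnW jD).
    have e2 : erg sigma (q + (2 * D - j.+1)).+2 (iter j (@fd R) a).
      by apply: erg_le e; rewrite addSn ltnS -addnS leq_add2l; lia.
    apply: cd_dir_s; exact: (sums_cd_s t s S (tfam_cderivable tc e2.1) (erg_fbd e2) (erg_fbd (erg_d e2)) rs).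
- move=> i; rewrite !inE => /orP[]/eqP ->; apply: cd_dir_pderivable.
  + apply: cd_dir_rho; exact: sums_cd_rho sums_Pop (erg_fbd eP) (erg_fbd (erg_e eP)) rs.
  + apply: cd_dir_theta; exact: sums_cd_t sums_Pop (erg_fbd eP) (erg_fbd (erg_j eP)) rs.
- apply: ord3_case; apply: cd_dir_pderivable.
  + exact: flux_cd_rho.
  + exact: flux_cd_theta.
  + exact: flux_cd_s.
Qed.

Hypothesis small_sigma : (3 ^+ q.+2) ^+ 2 * M ^+ 2 * sigma ^+ 2 <= 4^-1.

Lemma small_le p : (p <= q.+1)%N -> (3 ^+ p.+1) ^+ 2 * M ^+ 2 * sigma ^+ 2 <= 4^-1.
Proof.
move=> pq; apply: le_trans small_sigma; apply: ler_wpM2r; first exact: sqr_ge0.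
apply: ler_wpM2r; first exact: sqr_ge0.
apply: lerXn2r; rewrite ?nnegrE ?exprn_ge0//.
by apply: ler_weXn2l => //; lra.
Qed.

Local Notation quot := (fdiv l^-1 kap).

Lemma erg_quot p c : (p <= q.+1)%N -> tfam c -> erg sigma p.+1 c -> erg sigma p.+1 (quot c).
Proof. by move=> pq tc; apply: (erg_div _ tc (@Rb_le R p.+1 q.+2 M _ pq kapb) (small_le pq)). Qed.

Lemma series_quot p c rho t s : (p <= q.+1)%N -> tfam c -> erg sigma p.+1 c -> 0 < rho < sigma ->
  series_fun (quot c) rho t s = hVF rho t s * series_fun c rho t s.
Proof.
move=> pq tc ec rs; have tq := tfam_div l^-1 kap tc.
have -> : series_fun c rho t s = series_fun (hfam r (quot c)) rho t s.
  apply: eq_series => m n _; rewrite /hfam (realCM l); have lC := lC.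
  case: m => [|m]; rewrite /= /kmix /rowD /rowM /rowZ (realCV l) /z0.
    by rewrite mulr0 subr0 mulVKf.
  by rewrite mulrDr mulVKf//; ring.
rewrite -(h_series t s pq tq (erg_quot pq tc ec) rs) mulrA [_ * hF _ _ _]mulrC hF_hVF// mul1r.
by [].
Qed.

Local Notation vs := (quot U).
(** The Cartesian components are phi_x + (P phi)_x / h_s + l tau y U / h_s and phi_y + (P phi)_y /
    h_s - l tau x U / h_s; the last terms come from the metric entry coupling theta and s. *)
Definition vx m n s : C := fdx a m n s + quot (fdx P) m n s + eta s * fsin vs m n s.
Definition vy m n s : C := fdy a m n s + quot (fdy P) m n s + - eta s * fcos vs m n s.

Lemma erg_vs : erg sigma q.+2 vs. Proof. exact: erg_quot (leqnn _) tU eU. Qed.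
Lemma tfam_vs : tfam vs. Proof. exact: tfam_div. Qed.

Lemma erg_eta c : erg sigma q.+2 c -> erg sigma q.+1 (fun m n s => eta s * c m n s) /\
  erg sigma q.+1 (fun m n s => - eta s * c m n s).
Proof.
move=> ec; have e1 : erg sigma q.+1 (fun m n s => eta s * c m n s) := erg_le (leqnSn _) (ergM etab ec).
split; first exact: e1.
apply: eq_erg (ergZ (-1) e1) => m n _; apply/funext => x.
by rewrite [RHS]mulNr mulN1r.
Qed.

Lemma erg_vx : erg sigma q.+1 vx.
Proof.
apply: ergD; last exact: (erg_eta (erg_sin tfam_vs erg_vs)).1.
apply: ergD; first exact: erg_dx erg_q.
exact: erg_quot (leqnSn _) (tfam_dx tfamP) (erg_dx eP).
Qed.
Lemma erg_vy : erg sigma q.+1 vy.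
Proof.
apply: ergD; last exact: (erg_eta (erg_cos tfam_vs erg_vs)).2.
apply: ergD; first exact: erg_dy erg_q.
exact: erg_quot (leqnSn _) (tfam_dy tfamP) (erg_dy eP).
Qed.

(** x, c, z, h and e stand for rho, cos theta, sin theta, 1/h_s and l tau; the two hypotheses are
    the formulas for d/dx applied to phi and to P phi, and they remove the negative powers of
    rho. *)
Lemma cartesian_arith (x h c z e1 ja e2 jp fu da dp e : C) : x != 0 ->
  c * e1 - z * ja = x * da -> c * e2 - z * jp = x * dp ->
  c * (x^-1 * (e1 + h * e2)) - x * z * ((x ^+ 2)^-1 * (ja + h * jp) - e * h * fu) =
  da + h * dp + e * (x * z * (h * fu)).
Proof.
move=> x0 H1 H2; apply: (mulfI x0).
have -> : x * (da + h * dp + e * (x * z * (h * fu))) = x * da + h * (x * dp) + x * (e * (x * z * (h * fu))) by ring.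
by rewrite -H1 -H2; field.
Qed.

Lemma cartesian_arith2 (x h c z e1 ja e2 jp fu da dp e : C) : x != 0 ->
  z * e1 + c * ja = x * da -> z * e2 + c * jp = x * dp ->
  z * (x^-1 * (e1 + h * e2)) + x * c * ((x ^+ 2)^-1 * (ja + h * jp) - e * h * fu) =
  da + h * dp + - e * (x * c * (h * fu)).
Proof.
move=> x0 H1 H2; apply: (mulfI x0).
have -> : x * (da + h * dp + - e * (x * c * (h * fu))) = x * da + h * (x * dp) - x * (e * (x * c * (h * fu))) by ring.
by rewrite -H1 -H2; field.
Qed.

Lemma series_vx rho t s : 0 < rho < sigma -> series_fun vx rho t s =
  series_fun (fdx a) rho t s + hVF rho t s * series_fun (fdx P) rho t s +
  eta s * (rho%:C * (sin t)%:C * (hVF rho t s * series_fun U rho t s)).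
Proof.
move=> rs; have rs' := pos_norm rs; have esn := erg_sin tfam_vs erg_vs.
have [e3 _] := erg_eta esn; have e1 := erg_dx erg_q.
have e2 := erg_quot (leqnSn q) (tfam_dx tfamP) (erg_dx eP).
rewrite (series_add t s (erg_fbd (ergD e1 e2)) (erg_fbd e3) (erg_fbd erg_vx) rs').
rewrite (series_add t s (erg_fbd e1) (erg_fbd e2) (erg_fbd (ergD e1 e2)) rs').
rewrite (series_coef (h := fun s => eta s) t s (erg_fbd esn) rs' (erg_fbd e3)).
rewrite (series_sin t s tfam_vs (erg_fbd erg_vs) (erg_fbd esn) rs').
by rewrite (series_quot t s (leqnSn q) (tfam_dx tfamP) (erg_dx eP) rs) (series_quot t s (leqnn _) tU eU rs).
Qed.

Lemma series_vy rho t s : 0 < rho < sigma -> series_fun vy rho t s =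
  series_fun (fdy a) rho t s + hVF rho t s * series_fun (fdy P) rho t s +
  - eta s * (rho%:C * (cos t)%:C * (hVF rho t s * series_fun U rho t s)).
Proof.
move=> rs; have rs' := pos_norm rs; have esn := erg_cos tfam_vs erg_vs.
have [_ e3] := erg_eta esn; have e1 := erg_dy erg_q.
have e2 := erg_quot (leqnSn q) (tfam_dy tfamP) (erg_dy eP).
rewrite (series_add t s (erg_fbd (ergD e1 e2)) (erg_fbd e3) (erg_fbd erg_vy) rs').
rewrite (series_add t s (erg_fbd e1) (erg_fbd e2) (erg_fbd (ergD e1 e2)) rs').
rewrite (series_coef (h := fun s => - eta s) t s (erg_fbd esn) rs' (erg_fbd e3)).
rewrite (series_cos t s tfam_vs (erg_fbd erg_vs) (erg_fbd esn) rs').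
by rewrite (series_quot t s (leqnSn q) (tfam_dy tfamP) (erg_dy eP) rs) (series_quot t s (leqnn _) tU eU rs).
Qed.

(** V is given by the series themselves, which extend to the axis, where the polar expression of the
    field has no meaning. *)
Lemma cartesian_field_analytic : exists2 V : 'I_3 -> fn,
  forall i rho t s, 0 < rho < sigma -> V i rho t s = cartesian (BK r K D B0 Phi) i rho t s &
  forall sg, 0 < sg < sigma -> forall i, analytic sg (Hq R q.+1) (V i).
Proof.
exists (coord3 (series_fun vx) (series_fun vy) (series_fun vs)); last first.
  move=> sg sgs; apply: ord3_case; rewrite ?coord3_rho ?coord3_theta ?coord3_s.
  - exists vx; exact: erg_analytic sigma0 erg_vx _ sgs.
  - exists vy; exact: erg_analytic sigma0 erg_vy _ sgs.
  - exists vs; exact: erg_analytic sigma0 (erg_le (leqnSn _) erg_vs) _ sgs.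
move=> i rho t s rs; move: i; have x0 := rhoC_nz rs.
apply: ord3_case; rewrite /cartesian ?coord3_rho ?coord3_theta ?coord3_s.
- rewrite BK_rho// BK_theta// series_vx// (realCM rho) !realCV realCX; symmetry.
  apply: cartesian_arith x0 _ _; first exact: series_dx ta erg_q rs.
  exact: series_dx tfamP eP rs.
- rewrite BK_rho// BK_theta// series_vy// (realCM rho) !realCV realCX; symmetry.
  apply: cartesian_arith2 x0 _ _; first exact: series_dy ta erg_q rs.
  exact: series_dy tfamP eP rs.
- by rewrite BK_s// (series_quot t s (leqnn _) tU eU rs).
Qed.

End FunctionField.


(** * Dependence of the geometry on the curve *)

Section BoundedDerivatives.
Variable R : realType.
Implicit Types (f g h : R -> R) (p : nat) (G L c : R).

Lemma Rb_ge0 p G h : Rb p G h -> 0 <= G.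
Proof. by move=> /(Rb_bound 0); apply: le_trans; exact: normr_ge0. Qed.

Lemma Rb_mono p G G' h : G <= G' -> Rb p G h -> Rb p G' h.
Proof.
move=> GG; elim: p h => [|p IH] h [a b c d].
  by split=> // s; exact: le_trans (c s) GG.
split=> // [s|]; first exact: le_trans (c s) GG.
by have [dh [hd rb]] := d; exists dh; split=> //; exact: IH.
Qed.

Lemma eq_Rb p G h g : h =1 g -> Rb p G h -> Rb p G g.
Proof. by move=> /funext ->. Qed.

Lemma Rb_I p G h dh : (forall x, rd h x (dh x)) -> periodic h -> (forall s, `|h s| <= G) -> Rb p G dh ->
  Rb p.+1 G h.
Proof.
move=> hd ph hG rb; split=> //; last by exists dh.
by move=> x; exact: rd_continuous (hd x).
Qed.

Lemma Rb_cst p c : Rb p `|c| (fun=> c).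
Proof.
elim: p c => [|p IH] c; first by split=> // x; exact: cvg_cst.
apply: (@Rb_I _ _ _ (fun=> 0)) => // [x|]; first exact: rd_cst.
by apply: Rb_mono (IH 0); rewrite normr0.
Qed.

Lemma Rb_D p G G' f g : Rb p G f -> Rb p G' g -> Rb p (G + G') (fun s => f s + g s).
Proof.
have bd s (x y : R) : `|x| <= G -> `|y| <= G' -> `|x + y| <= G + G'.
  by move=> a b; apply: le_trans (ler_normD _ _) _; exact: lerD.
elim: p f g => [|p IH] f g [a1 b1 c1 d1] [a2 b2 c2 d2].
  split=> // [s|x|s]; [by rewrite a1 a2|by apply: continuousD; [exact: b1|exact: b2]|exact: bd].
have [df [fd rf]] := d1; have [dg [gd rg]] := d2.
apply: (@Rb_I _ _ _ (fun s => df s + dg s)) => [x|s|s|]; last exact: IH.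
- exact: rdD (fd x) (gd x).
- by rewrite a1 a2.
- exact: bd.
Qed.

Lemma Rb_M p G G' f g : Rb p G f -> Rb p G' g -> Rb p (2 ^+ p * (G * G')) (fun s => f s * g s).
Proof.
elim: p f g => [|p IH] f g rf rg; have G0 := Rb_ge0 rf; have G0' := Rb_ge0 rg;
    move: (rf) (rg) => [a1 b1 c1 d1] [a2 b2 c2 d2].
  have bd s : `|f s * g s| <= 2 ^+ 0 * (G * G') by rewrite expr0 mul1r normrM; exact: ler_pM.
  by split=> // [s|x]; [by rewrite a1 a2|apply: continuousM; [exact: b1|exact: b2]].
have GG : 0 <= G * G' by exact: mulr_ge0.
have [df [fd rdf]] := d1; have [dg [gd rdg]] := d2.
apply: (@Rb_I _ _ _ (fun s => df s * g s + f s * dg s)) => [x|s|s|].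
- exact: rdM (fd x) (gd x).
- by rewrite a1 a2.
- rewrite normrM; apply: le_trans (ler_pM (normr_ge0 _) (normr_ge0 _) (c1 s) (c2 s)) _.
  by rewrite ler_peMl// exprn_ege1//; lra.
have E : 2 ^+ p.+1 * (G * G') = 2 ^+ p * (G * G') + 2 ^+ p * (G * G') by rewrite exprS; ring.
by rewrite E; apply: Rb_D; apply: IH => //; exact: Rb_pred.
Qed.

Lemma Rb_N p G f : Rb p G f -> Rb p G (fun s => - f s).
Proof.
elim: p f => [|p IH] f [a b c d].
  by split=> // [s|x|s]; [by rewrite a|by apply: continuousN; exact: b|by rewrite normrN].
have [df [fd rf]] := d; apply: (@Rb_I _ _ _ (fun s => - df s)) => [x|s|s|]; last exact: IH.
- exact: rdN (fd x).
- by rewrite a.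
- by rewrite normrN.
Qed.

Lemma Rb_V p c G : 0 < c -> exists G', forall f, Rb p G f -> (forall s, c <= f s) ->
  Rb p G' (fun s => (f s)^-1).
Proof.
move=> c0; have bd f s : c <= f s -> `|(f s)^-1| <= c^-1.
  move=> cf; have f0 := lt_le_trans c0 cf.
  by rewrite ger0_norm ?lef_pV2// invr_ge0 ltW.
elim: p => [|p [G1 IH]].
  exists c^-1 => f [a b _ _] cf; split=> // [s|x|s]; [by rewrite a| |exact: bd].
  by apply: continuousV; [rewrite gt_eqF// (lt_le_trans c0)|exact: b].
exists (c^-1 + 2 ^+ p * (2 ^+ p * (G1 * G1) * G)) => f rf cf.
have rV := IH f (Rb_pred rf) cf; have [a b e [df [fd rdf]]] := rf.
have rb := Rb_N (Rb_M (Rb_M rV rV) rdf).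
have r0 := Rb_ge0 rb.
apply: (@Rb_I _ _ _ (fun s => - ((f s)^-1 * (f s)^-1 * df s))) => [x|s|s|].
- have fx : f x != 0 by rewrite gt_eqF// (lt_le_trans c0).
  by have := rdV fx (fd x); rewrite mulNr -invfM -expr2.
- by rewrite a.
- by apply: le_trans (bd f s (cf s)) _; rewrite lerDl.
- by apply: Rb_mono rb; rewrite lerDr invr_ge0 ltW.
Qed.

Lemma Rb_sqrt p c G : 0 < c -> exists G', forall f, Rb p G f -> (forall s, c <= f s) ->
  Rb p G' (fun s => Num.sqrt (f s)).
Proof.
move=> c0; have sc0 : 0 < Num.sqrt c by rewrite sqrtr_gt0.
have bd f s : `|f s| <= G -> c <= f s -> `|Num.sqrt (f s)| <= 1 + G.
  move=> fG cf; have f0 := le_trans (ltW c0) cf.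
  rewrite ger0_norm ?sqrtr_ge0//; have fG' : f s <= G by apply: le_trans fG; exact: ler_norm.
  rewrite -(ler_pXn2r (n := 2)) ?nnegrE ?sqrtr_ge0//; last lra.
  by rewrite sqr_sqrtr// expr2; nra.
elim: p => [|p [G1 IH]].
  exists (1 + G) => f [a b fG _] cf; split=> // [s|x|s]; [by rewrite a| |exact: bd].
  by apply: (@continuous_comp _ _ _ f Num.sqrt); [exact: b|exact: sqrt_continuous].
have sc2 : 0 < 2 * Num.sqrt c by exact: mulr_gt0.
have [G2 HV] := Rb_V p (2 ^+ p * (`|2| * G1)) sc2.
exists (1 + G + 2 ^+ p * (G2 * G)) => f rf cf.
have rs := IH f (Rb_pred rf) cf; have [a b e [df [fd rdf]]] := rf.
have cs s : 2 * Num.sqrt c <= 2 * Num.sqrt (f s) by apply: ler_wpM2l => //; exact: ler_wsqrtr.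
have rV := HV _ (Rb_M (Rb_cst p 2) rs) cs.
have rb := Rb_M rV rdf; have r0 := Rb_ge0 rb.
have G0 : 0 <= 1 + G by have := Rb_ge0 rf; lra.
apply: (@Rb_I _ _ _ (fun s => (2 * Num.sqrt (f s))^-1 * df s)) => [x|s|s|].
- exact: rd_sqrt (lt_le_trans c0 (cf x)) (fd x).
- by rewrite a.
- by apply: le_trans (bd f s (e s) (cf s)) _; rewrite lerDl.
- by apply: Rb_mono rb; rewrite lerDr.
Qed.

Lemma Rb_exists p f : Ck p (f : R -> R^o) -> periodic f -> exists G, Rb p G f.
Proof.
elim: p f => [|p IH] f.
  move=> /CkR0 cf pf; have pf' : periodic (fun s => (f s)%:C%C) by move=> s; rewrite pf.
  have [G _ fG] := periodic_bounded (ccont_real cf) pf'.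
  by exists G; split=> // s; rewrite -cabs_real.
move=> /CkRE[fd cd] pf.
have pd : periodic (derive1 f).
  move=> s; apply: rd_unique (fd s).
  have h : rd (fun x => x + period R) s 1 by have := rdD (rd_id s) (rd_cst (period R) s); rewrite addr0.
  have := rd_comp (f := f) (g := fun x => x + period R) (x := s) (fd (s + period R)) h; rewrite mulr1.
  by apply: rd_near ltr01 _ => y _; rewrite pf.
have [G rG] := IH _ cd pd.
have cf : continuous f by move=> x; exact: rd_continuous (fd x).
have pf' : periodic (fun s => (f s)%:C%C) by move=> s; rewrite pf.
have [G1 G10 fG] := periodic_bounded (ccont_real cf) pf'.
have G0 := Rb_ge0 rG.
exists (G1 + G); apply: (Rb_I fd pf) => [s|].
  by rewrite -cabs_real; apply: le_trans (fG s) _; rewrite lerDl.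
by apply: Rb_mono rG; rewrite lerDr.
Qed.

Lemma positive_periodic_lower f : continuous f -> periodic f -> (forall s, 0 < f s) ->
  exists2 c, 0 < c & forall s, c <= f s.
Proof.
move=> cf pf f0.
have cV : continuous (fun s => (f s)^-1).
  by move=> x; apply: continuousV; [rewrite gt_eqF|exact: cf].
have pV : periodic (fun s => ((f s)^-1)%:C%C) by move=> s; rewrite pf.
have [G G0 fG] := periodic_bounded (ccont_real cV) pV.
have Gp : 0 < G.
  by apply: lt_le_trans (fG 0); rewrite cabs_real ger0_norm ?invr_gt0// invr_ge0 ltW.
exists G^-1 => [|s]; first by rewrite invr_gt0.
have := fG s; rewrite cabs_real ger0_norm ?invr_ge0 ?(ltW (f0 s))// => h.
by rewrite -[f s]invrK lef_pV2// posrE invr_gt0.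
Qed.

(* A eps x y stands for a bound by eps on the distance from x to y. *)
Variables (T : Type) (A : R -> T -> T -> Prop).
Implicit Types (Q : T -> R -> R).

(** Boundedness and Lipschitz dependence are bundled because the product rule for differences needs
    both; the class is closed under sums, products, and inverses and roots of quantities bounded
    below. *)
Definition lipq p Q : Prop := exists G L, [/\ 0 <= G, 0 <= L &
  forall eps x y, 0 <= eps -> A eps x y ->
    [/\ Rb p G (Q x), Rb p G (Q y) & Rb p (L * eps) (fun s => Q y s - Q x s)]].

Lemma eq_lipq p Q Q' : (forall eps x y, A eps x y -> Q x =1 Q' x /\ Q y =1 Q' y) -> lipq p Q -> lipq p Q'.
Proof.
move=> E [G [L [G0 L0 H]]]; exists G, L; split=> // eps x y e0 a.
have [/funext Ex /funext Ey] := E _ _ _ a; have [h1 h2 h3] := H _ _ _ e0 a.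
by rewrite -Ex -Ey.
Qed.

Lemma lipqD p Q1 Q2 : lipq p Q1 -> lipq p Q2 -> lipq p (fun x s => Q1 x s + Q2 x s).
Proof.
move=> [G1 [L1 [G10 L10 H1]]] [G2 [L2 [G20 L20 H2]]].
exists (G1 + G2), (L1 + L2); split; [exact: addr_ge0|exact: addr_ge0|move=> eps x y e0 a].
have [a1 b1 c1] := H1 _ _ _ e0 a; have [a2 b2 c2] := H2 _ _ _ e0 a.
split; [exact: Rb_D|exact: Rb_D|].
by rewrite mulrDl; apply: eq_Rb (Rb_D c1 c2) => s; rewrite opprD addrACA.
Qed.

Lemma lipqN p Q : lipq p Q -> lipq p (fun x s => - Q x s).
Proof.
move=> [G [L [G0 L0 H]]]; exists G, L; split=> // eps x y e0 a.
have [h1 h2 h3] := H _ _ _ e0 a; split; [exact: Rb_N|exact: Rb_N|].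
by apply: eq_Rb (Rb_N h3) => s; rewrite opprD.
Qed.

Lemma lipqM p Q1 Q2 : lipq p Q1 -> lipq p Q2 -> lipq p (fun x s => Q1 x s * Q2 x s).
Proof.
move=> [G1 [L1 [G10 L10 H1]]] [G2 [L2 [G20 L20 H2]]].
have p0 : 0 <= (2 : R) ^+ p by exact: exprn_ge0.
exists (2 ^+ p * (G1 * G2)), (2 ^+ p * (L1 * G2) + 2 ^+ p * (G1 * L2)); split.
- by apply: mulr_ge0 => //; exact: mulr_ge0.
- by apply: addr_ge0; apply: mulr_ge0 => //; exact: mulr_ge0.
move=> eps x y e0 a.
have [a1 b1 c1] := H1 _ _ _ e0 a; have [a2 b2 c2] := H2 _ _ _ e0 a.
split; [exact: Rb_M|exact: Rb_M|].
have -> : (2 ^+ p * (L1 * G2) + 2 ^+ p * (G1 * L2)) * eps =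
  2 ^+ p * ((L1 * eps) * G2) + 2 ^+ p * (G1 * (L2 * eps)) by ring.
by apply: eq_Rb (Rb_D (Rb_M c1 b2) (Rb_M a1 c2)) => s; ring.
Qed.

Lemma lipq0 p : lipq p (fun _ _ => 0).
Proof.
exists 0, 0; split=> // eps x y e0 a; have r0 : Rb p 0 (fun _ : R => 0 : R) by have := Rb_cst p (0 : R); rewrite normr0.
by split=> //; rewrite mul0r; apply: eq_Rb r0 => s; rewrite subr0.
Qed.

Lemma lipq_sum p (I : Type) (r : seq I) (Q : I -> T -> R -> R) :
  (forall i, lipq p (Q i)) -> lipq p (fun x s => \sum_(i <- r) Q i x s).
Proof.
move=> H; elim: r => [|i r IH].
  by apply: eq_lipq (lipq0 p) => eps x y _; split=> s; rewrite big_nil.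
by apply: eq_lipq (lipqD (H i) IH) => eps x y _; split=> s; rewrite big_cons.
Qed.

Lemma lipqV p Q c : 0 < c -> (forall eps x y, A eps x y -> (forall s, c <= Q x s) /\ (forall s, c <= Q y s)) ->
  lipq p Q -> lipq p (fun x s => (Q x s)^-1).
Proof.
move=> c0 Qc [G [L [G0 L0 H]]]; have [G' HG] := Rb_V p G c0.
have p0 : 0 <= (2 : R) ^+ p by exact: exprn_ge0.
exists `|G'|, (2 ^+ p * (L * (2 ^+ p * (`|G'| * `|G'|)))); split=> //.
  by apply: mulr_ge0 => //; apply: mulr_ge0 => //; apply: mulr_ge0 => //; exact: mulr_ge0.
move=> eps x y e0 a; have [h1 h2 h3] := H _ _ _ e0 a; have [q1 q2] := Qc _ _ _ a.
have v1 : Rb p `|G'| (fun s => (Q x s)^-1) := Rb_mono (ler_norm _) (HG _ h1 q1).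
have v2 : Rb p `|G'| (fun s => (Q y s)^-1) := Rb_mono (ler_norm _) (HG _ h2 q2).
split=> //.
have -> : 2 ^+ p * (L * (2 ^+ p * (`|G'| * `|G'|))) * eps = 2 ^+ p * (L * eps * (2 ^+ p * (`|G'| * `|G'|))) by ring.
apply: eq_Rb (Rb_N (Rb_M h3 (Rb_M v1 v2))) => s.
have x0 : Q x s != 0 by rewrite gt_eqF// (lt_le_trans c0).
have y0 : Q y s != 0 by rewrite gt_eqF// (lt_le_trans c0).
by field; rewrite x0 y0.
Qed.

(** The difference of two roots is the difference of the radicands times the inverse of the sum of
    the roots, and that sum is bounded below. *)
Lemma lipq_sqrt p Q c : 0 < c -> (forall eps x y, A eps x y -> (forall s, c <= Q x s) /\ (forall s, c <= Q y s)) ->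
  lipq p Q -> lipq p (fun x s => Num.sqrt (Q x s)).
Proof.
move=> c0 Qc [G [L [G0 L0 H]]]; have [G' HG] := Rb_sqrt p G c0.
have sc0 : 0 < Num.sqrt c by rewrite sqrtr_gt0.
have sc2 : 0 < Num.sqrt c + Num.sqrt c by exact: addr_gt0.
have [G2 HV] := Rb_V p (`|G'| + `|G'|) sc2.
have p0 : 0 <= (2 : R) ^+ p by exact: exprn_ge0.
exists `|G'|, (2 ^+ p * (L * `|G2|)); split=> //.
  by apply: mulr_ge0 => //; exact: mulr_ge0.
move=> eps x y e0 a; have [h1 h2 h3] := H _ _ _ e0 a; have [q1 q2] := Qc _ _ _ a.
have v1 : Rb p `|G'| (fun s => Num.sqrt (Q x s)) := Rb_mono (ler_norm _) (HG _ h1 q1).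
have v2 : Rb p `|G'| (fun s => Num.sqrt (Q y s)) := Rb_mono (ler_norm _) (HG _ h2 q2).
split=> //.
have sb z : (forall s, c <= Q z s) -> forall s, Num.sqrt c <= Num.sqrt (Q z s).
  by move=> qz s; exact: ler_wsqrtr.
have v3 : Rb p `|G2| (fun s => (Num.sqrt (Q x s) + Num.sqrt (Q y s))^-1).
  apply: Rb_mono (ler_norm _) (HV _ (Rb_D v1 v2) _) => s.
  by apply: lerD; exact: sb.
have -> : 2 ^+ p * (L * `|G2|) * eps = 2 ^+ p * (L * eps * `|G2|) by ring.
apply: eq_Rb (Rb_M h3 v3) => s.
have xs : 0 < Num.sqrt (Q x s) by apply: lt_le_trans (sb x q1 s).
have ys : 0 < Num.sqrt (Q y s) by apply: lt_le_trans (sb y q2 s).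
have d0 : Num.sqrt (Q x s) + Num.sqrt (Q y s) != 0 by rewrite gt_eqF// addr_gt0.
apply: (mulIf d0); rewrite divfK// -[in LHS](sqr_sqrtr (le_trans (ltW c0) (q1 s))).
by rewrite -[in LHS](sqr_sqrtr (le_trans (ltW c0) (q2 s))); ring.
Qed.

End BoundedDerivatives.

(** * Curvature and torsion in terms of the derivatives of the curve *)

Section CurveGeometry.
Variable R : realType.
Local Notation V3 := 'rV[R]_3.
Implicit Types (f r : R -> V3) (u v : V3) (s x : R) (i : 'I_3) (k n p : nat) (G : R).

Definition vd f x v : Prop := forall i, rd (fun s => f s 0 i) x (v 0 i).

Lemma vd_derive1 f x v : vd f x v -> derivable f x 1 /\ derive1 f x = v.
Proof.
move=> fv; have df : derivable f x 1.
  apply/derivable_mxP => i j; rewrite (ord1 i); exact: rd_derivable (fv j).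
split=> //; rewrite derive1E derive_mx//; apply/rowP => j; rewrite mxE -derive1E.
exact: rd_derive1 (fv j).
Qed.

Lemma derivable_vd f x : derivable f x 1 -> vd f x (derive1 f x).
Proof.
move=> df i; have /derivable_mxP dfi := df.
have -> : derive1 f x 0 i = derive1 (fun s => f s 0 i) x.
  by rewrite [in LHS]derive1E derive_mx// mxE derive1E.
exact: derivable_rd (dfi 0 i).
Qed.

Lemma rd_eq (h : R -> R) x (a b : R) : a = b -> rd h x a -> rd h x b.
Proof. by move=> ->. Qed.

Lemma rd_periodic (h dh : R -> R) : (forall x, rd h x (dh x)) -> periodic h -> periodic dh.
Proof.
move=> hd ph s; apply: rd_unique (hd s).
have e : rd (fun x => x + period R) s 1 by have := rdD (rd_id s) (rd_cst (period R) s); rewrite addr0.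
have := rd_comp (f := h) (g := fun x => x + period R) (x := s) (hd (s + period R)) e; rewrite mulr1.
by apply: rd_near ltr01 _ => y _; rewrite ph.
Qed.

Definition crd r k i s : R := derive1n k r s 0 i.

Lemma crd_rd n r k i x : Ck n r -> (k < n)%N -> rd (crd r k i) x (crd r k.+1 i x).
Proof. by move=> [dr _] kn; rewrite /crd derive1nS; exact: derivable_vd (dr k x kn) i. Qed.

Lemma crd_cont n r k i : Ck n r -> (k <= n)%N -> continuous (crd r k i).
Proof.
move=> cr kn x; have [_ ck] := Ck_le kn cr.
by apply: (@continuous_comp _ _ _ (derive1n k r) (fun u => u 0 i)); [exact: ck|exact: coord_continuous].
Qed.

Lemma crd_periodic n r k i : Ck n r -> (forall s, r (s + period R) = r s) -> (k <= n)%N -> periodic (crd r k i).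
Proof.
move=> cr pr; elim: k => [_|k IH kn] ; first by move=> s; rewrite /crd /= pr.
exact: rd_periodic (fun x => crd_rd i x cr kn) (IH (ltnW kn)).
Qed.

Lemma crd_Ck n r p k i : Ck n r -> (k + p <= n)%N -> Ck p (crd r k i : R -> R^o).
Proof.
move=> cr; elim: p k => [|p IH] k kn.
  by apply/CkR0; apply: crd_cont cr _; rewrite addn0 in kn.
apply: (CkRI (df := crd r k.+1 i)); last by apply: IH; rewrite addSn -addnS.
by move=> x; apply: crd_rd cr _; lia.
Qed.


Lemma derive1n_sub n (r1 r2 : R -> V3) k : Ck n r1 -> Ck n r2 -> (k <= n)%N ->
  derive1n k (fun s => r2 s - r1 s) = (fun s => derive1n k r2 s - derive1n k r1 s).
Proof.
move=> c1 c2; elim: k => [//|k IH] kn; rewrite derive1nS IH ?(ltnW kn)//.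
apply/funext => s; rewrite !derive1nS; apply: (vd_derive1 _).2 => i.
have := rdB (crd_rd i s c2 kn) (crd_rd i s c1 kn); rewrite !mxE /crd !derive1nS.
by apply: rd_near ltr01 _ => y _; rewrite !mxE.
Qed.

Lemma coord_enorm u i : `|u 0 i| <= enorm u.
Proof.
rewrite -sqrtr_sqr ler_wsqrtr// /dotv (bigD1 i)//= -expr2 lerDl.
by apply: sumr_ge0 => j _; rewrite -expr2 sqr_ge0.
Qed.

Lemma Ck_norm_coord n (r1 r2 : R -> V3) (e : R) k i s : Ck n r1 -> Ck n r2 -> (k <= n)%N ->
  (Ck_norm n (fun s => r2 s - r1 s)%R < e%:E)%E -> `|crd r2 k i s - crd r1 k i s| <= e.
Proof.
move=> c1 c2 kn he.
have h : ((enorm (derive1n k (fun s => r2 s - r1 s)%R s))%:E <= e%:E)%E.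
  by apply: le_trans (ltW he); apply: ereal_sup_ubound; exists k, s.
rewrite lee_fin in h; apply: le_trans h.
by have := coord_enorm (derive1n k (fun s => r2 s - r1 s)%R s) i; rewrite (derive1n_sub c1 c2 kn) !mxE.
Qed.

Lemma dotvZ (a b : R) u v : dotv (a *: u) (b *: v) = a * b * dotv u v.
Proof. by rewrite /dotv mulr_sumr; apply: eq_bigr => i _; rewrite !mxE; ring. Qed.

Lemma enormZ (a : R) u : 0 <= a -> enorm (a *: u) = a * enorm u.
Proof. by move=> a0; rewrite /enorm dotvZ -expr2 sqrtrM ?sqr_ge0// sqrtr_sqr ger0_norm. Qed.

Lemma dotv_cross u v : dotv v (crossv u v) = 0.
Proof.
have s3 (F : 'I_3 -> R) : \sum_(i < 3) F i = F 0 + F 1 + F 2.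
  rewrite !big_ord_recl big_ord0 addr0 addrA; congr (F _ + F _ + F _); exact: val_inj.
have e11 : 1 + 1 = 2 :> 'I_3 by exact: val_inj.
have e12 : 1 + 2 = 0 :> 'I_3 by exact: val_inj.
have e21 : 2 + 1 = 0 :> 'I_3 by exact: val_inj.
have e22 : 2 + 2 = 1 :> 'I_3 by exact: val_inj.
rewrite /dotv s3 !mxE !add0r e11 e12 e21 e22; ring.
Qed.

Lemma scale_entry (a : R) u i : (a *: u) 0 i = a * u 0 i.
Proof. by rewrite mxE. Qed.

Lemma lin_entry (a b : R) u v i : a * u 0 i + b * v 0 i = (a *: u + b *: v) 0 i.
Proof. by rewrite !mxE. Qed.

Lemma dotv_lin (a b c : R) u v w :
  dotv (a *: u + b *: v) (c *: w) = c * (a * dotv u w + b * dotv v w).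
Proof.
by rewrite /dotv !mulr_sumr -big_split mulr_sumr; apply: eq_bigr => i _; rewrite -lin_entry scale_entry /=; ring.
Qed.

(** [N1], [N2] and [det3] are |r'|^2, |r''|^2 and det (r', r'', r'''). At constant speed kappa =
    |r''| / |r'|^2 and tau = det (r', r'', r''') / (|r'|^2 |r''|^2), expressions covered by the
    calculus of [lipq]. *)
Definition N1 r s : R := \sum_(i < 3) crd r 1 i s * crd r 1 i s.
Definition N2 r s : R := \sum_(i < 3) crd r 2 i s * crd r 2 i s.
Definition det3 r s : R := \sum_(i < 3) crd r 3 i s *
  (crd r 1 (i + 1) s * crd r 2 (i + 2) s - crd r 1 (i + 2) s * crd r 2 (i + 1) s).

Lemma dotv_det3 r s :
  dotv (derive1n 3 r s) (crossv (derive1n 1 r s) (derive1n 2 r s)) = det3 r s.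
Proof. by rewrite /dotv /crossv /det3; apply: eq_bigr => i _; rewrite [X in _ * X]mxE. Qed.

Section Admissible.
Variables (n : nat) (r : R -> V3).
Hypothesis n3 : (3 <= n)%N.
Hypothesis ra : admissible n r.
Local Notation l := (ell r).

Lemma ell_N1 s : l = Num.sqrt (N1 r s).
Proof. by have [_ _ _ /(_ s) <- _] := ra; rewrite /enorm /dotv /N1 /crd derive1n1. Qed.

Lemma sqr_ell s : l ^+ 2 = N1 r s.
Proof.
by rewrite (ell_N1 s) sqr_sqrtr// sumr_ge0// => i _; rewrite -expr2 sqr_ge0.
Qed.

Lemma adm_l0 : 0 < l. Proof. by case: ra. Qed.

Lemma derive_tangent s : derive1 (tangent r) s = l^-1 *: derive1n 2 r s.
Proof.
have [_ cr _ _ _] := ra; apply: (vd_derive1 _).2 => i.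
have n1 : (1 < n)%N by exact: leq_trans n3.
have e : 0 * crd r 1 i s + l^-1 * crd r 2 i s = (l^-1 *: derive1n 2 r s) 0 i.
  by rewrite mul0r add0r mxE.
refine (rd_eq e _); apply: (rd_near ltr01 _ (rdM (rd_cst l^-1 s) (crd_rd i s cr n1))) => y _.
by rewrite /tangent mxE /crd derive1n1.
Qed.

Lemma enorm_N2 s : enorm (derive1n 2 r s) = Num.sqrt (N2 r s).
Proof. by []. Qed.

Lemma curvatureE s : curvature r s = Num.sqrt (N2 r s) / N1 r s.
Proof.
have l0 := adm_l0; rewrite /curvature derive_tangent enormZ ?invr_ge0 ?(ltW l0)// enorm_N2.
by rewrite -(sqr_ell s); field; rewrite gt_eqF.
Qed.

Lemma N2_gt0 s : 0 < N2 r s.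
Proof.
have [_ _ _ _ /(_ s)] := ra; rewrite curvatureE -(sqr_ell s) => h.
by rewrite -sqrtr_gt0; move: h; rewrite pmulr_lgt0// invr_gt0 exprn_gt0// adm_l0.
Qed.

Lemma normalE s : normal r s = (Num.sqrt (N2 r s))^-1 *: derive1n 2 r s.
Proof.
have l0 := adm_l0; rewrite /normal derive_tangent scalerA; congr (_ *: _).
rewrite curvatureE -(sqr_ell s); have w0 : 0 < Num.sqrt (N2 r s) by rewrite sqrtr_gt0 N2_gt0.
by field; rewrite !gt_eqF.
Qed.

(** The coefficient d may stay unspecified: it multiplies r'', which is orthogonal to the binormal,
    and so drops out of the torsion. *)
Lemma derive_normal s : exists d, derive1 (normal r) s =
  d *: derive1n 2 r s + (Num.sqrt (N2 r s))^-1 *: derive1n 3 r s.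
Proof.
have [_ cr _ _ _] := ra; have n2 : (2 < n)%N by [].
have rN : exists z, rd (N2 r) s z.
  rewrite /N2; elim: (index_enum _) => [|i e [z hz]].
    by exists 0; apply: rd_near ltr01 _ (rd_cst 0 s) => y _; rewrite big_nil.
  have h := crd_rd i s cr n2; eexists; apply: rd_near ltr01 _ (rdD (rdM h h) hz) => y _.
  by rewrite big_cons.
have [z hz] := rN; have w0 : 0 < Num.sqrt (N2 r s) by rewrite sqrtr_gt0 N2_gt0.
have hw := rdV (f := fun y => Num.sqrt (N2 r y)) (lt0r_neq0 w0) (rd_sqrt (N2_gt0 s) hz).
set d := (X in rd _ _ X) in hw; exists d.
have hv : vd (normal r) s (d *: derive1n 2 r s + (Num.sqrt (N2 r s))^-1 *: derive1n 3 r s).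
  move=> i; refine (rd_eq (lin_entry _ _ _ _ _) _).
  refine (rd_near ltr01 _ (rdM hw (crd_rd i s cr n2))) => y _.
  by rewrite normalE; exact: esym (scale_entry _ _ _).
exact: (vd_derive1 hv).2.
Qed.

Lemma crossvZ (a b : R) u v : crossv (a *: u) (b *: v) = (a * b) *: crossv u v.
Proof. by apply/rowP => i; rewrite !mxE; ring. Qed.

Lemma torsion_arith (a b w c v x y z : R) : a != 0 -> w != 0 -> w ^+ 2 = v ->
  x = 0 -> y = c -> a ^+ 2 = z ->
  a^-1 * (a^-1 / w * (b * x + w^-1 * y)) = c / (z * v).
Proof. by move=> a0 w0 <- -> -> <-; field; rewrite a0 w0. Qed.

Lemma torsionE s : torsion r s = det3 r s / (N1 r s * N2 r s).
Proof.
have l0 := adm_l0; have [d dE] := derive_normal s.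
have w0 : 0 < Num.sqrt (N2 r s) by rewrite sqrtr_gt0 N2_gt0.
rewrite /torsion dE /binormal /tangent normalE crossvZ -derive1n1.
rewrite dotv_lin.
exact: (torsion_arith d (lt0r_neq0 l0) (lt0r_neq0 w0) (sqr_sqrtr (ltW (N2_gt0 s)))
  (dotv_cross (derive1n 1 r s) (derive1n 2 r s)) (dotv_det3 r s) (sqr_ell s)).
Qed.

End Admissible.

Section Near.
Variables (q : nat) (r0 : R -> V3).
Local Notation n := (4 + q.+1)%N.
Hypothesis r0a : admissible n r0.

Definition pairs G (e : R) (x y : R -> V3) : Prop :=
  [/\ admissible n x, admissible n y &
   forall k i, (k <= 3)%N -> [/\ Rb q.+2 G (crd x k i), Rb q.+2 G (crd y k i) &
     Rb q.+2 e (fun s => crd y k i s - crd x k i s)]].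

Lemma lipq_crd G k i : 0 <= G -> (k <= 3)%N -> lipq (pairs G) q.+2 (fun r => crd r k i).
Proof.
move=> G0 k3; exists G, 1; split=> // e x y e0 [_ _ /(_ k i k3)[a b c]].
by rewrite mul1r.
Qed.

Lemma lipq_polynomials G : 0 <= G ->
  [/\ lipq (pairs G) q.+2 N1, lipq (pairs G) q.+2 N2 & lipq (pairs G) q.+2 det3].
Proof.
move=> G0; have L1 i := lipq_crd i G0 (isT : (1 <= 3)%N).
have L2 i := lipq_crd i G0 (isT : (2 <= 3)%N); have L3 i := lipq_crd i G0 (isT : (3 <= 3)%N).
split.
- exact: (lipq_sum (index_enum 'I_3) (fun i => lipqM (L1 i) (L1 i))).
- exact: (lipq_sum (index_enum 'I_3) (fun i => lipqM (L2 i) (L2 i))).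
- exact: (lipq_sum (index_enum 'I_3) (fun i => lipqM (L3 i)
    (lipqD (lipqM (L1 (i + 1)) (L2 (i + 2))) (lipqN (lipqM (L1 (i + 2)) (L2 (i + 1))))))).
Qed.

Lemma diff_Rb (x y : R -> V3) (e : R) k i : admissible n x -> admissible n y -> (k <= 3)%N ->
  (Ck_norm n (fun s => y s - x s)%R < e%:E)%E -> Rb q.+2 e (fun s => crd y k i s - crd x k i s).
Proof.
move=> [px cx _ _ _] [py cy _ _ _] k3 he.
suff H p j : (j + p <= n)%N -> Rb p e (fun s => crd y j i s - crd x j i s) by apply: H; lia.
elim: p j => [|p IH] j jn.
  rewrite addn0 in jn; split=> // [s|s|s].
  - by rewrite (crd_periodic i cx px jn) (crd_periodic i cy py jn).
  - by apply: continuousB; [exact: crd_cont cy jn _|exact: crd_cont cx jn _].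
  - exact: Ck_norm_coord cx cy jn he.
have jn' : (j < n)%N by lia.
apply: (@Rb_I _ _ _ _ (fun s => crd y j.+1 i s - crd x j.+1 i s)) => [s|s|s|].
- exact: rdB (crd_rd i s cy jn') (crd_rd i s cx jn').
- by rewrite (crd_periodic i cx px (ltnW jn')) (crd_periodic i cy py (ltnW jn')).
- exact: Ck_norm_coord cx cy (ltnW jn') he.
- by apply: IH; rewrite addSn -addnS.
Qed.

Lemma base_bound : exists2 G, 0 <= G & forall k i, (k <= 3)%N -> Rb q.+2 G (crd r0 k i).
Proof.
have [p0 c0 _ _ _] := r0a.
have H (z : 'I_4 * 'I_3) : exists G, Rb q.+2 G (crd r0 z.1 z.2).
  have kn : (z.1 + q.+2 <= n)%N by have := ltn_ord z.1; lia.
  apply: Rb_exists; first exact: crd_Ck c0 kn.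
  by apply: crd_periodic c0 p0 _; lia.
have [f hf] := choice H; exists (\sum_z `|f z|); first exact: sumr_ge0.
move=> k i k3; have k4 : (k < 4)%N by [].
have := hf (Ordinal k4, i); apply: Rb_mono.
rewrite (bigD1 (Ordinal k4, i))//=; apply: le_trans (ler_norm _) _.
by rewrite lerDl; exact: sumr_ge0.
Qed.

Lemma lipq_sub (A A' : R -> (R -> V3) -> (R -> V3) -> Prop) p Q :
  (forall (e : R) (x y : R -> V3), A' e x y -> A e x y) -> lipq A p Q -> lipq A' p Q.
Proof.
move=> AA [G [L [G0 L0 H]]]; exists G, L; split=> // e x y e0 a.
exact: H e0 (AA _ _ _ a).
Qed.

Definition pairs_low G (c e : R) (x y : R -> V3) : Prop :=
  pairs G e x y /\ forall s, [/\ c <= N1 x s, c <= N2 x s, c <= N1 y s & c <= N2 y s].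

Lemma lipq_geometry (G c : R) : 0 <= G -> 0 < c ->
  [/\ lipq (pairs_low G c) q.+2 (fun r _ => ell r), lipq (pairs_low G c) q.+2 (fun r _ => (ell r)^-1),
      lipq (pairs_low G c) q.+2 (@curvature R), lipq (pairs_low G c) q.+2 (@torsion R) &
      lipq (pairs_low G c) q.+2 (fun r s => ell r * curvature r s) /\
      lipq (pairs_low G c) q.+2 (fun r s => ell r * torsion r s)].
Proof.
move=> G0 c0; have n3 : (3 <= n)%N by [].
have sub p Q : lipq (pairs G) p Q -> lipq (pairs_low G c) p Q by apply: lipq_sub => e x y [].
have [/sub l1 /sub l2 /sub l3] := lipq_polynomials G0.
have low1 (e : R) (x y : R -> V3) : pairs_low G c e x y -> (forall s, c <= N1 x s) /\ (forall s, c <= N1 y s).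
  by move=> [_ h]; split=> s; case: (h s) => h1 h2 h3 h4; [exact: h1|exact: h3].
have low2 (e : R) (x y : R -> V3) : pairs_low G c e x y -> (forall s, c <= N2 x s) /\ (forall s, c <= N2 y s).
  by move=> [_ h]; split=> s; case: (h s) => h1 h2 h3 h4; [exact: h2|exact: h4].
have low12 (e : R) (x y : R -> V3) : pairs_low G c e x y ->
    (forall s, c * c <= N1 x s * N2 x s) /\ (forall s, c * c <= N1 y s * N2 y s).
  by move=> [_ h]; split=> s; case: (h s) => h1 h2 h3 h4;
    [exact: ler_pM (ltW c0) (ltW c0) h1 h2|exact: ler_pM (ltW c0) (ltW c0) h3 h4].
have sc0 : 0 < Num.sqrt c by rewrite sqrtr_gt0.
have lowl (e : R) (x y : R -> V3) : pairs_low G c e x y ->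
    (forall s, Num.sqrt c <= Num.sqrt (N1 x s)) /\ (forall s, Num.sqrt c <= Num.sqrt (N1 y s)).
  by move=> /low1[h1 h2]; split=> s; [exact: ler_wsqrtr (h1 s)|exact: ler_wsqrtr (h2 s)].
have ll := lipq_sqrt c0 low1 l1; have lw := lipq_sqrt c0 low2 l2.
have lv := lipqV sc0 lowl ll.
have lk := lipqM lw (lipqV c0 low1 l1).
have lt := lipqM l3 (lipqV (mulr_gt0 c0 c0) low12 (lipqM l1 l2)).
have adm (e : R) (x y : R -> V3) : pairs_low G c e x y -> admissible n x /\ admissible n y by move=> [[ax ay _] _]; split; [exact: ax|exact: ay].
have L1 : lipq (pairs_low G c) q.+2 (fun r _ => ell r).
  by apply: eq_lipq ll => e x y /adm[ax ay]; split=> s; [rewrite -(ell_N1 ax s)|rewrite -(ell_N1 ay s)].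
have LK : lipq (pairs_low G c) q.+2 (@curvature R).
  by apply: eq_lipq lk => e x y /adm[ax ay]; split=> s; [exact: esym (curvatureE n3 ax s)|exact: esym (curvatureE n3 ay s)].
have LT : lipq (pairs_low G c) q.+2 (@torsion R).
  by apply: eq_lipq lt => e x y /adm[ax ay]; split=> s; [exact: esym (torsionE n3 ax s)|exact: esym (torsionE n3 ay s)].
have LV : lipq (pairs_low G c) q.+2 (fun r _ => (ell r)^-1).
  by apply: eq_lipq lv => e x y /adm[ax ay]; split=> s; [rewrite -(ell_N1 ax s)|rewrite -(ell_N1 ay s)].
exact: And5 L1 LV LK LT (conj (lipqM L1 LK) (lipqM L1 LT)).
Qed.

Lemma lower_arith (x y a b c : R) : `|x - y| <= a -> a <= c -> c + c <= b -> b <= y -> c <= x.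
Proof. by rewrite ler_norml => /andP[h1 _] h2 h3 h4; lra. Qed.

Lemma sum6_ge (a b c d e f : R) : 0 <= a -> 0 <= b -> 0 <= c -> 0 <= d -> 0 <= e -> 0 <= f ->
  forall S, S = a + b + c + d + e + f ->
  [/\ 0 <= S, a <= S, b <= S, c <= S & [/\ d <= S, e <= S & f <= S]].
Proof. by move=> a0 b0 c0' d0 e0 f0 S ->; split; [lra|lra|lra|lra|split; lra]. Qed.

(** Torsion takes three derivatives of the curve, and the multiplication bounds take q.+2 further
    ones: together 4 + q.+1, the regularity of the theorem. *)
Lemma near_geometry : exists M delta L : R, [/\ 1 <= M, 0 < delta, 0 <= L,
  forall r, admissible n r -> (Ck_norm n (fun s => r s - r0 s)%R < delta%:E)%E ->
    geo q M (ell r) (fun s => ell r * curvature r s) (fun s => ell r * torsion r s)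
      (curvature r) (torsion r) &
  forall r1 r2 (e : R), 0 <= e -> admissible n r1 -> (Ck_norm n (fun s => r1 s - r0 s)%R < delta%:E)%E ->
    admissible n r2 -> (Ck_norm n (fun s => r2 s - r0 s)%R < delta%:E)%E ->
    (Ck_norm n (fun s => r2 s - r1 s)%R < e%:E)%E ->
    [/\ `|ell r2 - ell r1| <= L * e, `|(ell r2)^-1 - (ell r1)^-1| <= L * e,
        Rb q.+2 (L * e) (dfun (fun s => ell r1 * curvature r1 s) (fun s => ell r2 * curvature r2 s)),
        Rb q.+2 (L * e) (dfun (fun s => ell r1 * torsion r1 s) (fun s => ell r2 * torsion r2 s)) &
        Rb q.+2 (L * e) (dfun (curvature r1) (curvature r2)) /\
        Rb q.+2 (L * e) (dfun (torsion r1) (torsion r2))]].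
Proof.
have [G0 G00 hG0] := base_bound; pose G := G0 + 1.
have Gge : 0 <= G by rewrite addr_ge0.
have GG : G0 <= G by rewrite lerDl.
have [l1 l2 _] := lipq_polynomials Gge.
have [GA [LA [_ LA0 HA]]] := l1; have [GB [LB [_ LB0 HB]]] := l2.
have r0p : pairs G 0 r0 r0.
  split=> // k i k3; split; try exact: Rb_mono (hG0 k i k3).
  have z : Rb q.+2 0 (fun _ : R => 0 : R) by have := Rb_cst q.+2 (0 : R); rewrite normr0.
  by apply: eq_Rb z => s; rewrite subrr.
have [ra _ _] := HA _ _ _ (lexx 0) r0p; have [rb _ _] := HB _ _ _ (lexx 0) r0p.
have n3 : (3 <= n)%N by [].
have N1p s : 0 < N1 r0 s by rewrite -(sqr_ell r0a) exprn_gt0// (adm_l0 r0a).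
have [ca ca0 hca] := positive_periodic_lower (Rb_cont ra) (Rb_periodic ra) N1p.
have [cb cb0 hcb] := positive_periodic_lower (Rb_cont rb) (Rb_periodic rb) (N2_gt0 n3 r0a).
(* Half of the lower bounds at [r0]: delta is chosen so that N1 and N2 move by at most c and thus
   stay above c on the whole neighbourhood. *)
pose c := Num.min ca cb / 2.
have cm : 0 < Num.min ca cb by rewrite lt_min ca0.
have c0 : 0 < c by rewrite /c; lra.
have cca : c + c <= ca by rewrite /c -splitr ge_min lexx.
have ccb : c + c <= cb by rewrite /c -splitr ge_min lexx orbT.
pose LL := LA + LB + 1; have LL0 : 0 < LL by rewrite /LL; lra.
pose delta := Num.min 1 (c / LL).
have d0 : 0 < delta by rewrite lt_min ltr01 divr_gt0.
have d1 : delta <= 1 by rewrite ge_min lexx.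
have dL : LL * delta <= c by rewrite -ler_pdivlMl// mulrC ge_min lexx orbT.
have dLA : LA * delta <= c by apply: le_trans dL; apply: ler_wpM2r; [exact: ltW|rewrite /LL; lra].
have dLB : LB * delta <= c by apply: le_trans dL; apply: ler_wpM2r; [exact: ltW|rewrite /LL; lra].
have near_pairs r : admissible n r -> (Ck_norm n (fun s => r s - r0 s)%R < delta%:E)%E ->
    pairs G delta r0 r.
  move=> ar hr; split=> // k i k3; have dR := diff_Rb i r0a ar k3 hr.
  split=> //; first exact: Rb_mono (hG0 k i k3).
  apply: (Rb_mono (G := G0 + delta)); first by rewrite /G lerD2l.
  by apply: eq_Rb (Rb_D (hG0 k i k3) dR) => s; rewrite addrC subrK.
have near_low r : admissible n r -> (Ck_norm n (fun s => r s - r0 s)%R < delta%:E)%E ->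
    forall s, c <= N1 r s /\ c <= N2 r s.
  move=> ar hr s; have pr := near_pairs r ar hr.
  have [_ _ h1] := HA _ _ _ (ltW d0) pr; have [_ _ h2] := HB _ _ _ (ltW d0) pr.
  exact: conj (lower_arith (Rb_bound s h1) dLA cca (hca s)) (lower_arith (Rb_bound s h2) dLB ccb (hcb s)).
have [Ll Lv Lk Lt [Lc Le]] := lipq_geometry Gge c0.
have [Gl [Sl [Gl0 Sl0 Hl]]] := Ll; have [Gv [Sv [Gv0 Sv0 Hv]]] := Lv.
have [Gk [Sk [Gk0 Sk0 Hk]]] := Lk; have [Gt [St [Gt0 St0 Ht]]] := Lt.
have [Gc [Sc [Gc0 Sc0 Hc]]] := Lc; have [Ge [Se [Ge0 Se0 He]]] := Le.
pose M := 1 + Gv + Gk + Gt + Gc + Ge; pose L := Sl + Sv + Sk + St + Sc + Se.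
have [M0 M1 Mv Mk [Mt Mc Me]] := sum6_ge ler01 Gv0 Gk0 Gt0 Gc0 Ge0 (erefl M).
have [L0 Lel Lv' Lk' [Lt' Lc' Le']] := sum6_ge Sl0 Sv0 Sk0 St0 Sc0 Se0 (erefl L).
have z : Rb q.+2 0 (fun _ : R => 0 : R) by have := Rb_cst q.+2 (0 : R); rewrite normr0.
exists M, delta, L; apply: (And5 M1 d0 L0) => [r ar hr|].
  (* Bounds for a single curve are the diagonal case of the estimates for pairs, at distance 0. *)
  have pr : pairs_low G c 0 r r.
    have [_ _ H] := near_pairs r ar hr.
    split; last by move=> s; case: (near_low r ar hr s) => u1 u2; exact: (And4 u1 u2 u1 u2).
    apply: (And3 ar ar) => k i k3; have [_ a _] := H k i k3; apply: (And3 a a).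
    by apply: eq_Rb z => s; rewrite subrr.
  have [hv _ _] := Hv _ _ _ (lexx 0) pr; have [hk _ _] := Hk _ _ _ (lexx 0) pr.
  have [ht _ _] := Ht _ _ _ (lexx 0) pr; have [hc _ _] := Hc _ _ _ (lexx 0) pr.
  have [he _ _] := He _ _ _ (lexx 0) pr.
  have lp := adm_l0 ar; have Mp : 0 < M := lt_le_trans ltr01 M1.
  have vM : (ell r)^-1 <= M.
    exact: le_trans (ler_norm _) (le_trans (Rb_bound 0 hv) Mv).
  have lM : M^-1 <= ell r by rewrite -[ell r]invrK lef_pV2// posrE ?invr_gt0.
  exact: And5 lM vM (Rb_mono Mc hc) (Rb_mono Me he) (conj (Rb_mono Mk hk) (Rb_mono Mt ht)).
move=> x y e e0 ax hx ay hy hxy.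
have pr : pairs_low G c e x y.
  split; last by move=> s; case: (near_low x ax hx s) => a1 a2; case: (near_low y ay hy s) => b1 b2;
    exact: (And4 a1 a2 b1 b2).
  have [_ _ Hx] := near_pairs x ax hx; have [_ _ Hy] := near_pairs y ay hy.
  apply: (And3 ax ay) => k i k3; have [_ a _] := Hx k i k3; have [_ b _] := Hy k i k3.
  exact: And3 a b (diff_Rb i ax ay k3 hxy).
have up S : S <= L -> S * e <= L * e by move=> SL; exact: ler_wpM2r.
have [_ _ hl] := Hl _ _ _ e0 pr; have [_ _ hv] := Hv _ _ _ e0 pr; have [_ _ hk] := Hk _ _ _ e0 pr.
have [_ _ ht] := Ht _ _ _ e0 pr; have [_ _ hc] := Hc _ _ _ e0 pr; have [_ _ he] := He _ _ _ e0 pr.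
have b1 := le_trans (Rb_bound 0 hl) (up _ Lel); have b2 := le_trans (Rb_bound 0 hv) (up _ Lv').
exact: And5 b1 b2 (Rb_mono (up _ Lc') hc) (Rb_mono (up _ Le') he)
  (conj (Rb_mono (up _ Lk') hk) (Rb_mono (up _ Lt') ht)).
Qed.

End Near.
End CurveGeometry.

(** * The near-axis solution of one curve *)

Section Assembly.
Variable R : realType.
Local Notation C := R[i].
Local Notation V3 := 'rV[R]_3.
Variables (K : R) (D q : nat).
Hypothesis K0 : 0 < K.
Hypothesis D0 : (0 < D)%N.
Local Notation pa := (q.+1 + 2 * D)%N.

Lemma eq_formal (a b : nat -> nat -> R -> C) :
  (forall m n, (n <= m)%N -> a m n = b m n) -> formal a = formal b.
Proof.
move=> E; rewrite !formalE; apply/funext => k; apply/funext => t; apply/funext => s.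
by apply: eq_formalf => m n nm; rewrite E.
Qed.

Lemma Rb_rd p G (h : R -> R) s : Rb p.+1 G h -> exists k, rd h s k.
Proof. by move=> [_ _ _ [dh [hd _]]]; exists (dh s). Qed.

Section Flux.
Variables (l : R) (kap tau : R -> R) (a g : nat -> nat -> R -> C).

(** Builds U from an arbitrary given family: a competitor in the uniqueness statement comes without
    its U, and the equation becomes a recursion only once U is supplied. *)
Fixpoint flux m : nat -> R -> C :=
  newu l tau g m (a m) (if m is m'.+1 then kmix kap (flux m') else @z0 R).

Lemma tfam_flux : tfam flux.
Proof. by case=> [|m]; exact: trow_newu. Qed.

Lemma flux_recU : recU l^-1 tau kap a flux g.
Proof. by move=> [|m] n s nm; rewrite /= /newu nm. Qed.

Lemma flux_cderivable :
  (forall s, exists k, rd kap s k) -> (forall s, exists k, rd tau s k) ->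
  (forall m n, cCk 2 (a m n)) -> (forall m n s, cderivable (g m n) s) ->
  forall m n s, cderivable (flux m n) s.
Proof.
move=> hk ht ha hg m n s; suff [z h] : exists z, cd (flux m n) s z by exact: cd_cderivable h.
have hnew d k i : (forall j, exists z, cd (d j) s z) -> exists z, cd (newu l tau g k (a k) d i) s z.
  move=> hd; rewrite /newu; case: ifP => _; last by exists 0; exact: cd_cst.
  have [t' ht'] := ht s; have [z hz] := hd i.
  have /cCkS[_ ca] := ha k i; have c1 := cCk_cd s (ha k i); have c2 := cCk_cd s ca.
  eexists; exact: (cdD (cdD (cdB (cdZ _ c2) (cdM (cd_real ht') (cdZ _ c1))) hz)
    (cderivable_cd (hg k i s))).
elim: m n => [|m IH] n; apply: hnew => i; first by exists 0; exact: cd_cst.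
have [k' hk'] := hk s; have [z hz] := IH i.
have [z' hz'] : exists z', cd (prv (flux m) i) s z'.
  by case: i {z hz} => [|i]; [exists 0; exact: cd_cst|exact: IH].
eexists; exact: (cdM (cd_real hk') (cdZ _ (cdD hz hz'))).
Qed.

End Flux.

Lemma source_sfam B0 : sobT q.+2 B0 -> sfam q.+2 (@source R B0).
Proof.
move=> sB [|m] n nm; last exact: sobT0.
by move: nm; rewrite leqn0 => /eqP ->.
Qed.

Lemma sobT_norm_ge0 p (f : R -> C) : 0 <= sobT_norm p f.
Proof. exact: sqrtr_ge0. Qed.

Lemma source_energy B0 x m : 0 <= x -> x ^+ m * Em q.+2 m (@source R B0 m) <= sobT_norm q.+2 B0 ^+ 2.
Proof.
move=> x0; case: m => [|m]; last by rewrite [source _ _](_ : _ = @z0 R)// Em0 mulr0 sqr_ge0.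
rewrite expr0 mul1r /Em big_ord1 /sobT_norm sqr_sqrtr; last first.
  by apply: fine_ge0; apply: esum_ge0 => k _; rewrite lee_fin mulr_ge0 ?exprn_ge0 ?sqmod_ge0// addr_ge0 ?sqr_ge0.
have -> : wj R 0 ord0 = 1 by rewrite /wj /jf /= subrr expr0n addr0.
exact: lexx.
Qed.

Section OneCurve.
Variables (r : R -> V3) (M : R).
Hypothesis M1 : 1 <= M.
Local Notation l := (ell r).
Local Notation chi := (fun s => l * curvature r s).
Local Notation eta := (fun s => l * torsion r s).
Hypothesis l0 : 0 < l.
Hypothesis rgeo : geo q M l chi eta (curvature r) (torsion r).
Variables (B0 : R -> C) (ic : nat -> nat -> R -> C).
Hypothesis sB : sobT q.+2 B0.
Hypothesis sic : sfam pa ic.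

Definition phi_of : nat -> nat -> R -> C :=
  sola K D l chi eta (curvature r) (torsion r) ic (source B0).
Definition flux_of : nat -> nat -> R -> C :=
  solu K D l chi eta (curvature r) (torsion r) ic (source B0).

Let sg := source_sfam sB.

Lemma phi_of_sfam : sfam pa phi_of. Proof. exact: (sfam_sola K0 D0 M1 rgeo sic sg). Qed.
Lemma flux_of_sfam : sfam q.+2 flux_of. Proof. exact: (sfam_solu K0 D0 M1 rgeo sic sg). Qed.
Lemma phi_of_tfam : tfam phi_of. Proof. exact: tfam_sola. Qed.
Lemma flux_of_tfam : tfam flux_of. Proof. exact: tfam_solu. Qed.
Lemma phi_of_recA : recA K D l chi eta 1 phi_of flux_of (fun _ => @z0 R).
Proof. exact: (sol_recA K0 D0 M1 rgeo sic sg). Qed.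
Lemma phi_of_recU : recU l^-1 (torsion r) (curvature r) phi_of flux_of (source B0).
Proof. exact: sol_recU. Qed.

Lemma phi_of_Ck m n : cCk (2 * D) (phi_of m n).
Proof.
have [nm|mn] := leqP n m; last by rewrite (phi_of_tfam mn); exact: cCk_cst.
apply: (@cCk_le _ _ (q + 2 * D)); first by rewrite leq_addl.
exact: sobT_cCk (phi_of_sfam nm).
Qed.

Lemma curvature_rd s : exists k, rd (curvature r) s k.
Proof. by have [_ _ _ _ [h _]] := rgeo; exact: Rb_rd h. Qed.
Lemma torsion_rd s : exists k, rd (torsion r) s k.
Proof. by have [_ _ _ _ [_ h]] := rgeo; exact: Rb_rd h. Qed.
Lemma source_tfam : tfam (@source R B0).
Proof. by move=> [|m] [|n]. Qed.
Lemma source_cderivable m n s : cderivable (@source R B0 m n) s.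
Proof. exact: (tfam_cderivable source_tfam sg). Qed.
Lemma data_cderivable s : cderivable B0 s.
Proof. exact: (source_cderivable 0 0). Qed.

Lemma phi_of_near_axis : near_axis_solution r K D B0 ic phi_of.
Proof.
split=> [m n nm|m s|].
- by split; [exact: phi_of_Ck|move=> s; case: (phi_of_sfam nm) => h _ _; exact: h].
- exact: sola_boundary.
apply: (poisson_recA K (lt0r_neq0 l0) D0 curvature_rd torsion_rd data_cderivable
  phi_of_tfam flux_of_tfam phi_of_Ck (tfam_cderivable flux_of_tfam flux_of_sfam) phi_of_recU).2.
exact: phi_of_recA.
Qed.

Lemma near_axis_unique a : near_axis_solution r K D B0 ic a ->
  forall m n s, (n <= m)%N -> a m n s = phi_of m n s.
Proof.
move=> [ra ba pa_] m n s nm.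
(* A solution is prescribed only for n <= m; cutting off the other values makes its rows vanish
   there, as the recursion requires, and leaves the formal series unchanged. *)
pose a' k j : R -> C := if (j <= k)%N then a k j else fun=> 0.
have aE k j : (j <= k)%N -> a k j = a' k j by rewrite /a' => ->.
have ta' : tfam a' by move=> k j kj; rewrite /a' leqNgt kj.
have ca' k j : cCk (2 * D) (a' k j).
  by rewrite /a'; case: ifP => jk; [exact: (ra k j jk).1|exact: cCk_cst].
have c2 k j : cCk 2 (a' k j) by apply: cCk_le (ca' k j); rewrite -{1}[2%N]muln1 leq_mul2l.
have ba' k x : a' k 0%N x = ic k 0%N x /\ a' k k x = ic k k x by rewrite -!aE.
have ra' k j : (j <= k)%N -> cCk (2 * D) (a' k j) /\ periodic (a' k j).
  by move=> jk; split; [exact: ca'|rewrite -aE//; exact: (ra k j jk).2].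
have tU := @tfam_flux l (curvature r) (torsion r) a' (source B0).
have HU := @flux_recU l (curvature r) (torsion r) a' (source B0).
have cU := flux_cderivable l curvature_rd torsion_rd c2 source_cderivable.
rewrite (eq_formal aE) in pa_.
have HA := (poisson_recA K (lt0r_neq0 l0) D0 curvature_rd torsion_rd data_cderivable
  ta' tU ca' cU HU).1 pa_.
have rphi k j : (j <= k)%N -> cCk (2 * D) (phi_of k j) /\ periodic (phi_of k j).
  by move=> jk; case: phi_of_near_axis => h _ _; exact: h.
have bphi k x := (@sola_boundary R K D l chi eta (curvature r) (torsion r) ic (source B0) k x).
rewrite aE//; have [-> _] // := solution_unique K0 D0 l0 ta' tU phi_of_tfam flux_of_tfam ra' rphi
  ba' bphi HA phi_of_recA HU phi_of_recU m.
Qed.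

Section Bounds.
Variables (sigma Y : R).
Hypothesis s0 : 0 < sigma.
Hypothesis Y0 : 0 <= Y.
Hypothesis sm : small K D q M (sigma ^+ 2).
Hypothesis icY : forall m, (sigma ^+ 2) ^+ m * Em pa m (ic m) <= Y ^+ 2.
Local Notation N := (sobT_norm q.+2 B0).
Local Notation AA := (2 * (Y ^+ 2 + c3 K D q M * 0 + N ^+ 2)).
Local Notation UU := (2 * c1 q M * AA + 8 * N ^+ 2).

Lemma phi_of_bound m :
  (sigma ^+ 2) ^+ m * Em pa m (phi_of m) <= AA /\
  (sigma ^+ 2) ^+ m * Em q.+2 m (flux_of m) <= UU.
Proof.
have z m' : (sigma ^+ 2) ^+ m' * Em q.+1 m' (@z0 R) <= 0 by rewrite Em0 mulr0.
exact: (apriori K0 D0 M1 (sqr_ge0 sigma) sm rgeo phi_of_tfam flux_of_tfam phi_of_sfam flux_of_sfam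
  sic (fun m => @sobrow0 R q.+1 m) sg (sola_boundary _ _ _ _ _ _ _ _ _) phi_of_recA phi_of_recU
  (sqr_ge0 Y) (lexx 0) (sqr_ge0 N) icY z (fun m => source_energy B0 m (sqr_ge0 sigma)) m).
Qed.

Lemma phi_of_energy m : sigma ^+ (2 * m) * Em pa m (phi_of m) <= AA.
Proof. by rewrite exprM; case: (phi_of_bound m). Qed.

Lemma phi_of_analytic : analytic_series sigma (Hq R pa) phi_of.
Proof. exact: series_analytic s0 phi_of_sfam phi_of_energy. Qed.

(** There is no source in the equation for phi, whence c * 0; what remains is below (2x + 2y)^2, and
    this yields the constant 2 of the final estimate. *)
Lemma norm_arith (x y c : R) : 0 <= x -> 0 <= y ->
  2 * (y ^+ 2 + c * 0 + x ^+ 2) <= (2 * x + 2 * y) ^+ 2.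
Proof. by move=> x0 y0; have := mulr_ge0 x0 y0; have := sqr_ge0 x; have := sqr_ge0 y; nra. Qed.

Lemma phi_of_norm : (analytic_norm sigma (Hq R pa) phi_of <= (2 * N + 2 * Y)%:E)%E.
Proof.
have N0 : 0 <= N by exact: sobT_norm_ge0.
apply: (analytic_norm_le s0 phi_of_sfam phi_of_energy); last exact: norm_arith.
by rewrite addr_ge0// mulr_ge0.
Qed.

(** The two conditions on sigma concern 1/h_s only: the first keeps division by h_s bounded in
    energy, the second keeps h_s away from zero, as |kappa rho cos theta| <= M sigma. *)
Lemma phi_of_field : (3 ^+ q.+2) ^+ 2 * M ^+ 2 * sigma ^+ 2 <= 4^-1 -> M * sigma <= 2^-1 ->
  let Phi : functions R := series_fun phi_of in
  let B : 'I_3 -> functions R := BK r K D B0 Phi in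
  (forall rho t s, 0 < rho < sigma ->
    BK_well_defined r K D B0 Phi rho t s /\ divergence r B rho t s = 0) /\
  exists2 V : 'I_3 -> R -> R -> R -> R[i],
    forall i rho t s, 0 < rho < sigma -> V i rho t s = cartesian B i rho t s &
    forall sigma', 0 < sigma' < sigma -> forall i, analytic sigma' (Hq R q.+1) (V i).
Proof.
move=> ss Ms Phi B.
have [_ _ chib etab [kapb _]] := rgeo.
have nz rho t s : 0 < rho < sigma -> 1 - curvature r s * cos t * rho != 0.
  move=> /andP[r0 rs]; apply: lt0r_neq0; rewrite subr_gt0.
  apply: le_lt_trans (ler_norm _) _; rewrite 2!normrM (gtr0_norm r0).
  have h : `|curvature r s| * `|cos t| * rho <= M * 1 * sigma.
    apply: ler_pM; [exact: mulr_ge0|exact: ltW| |exact: ltW].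
    by apply: ler_pM => //; [exact: Rb_bound kapb|rewrite ler_norml cos_geN1 cos_le1].
  by apply: le_lt_trans h _; rewrite mulr1; apply: le_lt_trans Ms _; rewrite invf_lt1// ltr1n.
have ea := erg_of phi_of_sfam (fun m => (phi_of_bound m).1).
have eU := erg_of flux_of_sfam (fun m => (phi_of_bound m).2).
have eB := erg_of sg (fun m => source_energy B0 m (sqr_ge0 sigma)).
have ln := lt0r_neq0 l0.
split=> [rho t s hr|].
  split.
    exact: (BK_is_well_defined K ln D0 s0 chib etab nz phi_of_tfam flux_of_tfam ea eU eB phi_of_recU).
  exact: (divergence_free ln D0 s0 chib etab nz phi_of_tfam flux_of_tfam ea eU eB phi_of_recU phi_of_recA).
exact: (cartesian_field_analytic K ln D0 s0 kapb chib etab nz phi_of_tfam flux_of_tfam ea eU eB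
  phi_of_recU ss).
Qed.

End Bounds.
End OneCurve.

End Assembly.

(** * Two nearby curves and the final assembly *)

Section TwoCurves.
Variable R : realType.
Local Notation C := R[i].
Local Notation V3 := 'rV[R]_3.
Variables (K : R) (D q : nat).
Hypothesis K0 : 0 < K.
Hypothesis D0 : (0 < D)%N.
Local Notation pa := (q.+1 + 2 * D)%N.

(** After clearing denominators each condition reads A_i y <= 1 with y one of sigma, sigma^2,
    sigma^4, all at most sigma when sigma <= 1; so 1/Q with Q above 1 and all A_i suffices. *)
Lemma exists_radius (sigma0 M : R) : 0 < sigma0 -> 1 <= M -> exists sigma : R,
  [/\ 0 < sigma <= sigma0, sigma <= 1, small K D q M (sigma ^+ 2),
      (3 ^+ q.+2) ^+ 2 * M ^+ 2 * sigma ^+ 2 <= 4^-1 & M * sigma <= 2^-1].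
Proof.
move=> s0 M1; pose A1 := c3 K D q M * 4; pose A2 := c2 q M * 2.
pose A3 := c3 K D q M * (2 * c1 q M) * 4; pose A4 := 8 * c3 K D q M.
pose A5 := (3 ^+ q.+2) ^+ 2 * M ^+ 2 * 4 : R; pose A6 := M * 2.
have M0 := le_trans ler01 M1.
have h3 := c3_ge0 K D q M; have h2 := c2_ge0 q M; have h1 := c1_ge0 q M.
have A10 : 0 <= A1 by exact: mulr_ge0.
have A20 : 0 <= A2 by exact: mulr_ge0.
have A30 : 0 <= A3 by rewrite /A3; apply: mulr_ge0 => //; apply: mulr_ge0 => //; exact: mulr_ge0.
have A40 : 0 <= A4 by exact: mulr_ge0.
have A50 : 0 <= A5 by rewrite /A5; apply: mulr_ge0 => //; apply: mulr_ge0; exact: sqr_ge0.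
have A60 : 0 <= A6 by exact: mulr_ge0.
pose Q := 1 + (A1 + A2 + A3 + A4 + A5 + A6).
have [S0 S1 S2 S3 [S4 S5 S6]] := sum6_ge A10 A20 A30 A40 A50 A60 (erefl (A1 + A2 + A3 + A4 + A5 + A6)).
have Q1 : 1 <= Q by rewrite lerDl.
have Qp : 0 < Q := lt_le_trans ltr01 Q1.
have SQ : A1 + A2 + A3 + A4 + A5 + A6 <= Q by rewrite lerDr.
pose sigma := Num.min sigma0 Q^-1.
have sp : 0 < sigma by rewrite lt_min s0 invr_gt0.
have sQ : sigma <= Q^-1 by rewrite ge_min lexx orbT.
have s1 : sigma <= 1 by apply: le_trans sQ _; rewrite invf_le1.
have x1 : sigma ^+ 2 <= sigma by rewrite expr2 ger_pMl.
have x2 : (sigma ^+ 2) ^+ 2 <= sigma.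
  apply: le_trans (x1); rewrite [X in X <= _]expr2 ger_pMl ?exprn_gt0//.
  exact: le_trans x1 s1.
have bd (a y : R) : 0 <= a -> a <= A1 + A2 + A3 + A4 + A5 + A6 -> y <= sigma -> a * y <= 1.
  move=> a0 aS ys; apply: (@le_trans _ _ (a * sigma)); first exact: ler_wpM2l.
  apply: (@le_trans _ _ (Q * Q^-1)); last by rewrite divff// gt_eqF.
  apply: ler_pM => //; [exact: ltW|exact: le_trans aS SQ].
have b1 := bd _ _ A10 S1 x1; have b2 := bd _ _ A20 S2 x1; have b3 := bd _ _ A30 S3 x2.
have b4 := bd _ _ A40 S4 x2; have b5 := bd _ _ A50 S5 x1; have b6 := bd _ _ A60 S6 (lexx _).
have quarter (c y : R) : c * 4 * y <= 1 -> c * y <= 4^-1 by move=> h; lra.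
have half (c y : R) : c * 2 * y <= 1 -> c * y <= 2^-1 by move=> h; lra.
exists sigma; split.
- by rewrite sp ge_min lexx.
- exact: s1.
- split; [exact: quarter b1|exact: half b2| |by rewrite mulrA].
  by rewrite mulrAC; exact: quarter b3.
- exact: quarter b5.
- exact: half b6.
Qed.

Variables (r1 r2 : R -> V3) (M sigma Y e : R).
Local Notation chi r := (fun s => ell r * curvature r s).
Local Notation eta r := (fun s => ell r * torsion r s).
Hypothesis M1 : 1 <= M.
Hypothesis geo1 : geo q M (ell r1) (chi r1) (eta r1) (curvature r1) (torsion r1).
Hypothesis geo2 : geo q M (ell r2) (chi r2) (eta r2) (curvature r2) (torsion r2).
Variables (B0 : R -> C) (ic : nat -> nat -> R -> C).
Hypothesis sB : sobT q.+2 B0.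
Hypothesis sic : sfam pa ic.
Hypothesis s0 : 0 < sigma.
Hypothesis s1 : sigma <= 1.
Hypothesis Y0 : 0 <= Y.
Hypothesis sm : small K D q M (sigma ^+ 2).
Hypothesis icY : forall m, (sigma ^+ 2) ^+ m * Em pa m (ic m) <= Y ^+ 2.
Local Notation phi r := (phi_of K D r B0 ic).
Local Notation N := (sobT_norm q.+2 B0).
Local Notation AA := (2 * (Y ^+ 2 + c3 K D q M * 0 + N ^+ 2)).
Local Notation UU := (2 * c1 q M * AA + 8 * N ^+ 2).
Local Notation S := (3 ^+ q.+1 : R).
Local Notation T := (3 ^+ q.+2 : R).

Definition lipschitz_constant : R :=
  2 * (c3 K D q M * ((16 * S ^+ 2 + 2) * AA + 8 * S * UU) + ((4 + 4 * T) * AA + 2 * T ^+ 2 * UU)).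

Hypothesis e0 : 0 <= e.
Hypothesis dl : `|ell r2 - ell r1| <= e.
Hypothesis dli : `|(ell r2)^-1 - (ell r1)^-1| <= e.
Hypothesis dchi : Rb q.+2 e (dfun (chi r1) (chi r2)).
Hypothesis deta : Rb q.+2 e (dfun (eta r1) (eta r2)).
Hypothesis dkap : Rb q.+2 e (dfun (curvature r1) (curvature r2)).
Hypothesis dtau : Rb q.+2 e (dfun (torsion r1) (torsion r2)).

Lemma phi_of_difference :
  (analytic_norm sigma (Hq R pa) (fun m n s => phi r2 m n s - phi r1 m n s)%R <=
   (e * Num.sqrt `|lipschitz_constant|)%:E)%E.
Proof.
have x0 := sqr_ge0 sigma.
have x1 : sigma ^+ 2 <= 1 by rewrite expr_le1// ltW.
have a1 := phi_of_sfam K0 D0 M1 geo1 sB sic; have a2 := phi_of_sfam K0 D0 M1 geo2 sB sic.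
have u1 := flux_of_sfam K0 D0 M1 geo1 sB sic; have u2 := flux_of_sfam K0 D0 M1 geo2 sB sic.
have bd := phi_of_bound K0 D0 M1 geo1 sB sic sm icY.
have H m : sigma ^+ (2 * m) * Em pa m (dfam (phi r1) (phi r2) m) <= e ^+ 2 * lipschitz_constant.
  rewrite exprM.
  exact: (difference_bound K0 D0 a1 a2 u1 u2 (phi_of_tfam _ _ _ _ _) (flux_of_tfam _ _ _ _ _)
    (phi_of_tfam _ _ _ _ _) (flux_of_tfam _ _ _ _ _) (sola_boundary _ _ _ _ _ _ _ _ _)
    (sola_boundary _ _ _ _ _ _ _ _ _) (phi_of_recA K0 D0 M1 geo1 sB sic)
    (phi_of_recA K0 D0 M1 geo2 sB sic) (phi_of_recU _ _ _ _ _) (phi_of_recU _ _ _ _ _)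
    M1 x0 x1 sm geo2 e0 dl dli dchi deta dkap dtau (fun m => (bd m).1) (fun m => (bd m).2)).
have sd m : sobrow pa m (dfam (phi r1) (phi r2) m) by apply: sobrowB; [exact: a2|exact: a1].
apply: (analytic_norm_le s0 sd H); first by rewrite mulr_ge0 ?sqrtr_ge0.
(* Under the root the absolute value spares a discussion of the sign of [lipschitz_constant], which
   it dominates. *)
by rewrite exprMn sqr_sqrtr// ler_wpM2l ?sqr_ge0// ler_norm.
Qed.

End TwoCurves.

Section Auxiliary.
Variable R : realType.

Lemma contraction_arith (L k eps : R) : 0 < eps -> 0 <= L * k -> L * (eps / (1 + L * k)) * k < eps.
Proof.
move=> e0 Lk; have h : 0 < 1 + L * k by lra.
have -> : L * (eps / (1 + L * k)) * k = eps * (L * k) / (1 + L * k) by field; rewrite gt_eqF.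
by rewrite ltr_pdivrMr// ltr_pM2l//; lra.
Qed.

Lemma Ck_norm_subrr n (r : R -> 'rV[R]_3) (d : R) : 0 < d ->
  (Ck_norm n (fun s => r s - r s)%R < d%:E)%E.
Proof.
move=> d0; apply: (@le_lt_trans _ _ 0%E); last by rewrite lte_fin.
have -> : (fun s => r s - r s) = (fun=> 0) by apply/funext => s; rewrite subrr.
have z j : derive1n j (fun=> 0 : 'rV[R]_3) = (fun=> 0).
  elim: j => [//|j IH]; rewrite derive1nS IH; apply/funext => s.
  by rewrite derive1_cst.
apply: ub_ereal_sup => y [j [s [_ ->]]]; rewrite z lee_fin /enorm /dotv big1 ?sqrtr0// => i _.
by rewrite mxE mul0r.
Qed.

End Auxiliary.

Theorem corollary3p9 (R : realType) (sigma0 K : R) (q D : nat)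
    (r0 : R -> 'rV[R]_3)
    (sigma0_gt0 : 0 < sigma0) (K_gt0 : 0 < K)
    (q_ge1 : (1 <= q)%N) (D_ge1 : (1 <= D)%N)
    (r0_adm : admissible (4 + q) r0) :
  exists sigma Cst delta : R,
    [/\ 0 < sigma <= sigma0,
        forall s, sigma < (curvature r0 s)^-1,
        0 < Cst, 0 < delta &
    forall (B0 : R -> R[i]) (ic : nat -> nat -> R -> R[i]),
      sobT (1 + q) B0 ->
      analytic_series sigma0 (Hq R (q + 2 * D)) ic ->
      (forall m n, (n <= m)%N -> cCk 0 (ic m n)) ->
      (forall m n s, (0 < n < m)%N -> ic m n s = 0) ->
      let W := Hq R (q + 2 * D) in
      let near r := admissible (4 + q) r /\
        (Ck_norm (4 + q) (fun s => r s - r0 s)%R < delta%:E)%E in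
      exists phi : (R -> 'rV[R]_3) -> nat -> nat -> R -> R[i],
        [/\ forall r, near r ->
              [/\ near_axis_solution r K D B0 ic (phi r),
                  forall a, near_axis_solution r K D B0 ic a ->
                    forall m n s, (n <= m)%N -> a m n s = phi r m n s &
                  analytic_series sigma W (phi r)],
            forall r1, near r1 -> forall eps : R, 0 < eps ->
              exists2 eta : R, 0 < eta &
                forall r2, near r2 ->
                  (Ck_norm (4 + q) (fun s => r2 s - r1 s)%R < eta%:E)%E ->
                  (analytic_norm sigma W
                     (fun m n s => phi r2 m n s - phi r1 m n s)%R < eps%:E)%E,
            (analytic_norm sigma W (phi r0) <=
               Cst%:E * (sobT_norm (1 + q) B0)%:E +
               Cst%:E * analytic_norm sigma0 W ic)%E &
            let Phi : functions R := series_fun (phi r0) in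
            let B : 'I_3 -> functions R := BK r0 K D B0 Phi in
            (forall rho t s, 0 < rho < sigma ->
               BK_well_defined r0 K D B0 Phi rho t s /\
               divergence r0 B rho t s = 0) /\
            exists2 V : 'I_3 -> R -> R -> R -> R[i],
              forall i rho t s, 0 < rho < sigma ->
                V i rho t s = cartesian B i rho t s &
              forall sigma', 0 < sigma' < sigma ->
                forall i, analytic sigma' (Hq R q) (V i)]].
Proof.
(* Since q >= 1, write q = p + 1; the preceding results are instantiated with p. *)
case: q q_ge1 r0_adm => // p _ ra.
have [M [delta [L [M1 d0 L0 Hgeo Hlip]]]] := near_geometry ra.
have [sigma [/andP[s0 ss0] s1 sm s5 s6]] := exists_radius K D p sigma0_gt0 M1.
have near0 : (Ck_norm (4 + p.+1) (fun s => r0 s - r0 s)%R < delta%:E)%E.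
  exact: Ck_norm_subrr.
have geo0 := Hgeo r0 ra near0.
(* sigma and delta depend on [r0], K, D, q and sigma0 alone, hence are fixed before B_0 and the
   data; 2 is the constant of [phi_of_norm]. *)
exists sigma, 2, delta; apply: And5; [by rewrite s0|move=> s|exact: ltr0Sn|exact: d0|].
  have k0 : 0 < curvature r0 s by case: ra.
  have [_ _ _ _ [/(Rb_bound s) kM _]] := geo0.
  have hk : sigma * curvature r0 s < 1.
    apply: (@le_lt_trans _ _ (M * sigma)); last by apply: le_lt_trans s6 _; rewrite invf_lt1// ltr1n.
    rewrite mulrC; apply: ler_wpM2r; first exact: ltW.
    exact: le_trans (ler_norm _) kM.
  by rewrite -(ltr_pM2r k0) mulVf// gt_eqF.
move=> B0 ic sB aic cic ic0 W near.
have [Y Y0 [Yn hY]] := analytic_series_energy sigma0_gt0 cic aic.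
have sic : sfam (p.+1 + 2 * D) ic by move=> m; case: (hY m).
have icY m : (sigma ^+ 2) ^+ m * Em (p.+1 + 2 * D) m (ic m) <= Y ^+ 2.
  have [_ h] := hY m; apply: le_trans h; rewrite exprM; apply: ler_wpM2r; first exact: Em_ge0.
  by apply: lerXn2r; rewrite ?nnegrE ?sqr_ge0//; apply: lerXn2r; rewrite ?nnegrE// ltW.
have geo_near r : near r -> geo p M (ell r) (fun s => ell r * curvature r s)
    (fun s => ell r * torsion r s) (curvature r) (torsion r).
  by move=> [ar hr]; exact: Hgeo ar hr.
have near_r0 : near r0 by split; [exact: ra|exact: near0].
exists (fun r => phi_of K D r B0 ic); apply: And4.
- move=> r nr; have lr := adm_l0 nr.1; have gr := geo_near r nr.
  apply: And3.
  + exact: (phi_of_near_axis K_gt0 D_ge1 M1 lr gr sB sic).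
  + exact: (near_axis_unique K_gt0 D_ge1 M1 lr gr sB sic).
  + exact: (phi_of_analytic K_gt0 D_ge1 M1 gr sB sic s0 sm icY).
- move=> x nx eps eps0.
  set k := Num.sqrt `|lipschitz_constant K D p M Y B0|.
  have k0 : 0 <= k by exact: sqrtr_ge0.
  (* The difference of the solutions is at most L k times the distance of the curves; the added 1
     keeps the denominator positive and the final inequality strict. *)
  exists (eps / (1 + L * k)) => [|y ny hxy].
    by apply: divr_gt0 => //; exact: ltr_wpDr (mulr_ge0 L0 k0) ltr01.
  set eta := eps / _ in hxy.
  have eta0 : 0 <= eta by apply: divr_ge0; [exact: ltW|rewrite addr_ge0// mulr_ge0].
  have [dl dli dchi deta [dkap dtau]] := Hlip x y eta eta0 nx.1 nx.2 ny.1 ny.2 hxy.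
  have := phi_of_difference K_gt0 D_ge1 M1 (geo_near x nx) (geo_near y ny) sB sic s0 s1 sm icY
    (mulr_ge0 L0 eta0) dl dli dchi deta dkap dtau.
  move/le_lt_trans; apply; rewrite lte_fin -/k.
  exact: contraction_arith eps0 (mulr_ge0 L0 k0).
- rewrite Yn -!EFinM -EFinD.
  exact: (phi_of_norm K_gt0 D_ge1 M1 geo0 sB sic s0 Y0 sm icY).
exact: (phi_of_field K_gt0 D_ge1 M1 (adm_l0 ra) geo0 sB sic s0 sm icY s5 s6).
Qed.
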